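(* Let $V$ be a real finite-dimensional vector space, regarded as a translation group. For $k\ge1$ consider in $V^{k-1}$, with variable $v_j$ in the $j$th factor, the subspaces $$D_j=\{v_j=0\},\qquad D_{jl}=\{v_j=v_l\},\qquad j,l=1,\dots,k-1,\ j<l .$$ The p-submanifolds formed from the intersections of subcollections of the $D_*$ with the sphere forming the boundary of the radial compactification $\overline{V^{k-1}}$ of $V^{k-1}$ form a p-clean collection $\mathcal I$, closed under intersection, and $$\overline{E}[k]=[\overline{V^{k-1}};\mathcal I]$$ is a simplicial compactification of the translation group $V$.
   Context: Manifolds with corners have embedded boundary hypersurfaces, each having a boundary defining function. Adapted coordinates near a point consist of the $x_1,\dots,x_r\ge 0$ defining the boundary hypersurfaces through the point and further functions $y_l$. A b-map $F:M_1\to M_2$ is a smooth map such that for each boundary defining function $x'_j$ of $M_2$ either $F^*x'_j\equiv 0$ or $F^*x'_j=\alpha_j\prod_k x_k^{a(j,k)}$ with $\alpha_j>0$ smooth and $a(j,k)$ non-negative integers; it is an interior b-map if the first case does not occur. A p-submanifold is a closed subset which near each of its points is given, in some adapted coordinates, by the vanishing of some of the $x_i$ and some of the $y_l$. A p-embedding is a diffeomorphism onto a p-submanifold. A b-fibration is a surjective b-map $F:M_1\to M_2$ such that near each $m\in M_1$ there are adapted coordinates $x,y$, and adapted coordinates $x',y'$ near $F(m)$, such that the $F^*y'_{l'}$ are amongst the $y_l$ and $F^*x'_{j'}=\prod_{j\in J(j')}x_j$ where the index sets $J(j')$ are disjoint for different $j'$. A finite collection of p-submanifolds is p-clean if near each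 point of the union there are adapted coordinates in which each element through that point is defined by the vanishing of some of the $x_j$ and some linear functions of the $y_l$. It is closed under intersection if any two elements are either disjoint or have intersection in the collection. For such a collection $[X;\mathcal C]$ is the manifold obtained by successively blowing up (real, spherical, inward-pointing blow-up) the lifts of the elements in a size order (dimension weakly increasing); it is independent of choice. Let $J(k)=\{1,\dots,k\}$. A generalized product is a contravariant functor from the category with objects $J(k)$, $k=1,2,\dots$, and morphisms all maps $J(n)\to J(m)$, to manifolds with corners and interior b-maps, $J(k)\mapsto M[k]$, $(I:J(n)\to J(m))\mapsto(S_I:M[m]\to M[n])$, such that $\dim M[k]=\mu+(k-1)\kappa$ for fixed integers $\mu,\kappa$, injective $I$ are taken to b-fibrations, surjective $I$ to p-embeddings, all manifolds (including fibres of b-fibrations) being connected. For a connected Lie group $G$ the products $G^k$, with $S_I(g_1,\dots,g_m)=(g_{I(1)},\dots,g_{I(n)})$ for $I:J(n)\to J(m)$, form a generalized product on which $G$ acts by $(g_1,\dots,g_k)\mapsto(g_1g^{-1},\dots,g_kg^{-1})$; the quotients $G[k]=G^k/G$ form a generalized product. A simplicial compactification of $G$ is a generalized product $\overline G[*]$ in the category of compact manifolds with corners which reduces in the interior to $G[*]$. For $G=V$ one identifies $V^k/V$ with $V^{k-1}$ by $(w_1,\dots,w_k)\mapsto(w_1-w_k,\dots,w_{k-1}-w_k)$. *)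

(* Defs.v *)
From HB Require Import structures.
From mathcomp Require Import all_boot all_order all_algebra.
From mathcomp Require Import all_classical all_reals all_analysis.
Import Order.TTheory GRing.Theory Num.Theory numFieldNormedType.Exports.
Import VectorInternalTheory.

Set Implicit Arguments.
Unset Strict Implicit.
Unset Printing Implicit Defensive.

Local Open Scope classical_set_scope.
Local Open Scope ring_scope.

(* C^k on the open set U, by iterated continuous partial derivatives. *)
Fixpoint Ck_on (R : realType) (n k : nat) (U : set 'rV[R]_n)
    (f : 'rV[R]_n -> R^o) : Prop :=
  (forall x, U x -> {for x, continuous f}) /\
  if k is k'.+1 then
    forall i : 'I_n, (forall x, U x -> derivable f x (delta_mx 0 i)) /\
      Ck_on k' U (fun x => 'D_(delta_mx 0 i) f x)
  else True.

Definition smooth_near_rV (R : realType) (n : nat) (p : 'rV[R]_n)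
    (f : 'rV[R]_n -> R) : Prop :=
  exists U : set 'rV[R]_n, [/\ open U, U p & forall k, Ck_on k U f].

(* A manifold with corners is carried by a topological space together with its
   smooth functions: [smooth_near p f] means that the germ of f at p is smooth
   (values of f away from p are irrelevant).  The record is raw data; the
   axioms are in [manifold_with_corners]. *)
Record germ_space (R : realType) := GermSpace {
  car :> topologicalType;
  sdim : nat;
  smooth_near : car -> (car -> R) -> Prop }.

Definition euclidean (R : realType) (n : nat) : germ_space R :=
  @GermSpace R 'rV[R]_n n (@smooth_near_rV R n).

Definition submanifold_space (R : realType) (X : germ_space R) (A : set X)
    (n : nat) : germ_space R :=
  @GermSpace R (set_type A) n
    (fun p f => exists h : X -> R, smooth_near (set_val p) h /\
       (\forall q \near p, f q = h (set_val q))).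

Section Maps.
Variable R : realType.
Implicit Types X Y : germ_space R.

Definition smooth_map X Y (F : X -> Y) : Prop :=
  continuous F /\
  forall p (f : Y -> R), smooth_near (F p) f -> smooth_near p (f \o F).

(* F maps the open set U diffeomorphically onto its image, where F(U) carries
   the topology and the smooth functions induced from Y. *)
Definition embeds X Y (U : set X) (F : X -> Y) : Prop :=
  [/\ open U,
      {in U &, injective F},
      (forall p, U p -> forall A : set X, nbhs p A <->
         exists2 B, nbhs (F p) B & U `&` F @^-1` B `<=` A) &
      (forall p, U p -> forall f : X -> R, smooth_near p f <->
         exists h : Y -> R, smooth_near (F p) h /\
           (\forall q \near p, f q = h (F q)))].

Definition diffeomorphism X Y (F : X -> Y) : Prop :=
  [/\ sdim X = sdim Y, embeds setT F & range F = setT].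

(* The coordinates x are the entries of [crd] with index in [bnd], the
   coordinates y are the other entries. *)
Record coords X := Coords {
  dom : set X;
  crd : X -> euclidean R (sdim X);
  bnd : {set 'I_(sdim X)} }.

Definition corner n (B : {set 'I_n}) : set (euclidean R n) :=
  [set u : 'rV[R]_n | forall i, i \in B -> 0 <= u 0 i].

Definition adapted X (p : X) (c : coords X) : Prop :=
  [/\ dom c p, embeds (dom c) (crd c),
      (exists2 O, open O & crd c @` dom c = O `&` corner (bnd c)) &
      forall i, i \in bnd c -> crd c p 0 i = 0].

Definition vanishing X (c : coords X) (A : {set 'I_(sdim X)}) : set X :=
  [set q | forall i, i \in A -> crd c q 0 i = 0].

Definition interior_points X : set X :=
  [set p | exists c : coords X, adapted p c /\ bnd c = finset.set0].

(* The zero set of rho is then a boundary hypersurface: it is closed, connected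
   and everywhere locally a boundary face of codimension one. *)
Definition boundary_defining X (rho : X -> R) : Prop :=
  [/\ forall p, smooth_near p rho, forall p, 0 <= rho p,
      [set p | rho p = 0] !=set0, connected [set p | rho p = 0] &
      forall p, rho p = 0 -> exists (c : coords X) (i : 'I_(sdim X)),
        [/\ adapted p c, i \in bnd c & \forall q \near p, rho q = crd c q 0 i]].

(* The last clause says that boundary hypersurfaces are embedded and have
   boundary defining functions. *)
Definition manifold_with_corners X : Prop :=
  [/\ hausdorff_space X, @second_countable X,
      (forall p : X, exists c : coords X, adapted p c) &
      (forall (p : X) (c : coords X) i, adapted p c -> i \in bnd c ->
         exists2 rho : X -> R, boundary_defining rho &
           \forall q \near p, rho q = 0 <-> crd c q 0 i = 0)].

(* The pairs in s are boundary defining functions of X with their exponents. *)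
Definition b_pullback X Y (F : X -> Y) (rho' : Y -> R) : Prop :=
  exists (alpha : X -> R) (s : seq ((X -> R) * nat)),
    [/\ forall p, smooth_near p alpha, forall p, 0 < alpha p,
        (forall e, e \in s -> boundary_defining e.1) &
        forall p, rho' (F p) = alpha p * \prod_(e <- s) e.1 p ^+ e.2].

Definition b_map X Y (F : X -> Y) : Prop :=
  smooth_map F /\ forall rho' : Y -> R, boundary_defining rho' ->
    (forall p, rho' (F p) = 0) \/ b_pullback F rho'.

Definition interior_b_map X Y (F : X -> Y) : Prop :=
  b_map F /\ forall rho' : Y -> R, boundary_defining rho' ->
    ~ (forall p, rho' (F p) = 0).

Definition b_fibration X Y (F : X -> Y) : Prop :=
  [/\ b_map F, range F = setT &
    forall m : X, exists (c : coords X) (c' : coords Y),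
      [/\ adapted m c, adapted (F m) c',
        (exists g : 'I_(sdim Y) -> 'I_(sdim X),
          {in ~: bnd c' &, injective g}%SET /\
          forall l, l \notin bnd c' -> g l \notin bnd c /\
            \forall p \near m, crd c' (F p) 0 l = crd c p 0 (g l)) &
        (exists J : 'I_(sdim Y) -> {set 'I_(sdim X)},
          (forall j j', j \in bnd c' -> j' \in bnd c' -> j != j' ->
             (J j :&: J j' = finset.set0)%SET) /\
          forall j, j \in bnd c' -> J j \subset bnd c /\
            \forall p \near m,
              crd c' (F p) 0 j = \prod_(i in J j) crd c p 0 i)]].

Definition p_submanifold_at X (Z : set X) (p : X) (c : coords X)
    (A : {set 'I_(sdim X)}) : Prop :=
  adapted p c /\ Z `&` dom c = vanishing c A `&` dom c.

Definition p_submanifold X (Z : set X) : Prop :=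
  closed Z /\ forall p, Z p -> exists c A, p_submanifold_at Z p c A.

Definition p_submanifold_dim X (Z : set X) (d : nat) : Prop :=
  closed Z /\ forall p, Z p -> exists c A,
    p_submanifold_at Z p c A /\ (#|A| + d = sdim X)%N.

Definition p_embedding X Y (F : X -> Y) : Prop :=
  embeds setT F /\ p_submanifold_dim (range F) (sdim X).

(* A selects boundary coordinates; the columns of L are linear functions of the
   remaining coordinates. *)
Definition p_clean X (C : set (set X)) : Prop :=
  [/\ finite_set C, forall Z, C Z -> p_submanifold Z &
    forall p, (\bigcup_(Z in C) Z) p -> exists c : coords X, adapted p c /\
      forall Z, C Z -> Z p ->
        exists (A : {set 'I_(sdim X)}) (r : nat) (L : 'M[R]_(sdim X, r)),
          [/\ A \subset bnd c, (forall i j, i \in bnd c -> L i j = 0) &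
            Z `&` dom c =
            vanishing c A `&` [set q | crd c q *m L = 0] `&` dom c]].

Definition closed_under_intersection (T : Type) (C : set (set T)) : Prop :=
  forall Z Z', C Z -> C Z' -> Z `&` Z' = set0 \/ C (Z `&` Z').

(* Polar coordinates for the submanifold {u_i = 0, i in A}: the row (s, u)
   stands for the radius s, the point (u_i)_{i in A} of the unit sphere, and
   the coordinates (u_i)_{i notin A} along the submanifold. *)
Definition polar n (A : {set 'I_n}) (w : 'rV[R]_(1 + n)) : euclidean R n :=
  \row_i ((if i \in A then lsubmx w 0 0 else 1) * rsubmx w 0 i).

(* In b the submanifold is {u_i = 0, i in A} and the domain is D; directions are
   inward-pointing. *)
Definition polar_domain n (A B : {set 'I_n}) (D : set (euclidean R n)) :
    set (euclidean R (1 + n)) :=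
  [set w : 'rV[R]_(1 + n) |
    [/\ 0 <= lsubmx w 0 0, \sum_(i in A) rsubmx w 0 i ^+ 2 = 1,
        (forall i, i \in A :&: B -> 0 <= rsubmx w 0 i)%SET &
        D (polar A w)]].

(* b exhibits X' as the real, spherical, inward-pointing blow-up [X; Z] of the
   closed p-submanifold Z: a diffeomorphism off Z, and introduction of polar
   coordinates normal to Z near each point of Z.  This determines X' up to a
   unique diffeomorphism over X. *)
Definition is_blowup X (Z : set X) X' (b : X' -> X) : Prop :=
  [/\ sdim X' = sdim X, closed Z,
      embeds (b @^-1` (~` Z)) b, ~` Z `<=` range b &
      forall p, Z p -> exists (c : coords X) (A : {set 'I_(sdim X)}),
        p_submanifold_at Z p c A /\
        exists Phi : X' -> euclidean R (1 + sdim X),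
          [/\ embeds (b @^-1` dom c) Phi,
              Phi @` (b @^-1` dom c) =
                polar_domain A (bnd c) (crd c @` dom c) &
              forall q, dom c (b q) -> crd c (b q) = polar A (Phi q)]].

(* The lift (proper transform) of Z' under the blow-up b of Z. *)
Definition blowup_lift X (Z : set X) X' (b : X' -> X) (Z' : set X) : set X' :=
  [set q | if `[< Z' `<=` Z >] then Z' (b q)
           else closure (b @^-1` (Z' `\` Z)) q].

Inductive iterated_blowup X' : forall X, seq (set X) -> (X' -> X) -> Prop :=
| IteratedBlowup0 X (b : X' -> X) :
    diffeomorphism b -> iterated_blowup [::] b
| IteratedBlowupS X (Z : set X) (s : seq (set X)) X1 (b1 : X1 -> X)
    (b2 : X' -> X1) :
    is_blowup Z b1 -> iterated_blowup [seq blowup_lift Z b1 Z' | Z' <- s] b2 ->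
    iterated_blowup (Z :: s) (b1 \o b2).

Definition size_order X (C : set (set X)) (s : seq (set X)) : Prop :=
  [/\ uniq s, [set Z | Z \in s] = C &
    exists d : set X -> nat, (forall Z, C Z -> p_submanifold_dim Z (d Z)) /\
      sorted (fun Z Z' => d Z <= d Z')%N s].

Definition is_blowup_of_collection X (C : set (set X)) X' (b : X' -> X) : Prop :=
  exists s, size_order C s /\ iterated_blowup s b.

(* Indices are shifted: M k is M[k+1] and 'I_k.+1 is J(k+1). *)
Definition simplicial_maps (M : nat -> germ_space R) : Type :=
  forall n m : nat, ('I_n.+1 -> 'I_m.+1) -> M m -> M n.

Definition generalized_product (M : nat -> germ_space R)
    (S : simplicial_maps M) : Prop :=
  [/\ (forall k, manifold_with_corners (M k) /\ connected [set: M k]) /\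
      (exists mu kappa : int, forall k, (sdim (M k))%:Z = mu + k%:Z * kappa),
      (forall n, S n n id =1 id) /\
      (forall n m r (I : 'I_n.+1 -> 'I_m.+1) (I' : 'I_m.+1 -> 'I_r.+1),
         S n r (I' \o I) =1 S n m I \o S m r I'),
      (forall n m (I : 'I_n.+1 -> 'I_m.+1), interior_b_map (S n m I)),
      (forall n m (I : 'I_n.+1 -> 'I_m.+1), injective I ->
         b_fibration (S n m I) /\
         forall q, connected (S n m I @^-1` [set q])) &
      (forall n m (I : 'I_n.+1 -> 'I_m.+1), (forall i, exists j, I j = i) ->
         p_embedding (S n m I))].

(* iota identifies the generalized product (G, SG) with the interior of
   (M, S). *)
Definition reduces_in_interior (M : nat -> germ_space R) (S : simplicial_maps M)
    (G : nat -> germ_space R) (SG : simplicial_maps G)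
    (iota : forall k, G k -> M k) : Prop :=
  (forall k, [/\ sdim (G k) = sdim (M k), embeds setT (iota k) &
                 range (iota k) = @interior_points (M k)]) /\
  forall n m (I : 'I_n.+1 -> 'I_m.+1) (v : G m),
    S n m I (iota m v) = iota n (SG n m I v).

Definition simplicial_compactification
    (G : nat -> germ_space R) (SG : simplicial_maps G)
    (M : nat -> germ_space R) (S : simplicial_maps M)
    (iota : forall k, G k -> M k) : Prop :=
  [/\ generalized_product S, forall k, compact [set: M k] &
      reduces_in_interior S SG iota].

End Maps.

Section VectorSpaces.
Variables (R : realType) (W : vectType R).

Definition vector_space : germ_space R :=
  @GermSpace R (initial_topology (v2r : W -> 'rV[R]_(dim W))) (dim W)
    (fun p f => smooth_near_rV (v2r (p : W)) (f \o r2v)).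

(* The radial compactification of W is the closed upper half-sphere in R x W,
   W being embedded by v |-> (1, v) / |(1, v)|; R x W is given the Euclidean
   norm of linear coordinates. *)
Definition half_sphere : set (euclidean R (1 + dim W)) :=
  [set w : 'rV[R]_(1 + dim W) |
    0 <= lsubmx w 0 0 /\ \sum_i w 0 i ^+ 2 = 1].

Definition radial : germ_space R := submanifold_space half_sphere (dim W).

Definition radial_row (v : W) : 'rV[R]_(1 + dim W) :=
  (Num.sqrt (1 + \sum_i v2r v 0 i ^+ 2))^-1 *: row_mx (const_mx 1) (v2r v).

Lemma radial_row_in (v : W) : radial_row v \in half_sphere.
Proof.
have h : 0 < 1 + \sum_i v2r v 0 i ^+ 2.
  by rewrite ltr_wpDr ?ltr01// sumr_ge0// => i _; exact: sqr_ge0.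
apply/mem_set; split.
  by rewrite /radial_row scale_row_mx /= row_mxKl !mxE mulr1 invr_ge0 sqrtr_ge0.
rewrite /radial_row; set c := _^-1; rewrite scale_row_mx big_split_ord /= big_ord1.
rewrite row_mxEl !mxE mulr1.
under eq_bigr => i _ do rewrite row_mxEr mxE exprMn.
rewrite -mulr_sumr -{1}[c ^+ 2]mulr1 -mulrDr.
by rewrite exprVn sqr_sqrtr ?ltW// mulVf ?gt_eqF.
Qed.

Definition radial_incl (v : W) : radial :=
  exist _ (radial_row v) (radial_row_in v).

(* The intersection of a linear subspace L with the sphere at infinity. *)
Definition at_infinity (L : set W) : set radial :=
  [set q | lsubmx (set_val q : 'rV[R]_(1 + dim W)) 0 0 = 0 /\
           L (r2v (rsubmx (set_val q : 'rV[R]_(1 + dim W))))].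

End VectorSpaces.

Section Translation.
Variables (R : realType) (V : vectType R).

(* V^k, the model of V^(k+1) / V. *)
Definition vpow (k : nat) : vectType R := {ffun 'I_k -> V}.

Definition diagonals (k : nat) : set (set (vpow k)) :=
  [set D | (exists j : 'I_k, D = [set v : vpow k | v j = 0]) \/
           (exists j l : 'I_k, (j < l)%N /\ D = [set v : vpow k | v j = v l])].

Arguments diagonals : clear implicits.

(* Intersections missing the sphere at infinity are left out. *)
Definition diagonals_at_infinity (k : nat) : set (set (radial (vpow k))) :=
  [set Z | Z !=set0 /\ exists K : set (set (vpow k)),
     [/\ K !=set0, K `<=` diagonals k &
         Z = at_infinity (\bigcap_(D in K) D)]].

Definition quotient_map (k : nat) (w : 'I_k.+1 -> V) : vpow k :=
  [ffun j => w (lift ord_max j) - w ord_max].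

(* The representative (v_1, ..., v_k, 0) of the class in V^(k+1) / V. *)
Definition representative (k : nat) (v : vpow k) : 'I_k.+1 -> V :=
  fun i => if unlift ord_max i is Some j then v j else 0.

Definition translation_group (k : nat) : germ_space R := vector_space (vpow k).

Definition translation_maps : simplicial_maps translation_group :=
  fun n m I v => quotient_map (representative v \o I).

End Translation.

Arguments diagonals_at_infinity {R} V k.
Arguments translation_maps {R} V n m.

(* Main.v *)
(* After finitely many blow-ups the space is the closure of the image of the
   vector space under the maps theta_A(v) = (1, A v) / |(1, A v)|, one for each
   flat A blown up so far (a flat is a space of functionals A, with center the
   trace at infinity of its kernel), together with A = 1, which gives the radial
   compactification. Near a point p the flats are filtered by the growth of A v:
   this gives a chain A_0 > A_1 > ... > A_m and a basis of functionals adapted to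
   it. If R_l is a functional of maximal growth at level l, and R_m = 1, then the
   R_(l+1) / R_l are boundary coordinates and the remaining f / R_l interior ones,
   and |(1, A v)| is R_l times a positive smooth function for some l. So blowing
   up the next flat, in order of dimension, yields a space of the same kind.
   A translation map is linear and pulls flats back to flats, hence the ratios of
   the |(1, A v)|, which define the boundary hypersurfaces, to monomials. If I is
   injective, an adapted basis of the target pulls back to part of an adapted
   basis of the source, which puts the map in the normal form of a b-fibration; if
   I is surjective, the kernel of the pullback is a flat of the target, and the
   image is cut out by the coordinates f / R_l with f in this flat. *)

(* [is_blowup] only asks for polar coordinates in some chart, and the theorem concerns arbitrary
   iterated blow-ups, so nothing is known about [E] beyond such local data. The remedy is to let the
   interior vector space carry all information: [presents] says that a space is embedded as the
   closure of the image of a map defined there, and [xt] computes with functions on the interior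
   that extend smoothly to a boundary point. A blow-up of a presented space is again presented, with
   [theta A] added, since a continuous injection of a compact space is a homeomorphism onto its
   image; read backwards, the closure is a model, which gives existence. Comparing two charts, or
   two systems of equations of one submanifold, rests on Hadamard's lemma for [Ck_on], proved by
   integration. The order by dimension enters only through [next_center]: a flat still to be treated
   contains no nonzero flat of [F], and its sum with one is again in [F]. Finally, the zero set of a
   boundary defining function must be connected, whereas a [face] is not shown to be so: its
   connected components serve as hypersurfaces. *)
From HB Require Import structures.
Require Import Defs.
From mathcomp Require Import all_boot all_order all_algebra.
From mathcomp Require Import all_classical all_reals all_analysis.
From mathcomp Require Import ring lra.
Import Order.TTheory GRing.Theory Num.Theory numFieldNormedType.Exports.
Import VectorInternalTheory.
Set Implicit Arguments.
Unset Strict Implicit.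
Unset Printing Implicit Defensive.
Local Open Scope classical_set_scope.
Local Open Scope ring_scope.

(* Unification often unfolds the neighbourhood filters of row vectors. *)
#[export] Instance rV_nbhs_filter (R : realType) n (x : 'rV[R]_n) :
  Filter [set P | exists2 Q : 'I_1 -> 'I_n -> set R, [set P0 | forall i j, nbhs (x i j) (P0 i j)] Q &
    [set my : 'rV[R]_n | forall i j, Q i j (my i j)] `<=` P].
Proof. exact: (nbhs_filter x). Qed.

(** * Smooth functions on row vectors *)

Section Ck.
Context {R : realType}.

(** Restriction to a line turns a directional derivative into a derivative in one variable, to which
    the chain rule, the mean value theorem and the fundamental theorem apply. *)
Lemma derive_line (V W : normedModType R) (f : V -> W) x v :
  'D_v f x = 'D_1 (fun h : R => f (h *: v + x)) 0.
Proof.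
rewrite /derive; set F := fun h => _; set G := fun h => _.
suff -> : F = G by [].
by apply/funext => h; rewrite /F /G /= addr0 [h%:A]mulr1 scale0r add0r.
Qed.

Lemma is_derive_line (V W : normedModType R) (f : V -> W) x v d :
  is_derive x v f d <-> is_derive (0 : R) 1 (fun h : R => f (h *: v + x)) d.
Proof.
have E := derivable1P f x v; have D := derive_line f x v.
split=> -[d1 d2].
  have h1 := E.1 d1; have h2 := etrans (esym D) d2; exact: DeriveDef h1 h2.
have h1 := E.2 d1; have h2 := etrans D d2; exact: DeriveDef h1 h2.
Qed.

Lemma is_derive_comp1 (V : normedModType R) (h : R -> R) (f : V -> R) x v a d :
  is_derive (f x) 1 h a -> is_derive x v f d -> is_derive x v (h \o f) (a * d).
Proof.
move=> dh /is_derive_line df; apply/is_derive_line.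
apply: (@is_derive1_comp R h (fun t : R => f (t *: v + x))) => //.
by rewrite scale0r add0r.
Qed.

Variable n : nat.
Implicit Types (f g : 'rV[R]_n -> R) (U : set 'rV[R]_n) (x : 'rV[R]_n).

Lemma Ck_on_cont k U f x : Ck_on k U f -> U x -> f y @[y --> x] --> f x.
Proof. by case: k => [|k] [h _] Ux; exact: h. Qed.

Lemma Ck_on_der k U f x i : Ck_on k.+1 U f -> U x ->
  is_derive x (delta_mx 0 i) f ('D_(delta_mx 0 i) f x).
Proof. by move=> [_ /(_ i)[h _]] /h d; exact: derivableP. Qed.

Lemma Ck_on_D k U f i : Ck_on k.+1 U f -> Ck_on k U (fun x => 'D_(delta_mx 0 i) f x).
Proof. by move=> [_ /(_ i)[]]. Qed.

Lemma Ck_onW k U f : Ck_on k.+1 U f -> Ck_on k U f.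
Proof.
elim: k f => [|k IH] f [c h]; first by split.
by split=> // i; have [h1 h2] := h i; split=> //; exact: IH.
Qed.

Lemma Ck_on_sub k U U' f : U' `<=` U -> Ck_on k U f -> Ck_on k U' f.
Proof.
move=> sU; elim: k f => [|k IH] f [c h]; (split=> [x /sU/c//|]) => //.
move=> i; by have [h1 h2] := h i; split=> [x /sU/h1//|]; exact: IH.
Qed.

Lemma Ck_on_ext k U f g : open U -> (forall x, U x -> f x = g x) -> Ck_on k U f -> Ck_on k U g.
Proof.
move=> oU; elim: k f g => [|k IH] f g fg [c h].
  split=> // x Ux; have nfg : \near x, f x = g x.
    by near do apply: fg; exact: open_nbhs_nbhs.
  rewrite /prop_for /continuous_at -(fg x Ux); apply: cvg_trans (c _ Ux).
  exact: (@near_eq_cvg _ _ (nbhs x)).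
have nfg x : U x -> \near x, f x = g x.
  by move=> Ux; near do apply: fg; exact: open_nbhs_nbhs.
split=> [x Ux|i].
  rewrite /prop_for /continuous_at -(fg x Ux); apply: cvg_trans (c _ Ux).
  exact: near_eq_cvg (nfg x Ux).
have [h1 h2] := h i; split=> [x Ux|].
  by apply: near_eq_derivable (nfg _ Ux) (h1 _ Ux).
apply: IH h2 => x Ux; exact: near_eq_derive (nfg _ Ux).
Unshelve. all: by end_near. Qed.

(** Partial derivatives may be supplied by a formula [df] instead of ['D], so that an induction on
    [k] can be applied to the formula. *)
Lemma Ck_onS k U f (df : 'I_n -> 'rV[R]_n -> R) : open U -> (forall x, U x -> f y @[y --> x] --> f x) ->
  (forall x i, U x -> is_derive x (delta_mx 0 i) f (df i x)) ->
  (forall i, Ck_on k U (df i)) -> Ck_on k.+1 U f.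
Proof.
move=> oU cf d h; split=> // i; split=> [x Ux|]; first by have [] := d x i Ux.
by apply: Ck_on_ext (h i) => // x Ux; have [_ ->] := d x i Ux.
Qed.

Lemma Ck_on_cst k U c : open U -> Ck_on k U (fun=> c).
Proof.
move=> oU; elim: k c => [|k IH] c; first by split=> // x _; exact: cst_continuous.
apply: (@Ck_onS _ _ _ (fun _ _ => 0)) => // x Ux; exact: cst_continuous.
Qed.

Lemma is_derive_coord x v (j : 'I_n) : is_derive x v (fun y : 'rV[R]_n => y 0 j) (v 0 j).
Proof.
apply/is_derive_line.
have -> : (fun h : R => (h *: v + x) 0 j) = (fun h => h * v 0 j + x 0 j).
  by apply/funext => h; rewrite !mxE.
by apply: is_derive_eq; rewrite scaler0 add0r addr0 scaler1.
Qed.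

Lemma Ck_on_coord k U (j : 'I_n) : open U -> Ck_on k U (fun x => x 0 j).
Proof.
move=> oU; have cc x : (y : 'rV[R]_n) 0 j @[y --> x] --> x 0 j.
  exact: coord_continuous.
case: k => [|k]; first by split=> // x _; exact: cc.
apply: (@Ck_onS _ _ _ (fun i _ => (delta_mx 0 i : 'rV[R]_n) 0 j)) => //.
  by move=> x i _; exact: is_derive_coord.
by move=> i; exact: Ck_on_cst.
Qed.

Lemma Ck_onD k U f g : open U -> Ck_on k U f -> Ck_on k U g -> Ck_on k U (fun x => f x + g x).
Proof.
move=> oU; elim: k f g => [|k IH] f g hf hg.
  by split=> // x Ux; apply: (@cvgD _ _ _ (nbhs x)); [exact: (Ck_on_cont hf Ux)|exact: (Ck_on_cont hg Ux)].
apply: (@Ck_onS _ _ _ (fun i x => 'D_(delta_mx 0 i) f x + 'D_(delta_mx 0 i) g x)) => //.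
- by move=> x Ux; apply: (@cvgD _ _ _ (nbhs x)); [exact: (Ck_on_cont hf Ux)|exact: (Ck_on_cont hg Ux)].
- by move=> x i Ux; have := Ck_on_der i hf Ux; have := Ck_on_der i hg Ux => ? ?; apply: is_deriveD.
- by move=> i; apply: IH; exact: Ck_on_D.
Qed.

Lemma Ck_onM k U f g : open U -> Ck_on k U f -> Ck_on k U g -> Ck_on k U (fun x => f x * g x).
Proof.
move=> oU; elim: k f g => [|k IH] f g hf hg.
  by split=> // x Ux; apply: (@cvgM _ _ (nbhs x)); [exact: (Ck_on_cont hf Ux)|exact: (Ck_on_cont hg Ux)].
apply: (@Ck_onS _ _ _ (fun i x => f x * 'D_(delta_mx 0 i) g x + g x * 'D_(delta_mx 0 i) f x)) => //.
- by move=> x Ux; apply: (@cvgM _ _ (nbhs x)); [exact: (Ck_on_cont hf Ux)|exact: (Ck_on_cont hg Ux)].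
- by move=> x i Ux; have := Ck_on_der i hf Ux; have := Ck_on_der i hg Ux => ? ?; apply: is_deriveM.
- by move=> i; apply: Ck_onD => //; apply: IH; rewrite //; try exact: Ck_on_D; exact: Ck_onW.
Qed.

(** The induction on [k] passes from [h] to its derivative, so it runs over a class [S] closed under
    differentiation on [I] instead of a single function. The classes used are the [c t^-m], the
    [c sqrt t t^-m] and [flat_span]. *)
Lemma Ck_on_comp1 (S : (R -> R) -> Prop) (I : set R) k U f h : open U ->
  (forall h, S h -> exists2 h', S h' & forall t, I t -> is_derive t 1 h (h' t)) ->
  S h -> Ck_on k U f -> (forall x, U x -> I (f x)) -> Ck_on k U (h \o f).
Proof.
move=> oU SD; elim: k h => [|k IH] h Sh hf UI.
  split=> // x Ux; apply: continuous_comp; first exact: Ck_on_cont hf Ux.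
  have [h' Sh' d] := SD _ Sh; have [d1 _] := d _ (UI _ Ux).
  exact/differentiable_continuous/derivable1_diffP.
have [h' Sh' d] := SD _ Sh.
apply: (@Ck_onS _ _ _ (fun i x => h' (f x) * 'D_(delta_mx 0 i) f x)) => //.
- move=> x Ux; apply: continuous_comp; first exact: Ck_on_cont hf Ux.
  have [d1 _] := d _ (UI _ Ux).
  exact/differentiable_continuous/derivable1_diffP.
- by move=> x i Ux; apply: is_derive_comp1; [exact/d/UI|exact: Ck_on_der hf Ux].
- by move=> i; apply: Ck_onM => //; [apply: IH => //; exact: Ck_onW|exact: Ck_on_D].
Qed.

Lemma is_derive_exprn m (t : R) : is_derive t 1 (fun t : R => t ^+ m) (m%:R * t ^+ m.-1).
Proof.
have := @is_deriveX R R id m t 1 1 (@is_derive_id _ _ _ _).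
by rewrite /GRing.scale /= mulr1 fctE.
Qed.

Lemma is_derive_exprnV m (t : R) : t != 0 ->
  is_derive t 1 (fun t : R => (t ^+ m)^-1) (- (t ^+ m) ^- 2 * (m%:R * t ^+ m.-1)).
Proof.
move=> t0; have d := is_derive_exprn m t.
by apply: is_deriveV; rewrite expf_neq0.
Qed.

Lemma Ck_onV k U f : open U -> Ck_on k U f -> (forall x, U x -> f x != 0) ->
  Ck_on k U (fun x => (f x)^-1).
Proof.
move=> oU hf f0.
apply: (@Ck_on_comp1 (fun h => exists c m, h = fun t => c * t ^- m)
  [set t | t != 0] k U f (fun t => t^-1)) => //; last first.
  by exists 1, 1%N; apply/funext => t; rewrite mul1r expr1.
move=> _ [c [m ->]]; exists (fun t => (- (c * m%:R)) * t ^- m.+1).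
  by exists (- (c * m%:R)), m.+1.
move=> t /= t0.
have dV := is_derive_exprnV m t0.
have -> : - (c * m%:R) / t ^+ m.+1 = c * (- (t ^+ m) ^- 2 * (m%:R * t ^+ m.-1)).
  case: m dV => [|m] dV; first by rewrite !(mulr0, mul0r, oppr0).
  have a0 : t ^+ m != 0 by rewrite expf_neq0.
  move: a0; rewrite /= !exprS; move: (t ^+ m) (m.+1%:R : R) => a b a0.
  by field; rewrite t0 a0.
exact: is_deriveZ.
Qed.

Lemma Ck_on_sqrt k U f : open U -> Ck_on k U f -> (forall x, U x -> 0 < f x) ->
  Ck_on k U (fun x => Num.sqrt (f x)).
Proof.
move=> oU hf f0.
apply: (@Ck_on_comp1 (fun h => exists c m, h = fun t => c * (Num.sqrt t * t ^- m))
  [set t | 0 < t] k U f Num.sqrt) => //; last first.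
  by exists 1, 0%N; apply/funext => t; rewrite mul1r expr0 invr1 mulr1.
move=> _ [c [m ->]]; exists (fun t => (c * (2^-1 - m%:R)) * (Num.sqrt t * t ^- m.+1)).
  by exists (c * (2^-1 - m%:R)), m.+1.
move=> t /= t_gt0; have t0 : t != 0 by rewrite gt_eqF.
have dV := is_derive_exprnV m t0.
have dS := is_derive1_sqrt t_gt0.
have s0 : Num.sqrt t != 0 by rewrite gt_eqF// sqrtr_gt0.
have ts : t = Num.sqrt t ^+ 2 by rewrite sqr_sqrtr// ltW.
have -> : c * (2^-1 - m%:R) * (Num.sqrt t / t ^+ m.+1) =
  c * (Num.sqrt t * (- (t ^+ m) ^- 2 * (m%:R * t ^+ m.-1)) + (t ^+ m)^-1 * (2 * Num.sqrt t)^-1).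
  move: s0 ts {dV dS t_gt0 t0}; generalize (Num.sqrt t) => r r0 ->.
  case: m => [|m]; first by rewrite !(mulr0, mul0r, expr0, oppr0); field; rewrite r0.
  have a0 : (r ^+ 2) ^+ m != 0 by rewrite !expf_neq0.
  move: a0; rewrite /= ![(r ^+ 2) ^+ _.+1]exprS.
  move: ((r ^+ 2) ^+ m) (m.+1%:R : R) => a b a0.
  by field; rewrite r0 a0.
apply: is_deriveZ; exact: is_deriveM.
Qed.

End Ck.

(** * Differentiability and the chain rule for C^1 functions *)

Section C1.
Context {R : realType}.

Lemma rV_norm_le n (w : 'rV[R]_n) c : 0 <= c -> (forall j, `|w 0 j| <= c) -> `|w| <= c.
Proof.
move=> c0 h; rewrite /Num.norm /= mx_normrE; apply: bigmax_le => //= -[i j] _ /=.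
by rewrite (ord1 i).
Qed.

Lemma rV_coord_le n (w : 'rV[R]_n) j : `|w 0 j| <= `|w|.
Proof.
rewrite [leRHS]/Num.norm /= mx_normrE.
exact: (le_bigmax _ (fun i : 'I_1 * 'I_n => `|w i.1 i.2|) (0, j)).
Qed.

Lemma near_forall (I : finType) (T : topologicalType) (p : T) (P : I -> T -> Prop) :
  (forall i, \forall q \near p, P i q) -> \forall q \near p, forall i, P i q.
Proof. exact: filter_forall. Qed.

Lemma rV_cvg (T : Type) (F : set_system T) {FF : Filter F} n (g : 'I_n -> T -> R) (l : 'rV[R]_n) :
  (forall j, g j y @[y --> F] --> l 0 j) -> (\row_j g j y : 'rV[R]_n) @[y --> F] --> l.
Proof.
move=> h A [P hP sP].
have : \forall y \near F, forall j, P 0 j (g j y).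
  by apply: filter_forall => j; apply: h; exact: hP.
by apply: filterS => y Py; apply: sP => i j; rewrite mxE (ord1 i).
Qed.

Lemma is_derive_along (V W : normedModType R) (f : V -> W) x v (t : R) d :
  is_derive (t *: v + x) v f d -> is_derive t 1 (fun s : R => f (s *: v + x)) d.
Proof.
move=> /is_derive_line D; apply/is_derive_line; move: D.
suff -> : (fun h : R => f (h *: v + (t *: v + x))) = (fun h : R => f ((h *: 1 + t) *: v + x)) by [].
by apply/funext => h; rewrite scalerDl addrA [h *: 1]mulr1.
Qed.

(** The increments of a row vector have either sign, so the mean value theorem is put in a form that
    covers the segments from 0 to [a] on both sides. *)
Lemma MVT0 (g dg : R -> R) (a : R) : (forall t : R, `|t| <= `|a| -> is_derive t 1 g (dg t)) ->
  exists2 t, `|t| <= `|a| & g a - g 0 = a * dg t.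
Proof.
move=> D.
have cg (b c : R) : (forall t, b <= t <= c -> `|t| <= `|a|) -> {within `[b, c], continuous g}.
  move=> bc; apply: derivable_within_continuous => s; rewrite in_itv /=.
  by move=> /bc/D[].
have [a0|/ltW a0] := leP 0 a.
  have I t : 0 <= t <= a -> `|t| <= `|a|.
    by move=> /andP[t0 ta]; rewrite !ger0_norm.
  have Dg t : t \in `]0, a[%R -> is_derive t 1 g (dg t).
    by rewrite in_itv => /andP[/ltW t1 /ltW t2]; apply/D/I/andP.
  have [t tI E] := MVT_segment a0 Dg (cg _ _ I).
  by exists t; [exact: I|rewrite E subr0 mulrC].
have I t : a <= t <= 0 -> `|t| <= `|a|.
  by move=> /andP[t0 ta]; rewrite !ler0_norm ?lerN2.
have Dg t : t \in `]a, 0[%R -> is_derive t 1 g (dg t).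
  by rewrite in_itv => /andP[/ltW t1 /ltW t2]; apply/D/I/andP.
have [t tI E] := MVT_segment a0 Dg (cg _ _ I).
by exists t; [exact: I|rewrite -opprB E sub0r mulrN opprK mulrC].
Qed.

Lemma differentiable_littleo (V W : normedModType R) (f : V -> W) x
    (L : {linear V -> W}) : continuous L ->
  (forall e, 0 < e -> \forall h \near 0, `|f (h + x) - f x - L h| <= e * `|h|) -> differentiable f x.
Proof.
move=> cL fL.
have E : f \o shift x = cst (f x) + L +o_ 0 id.
  apply/eqaddoP => e e0; apply: filterS (fL _ e0) => h /=.
  by rewrite opprD addrA.
have dL := diff_unique cL E.
by apply/diff_locallyP; rewrite dL.
Qed.

Lemma Ck_on_sum n k (I : Type) (s : seq I) (P : pred I) (U : set 'rV[R]_n)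
    (F : I -> 'rV[R]_n -> R) : open U ->
  (forall i, P i -> Ck_on k U (F i)) -> Ck_on k U (fun x => \sum_(i <- s | P i) F i x).
Proof.
move=> oU hF; elim: s => [|i s IH].
  apply: Ck_on_ext (Ck_on_cst k 0 oU) => // x _; by rewrite big_nil.
have [Pi|Pi] := boolP (P i).
  by apply: Ck_on_ext (Ck_onD oU (hF _ Pi) IH) => // x _; rewrite big_cons Pi.
by apply: Ck_on_ext IH => // x _; rewrite big_cons (negbTE Pi).
Qed.

(** The coordinates are changed one at a time; the mean value theorem turns each increment into a
    partial derivative at a nearby point, which by continuity differs little from the one at [x]. *)
Lemma Ck_on_differentiable n (U : set 'rV[R]_n) (f : 'rV[R]_n -> R) x :
  open U -> Ck_on 1 U f -> U x -> differentiable f x.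
Proof.
move=> oU hf Ux.
pose df (h : 'rV[R]_n) : R^o := \sum_i h 0 i *: 'D_(delta_mx 0 i) f x.
have lin_df : linear df.
  move=> a u v; rewrite /df scaler_sumr -big_split /=; apply: eq_bigr => i _.
  by rewrite !mxE scalerDl scalerA.
pose L : {linear 'rV[R]_n -> R^o} := HB.pack df (GRing.isLinear.Build _ _ _ _ df lin_df).
have cL : continuous L.
  have : Ck_on 0 setT (fun h : 'rV[R]_n => \sum_i h 0 i * 'D_(delta_mx 0 i) f x).
    apply: Ck_on_sum => [|i _]; first exact: openT.
    by apply: Ck_onM; [exact: openT|apply: Ck_on_coord; exact: openT|apply: Ck_on_cst; exact: openT].
  by move=> [cL _] y; exact: cL.
apply: (@differentiable_littleo _ _ (f : 'rV[R]_n -> R^o) x L cL) => _/posnumP[e].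
  (* There are [n] increments, each with error at most [e'] times the norm of [h]; the denominator
     [n.+1] is also valid for [n = 0]. *)
  pose e' := e%:num / n.+1%:R.
  have e'0 : 0 < e' by rewrite divr_gt0.
  have : \forall y \near x, U y /\ forall i : 'I_n,
      `|'D_(delta_mx 0 i) f x - 'D_(delta_mx 0 i) f y| <= e'.
    apply: filterI; first exact: open_nbhs_nbhs.
    apply: (@filter_forall _ _ (fun i y => `|'D_(delta_mx 0 i) f x - 'D_(delta_mx 0 i) f y| <= e') (nbhs x)) => i.
    have /cvgr_dist_le := Ck_on_cont (Ck_on_D i hf) Ux; exact.
  move=> /nbhs_ballP[d /= d0 hd].
  have h0d : \forall h \near (0 : 'rV[R]_n), `|h| < d by exact: nbhs0_lt.
  apply: filterS h0d => h hd'.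
  (* The vertices of the path from 0 to [h] along the axes: the first [k] coordinates have been
     switched on. *)
  pose hk k : 'rV[R]_n := \row_j (if (j < k)%N then h 0 j else 0).
  have h0 : hk 0%N = 0 by apply/rowP => j; rewrite !mxE.
  have hn : hk n = h by apply/rowP => j; rewrite !mxE ltn_ord.
  have step (k : 'I_n) : exists2 y, ball x d y &
      f (hk k.+1 + x) - f (hk k + x) = h 0 k * 'D_(delta_mx 0 k) f y.
    pose c t : 'rV[R]_n := t *: delta_mx 0 k + (hk k + x).
    have bc (t : R) : `|t| <= `|h 0 k| -> ball x d (c t).
      move=> th; rewrite mx_norm_ball /ball_ /= distrC /c addrA addrK.
      apply: le_lt_trans hd'; apply: rV_norm_le => // j.
      rewrite !mxE; case: (eqVneq j k) => [->|jk].
        by rewrite ltnn addr0 mulr1; exact: le_trans th (rV_coord_le _ _).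
      by rewrite mulr0 add0r; case: ifP => _; rewrite ?normr0// rV_coord_le.
    have dc (t : R) : `|t| <= `|h 0 k| ->
        is_derive t (1 : R) (fun t : R => f (c t)) ('D_(delta_mx 0 k) f (c t)).
      move=> /bc/hd[Uc _].
      exact: is_derive_along (Ck_on_der k hf Uc).
    have cE : hk k.+1 + x = c (h 0 k).
      apply/rowP => j; rewrite !mxE ltnS; case: (eqVneq j k) => [->|jk].
        by rewrite leqnn ltnn mulr1 add0r.
      by rewrite mulr0 add0r leq_eqVlt (negbTE (_ : val j != val k)).
    have cE0 : hk k + x = c 0 by rewrite /c scale0r add0r.
    have [t th E] := MVT0 dc; exists (c t); first exact: bc.
    by rewrite cE cE0.
  have -> : f (h + x) - f x - L h =
    \sum_(k < n) (f (hk k.+1 + x) - f (hk k + x) - h 0 k * 'D_(delta_mx 0 k) f x).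
    rewrite sumrB -(big_mkord xpredT (fun k => f (hk k.+1 + x) - f (hk k + x))).
    by rewrite telescope_sumr// hn h0 add0r.
  apply: le_trans (ler_norm_sum _ _ _) _.
  have : \sum_(k < n) `|f (hk k.+1 + x) - f (hk k + x) - h 0 k * 'D_(delta_mx 0 k) f x| <= \sum_(k < n) (`|h| * e').
    apply: ler_sum => k _; have [y /hd[_ yd] ->] := step k.
    rewrite -mulrBr normrM distrC; apply: ler_pM => //; first exact: rV_coord_le.
  move=> /le_trans; apply.
  rewrite sumr_const card_ord -mulr_natr -mulrA mulrC ler_wpM2r//.
  by rewrite /e' -mulrA ler_piMr// mulrC ler_pdivrMr// mul1r ler_nat.
Qed.

Lemma diff_partial n (U : set 'rV[R]_n) (f : 'rV[R]_n -> R) x (w : 'rV[R]_n) :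
  open U -> Ck_on 1 U f -> U x -> 'd f x w = \sum_j w 0 j * 'D_(delta_mx 0 j) f x :> R.
Proof.
move=> oU hf Ux; have df := Ck_on_differentiable oU hf Ux.
rewrite {1}(row_sum_delta w) linear_sum; apply: eq_bigr => j _ /=.
by rewrite linearZ /= deriveE.
Qed.

(** The line through [x] is mapped to a curve [c] in the second space, and the differential of [h]
    at [c 0] is evaluated on its velocity. *)
Lemma is_derive_row n m (g : 'I_m -> 'rV[R]_n -> R) (dg : 'I_m -> R) x v
    (U : set 'rV[R]_m) (h : 'rV[R]_m -> R) : (forall j, is_derive x v (g j) (dg j)) ->
  open U -> Ck_on 1 U h -> U (\row_j g j x) -> is_derive x v (fun y => h (\row_j g j y))
    (\sum_j dg j * 'D_(delta_mx 0 j) h (\row_j g j x)).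
Proof.
move=> gd oU hh Ux; apply/is_derive_line.
pose c t : 'rV[R]_m := \row_j g j (t *: v + x).
have c0 : c 0 = \row_j g j x by rewrite /c scale0r add0r.
have cE : c = \sum_j (fun t => g j (t *: v + x) *: (delta_mx 0 j : 'rV[R]_m)).
  apply/funext => t; rewrite fct_sumE [LHS]row_sum_delta.
  by apply: eq_bigr => j _; rewrite mxE.
have gdiff j : differentiable (fun t : R => g j (t *: v + x)) 0.
  by apply/derivable1_diffP; have /is_derive_line[] := gd j.
have cj j : differentiable (fun t : R => g j (t *: v + x) *: (delta_mx 0 j : 'rV[R]_m)) 0.
  exact: differentiableZl.
have cd : differentiable c 0 by rewrite cE; exact: differentiable_sum.
have hd : differentiable h (c 0) by rewrite c0; exact: Ck_on_differentiable Ux.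
have hc : differentiable (h \o c) 0 by exact: differentiable_comp.
have cder : is_derive (0 : R) 1 c (\row_j dg j).
  rewrite cE [X in is_derive _ _ _ X]row_sum_delta; apply: is_derive_sum => j.
  rewrite mxE; apply: DeriveDef; first exact: diff_derivable.
  rewrite deriveE// diffZl// -deriveE//.
  by have /is_derive_line[_ ->] := gd j.
apply: DeriveDef; first exact: diff_derivable.
have E1 : 'd c 0 1 = \row_j dg j by rewrite -deriveE//; case: cder.
rewrite deriveE// (diff_comp cd hd) /= E1.
by rewrite c0 (diff_partial _ oU hh Ux); apply: eq_bigr => j _; rewrite mxE.
Qed.

Lemma Ck_on_comp k n m (U : set 'rV[R]_n) (g : 'I_m -> 'rV[R]_n -> R)
    (V : set 'rV[R]_m) (h : 'rV[R]_m -> R) : open U -> open V ->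
  (forall j, Ck_on k U (g j)) -> Ck_on k V h -> (forall x, U x -> V (\row_j g j x)) ->
  Ck_on k U (fun x => h (\row_j g j x)).
Proof.
move=> oU oV; elim: k h => [|k IH] h hg hh UV.
  split=> // x Ux.
  apply: (@continuous_comp _ _ _ (fun y => \row_j g j y) h); last first.
    exact: Ck_on_cont hh (UV _ Ux).
  by apply: (@rV_cvg _ (nbhs x)) => j; rewrite mxE; exact: Ck_on_cont (hg j) Ux.
apply: (@Ck_onS _ _ _ _ _ (fun i x => \sum_j 'D_(delta_mx 0 i) (g j) x *
    'D_(delta_mx 0 j) h (\row_j g j x))) => //.
- move=> x Ux.
  apply: (@continuous_comp _ _ _ (fun y => \row_j g j y) h); last first.
    exact: Ck_on_cont hh (UV _ Ux).
  by apply: (@rV_cvg _ (nbhs x)) => j; rewrite mxE; exact: Ck_on_cont (hg j) Ux.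
- move=> x i Ux; apply: (@is_derive_row _ _ _ _ _ _ V) => //.
  + by move=> j; exact: Ck_on_der (hg j) Ux.
  + by elim: (k) hh {IH hg} => // k' IH' /Ck_onW.
  + exact: UV.
- move=> i; apply: Ck_on_sum => // j _; apply: Ck_onM => //.
    exact: Ck_on_D.
  apply: (IH ('D_(delta_mx 0 j) h)) => //; last exact: Ck_on_D.
  by move=> j'; exact: Ck_onW.
Qed.

End C1.

(** * Hadamard's lemma in one coordinate *)

Section Hadamard.
Context {R : realType} (n : nat) (i : 'I_n) (x0 : 'rV[R]_n) (e : R).
Hypothesis x0i : x0 0 i = 0.
Local Notation mu := (@lebesgue_measure R).
Let U : set 'rV[R]_n := [set u | `|u - x0| < e].

(** A homotopy from the projection onto the hyperplane where coordinate [i] vanishes, at [t = 0], to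
    the identity, at [t = 1]. As [x0 0 i = 0], it preserves the balls about [x0]. *)
Definition shrink (t : R) (u : 'rV[R]_n) : 'rV[R]_n := \row_j (if j == i then t * u 0 j else u 0 j).

Lemma shrink1 u : shrink 1 u = u.
Proof. by apply/rowP => j; rewrite mxE mul1r; case: ifP. Qed.

Let oU : open U.
Proof.
have [e0|e0] := ltP 0 e.
  have -> : U = ball x0 e.
    by apply/seteqP; split=> u; rewrite /U mx_norm_ball /ball_ /= distrC.
  exact: ball_open.
have -> : U = set0; last exact: open0.
apply/seteqP; split=> u //; rewrite /U /= => /(le_lt_trans (normr_ge0 _)).
by rewrite ltNge e0.
Qed.

Let shrinkU t u : 0 <= t <= 1 -> U u -> U (shrink t u).
Proof.
move=> /andP[t0 t1]; apply: le_lt_trans; apply: rV_norm_le => // j.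
rewrite !mxE; case: eqVneq => [->|_].
  rewrite x0i subr0 normrM (ger0_norm t0).
  apply: (@le_trans _ _ `|u 0 i|); first by rewrite ler_piMl.
  by have := rV_coord_le (u - x0) i; rewrite !mxE x0i subr0.
by have := rV_coord_le (u - x0) j; rewrite !mxE.
Qed.

Let shrink_cvg (T : Type) (F : set_system T) (FF : Filter F) (f : T -> R) (g : T -> 'rV[R]_n) t u :
  f y @[y --> F] --> t -> g y @[y --> F] --> u -> shrink (f y) (g y) @[y --> F] --> shrink t u.
Proof.
move=> ft gu; apply: rV_cvg => j; rewrite mxE.
have gj : g y 0 j @[y --> F] --> u 0 j.
  by apply: (@cvg_comp _ _ _ g (fun v : 'rV[R]_n => v 0 j) _ (nbhs u) _ gu); exact: coord_continuous.
by case: eqP => _ //; exact: cvgM.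
Qed.

Let int01_le (f : R -> R) c : {within `[0, 1], continuous f} ->
  (forall t, 0 <= t <= 1 -> `|f t| <= c) -> `|\int[mu]_(t in `[0, 1]) f t| <= c.
Proof.
move=> cf fc.
have If : mu.-integrable `[0, 1] (EFin \o f).
  by apply: continuous_compact_integrable => //; exact: segment_compact.
apply: le_trans (le_normr_Rintegral _ If) _ => //.
have Ic : mu.-integrable `[0, 1] (EFin \o (cst c)).
  apply: continuous_compact_integrable; first exact: segment_compact.
  by apply: continuous_subspaceT; exact: cst_continuous.
have In : mu.-integrable `[0, 1] (EFin \o (fun t => `|f t|)).
  exact: (integrable_norm If).
have fcst t : `[0, 1]%classic t -> `|f t| <= cst c t.
  by rewrite /= in_itv /=; exact: fc.
apply: le_trans (le_Rintegral _ In Ic fcst) _ => //.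
have m1 : mu `[0, 1]%classic = 1%E by rewrite lebesgue_measure_itv /= lte_fin ltr01 oppr0 adde0.
have E : \int[mu]_(t in `[0, 1]) (cst c t) = c * fine (mu `[0, 1]%classic).
  exact: Rintegral_cst.
rewrite m1 in E; rewrite le_eqVlt; apply/orP; left; apply/eqP.
exact: etrans E (mulr1 _).
Qed.

(** The weight [t ^+ m] is there for stability: differentiating the integrand in direction [i]
    produces one more factor [t], the other directions none. Hadamard's quotient is the case
    [m = 0]. *)
Definition shrink_int m (h : 'rV[R]_n -> R) (u : 'rV[R]_n) : R :=
  \int[mu]_(t in `[0, 1]) (t ^+ m * h (shrink t u)).

Implicit Types h : 'rV[R]_n -> R.

Let integrand_cvg m h u (t : R) : (forall x, U x -> {for x, continuous h}) -> U u ->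
  0 <= t <= 1 -> (s ^+ m * h (shrink s u)) @[s --> t] --> t ^+ m * h (shrink t u).
Proof.
move=> ch Uu t01; apply: cvgM; first exact: exprn_continuous.
apply: (@cvg_comp _ _ _ (fun s => shrink s u) h _ (nbhs (shrink t u))).
  by apply: shrink_cvg; [exact: cvg_id|exact: cvg_cst].
exact/ch/shrinkU.
Qed.

Let integrand_cont m h u : (forall x, U x -> {for x, continuous h}) -> U u ->
  {within `[0, 1], continuous (fun t => t ^+ m * h (shrink t u))}.
Proof.
move=> ch Uu; apply: continuous_in_subspaceT => t.
by rewrite inE /= in_itv /=; exact: integrand_cvg.
Qed.

(** Compactness of the interval turns continuity at each [shrink t u] into an estimate uniform in
    [t]. *)
Let unif_cvg h u c : (forall x, U x -> {for x, continuous h}) -> U u -> 0 < c ->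
  \forall u' \near u, forall t, `[0, 1]%classic t -> `|h (shrink t u') - h (shrink t u)| <= c.
Proof.
move=> ch Uu c0.
have /compact_near_coveringP C := @segment_compact R 0 1.
apply: (C _ (nbhs u) (fun u' t => `|h (shrink t u') - h (shrink t u)| <= c)).
move=> t; rewrite /= in_itv /= => t01.
have cvh (T : Type) (F : set_system T) (FF : Filter F) (f : T -> R) (g : T -> 'rV[R]_n) :
    f y @[y --> F] --> t -> g y @[y --> F] --> u ->
    h (shrink (f y) (g y)) @[y --> F] --> h (shrink t u).
  move=> ft gu.
  apply: (@cvg_comp _ _ _ (fun s => shrink (f s) (g s)) h _ (nbhs (shrink t u))).
    exact: shrink_cvg.
  exact/ch/shrinkU.
have FP : Filter (filter_prod (nbhs t) (nbhs u)) by exact: filter_prod_filter.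
have h1 : h (shrink y.1 y.2) @[y --> filter_prod (nbhs t) (nbhs u)] --> h (shrink t u).
  by apply: cvh; [exact: cvg_fst|exact: cvg_snd].
have h2 : h (shrink y.1 u) @[y --> filter_prod (nbhs t) (nbhs u)] --> h (shrink t u).
  by apply: (cvh _ _ _ fst (cst u)); [exact: cvg_fst|exact: cvg_cst].
have := @cvgB _ _ _ _ FP _ _ _ _ h1 h2; rewrite subrr => /cvgrPdist_le/(_ _ c0).
by apply: filterS => -[t' u'] /=; rewrite sub0r normrN.
Qed.

Lemma shrink_int_cvg m h u : (forall x, U x -> {for x, continuous h}) -> U u ->
  {for u, continuous (shrink_int m h)}.
Proof.
move=> ch Uu; apply/cvgrPdist_le => c c0.
have := unif_cvg ch Uu c0; have : nbhs u U by exact: open_nbhs_nbhs.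
apply: filterS2 => u' Uu' hu'.
rewrite /shrink_int -RintegralB//; first last.
- by apply: continuous_compact_integrable; [exact: segment_compact|exact: integrand_cont].
- by apply: continuous_compact_integrable; [exact: segment_compact|exact: integrand_cont].
apply: int01_le.
  move=> t; apply: (@cvgB _ _ _ _ _ (fun t => t ^+ m * h (shrink t u))
    (fun t => t ^+ m * h (shrink t u'))); exact: integrand_cont.
move=> t t01; rewrite -mulrBr normrM distrC.
have /andP[t0 t1] := t01.
rewrite -[leRHS]mul1r ler_pM//; first by rewrite normrX ger0_norm// exprn_ile1.
by apply: hu'; rewrite /= in_itv.
Qed.

(** Differentiation under the integral sign; the dominating constant combines a bound of the
    derivative on the compact segment over [u] with the uniform closeness of nearby segments. *)
Lemma is_derive_shrink m h u (j : 'I_n) : Ck_on 1 U h -> U u ->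
  is_derive u (delta_mx 0 j) (shrink_int m h)
    (shrink_int (if j == i then m.+1 else m) ('D_(delta_mx 0 j) h) u).
Proof.
move=> hh Uu; apply/is_derive_line.
have ch := fun x (Ux : U x) => Ck_on_cont hh Ux.
have cdh := fun x (Ux : U x) => Ck_on_cont (Ck_on_D j hh) Ux.
pose m' := if j == i then m.+1 else m.
pose c (s : R) := s *: delta_mx 0 j + u.
have cc s : {for s, continuous c}.
  by apply: cvgD; [apply: cvgZr_tmp; exact: cvg_id|exact: cvg_cst].
pose f s t := t ^+ m * h (shrink t (c s)).
have shc t s : shrink t (c s) = ((if j == i then t else 1) * s) *: delta_mx 0 j + shrink t u.
  apply/rowP => k; rewrite !mxE; case: (eqVneq k j) => [->|kj].
    by rewrite eqxx /=; case: eqP => _; rewrite ?mulr1 ?mul1r// mulrDr.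
  by rewrite andbF !mulr0 !add0r.
have df s t : U (c s) -> 0 <= t <= 1 ->
    is_derive s (1 : R) (fun s => f s t) (t ^+ m' * 'D_(delta_mx 0 j) h (shrink t (c s))).
  move=> Us t01; pose a := if j == i then t else 1.
  have -> : t ^+ m' * 'D_(delta_mx 0 j) h (shrink t (c s)) =
      t ^+ m * ('D_(delta_mx 0 j) h (shrink t (c s)) * a).
    by rewrite /m' /a; case: eqP => _; rewrite ?mulr1// exprSr mulrAC mulrA.
  apply: is_deriveZ.
  have E : (fun s => h (shrink t (c s))) =
     (fun r : R => h (r *: delta_mx 0 j + shrink t u)) \o (fun s => a * s).
    by apply/funext => s' /=; rewrite shc.
  rewrite E; apply: is_derive1_comp; last first.
    by have := @is_deriveZ _ _ _ id a s 1 1 (@is_derive_id _ _ _ _); rewrite [a *: 1]mulr1.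
  apply: is_derive_along; rewrite -shc.
  by apply: Ck_on_der hh _; exact: shrinkU.
have : \forall u' \near u, U u' /\ forall t, `[0, 1]%classic t ->
    `|'D_(delta_mx 0 j) h (shrink t u') - 'D_(delta_mx 0 j) h (shrink t u)| <= 1.
  by apply: filterI; [exact: open_nbhs_nbhs|exact: (unif_cvg cdh Uu ltr01)].
have c0 : c 0 = u by rewrite /c scale0r add0r.
rewrite -{1}c0 => /(cc 0) /nbhs_ballP[d /= d0 hd].
have Ud s : `]-d, d[%classic s -> U (c s) /\ forall t, `[0, 1]%classic t ->
    `|'D_(delta_mx 0 j) h (shrink t (c s)) - 'D_(delta_mx 0 j) h (shrink t u)| <= 1.
  move=> sd; apply: hd; rewrite /ball /= sub0r normrN.
  by move: sd; rewrite /= in_itv /= -ltr_norml.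
have cd0 : {within `[0, 1], continuous (fun t => t ^+ m' * 'D_(delta_mx 0 j) h (shrink t u))}.
  exact: (@integrand_cont m' _ _ cdh Uu).
have [M [_ HM]] : bounded_set ((fun t => 'D_(delta_mx 0 j) h (shrink t u)) @` `[0, 1]%classic).
  apply: compact_bounded; apply: continuous_compact; last exact: segment_compact.
  have := @integrand_cont 0%N _ _ cdh Uu; apply: subspace_eq_continuous => t _.
  by rewrite /from_subspace expr0 mul1r.
have HM' t : 0 <= t <= 1 -> `|'D_(delta_mx 0 j) h (shrink t u)| <= M + 1.
  by move=> t01; apply: (HM (M + 1)); [rewrite ltrDl|exists t => //; rewrite /= in_itv].
have I0 : (`]-d, d[%classic : set R) 0 by rewrite /= in_itv /= oppr_lt0 d0.
have If s : (`]-d, d[%classic : set R) s -> mu.-integrable `[0, 1] (EFin \o f s).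
  move=> /Ud[Us _]; apply: continuous_compact_integrable; first exact: segment_compact.
  exact: (@integrand_cont m _ _ ch Us).
have dfs s t : (`]-d, d[%classic : set R) s -> (`[0, 1]%classic : set R) t -> derivable (f ^~ t) s 1.
  by move=> /Ud[Us _] t01; have [] := df s t Us t01.
(* [M + 1] bounds the derivative on the segment over [u], and [hs] adds at most 1 for a nearby
   segment. *)
have bd s t : (`]-d, d[%classic : set R) s -> (`[0, 1]%classic : set R) t -> `|partial1of2 f s t| <= M + 2.
  move=> /Ud[Us hs] t01; rewrite partial1of2E.
  have [_ ->] := df s t Us t01.
  rewrite normrM -[leRHS]mul1r ler_pM//.
    by move: t01; rewrite /= in_itv /= => /andP[t0 t1]; rewrite normrX ger0_norm// exprn_ile1.
  rewrite -[X in `|X|](subrK ('D_(delta_mx 0 j) h (shrink t u))).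
  apply: le_trans (ler_normD _ _) _.
  move: t01; rewrite /= => t01'; have t01 := t01'; rewrite in_itv /= in t01.
  by apply: le_trans (lerD (hs t t01') (HM' t t01)) _; rewrite addrCA.
have M2 : 0 <= M + 2.
  by apply: le_trans (bd 0 0 I0 _) => //=; rewrite in_itv /= lexx ler01.
have IM : mu.-integrable `[0, 1] (EFin \o (fun _ : R => M + 2)).
  apply: continuous_compact_integrable; first exact: segment_compact.
  by apply: continuous_subspaceT; exact: cst_continuous.
have ID := @cvg_differentiation_under_integral R _ _ mu f `[0, 1]%classic
  (measurable_itv _) 0 (-d) d I0 If dfs (fun=> M + 2) (fun=> M2) IM bd.
have -> : shrink_int m' ('D_(delta_mx 0 j) h) u = \int[mu]_(t in `[0, 1]) partial1of2 f 0 t.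
  apply: eq_Rintegral => t; rewrite inE /= in_itv /= => t01; rewrite partial1of2E.
  have U0 : U (c 0) by rewrite c0.
  by have [_ ->] := df 0 t U0 t01; rewrite c0.
pose G := fun h0 : R => shrink_int m h (h0 *: delta_mx 0 j + u).
have ID' : r^-1 *: ((G \o shift 0) (r *: 1) - G 0) @[r --> 0^'] -->
    \int[mu]_(t in `[0, 1]) partial1of2 f 0 t.
  by move: ID; under eq_fun do rewrite -[X in X + 0]mulr1.
apply: DeriveDef; last exact: (cvg_lim (@Rhausdorff R) ID').
by apply/cvg_ex; exists (\int[mu]_(t in `[0, 1]) partial1of2 f 0 t).
Qed.

Lemma Ck_on_shrink_int k m h : Ck_on k.+1 U h -> Ck_on k U (shrink_int m h).
Proof.
elim: k m h => [|k IH] m h hh.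
  by split=> // x Ux; apply: shrink_int_cvg => // y Uy; exact: Ck_on_cont hh Uy.
apply: (@Ck_onS _ _ _ _ _ (fun j => shrink_int (if j == i then m.+1 else m) ('D_(delta_mx 0 j) h))) => //.
- by move=> x Ux; apply: shrink_int_cvg => // y Uy; exact: Ck_on_cont hh Uy.
- move=> x j Ux; apply: is_derive_shrink => //.
  by elim: (k) hh => [|k' IH'] /Ck_onW.
- by move=> j; apply: IH; exact: Ck_on_D.
Qed.

(** The fundamental theorem of calculus for [h (shrink t u)] on the unit interval: its derivative in
    [t] is [u 0 i] times the partial derivative of [h] in direction [i]. *)
Lemma hadamard h u : Ck_on 2 U h -> U u ->
  h u = h (shrink 0 u) + u 0 i * shrink_int 0 ('D_(delta_mx 0 i) h) u.
Proof.
move=> hh Uu; apply/eqP; rewrite addrC -subr_eq; apply/eqP.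
have h1 := Ck_onW hh.
have cdh := fun x (Ux : U x) => Ck_on_cont (Ck_on_D i hh) Ux.
pose F t := h (shrink t u).
pose f t := u 0 i * (t ^+ 0 * 'D_(delta_mx 0 i) h (shrink t u)).
have sE t : shrink t u = (t * u 0 i) *: delta_mx 0 i + shrink 0 u.
  by apply/rowP => k; rewrite !mxE; case: eqP => [->|]; rewrite ?mulr1 ?mul0r ?addr0// andbF mulr0 add0r.
have dF (t : R) : 0 <= t <= 1 -> is_derive t (1 : R) F (f t).
  move=> t01.
  have E : F = (fun r : R => h (r *: delta_mx 0 i + shrink 0 u)) \o (fun s => u 0 i * s).
    by apply/funext => s' /=; rewrite /F sE mulrC.
  rewrite E /f expr0 mul1r mulrC; apply: is_derive1_comp; last first.
    by have := @is_deriveZ _ _ _ id (u 0 i) t 1 1 (@is_derive_id _ _ _ _); rewrite [_ *: 1]mulr1.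
  apply: is_derive_along; rewrite mulrC -sE.
  by apply: Ck_on_der h1 _; exact: shrinkU.
have cf0 := @integrand_cont 0%N _ _ cdh Uu.
have cf : {within `[0, 1], continuous f}.
  move=> t; apply: (@cvgM _ _ _ _ (cst (u 0 i)) _); [exact: cvg_cst|exact: cf0].
have cF t : 0 <= t <= 1 -> {for t, continuous F}.
  by move=> /dF[d _]; exact/differentiable_continuous/derivable1_diffP.
have DF : derivable_oo_LRcontinuous F 0 1.
  split.
  - by move=> t; rewrite in_itv /= => /andP[/ltW t0 /ltW t1]; have [|] := dF t; rewrite ?t0.
  - by apply: cvg_at_right_filter; apply: cF; rewrite lexx ler01.
  - by apply: cvg_at_left_filter; apply: cF; rewrite lexx ler01.
have dFf : {in `]0, 1[%R, derive1 F =1 f}.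
  move=> t; rewrite in_itv /= => /andP[/ltW t0 /ltW t1]; rewrite derive1E.
  by have [|_ ->] := dF t; rewrite ?t0.
have If := continuous_FTC2 ltr01 cf DF dFf.
have E1 : h u = F 1 by rewrite /F shrink1.
rewrite E1 /shrink_int -RintegralZl//; last first.
  by apply: continuous_compact_integrable => //; exact: segment_compact.
by rewrite /Rintegral If.
Qed.

End Hadamard.

(** * A smooth function that vanishes on the negative half-line *)

Section Bump.
Context {R : realType}.

(** For [m = 0] this is the usual exp(-1/t), from which bump functions are made; the powers of [1/t]
    appear in its derivatives. *)
Definition flat m (t : R) : R := if 0 < t then t ^- m * expR (- t^-1) else 0.

Inductive flat_span : (R -> R) -> Prop :=
| flat_span_gen m : flat_span (flat m)
| flat_spanD f g : flat_span f -> flat_span g -> flat_span (fun t => f t + g t)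
| flat_spanZ c f : flat_span f -> flat_span (fun t => c * f t).

(** One term of the exponential series bounds exp(1/t) from below. The quadratic bound makes the
    derivative at 0 exist and vanish. *)
Lemma flat_le m t : `|flat m t| <= (m.+2)`!%:R * t ^+ 2.
Proof.
rewrite /flat; case: ifPn => [t0|_]; last first.
  by rewrite normr0 mulr_ge0// sqr_ge0.
have V0 : 0 <= t^-1 by rewrite invr_ge0 ltW.
rewrite ger0_norm; last by rewrite mulr_ge0 ?expR_ge0// invr_ge0 exprn_ge0// ltW.
have fac0 : 0 < (m.+2)`!%:R :> R by rewrite ltr0n fact_gt0.
have := expR_ge1Dxn m.+1 V0; rewrite expRN => h.
have h1 : t ^- m.+2 / (m.+2)`!%:R <= expR t^-1.
  by rewrite -exprVn; apply: le_trans h; rewrite lerDr.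
have tm0 : 0 < t ^- m by rewrite invr_gt0 exprn_gt0.
rewrite ler_pdivrMr ?expR_gt0//.
have c0 : 0 <= (m.+2)`!%:R * t ^+ 2 by rewrite mulr_ge0 ?(ltW fac0)// sqr_ge0.
apply: le_trans (ler_wpM2l c0 h1).
have tn : t != 0 by rewrite gt_eqF.
have tmn : t ^+ m != 0 by rewrite expf_neq0.
have fn : (m.+2)`!%:R != 0 :> R by rewrite gt_eqF.
rewrite le_eqVlt; apply/orP; left; apply/eqP.
rewrite !exprS expr0; move: (t ^+ m) tmn ((m.+2)`!%:R : R) fn => a a0 b b0.
by field; rewrite tn a0 b0.
Qed.

Lemma is_derive_flat m (t : R) : is_derive t 1 (flat m) (- m%:R * flat m.+1 t + flat m.+2 t).
Proof.
have [t0|t0|t0] := ltgtP 0 t.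
- have E : \near t, (fun t => t ^- m * expR (- t^-1)) t = flat m t.
    near=> s; rewrite /flat ifT//; near: s; exact: lt_nbhsr.
  apply: (@near_eq_is_derive R R^o R^o (fun t : R => t ^- m * expR (- t^-1)) _ _ _ _ E).
  rewrite /flat t0.
  have tn : t != 0 by rewrite gt_eqF.
  have dV := is_derive_exprnV m tn.
  have dI : is_derive t 1 (fun t : R => - t^-1) (- (- t ^- 2 * 1)).
    by apply: is_deriveN; apply: is_deriveV.
  have dE : is_derive (- t^-1) 1 (@expR R) (expR (- t^-1)).
    apply: DeriveDef; first exact: derivable_expR.
    by have := congr1 (@^~ (- t^-1)) (@derive_expR R).
  have dEI := @is_derive1_comp R (@expR R) (fun t => - t^-1) t _ _ dE dI.
  have dM := is_deriveM dV dEI; apply: is_derive_eq.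
  rewrite /GRing.scale /=.
  case: m {E dV dM} => [|m].
    by rewrite !(mulr0,mul0r,expr0,oppr0,invr1,add0r); move: (expR _) => x; field.
  have a0 : t ^+ m != 0 by rewrite expf_neq0.
  move: a0; rewrite !exprS expr0; move: (t ^+ m) (m.+1%:R : R) (expR _) => a b x a0.
  by field; rewrite tn a0.
- have E : \near t, cst 0 t = flat m t.
    near=> s; rewrite /flat ifF//; apply/negbTE; rewrite -leNgt ltW//.
    near: s; exact: lt_nbhsl.
  apply: (@near_eq_is_derive R R^o R^o (cst 0) _ _ _ _ E).
  by rewrite /flat ltNge (ltW t0) /= mulr0 addr0; exact: is_derive_cst.
- rewrite -t0 {2 3}/flat ltxx mulr0 addr0.
  have D : r^-1 *: ((flat m \o shift 0) (r *: 1) - flat m 0) @[r --> (0:R)^'] --> (0 : R).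
    apply/cvgrPdist_le => e e0.
    have f0 : 0 < (m.+2)`!%:R :> R by rewrite ltr0n fact_gt0.
    near=> r; rewrite sub0r normrN /= addr0 [_ *: 1]mulr1 {2}/flat ltxx subr0.
    have r0 : 0 < `|r| by rewrite normr_gt0; near: r; exact: nbhs_dnbhs_neq.
    rewrite normrM normfV ler_pdivrMl//.
    apply: le_trans (flat_le m r) _.
    rewrite -[r ^+ 2]real_normK ?num_real// expr2 mulrCA ler_wpM2l//.
    rewrite mulrC -ler_pdivlMr//.
    near: r; apply: nbhs_dnbhs; apply: filterS (@nbhs0_le R R _ (divr_gt0 e0 f0)) => r //.
  apply: DeriveDef; last exact: (cvg_lim (@Rhausdorff R) D).
  by apply/cvg_ex; exists 0.
Unshelve. all: by end_near. Qed.

Lemma Ck_on_flat n k (U : set 'rV[R]_n) (f : 'rV[R]_n -> R) : open U ->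
  Ck_on k U f -> Ck_on k U (fun x => flat 0 (f x)).
Proof.
move=> oU hf; apply: (@Ck_on_comp1 R n flat_span setT) hf _ => //; last first.
  exact: flat_span_gen.
move=> h; elim=> [m|f1 f2 _ [g1 s1 d1] _ [g2 s2 d2]|c f1 _ [g1 s1 d1]].
- exists (fun t => - m%:R * flat m.+1 t + flat m.+2 t); last first.
    by move=> t _; exact: is_derive_flat.
  by apply: flat_spanD; [apply: flat_spanZ|]; exact: flat_span_gen.
- exists (fun t => g1 t + g2 t); first exact: flat_spanD.
  by move=> t It; have := d1 t It; have := d2 t It => ? ?; apply: is_deriveD.
- exists (fun t => c * g1 t); first exact: flat_spanZ.
  by move=> t It; have := d1 t It => ?; apply: is_deriveZ.
Qed.

End Bump.

(** * Germs of smooth functions on row vectors *)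

Section SmoothRow.
Context {R : realType} (n : nat).
Implicit Types (p : 'rV[R]_n) (f g : 'rV[R]_n -> R).

Lemma sm_near p f : smooth_near_rV p f -> \forall q \near p, smooth_near_rV q f.
Proof.
move=> [U [oU Up h]]; near=> q; exists U; split=> //.
by near: q; exact: open_nbhs_nbhs.
Unshelve. all: by end_near. Qed.

Lemma sm_cont p f : smooth_near_rV p f -> {for p, continuous f}.
Proof. by move=> [U [oU Up h]]; exact: Ck_on_cont (h 0%N) Up. Qed.

Lemma sm_eq p f g : (\forall q \near p, f q = g q) -> smooth_near_rV p f -> smooth_near_rV p g.
Proof.
move=> /nbhs_interior fg [U [oU Up h]].
exists (U `&` [set q | f q = g q]^°); split.
- by apply: openI => //; exact: open_interior.
- by split=> //; exact: nbhs_singleton.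
- move=> k; apply: (@Ck_on_ext _ _ _ _ f).
  + by apply: openI => //; exact: open_interior.
  + by move=> x [_ /interior_subset].
  + by apply: Ck_on_sub (h k) => x [].
Qed.

Lemma sm_cst p c : smooth_near_rV p (fun=> c).
Proof.
by exists setT; split=> // [|k]; [exact: openT|apply: Ck_on_cst; exact: openT].
Qed.

Lemma sm_coord p j : smooth_near_rV p (fun q => q 0 j).
Proof.
by exists setT; split=> // [|k]; [exact: openT|apply: Ck_on_coord; exact: openT].
Qed.

Lemma sm2 (op : R -> R -> R) p f g : (forall k U f g, open U -> Ck_on k U f -> Ck_on k U g ->
     Ck_on k U (fun x : 'rV[R]_n => op (f x) (g x))) -> smooth_near_rV p f -> smooth_near_rV p g ->
  smooth_near_rV p (fun x => op (f x) (g x)).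
Proof.
move=> H [U [oU Up h]] [U' [oU' Up' h']]; exists (U `&` U'); split=> //.
  exact: openI.
move=> k; apply: H; first exact: openI.
  by apply: Ck_on_sub (h k) => x [].
by apply: Ck_on_sub (h' k) => x [].
Qed.

Lemma smD p f g : smooth_near_rV p f -> smooth_near_rV p g -> smooth_near_rV p (fun x => f x + g x).
Proof. by apply: (@sm2 +%R) => *; exact: Ck_onD. Qed.

Lemma smM p f g : smooth_near_rV p f -> smooth_near_rV p g -> smooth_near_rV p (fun x => f x * g x).
Proof. by apply: (@sm2 *%R) => *; exact: Ck_onM. Qed.

Lemma sm1 (op : R -> R) (I : set R) p f : open I -> I (f p) ->
  (forall k U f, open U -> Ck_on k U f -> (forall x, U x -> I (f x)) ->
     Ck_on k U (fun x : 'rV[R]_n => op (f x))) ->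
  smooth_near_rV p f -> smooth_near_rV p (fun x => op (f x)).
Proof.
move=> oI Ip H [U [oU Up h]].
have oU' : open (U `&` f @^-1` I).
  rewrite openE => x [Ux Ix]; rewrite /interior; apply: filterI.
    exact: open_nbhs_nbhs.
  by apply: (Ck_on_cont (h 0%N) Ux); exact: open_nbhs_nbhs.
exists (U `&` f @^-1` I); split=> // k; apply: H => //; last by move=> x [].
by apply: Ck_on_sub (h k) => x [].
Qed.

Lemma smV p f : smooth_near_rV p f -> f p != 0 -> smooth_near_rV p (fun x => (f x)^-1).
Proof.
move=> hf f0; apply: (@sm1 (@GRing.inv R) [set t | t != 0]) hf => //.
  by move=> k U g oU hg g0; exact: Ck_onV.
Qed.

Lemma sm_sqrt p f : smooth_near_rV p f -> 0 < f p -> smooth_near_rV p (fun x => Num.sqrt (f x)).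
Proof.
move=> hf f0; apply: (@sm1 Num.sqrt [set t | 0 < t]) hf => //.
  by move=> k U g oU hg g0; exact: Ck_on_sqrt.
Qed.

Lemma sm_flat p f : smooth_near_rV p f -> smooth_near_rV p (fun x => flat 0 (f x)).
Proof.
move=> hf; apply: (@sm1 (flat 0) setT) hf => //; first exact: openT.
by move=> k U g oU hg _; exact: Ck_on_flat.
Qed.

Lemma sm_comp m p (g : 'I_m -> 'rV[R]_n -> R) (h : 'rV[R]_m -> R) :
  (forall j, smooth_near_rV p (g j)) -> smooth_near_rV (\row_j g j p) h ->
  smooth_near_rV p (fun x => h (\row_j g j x)).
Proof.
move=> hg [V [oV Vp hh]].
have [U] := choice hg => hU.
have W1 : nbhs p [set x | V (\row_j g j x)].
  have cg : \row_j g j x @[x --> p] --> \row_j g j p.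
    apply: rV_cvg => j; rewrite mxE; exact: sm_cont.
  by apply: cg; exact: open_nbhs_nbhs.
have W2 : nbhs p [set x | forall j, U j x].
  apply: (@filter_forall _ _ (fun j x => U j x) (nbhs p)) => j.
  have [oU Up _] := hU j; exact: open_nbhs_nbhs.
pose W := [set x | V (\row_j g j x)] `&` [set x | forall j, U j x].
have Wp : nbhs p W^° by apply: nbhs_interior; exact: filterI.
 exists W^°; split; [exact: open_interior|exact: nbhs_singleton|].
move=> k; apply: (@Ck_on_comp _ _ _ _ _ _ V) => //.
- exact: open_interior.
- move=> j; have [_ _ hj] := hU j; apply: Ck_on_sub (hj k) => x /interior_subset[_].
  exact.
- by move=> x /interior_subset[].
Qed.

End SmoothRow.

Section SmoothHadamard.
Context {R : realType} (n : nat).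

(** Induction on [A]: the one-coordinate lemma removes [i], and the induction hypothesis is applied
    to [h'], which is [h] with coordinate [i] set to zero. *)
Lemma sm_hadamard (p : 'rV[R]_n) (h : 'rV[R]_n -> R) (A : {set 'I_n}) :
  smooth_near_rV p h -> (forall i, i \in A -> p 0 i = 0) -> exists g : 'I_n -> 'rV[R]_n -> R,
    (forall i, smooth_near_rV p (g i)) /\
    \forall u \near p, h u = h (\row_j (if j \in A then 0 else u 0 j)) + \sum_(i in A) u 0 i * g i u.
Proof.
have [k] := ubnP #|A|; elim: k h A => // k IH h A kA hh pA.
have [->|[i iA]] := set_0Vmem A.
  exists (fun _ _ => 0); split=> [i|]; first exact: sm_cst.
  near=> u; rewrite big_set0 addr0; congr (h _).
  by apply/rowP => j; rewrite !mxE inE.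
have [U [oU Up hU]] := hh.
have /nbhs_ballP[e /= e0 sU] := open_nbhs_nbhs (conj oU Up).
have pi := pA i iA.
have sU' : [set u | `|u - p| < e] `<=` U.
  by move=> u ue; apply: sU; rewrite mx_norm_ball /ball_ /= distrC.
have oB : open [set u | `|u - p| < e].
  have -> : [set u | `|u - p| < e] = ball p e.
    by apply/seteqP; split=> u; rewrite mx_norm_ball /ball_ /= distrC.
  exact: ball_open.
have nB : nbhs p [set u | `|u - p| < e].
  by apply: open_nbhs_nbhs; split=> //=; rewrite subrr normr0.
have hB k' : Ck_on k' [set u | `|u - p| < e] h by exact: Ck_on_sub (hU k').
pose h' u := h (shrink i 0 u).
have zp : shrink i 0 p = p.
  by apply/rowP => j; rewrite mxE; case: eqP => // ->; rewrite pi mul0r.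
have hh' : smooth_near_rV p h'.
  apply: (@sm_comp _ _ _ _ (fun j u => if j == i then 0 * u 0 j else u 0 j) h); last first.
    by rewrite -/(shrink i 0 p) zp.
  by move=> j; case: eqP => _; [apply: smM; [exact: sm_cst|]|]; exact: sm_coord.
have [||g [gs gE]] := IH h' (A :\ i) _ hh'.
- by move: kA; rewrite (cardsD1 i A) iA ltnS.
- by move=> j /setD1P[_ /pA].
exists (fun j => if j == i then shrink_int i 0 ('D_(delta_mx 0 i) h) else g j); split.
  move=> j; case: eqP => _ //; exists [set u | `|u - p| < e]; split=> //.
    by rewrite /= subrr normr0.
  by move=> k'; apply: Ck_on_shrink_int => //; exact: Ck_on_D.
apply: filterS2 nB gE => u uB gE.
rewrite (hadamard pi (hB 2%N) uB) -/(h' u) gE [in RHS](bigD1 i)//= eqxx.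
rewrite -addrA [X in _ + X = _]addrC; congr (_ + (_ + _)).
  congr (h _); apply/rowP => j; rewrite !mxE in_setD1.
  by case: eqP => [->|_] /=; rewrite ?iA ?mul0r.
rewrite (eq_bigl (fun j => (j \in A) && (j != i))).
  by apply: eq_bigr => j /andP[_ /negbTE ->].
by move=> j; rewrite in_setD1 andbC.
Unshelve. all: by end_near. Qed.
End SmoothHadamard.

(** * Germs of smooth functions on germ spaces *)

Section Germs.
Context {R : realType}.
Implicit Types X Y Z : germ_space R.

Lemma embeds_open X Y (U : set X) (F : X -> Y) : embeds U F -> open U.
Proof. by case. Qed.

Lemma embeds_inj X Y (U : set X) (F : X -> Y) : embeds U F ->
  forall p q, U p -> U q -> F p = F q -> p = q.
Proof. by move=> [_ h _ _] p q Up Uq; apply: h; rewrite inE. Qed.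

Lemma embeds_dom X Y (U : set X) (F : X -> Y) p : embeds U F -> U p -> nbhs p U.
Proof. by move=> e Up; apply: open_nbhs_nbhs; split=> //; case: e. Qed.

Lemma embeds_nbhs X Y (U : set X) (F : X -> Y) p B : embeds U F -> U p ->
  nbhs (F p) B -> nbhs p (F @^-1` B).
Proof.
move=> [oU _ h _] Up nB; have /h nU := Up.
have : nbhs p (U `&` F @^-1` B) by apply/nU; exists B.
by apply: filterS => q [].
Qed.

Lemma embeds_cont X Y (U : set X) (F : X -> Y) p : embeds U F -> U p -> {for p, continuous F}.
Proof. by move=> h Up B nB; apply: (embeds_nbhs h Up nB). Qed.

Lemma embeds_nbhsE X Y (U : set X) (F : X -> Y) p A : embeds U F -> U p ->
  nbhs p A -> exists2 B, nbhs (F p) B & U `&` F @^-1` B `<=` A.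
Proof. by move=> [_ _ h _] Up; apply: (h _ Up _).1. Qed.

Lemma embeds_sub X Y (U U' : set X) (F : X -> Y) : U' `<=` U -> open U' -> embeds U F -> embeds U' F.
Proof.
move=> sU oU' h; split=> //.
- by move=> p q; rewrite !inE => /sU Up /sU Uq; exact: (embeds_inj h).
- move=> p U'p A; split.
    move=> /(embeds_nbhsE h (sU _ U'p))[B nB sB]; exists B => // q [/sU Uq Bq].
    by apply: sB.
  move=> [B nB sB]; apply: filterS sB _; apply: filterI.
    exact: open_nbhs_nbhs.
  exact: embeds_nbhs h (sU _ U'p) nB.
- by move=> p /sU Up f; case: h => _ _ _; apply.
Qed.

(** A [germ_space] carries no axioms. Local embeddings in Euclidean spaces provide what is needed:
    smoothness is local, implies continuity and is preserved by smooth operations. Corners are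
    allowed, as the image need not be open. *)
Definition ambient X := forall p : X, exists N (psi : X -> euclidean R N) U, U p /\ embeds U psi.

Lemma smooth_emb X Y (U : set X) (F : X -> Y) p f : embeds U F -> U p ->
  smooth_near p f <-> exists h : Y -> R, smooth_near (F p) h /\ (\forall q \near p, f q = h (F q)).
Proof. by move=> [_ _ _ h] Up; exact: h. Qed.

Section Ambient.
Variables (X : germ_space R) (aX : ambient X).
Implicit Types (p : X) (f g : X -> R).

Lemma Sm_eq p f g : (\forall q \near p, f q = g q) -> smooth_near p f -> smooth_near p g.
Proof.
move=> fg; have [N [psi [U [Up e]]]] := aX p.
move=> /(smooth_emb _ e Up)[h [sh fh]]; apply/(smooth_emb _ e Up).
by exists h; split=> //; apply: filterS2 fg fh => q <-.
Qed.

Lemma Sm_near p f : smooth_near p f -> \forall q \near p, smooth_near q f.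
Proof.
have [N [psi [U [Up e]]]] := aX p.
move=> /(smooth_emb _ e Up)[h [/sm_near sh fh]].
have := embeds_nbhs e Up sh; have := near_join fh.
have : nbhs p U by exact: (embeds_dom e).
apply: filterS3 => q Uq fq sq; apply/(smooth_emb _ e Uq).
by exists h.
Qed.

Lemma Sm_cont p f : smooth_near p f -> {for p, continuous f}.
Proof.
have [N [psi [U [Up e]]]] := aX p.
move=> /(smooth_emb _ e Up)[h [/sm_cont ch fh]].
have E : f p = h (psi p) by exact: nbhs_singleton fh.
rewrite /prop_for /continuous_at E.
have c : h (psi q) @[q --> p] --> h (psi p).
  by apply: (@continuous_comp _ _ _ psi h) => //; exact: embeds_cont e Up.
apply: cvg_trans c; apply: near_eq_cvg; by apply: filterS fh => q ->.
Qed.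

Lemma Sm_lift p f : smooth_near p f -> forall N (psi : X -> euclidean R N) U,
  U p -> embeds U psi -> exists2 h, smooth_near_rV (psi p) h & \forall q \near p, f q = h (psi q).
Proof.
by move=> sf N psi U Up e; have /(smooth_emb _ e Up)[h []] := sf; exists h.
Qed.

Lemma Sm_cst p c : smooth_near p (fun=> c).
Proof.
have [N [psi [U [Up e]]]] := aX p; apply/(smooth_emb _ e Up).
by exists (fun=> c); split; [exact: sm_cst|exact: nearW].
Qed.

Lemma SmD p f g : smooth_near p f -> smooth_near p g -> smooth_near p (fun x => f x + g x).
Proof.
have [N [psi [U [Up e]]]] := aX p.
move=> /(smooth_emb _ e Up)[a [sa fa]] /(smooth_emb _ e Up)[b [sb gb]].
apply/(smooth_emb _ e Up); exists (fun x => a x + b x); split; first exact: smD.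
by apply: filterS2 fa gb => q -> ->.
Qed.

Lemma SmM p f g : smooth_near p f -> smooth_near p g -> smooth_near p (fun x => f x * g x).
Proof.
have [N [psi [U [Up e]]]] := aX p.
move=> /(smooth_emb _ e Up)[a [sa fa]] /(smooth_emb _ e Up)[b [sb gb]].
apply/(smooth_emb _ e Up); exists (fun x => a x * b x); split; first exact: smM.
by apply: filterS2 fa gb => q -> ->.
Qed.

Lemma Sm1 (op : R -> R) (P : R -> Prop) p f :
  (forall N (q : 'rV[R]_N) h, smooth_near_rV q h -> P (h q) -> smooth_near_rV q (fun x => op (h x))) ->
  smooth_near p f -> P (f p) -> smooth_near p (fun x => op (f x)).
Proof.
move=> H; have [N [psi [U [Up e]]]] := aX p.
move=> /(smooth_emb _ e Up)[a [sa fa]] Pf.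
apply/(smooth_emb _ e Up); exists (fun x => op (a x)); split.
  by apply: H => //; rewrite -(nbhs_singleton fa).
by apply: filterS fa => q ->.
Qed.

Lemma SmV p f : smooth_near p f -> f p != 0 -> smooth_near p (fun x => (f x)^-1).
Proof. by apply: (@Sm1 _ (fun t => t != 0)) => *; exact: smV. Qed.

Lemma Sm_sqrt p f : smooth_near p f -> 0 < f p -> smooth_near p (fun x => Num.sqrt (f x)).
Proof. by apply: (@Sm1 _ (fun t => 0 < t)) => *; exact: sm_sqrt. Qed.

Lemma Sm_flat p f : smooth_near p f -> smooth_near p (fun x => flat 0 (f x)).
Proof. by move=> sf; apply: (@Sm1 _ (fun=> True)) => // *; exact: sm_flat. Qed.

Lemma SmZ p c f : smooth_near p f -> smooth_near p (fun x => c * f x).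
Proof. by apply: SmM; exact: Sm_cst. Qed.

Lemma SmN p f : smooth_near p f -> smooth_near p (fun x => - f x).
Proof. by move=> /(SmZ (-1)); apply: Sm_eq; near=> x; rewrite mulN1r.
Unshelve. all: by end_near. Qed.

Lemma SmB p f g : smooth_near p f -> smooth_near p g -> smooth_near p (fun x => f x - g x).
Proof. by move=> sf /SmN; exact: SmD. Qed.

Lemma SmX p f k : smooth_near p f -> smooth_near p (fun x => f x ^+ k).
Proof.
move=> sf; elim: k => [|k IH]; first exact: Sm_cst.
by apply: Sm_eq (SmM sf IH); near=> x; rewrite exprS.
Unshelve. all: by end_near. Qed.

Lemma Sm_div p f g : smooth_near p f -> smooth_near p g -> g p != 0 ->
  smooth_near p (fun x => f x / g x).
Proof. by move=> sf sg g0; apply: SmM => //; exact: SmV. Qed.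

Lemma Sm_sum p (I : Type) (s : seq I) (P : pred I) (F : I -> X -> R) :
  (forall i, P i -> smooth_near p (F i)) -> smooth_near p (fun x => \sum_(i <- s | P i) F i x).
Proof.
move=> h; elim: s => [|i s IH].
  by apply: Sm_eq (Sm_cst p 0); near=> x; rewrite big_nil.
have [Pi|Pi] := boolP (P i).
  by apply: Sm_eq (SmD (h i Pi) IH); near=> x; rewrite big_cons Pi.
by apply: Sm_eq IH; near=> x; rewrite big_cons (negbTE Pi).
Unshelve. all: by end_near. Qed.

Lemma Sm_prod p (I : Type) (s : seq I) (P : pred I) (F : I -> X -> R) :
  (forall i, P i -> smooth_near p (F i)) -> smooth_near p (fun x => \prod_(i <- s | P i) F i x).
Proof.
move=> h; elim: s => [|i s IH].
  by apply: Sm_eq (Sm_cst p 1); near=> x; rewrite big_nil.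
have [Pi|Pi] := boolP (P i).
  by apply: Sm_eq (SmM (h i Pi) IH); near=> x; rewrite big_cons Pi.
by apply: Sm_eq IH; near=> x; rewrite big_cons (negbTE Pi).
Unshelve. all: by end_near. Qed.

Lemma Sm_comp m p (g : 'I_m -> X -> R) (h : 'rV[R]_m -> R) :
  (forall j, smooth_near p (g j)) -> smooth_near_rV (\row_j g j p) h ->
  smooth_near p (fun x => h (\row_j g j x)).
Proof.
have [N [psi [U [Up e]]]] := aX p => hg hh.
have {hg} : forall j, exists a, smooth_near_rV (psi p) a /\ \forall q \near p, g j q = a (psi q).
  by move=> j; have /(smooth_emb _ e Up)[a] := hg j; exists a.
move=> /choice[a ha]; apply/(smooth_emb _ e Up).
have nE : \forall q \near p, forall j, g j q = a j (psi q).
  by apply: near_forall => j; case: (ha j).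
exists (fun x => h (\row_j a j x)); split.
  apply: sm_comp; first by move=> j; case: (ha j).
  rewrite (_ : \row_j a j (psi p) = \row_j g j p)//.
  by apply/rowP => j; rewrite !mxE (nbhs_singleton nE).
by apply: filterS nE => q qE; congr (h _); apply/rowP => j; rewrite !mxE qE.
Qed.

End Ambient.

Lemma embeds_ambient X N (psi : X -> euclidean R N) : embeds setT psi -> ambient X.
Proof. by move=> e p; exists N, psi, setT. Qed.

Lemma embeds_id N : embeds setT (id : euclidean R N -> euclidean R N).
Proof.
split=> //; first exact: openT.
- move=> p _ A; split=> [nA|[B nB sB]]; first by exists A => // q [].
  by apply: filterS nB => q Bq; apply: sB.
- move=> p _ f; split=> [sf|[h [sh fh]]]; first by exists f; split=> //; apply: (@nearW _ (nbhs p)).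
  by apply: sm_eq sh; apply: filterS fh => q ->.
Qed.

Lemma ambient_euclidean N : ambient (euclidean R N).
Proof. exact: embeds_ambient (@embeds_id N). Qed.

Lemma Sm_embed_coord X N (psi : X -> euclidean R N) U p j : embeds U psi -> U p ->
  smooth_near p (fun q => psi q 0 j).
Proof.
move=> e Up; apply/(smooth_emb _ e Up); exists (fun x : 'rV[R]_N => x 0 j).
by split; [exact: sm_coord|apply: nearW].
Qed.

(** Every smooth germ on the target is a smooth function of the entries of [psi], so only the
    entries of [psi \o F] have to be checked. *)
Lemma smooth_pull X Y (aX : ambient X) N (psi : Y -> euclidean R N) V (F : X -> Y) p :
  embeds V psi -> V (F p) -> (\forall q \near p, V (F q)) ->
  (forall j, smooth_near p (fun q => psi (F q) 0 j)) -> {for p, continuous F} /\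
  forall f, smooth_near (F p) f -> smooth_near p (f \o F).
Proof.
move=> e Vp nV sF.
have cF : {for p, continuous F}.
  move=> A /(embeds_nbhsE e Vp)[B nB sB].
  have : nbhs p [set q | B (psi (F q))].
    have c : psi (F q) @[q --> p] --> psi (F p).
      rewrite (_ : (fun q => psi (F q)) = (fun q => \row_j psi (F q) 0 j)).
        by apply: (@rV_cvg _ _ (nbhs p)) => j; exact: Sm_cont (sF j).
      by apply/funext => q; apply/rowP => j; rewrite mxE.
    exact: c.
  by apply: filterS2 nV => q Vq Bq; apply: sB.
split=> // f /(smooth_emb _ e Vp)[h [sh fh]].
have E q : psi (F q) = \row_j psi (F q) 0 j by apply/rowP => j; rewrite mxE.
apply: (Sm_eq aX (f := fun q => h (\row_j psi (F q) 0 j))).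
  have : nbhs p (F @^-1` [set q | f q = h (psi q)]) by exact: cF.
  by apply: filterS => q /= ->; rewrite -E.
by apply: (Sm_comp aX) => //; rewrite -E.
Qed.

Lemma open_preimage X Y (U : set X) (F : X -> Y) (B : set Y) : embeds U F ->
  open B -> open (U `&` F @^-1` B).
Proof.
move=> e oB; rewrite openE => p [Up Bp]; rewrite /interior; apply: filterI.
  by exact: (embeds_dom e).
by apply: embeds_nbhs e Up _; exact: open_nbhs_nbhs.
Qed.

End Germs.

(* Functions F on T, a dense subset of X through iota, that extend smoothly
   across p with value a. *)
Section Extension.
Context {R : realType} (X : germ_space R) (aX : ambient X) (T : Type) (iota : T -> X).
Hypothesis dns : forall (p : X) (A : set X), nbhs p A -> exists v, A (iota v).
Implicit Types (p : X) (F G : T -> R).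

Definition xt p F a := exists h : X -> R, [/\ smooth_near p h, h p = a &
  \forall q \near p, forall v, iota v = q -> h q = F v].

Definition nearT p (P : T -> Prop) := \forall q \near p, forall v, iota v = q -> P v.

Lemma nearTW p (P : T -> Prop) : (forall v, P v) -> nearT p P.
Proof. by move=> h; apply: nearW => q v _; exact: h. Qed.

Lemma nearTS p (P Q : T -> Prop) : (forall v, P v -> Q v) -> nearT p P -> nearT p Q.
Proof. by rewrite /nearT => PQ; apply: filterS => q h v /h/PQ. Qed.

Lemma xt_eq p F G a : nearT p (fun v => F v = G v) -> xt p F a -> xt p G a.
Proof.
rewrite /nearT => FG [h [sh ha hF]]; exists h; split=> //.
by apply: filterS2 FG hF => q h1 h2 v vq; rewrite (h2 v vq) (h1 v vq).
Qed.

Lemma xt_cst p c : xt p (fun=> c) c.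
Proof. by exists (fun=> c); split; [exact: Sm_cst| |apply: nearW]. Qed.

Lemma xtD p F G a b : xt p F a -> xt p G b -> xt p (fun v => F v + G v) (a + b).
Proof.
move=> [f [sf fa fF]] [g [sg gb gG]]; exists (fun x => f x + g x).
split; [exact: SmD|by rewrite fa gb|].
by apply: filterS2 fF gG => q h1 h2 v vq; rewrite (h1 v vq) (h2 v vq).
Qed.

Lemma xtM p F G a b : xt p F a -> xt p G b -> xt p (fun v => F v * G v) (a * b).
Proof.
move=> [f [sf fa fF]] [g [sg gb gG]]; exists (fun x => f x * g x).
split; [exact: SmM|by rewrite fa gb|].
by apply: filterS2 fF gG => q h1 h2 v vq; rewrite (h1 v vq) (h2 v vq).
Qed.

Lemma xtV p F a : a != 0 -> xt p F a -> xt p (fun v => (F v)^-1) a^-1.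
Proof.
move=> a0 [f [sf fa fF]]; exists (fun x => (f x)^-1).
split; [by apply: SmV; rewrite ?fa|by rewrite fa|].
by apply: filterS fF => q h1 v vq; rewrite (h1 v vq).
Qed.

Lemma xt_div p F G a b : b != 0 -> xt p F a -> xt p G b -> xt p (fun v => F v / G v) (a / b).
Proof. by move=> b0 hF hG; apply: xtM => //; exact: xtV. Qed.

Lemma xt_sqrt p F a : 0 < a -> xt p F a -> xt p (fun v => Num.sqrt (F v)) (Num.sqrt a).
Proof.
move=> a0 [f [sf fa fF]]; exists (fun x => Num.sqrt (f x)).
split; [by apply: Sm_sqrt; rewrite ?fa|by rewrite fa|].
by apply: filterS fF => q h1 v vq; rewrite (h1 v vq).
Qed.

Lemma xtZ p c F a : xt p F a -> xt p (fun v => c * F v) (c * a).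
Proof. by apply: xtM; exact: xt_cst. Qed.

Lemma xt_sum p (I : Type) (s : seq I) (P : pred I) (F : I -> T -> R) a :
  (forall i, P i -> xt p (F i) (a i)) ->
  xt p (fun v => \sum_(i <- s | P i) F i v) (\sum_(i <- s | P i) a i).
Proof.
move=> h; elim: s => [|i s IH].
  rewrite big_nil; apply: xt_eq (xt_cst p 0); apply: nearTW => v; by rewrite big_nil.
rewrite big_cons; case: ifPn => Pi.
  by apply: xt_eq (xtD (h i Pi) IH); apply: nearTW => v; rewrite big_cons Pi.
by apply: xt_eq IH; apply: nearTW => v; rewrite big_cons (negbTE Pi).
Qed.

Lemma xt_comp m p (g : 'I_m -> T -> R) (a : 'rV[R]_m) (h : 'rV[R]_m -> R) :
  (forall j, xt p (g j) (a 0 j)) -> smooth_near_rV a h -> xt p (fun v => h (\row_j g j v)) (h a).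
Proof.
move=> /choice[f hf] sh; exists (fun x => h (\row_j f j x)).
have E : \row_j f j p = a by apply/rowP => j; rewrite mxE; case: (hf j).
split; [|by rewrite E|].
  by apply: (Sm_comp aX); rewrite ?E// => j; case: (hf j).
have : \forall q \near p, forall j v, iota v = q -> f j q = g j v.
  by apply: near_forall => j; case: (hf j).
apply: filterS => q hq v vq; congr (h _); apply/rowP => j; rewrite !mxE.
exact: hq.
Qed.

Lemma nearT_gt p F a c : xt p F a -> c < a -> nearT p (fun v => c < F v).
Proof.
move=> [f [/(Sm_cont aX) cf fa fF]] ca.
have : \forall q \near p, c < f q by apply: (cvgr_gt (f p)) => //; rewrite fa.
by apply: filterS2 fF => q h1 h2 v vq; rewrite -(h1 v vq).
Qed.

Lemma xt_ge p F a c : xt p F a -> nearT p (fun v => c <= F v) -> c <= a.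
Proof.
move=> hF hc; rewrite leNgt; apply/negP => ac.
have [f [/(Sm_cont aX) cf fa fF]] := hF; rewrite /nearT in hc.
have : \forall q \near p, f q < c by apply: (cvgr_lt (f p)) => //; rewrite fa.
move=> /filterI/(_ (filterI fF hc))/dns[v [h1 [h2 h3]]].
by have := h3 v erefl; rewrite leNgt -(h2 v erefl) h1.
Qed.

(** Density enters through [xt_ge], which compares with constants; the difference of the two values
    is therefore bounded by 0 on both sides. *)
Lemma xt_uniq p F a b : xt p F a -> xt p F b -> a = b.
Proof.
move=> ha hb; apply/eqP; rewrite -subr_eq0; have := xtD ha (xtZ (-1) hb).
rewrite mulN1r => hab.
have z : nearT p (fun v => 0 <= F v + -1 * F v) by apply: nearTW => v; rewrite mulN1r subrr.
have z' : nearT p (fun v => 0 <= -1 * (F v + -1 * F v)).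
  by apply: nearTW => v; rewrite !mulN1r subrr oppr0.
rewrite eq_le (xt_ge hab z) andbT.
by have := xt_ge (xtZ (-1) hab) z'; rewrite mulN1r oppr_ge0.
Qed.

Lemma xt_near p F a : xt p F a -> exists2 h, smooth_near p h &
  h p = a /\ \forall q \near p, xt q F (h q).
Proof.
move=> [h [sh ha hF]]; exists h => //; split=> //.
have := Sm_near aX sh; have := near_join hF; apply: filterS2 => q hq sq.
by exists h.
Qed.

Lemma xt_iota v F a : xt (iota v) F a -> a = F v.
Proof. by move=> [h [_ <- /nbhs_singleton/(_ v erefl)]]. Qed.

(** Uniqueness of the values makes the local extensions agree, so that they glue. *)
Lemma xt_extend F : (forall p, exists a, xt p F a) ->
  exists Fb : X -> R, [/\ forall p, smooth_near p Fb, forall v, Fb (iota v) = F v &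
    forall p a, xt p F a <-> Fb p = a].
Proof.
move=> /choice[Fb hF]; exists Fb; split.
- move=> p; have [h sh [_ hq]] := xt_near (hF p).
  apply: Sm_eq sh => //; apply: filterS hq => q hq; exact: xt_uniq hq (hF q).
- by move=> v; exact: xt_iota (hF _).
- by move=> p a; split=> [/xt_uniq/(_ (hF p))->//|<-].
Qed.

Lemma xt_of_smooth p (h : X -> R) F : smooth_near p h -> (forall v, h (iota v) = F v) -> xt p F (h p).
Proof. by move=> sh hF; exists h; split=> //; apply: nearW => q v <-; exact: hF. Qed.

End Extension.

(** * Charts *)

Section Charts.
Context {R : realType}.
Implicit Types X Y : germ_space R.

Definition chart X (c : coords X) := embeds (dom c) (crd c) /\
  exists2 O, open O & crd c @` dom c = O `&` corner (bnd c).

Lemma adapted_chart X (p : X) c : adapted p c -> chart c.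
Proof. by case. Qed.

Lemma adapted_dom X (p : X) c : adapted p c -> dom c p.
Proof. by case. Qed.

Lemma chart_corner X (c : coords X) q : chart c -> dom c q -> forall i, i \in bnd c -> 0 <= crd c q 0 i.
Proof.
move=> [_ [Q oO E]] dq; have [] : (Q `&` corner (bnd c)) (crd c q).
  by rewrite -E; exists q.
by [].
Qed.

Lemma nearI (T : topologicalType) (p : T) (A B : set T) : nbhs p A -> nbhs p B -> nbhs p (A `&` B).
Proof. exact: filterI. Qed.

Lemma rightI (A B : set R) : (0 : R)^'+ A -> 0^'+ B -> 0^'+ (A `&` B).
Proof. exact: filterI. Qed.

Lemma right_lt (f : R -> R) (a b : R) : f t @[t --> 0^'+] --> a -> a < b ->
  \forall t \near 0^'+, f t < b.
Proof. by move=> fa; exact: cvgr_lt. Qed.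

Lemma near_cvg (T : Type) (U : topologicalType) (F : set_system T) (f : T -> U) (l : U)
    (P : U -> Prop) : f y @[y --> F] --> l -> (\forall u \near l, P u) -> \forall t \near F, P (f t).
Proof. by move=> h nP; exact: h. Qed.

Lemma near_eq_lim (T : Type) (F : set_system T) (FF : ProperFilter F) (f g : T -> R) (a b : R) :
  f y @[y --> F] --> a -> g y @[y --> F] --> b -> (\forall t \near F, f t = g t) -> a = b.
Proof.
move=> fa gb fg; apply: (@cvg_unique _ (@Rhausdorff R) (f @ F)) => //.
apply: cvg_trans gb; apply: near_eq_cvg; by apply: filterS fg => t ->.
Qed.

(** The image of a chart is relatively open in the corner, so a row close to [crd c p] that stays in
    the corner is the coordinate row of a point close to [p]. This is what makes perturbation of
    coordinates possible. *)
Lemma chart_near_pt X (c : coords X) p (P : X -> Prop) : chart c -> dom c p ->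
  (\forall q \near p, P q) ->
  \forall u \near crd c p, corner (bnd c) u -> exists q, [/\ dom c q, crd c q = u & P q].
Proof.
move=> [e [Q oO E]] dp nP; have [B nB sB] := embeds_nbhsE e dp nP.
have Op : Q (crd c p).
  by have [] : (Q `&` corner (bnd c)) (crd c p) by rewrite -E; exists p.
have : nbhs (crd c p) Q by exact: open_nbhs_nbhs.
apply: filterS2 nB => u Bu Ou cu.
have [q dq qu] : (crd c @` dom c) u by rewrite E.
by exists q; split=> //; apply: sB; split=> //; rewrite /preimage /= qu.
Qed.

Lemma rV_near_gt n (u : 'rV[R]_n) i : 0 < u 0 i -> \forall v \near u, 0 < (v : 'rV[R]_n) 0 i.
Proof. by move=> ui; exact: (cvgr_gt (u 0 i) (@coord_continuous _ _ _ 0 i u)) ui. Qed.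

(** Boundary coordinates of [c] that are positive at [q] become ordinary coordinates there, once the
    domain is cut down to where they stay positive. *)
Lemma chart_at X (q : X) (c : coords X) : chart c -> dom c q ->
  exists c' : coords X, [/\ adapted q c', dom c' `<=` dom c, crd c' = crd c &
    bnd c' = [set i in bnd c | crd c q 0 i == 0]%SET].
Proof.
move=> ch dq; have [e [Q oO E]] := ch.
set B' := [set i in bnd c | crd c q 0 i == 0]%SET.
pose V : set 'rV[R]_(sdim X) := [set u | forall i, i \in bnd c :\: B' -> 0 < u 0 i].
have oV : open V.
  rewrite openE => u Vu; rewrite /interior.
  apply: (@filter_forall _ _ (fun i (u : 'rV[R]_(sdim X)) => i \in bnd c :\: B' -> 0 < u 0 i) (nbhs u)) => i.
  have [iB|iB] := boolP (i \in bnd c :\: B'); last by apply: nearW.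
  have : \forall v \near u, 0 < (v : 'rV[R]_(sdim X)) 0 i.
    by apply: rV_near_gt; exact: Vu.
  by apply: filterS.
have oD : open (dom c `&` crd c @^-1` V) by exact: open_preimage e _.
have Vq : V (crd c q).
  move=> i; rewrite !inE => /andP[+ iB]; rewrite iB /= => i0.
  by rewrite lt_neqAle eq_sym i0 (chart_corner ch).
exists (Coords (dom c `&` crd c @^-1` V) (crd c) B'); split; [|by move=> ? []|by []|by []].
split => /=.
- by [].
- by apply: embeds_sub e => // x [].
- exists (Q `&` V); first exact: openI.
  apply/seteqP; split=> [u [x [dx Vx] <-]|u [[Ou Vu] cu]].
    have [Ox cx] : (Q `&` corner (bnd c)) (crd c x) by rewrite -E; exists x.
    by split=> // i; rewrite inE => /andP[ib _]; exact: cx.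
  have [x dx xu] : (crd c @` dom c) u.
    rewrite E; split=> // i ib; have [iB|iB] := boolP (i \in B'); first exact: cu.
    by apply/ltW/Vu; rewrite inE iB.
  by exists x => //; split; [exact: dx|rewrite /preimage /= xu].
- by move=> i; rewrite inE => /andP[_ /eqP].
Qed.

Lemma cvg_line n (u w : 'rV[R]_n) : (u + t *: w) @[t --> (0 : R)] --> u.
Proof.
have c1 : (t *: w) @[t --> (0 : R)] --> 0 *: w by apply: cvgZr_tmp; exact: cvg_id.
have c2 : u @[t --> (0 : R)] --> u by exact: cvg_cst.
have H := cvgD c2 c1; rewrite scale0r addr0 in H; exact: H.
Qed.

(** Only the boundary coordinates that vanish at [u] restrict the direction [w]; the positive ones
    stay positive for small [t]. *)
Lemma corner_near n (B : {set 'I_n}) (u w : 'rV[R]_n) (P : 'rV[R]_n -> Prop) :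
  corner B u -> (forall i, i \in B -> u 0 i = 0 -> 0 <= w 0 i) -> (\forall v \near u, P v) ->
  \forall t \near (0 : R)^'+, P (u + t *: w) /\ corner B (u + t *: w).
Proof.
move=> cu cw nP.
have cv : (u + t *: w) @[t --> (0 : R)^'+] --> u.
  by apply: cvg_at_right_filter; exact: cvg_line.
have nc : \forall t \near (0 : R)^'+, corner B (u + t *: w).
  apply: (@filter_forall _ _ (fun i (t : R) => i \in B -> 0 <= (u + t *: w) 0 i) (0^'+)) => i.
  have [iB|iB] := boolP (i \in B); last by apply: nearW.
  have [ui0|ui0] := eqVneq (u 0 i) 0.
    near=> t; rewrite !mxE ui0 add0r => _; apply: mulr_ge0; last exact: cw.
    by apply: ltW; near: t; exact: nbhs_right_gt.
  have ui : 0 < u 0 i by rewrite lt_neqAle eq_sym ui0 cu.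
  have : \forall v \near u, 0 < (v : 'rV[R]_n) 0 i.
    exact: rV_near_gt.
  by move=> /(near_cvg cv); apply: filterS => t /= /ltW.
by apply: filterI nc; exact: cv.
Unshelve. all: by end_near. Qed.

(** Hadamard's lemma is applied to [f] written in coordinates. Its remainder is the value with the
    coordinates in [A] set to zero; that row is still in the corner, hence comes from a point near
    [p], where [f] vanishes. *)
Lemma chart_hadamard X (p : X) (c : coords X) (A : {set 'I_(sdim X)}) f :
  chart c -> dom c p -> (forall i, i \in A -> crd c p 0 i = 0) -> smooth_near p f ->
  (\forall q \near p, (forall i, i \in A -> crd c q 0 i = 0) -> f q = 0) ->
  exists g : 'I_(sdim X) -> X -> R, (forall i, smooth_near p (g i)) /\
    \forall q \near p, f q = \sum_(i in A) crd c q 0 i * g i q.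
Proof.
move=> ch dp A0 sf f0; have [e _] := ch.
have /(smooth_emb _ e dp)[h [sh fh]] := sf.
have [g [sg gE]] := sm_hadamard sh A0.
exists (fun i q => g i (crd c q)); split.
  by move=> i; apply/(smooth_emb _ e dp); exists (g i); split; [exact: sg|apply: nearW].
pose z (u : 'rV[R]_(sdim X)) : 'rV[R]_(sdim X) := \row_j (if j \in A then 0 else u 0 j).
have zp : z (crd c p) = crd c p.
  by apply/rowP => j; rewrite mxE; case: ifP => // jA; rewrite A0.
have nf : \forall q \near p, ((forall i, i \in A -> crd c q 0 i = 0) -> f q = 0) /\ f q = h (crd c q).
  exact: filterI.
have n0 := chart_near_pt ch dp nf.
have n1 : \forall q \near p, corner (bnd c) (z (crd c q)) -> exists q', [/\ dom c q', crd c q' = z (crd c q) &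
    ((forall i, i \in A -> crd c q' 0 i = 0) -> f q' = 0) /\ f q' = h (crd c q')].
  have cz : z (crd c q) @[q --> p] --> crd c p.
    rewrite -[X in _ --> X]zp; apply: (@rV_cvg _ _ (nbhs p)) => j; rewrite mxE; case: ifP => _; first exact: cvg_cst.
    have := @continuous_comp _ _ _ (crd c) (fun u : 'rV[R]_(sdim X) => u 0 j) p.
    by apply; [exact: embeds_cont e dp|exact: coord_continuous].
  exact: cz n0.
have n2 := embeds_nbhs e dp gE.
have n3 : nbhs p (dom c) by exact: (embeds_dom e).
apply: filterS (filterI (filterI n1 n2) (filterI fh n3)) => q [[h1 h2] [h3 dq]].
rewrite h3 h2.
have [|q' [dq' q'z [h4 h5]]] := h1.
  by move=> i ib; rewrite mxE; case: ifP => // _; exact: chart_corner ch dq _ ib.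
rewrite -/(z (crd c q)) -q'z -h5 h4 ?add0r//.
by move=> i iA; rewrite q'z mxE iA.
Qed.

Lemma sm_taylor n (p : 'rV[R]_n) h : smooth_near_rV p h ->
  exists g : 'I_n -> 'rV[R]_n -> R, (forall i, smooth_near_rV p (g i)) /\
    \forall u \near p, h u = h p + \sum_i (u 0 i - p 0 i) * g i u.
Proof.
move=> sh; pose h' (u : 'rV[R]_n) := h (\row_j (u 0 j + p 0 j)).
have z0 : \row_j ((0 : 'rV[R]_n) 0 j + p 0 j) = p by apply/rowP => j; rewrite !mxE add0r.
have sh' : smooth_near_rV 0 h'.
  apply: (@sm_comp _ _ _ _ (fun j (u : 'rV[R]_n) => u 0 j + p 0 j) h); last by rewrite z0.
  by move=> j; apply: smD; [exact: sm_coord|exact: sm_cst].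
have [i _|g [sg gE]] := @sm_hadamard _ _ 0 h' [set: 'I_n]%SET sh'; first by rewrite mxE.
have pp : \row_j (p 0 j - p 0 j) = 0 :> 'rV[R]_n by apply/rowP => j; rewrite !mxE subrr.
exists (fun i u => g i (\row_j (u 0 j - p 0 j))); split.
  move=> i; apply: (@sm_comp _ _ _ _ (fun j (u : 'rV[R]_n) => u 0 j - p 0 j) (g i)).
    by move=> j; apply: smD; [exact: sm_coord|exact: sm_cst].
  by rewrite pp; exact: sg.
have cv : (fun u : 'rV[R]_n => \row_j (u 0 j - p 0 j) : 'rV[R]_n) u @[u --> p] --> (0 : 'rV[R]_n).
  rewrite -pp; apply: (@rV_cvg _ _ (nbhs p)) => j; rewrite mxE.
  by apply: (@cvgB _ _ _ (nbhs p)); [exact: coord_continuous|exact: cvg_cst].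
apply: filterS (near_cvg cv gE) => u /=.
have -> : h' (\row_j (u 0 j - p 0 j)) = h u.
  by rewrite /h'; congr h; apply/rowP => j; rewrite !mxE subrK.
move=> ->; congr (_ + _).
  by rewrite /h'; congr h; apply/rowP => j; rewrite !mxE inE add0r.
by apply: eq_big => [i|i _]; rewrite ?inE// !mxE.
Qed.

Lemma sm_quotient n (p w : 'rV[R]_n) g : smooth_near_rV p g ->
  g (p + t *: w) @[t --> (0 : R)^'+] --> g p.
Proof.
move=> /sm_cont sg; apply: cvg_at_right_filter.
exact: (@cvg_comp _ _ _ (fun t => p + t *: w) g _ (nbhs p) _ (@cvg_line _ p w) sg).
Qed.

Lemma cvg_lineC n (u w : 'rV[R]_n) : (t *: w + u) @[t --> (0 : R)] --> u.
Proof. by under eq_fun do rewrite addrC; exact: cvg_line. Qed.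

Lemma taylor_line n (p : 'rV[R]_n) (g : 'I_n -> 'rV[R]_n -> R) (t : R) i :
  \sum_k ((p + t *: delta_mx 0 i) 0 k - p 0 k) * g k (p + t *: delta_mx 0 i) =
  t * g i (p + t *: delta_mx 0 i).
Proof.
rewrite (bigD1 i)//= big1 ?addr0 => [|k ki].
  by rewrite !mxE !eqxx mulr1 addrAC subrr add0r.
by rewrite !mxE eqxx (negbTE ki) mulr0 addr0 subrr mul0r.
Qed.

Section FaceCmp.
Variables (X : germ_space R) (aX : ambient X) (p : X).

(** Boundary faces do not depend on the chart. Let [h] be the coordinate [i] of [c] as a function of
    the coordinates of [c']. It vanishes at [p] and is non-negative on the corner, so its gradient
    at [p] is zero in the interior directions and non-negative in the boundary ones; and the
    gradient is not zero because the change of coordinates is invertible. This yields [j].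
    Non-negativity of [h] where coordinate [j] is zero gives the last clause. *)
Lemma chart_face_sub (c c' : coords X) i : adapted p c -> adapted p c' ->
  i \in bnd c -> exists j G (h : 'rV[R]_(sdim X) -> R), [/\ j \in bnd c', smooth_near p G, 0 < G p,
    \forall q \near p, crd c q 0 i = h (crd c' q) /\
      crd c q 0 i = h (\row_k (if k == j then 0 else crd c' q 0 k)) + crd c' q 0 j * G q &
    \forall q \near p, crd c q 0 i = 0 -> crd c' q 0 j = 0].
Proof.
move=> ac ac' ib; have [dp e E p0] := ac; have [dp' e' E' p0'] := ac'.
have ch := adapted_chart ac; have ch' := adapted_chart ac'.
have si : smooth_near p (fun q => crd c q 0 i) by exact: Sm_embed_coord e dp.
have [h sh hE] := Sm_lift si dp' e'.
set u0 : 'rV[R]_(sdim X) := crd c' p in sh *; set w0 : 'rV[R]_(sdim X) := crd c p.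
have h0 : h u0 = 0 by rewrite -(nbhs_singleton hE) p0.
have nd : nbhs p (dom c) by exact: (embeds_dom e).
have hc : \forall u \near u0, corner (bnd c') u -> 0 <= h u.
  have nh : \forall q \near p, dom c q /\ crd c q 0 i = h (crd c' q) by exact: nearI.
  apply: filterS (chart_near_pt ch' dp' nh) => u hu /hu[q [_ <- [dq <-]]].
  exact: chart_corner ch dq _ ib.
have [g [sg gE]] := sm_taylor sh.
have cp' : corner (bnd c') u0 by move=> k; exact: chart_corner ch' dp' k.
have cp : corner (bnd c) w0 by move=> k; exact: chart_corner ch dp k.
have nE : \forall u \near u0, (corner (bnd c') u -> 0 <= h u) /\ h u = \sum_i (u 0 i - u0 0 i) * g i u.
  by apply: filterS2 hc gE => u h1 h2; split=> //; rewrite h2 h0 add0r.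
(* The one-sided derivative of [h] in the direction of [s] times the basis vector [k], when that
   direction points into the corner; both [s = 1] and [s = -1] are used. *)
have line k (s : R) : (forall k', k' \in bnd c' -> 0 <= s * (k' == k)%:R) -> 0 <= s * g k u0.
  move=> sk; rewrite leNgt; apply/negP => neg.
  have sk' k' : k' \in bnd c' -> u0 0 k' = 0 -> 0 <= (s *: delta_mx 0 k : 'rV[R]_(sdim X)) 0 k'.
    by move=> h1 h2; rewrite !mxE; exact: sk.
  have n2 := corner_near cp' sk' nE.
  have cvs : s * g k (u0 + t *: (s *: delta_mx 0 k)) @[t --> 0^'+] --> s * g k u0.
    by apply: cvgM; [exact: cvg_cst|exact: sm_quotient].
  have n3 := right_lt cvs neg.
  have [t [[[h1 h2] h3] [h4 t0]]] := filter_ex (rightI n2 (rightI n3 (@nbhs_right_gt R 0))).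
  have := h1 h3; rewrite h2 scalerA taylor_line -scalerA -mulrA pmulr_rge0//.
  by rewrite leNgt h4.
(* Otherwise let [T] be the transition map from [c] to [c']. The chain rule gives [phi] as
   difference quotient of coordinate [i] along its own axis; it tends to 0, whereas this quotient is
   1. *)
have [k gk0] : exists k, g k u0 != 0.
  apply: contrapT => /forallNP nog.
  have g0 k : g k u0 = 0 by apply/eqP/negP => /negP; exact: nog.
  have sT k : smooth_near p (fun q => crd c' q 0 k) by exact: Sm_embed_coord e' dp'.
  have /choice[T hT] : forall k, exists Tk, smooth_near_rV w0 Tk /\
      \forall q \near p, crd c' q 0 k = Tk (crd c q).
    by move=> k; have [Tk ? ?] := Sm_lift (sT k) dp e; exists Tk.
  have /choice[G hG] : forall k, exists Gk : 'I_(sdim X) -> 'rV[R]_(sdim X) -> R,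
      (forall l, smooth_near_rV w0 (Gk l)) /\
      \forall w \near w0, T k w = T k w0 + \sum_l (w 0 l - w0 0 l) * Gk l w.
    by move=> k; exact: sm_taylor (hT k).1.
  have T0 : \row_k T k w0 = u0.
    by apply/rowP => k; rewrite mxE -(nbhs_singleton (hT k).2).
  pose phi w := \sum_k G k i w * g k (\row_k T k w).
  have sphi : smooth_near_rV w0 phi.
    apply: (Sm_sum (@ambient_euclidean R _)) => k _.
    apply: smM; first by case: (hG k).
    by apply: (@sm_comp _ _ _ _ T (g k)); [move=> j; case: (hT j)|rewrite T0; exact: sg].
  have phi0 : phi w0 = 0 by rewrite /phi big1// => k _; rewrite T0 g0 mulr0.
  have cphi := @sm_quotient _ w0 (delta_mx 0 i) phi sphi.
  rewrite phi0 in cphi.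
  have n1 := right_lt cphi ltr01.
  have n2 : \forall q \near p, crd c q 0 i = h (crd c' q) /\ (h (crd c' q) = \sum_i (crd c' q 0 i - u0 0 i) * g i (crd c' q)) /\
      (forall k, crd c' q 0 k = T k (crd c q)).
    have n4 : \forall q \near p, forall k, crd c' q 0 k = T k (crd c q).
      by apply: near_forall => k; case: (hT k).
    have n5 := embeds_nbhs e' dp' nE.
    by apply: filterS (nearI hE (nearI n5 n4)) => q [? [[? ?] ?]].
  have n3 := chart_near_pt ch dp n2.
  have n4 : \forall w \near w0, forall k, T k w = T k w0 + \sum_l (w 0 l - w0 0 l) * G k l w.
    by apply: (@filter_forall _ _ (fun k w => T k w = T k w0 + \sum_l (w 0 l - w0 0 l) * G k l w) (nbhs w0)) => k; case: (hG k).
  have pos k' : k' \in bnd c -> w0 0 k' = 0 -> 0 <= (delta_mx 0 i : 'rV[R]_(sdim X)) 0 k'.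
    by move=> _ _; rewrite !mxE ler0n.
  have n5 := corner_near cp pos (nearI n3 n4).
  have [t [[[h1 h2] h3] [h4 t0]]] := filter_ex (rightI n5 (rightI n1 (@nbhs_right_gt R 0))).
  have [q [dq qw [h5 [h6 h7]]]] := h1 h3.
  have E1 : crd c' q = \row_k T k (w0 + t *: delta_mx 0 i).
    by apply/rowP => k; rewrite mxE h7 qw.
  have : t = t * phi (w0 + t *: delta_mx 0 i).
    transitivity (crd c q 0 i).
      by rewrite qw !mxE /w0 p0// !eqxx mulr1 add0r.
    rewrite h5 h6 /phi mulr_sumr; apply: eq_bigr => k _.
    rewrite mulrA -E1; congr (_ * _).
    by rewrite h7 qw h2 taylor_line -T0 mxE addrAC subrr add0r.
  rewrite -{1}[t]mulr1 => /mulfI; rewrite gt_eqF// => /(_ isT) E2.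
  by move: h4; rewrite -E2 ltxx.
have kb : k \in bnd c'.
  apply: contraT => kb; case/negP: gk0; rewrite eq_le; apply/andP; split.
    rewrite -oppr_ge0 -mulN1r; apply: line => k' k'b.
    by case: (eqVneq k' k) => [kk|_]; [rewrite -kk k'b in kb|rewrite mulr0].
  rewrite -[X in 0 <= X]mul1r; apply: line => k' k'b.
  by case: (eqVneq k' k) => [kk|_]; [rewrite -kk k'b in kb|rewrite mulr0].
have gk : 0 < g k u0.
  rewrite lt_neqAle eq_sym gk0 -[X in 0 <= X]mul1r; apply: line => k' _.
  by rewrite mul1r ler0n.
have u0k : u0 0 k = 0 by exact: p0'.
have [|G [sG GE]] := @sm_hadamard _ _ u0 h [set k]%SET sh.
  by move=> j /set1P ->.
pose z (u : 'rV[R]_(sdim X)) : 'rV[R]_(sdim X) := \row_j (if j == k then 0 else u 0 j).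
have {}GE : \forall u \near u0, h u = h (z u) + u 0 k * G k u.
  apply: filterS GE => u ->; rewrite big_set1; congr (h _ + _).
  by apply/rowP => j; rewrite !mxE inE.
have Gk : g k u0 = G k u0.
  have n1 := @cvg_at_right_filter _ _ _ _ _ (@cvg_line _ u0 (delta_mx 0 k)).
  have n2 := near_cvg n1 (nearI nE GE).
  apply: (near_eq_lim _ (@sm_quotient _ u0 (delta_mx 0 k) _ (sg k)) (@sm_quotient _ u0 (delta_mx 0 k) _ (sG k))).
  apply: filterS2 n2 (@nbhs_right_gt R 0) => t [[_ h1] h2] t0.
  have z0 : z (u0 + t *: delta_mx 0 k) = u0.
    by apply/rowP => j; rewrite !mxE; case: eqP => [->|_]; rewrite ?u0k ?mulr0 ?addr0.
  move: h2; rewrite h1 taylor_line z0 h0 add0r !mxE u0k !eqxx mulr1 add0r.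
  by move=> /mulfI; apply; rewrite gt_eqF.
have zu0 : z u0 = u0 by apply/rowP => j; rewrite mxE; case: eqP => [->|].
have cz : z (crd c' q) @[q --> p] --> u0.
  rewrite -[X in _ --> X]zu0; apply: (@rV_cvg _ _ (nbhs p)) => j; rewrite mxE; case: ifP => _; first exact: cvg_cst.
  have := @continuous_comp _ _ _ (crd c') (fun u : 'rV[R]_(sdim X) => u 0 j) p.
  by apply; [exact: embeds_cont e' dp'|exact: coord_continuous].
have sGq : smooth_near p (fun q => G k (crd c' q)).
  by apply/(smooth_emb _ e' dp'); exists (G k); split; [exact: sG|apply: nearW].
have nE2 : \forall q \near p, crd c q 0 i = h (crd c' q) /\ crd c q 0 i = h (z (crd c' q)) + crd c' q 0 k * G k (crd c' q).
  apply: filterS2 hE (embeds_nbhs e' dp' GE) => q h1 h2; split=> //.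
  by rewrite h1 h2.
exists k, (fun q => G k (crd c' q)), h; split=> //; first by rewrite -/u0 -Gk.
have nd' : nbhs p (dom c') by exact: (embeds_dom e').
have nG : \forall q \near p, 0 < G k (crd c' q).
  by apply: (cvgr_gt _ (Sm_cont aX sGq)); rewrite -/u0 -Gk.
apply: filterS (nearI (nearI nE2 nG) (nearI nd' (near_cvg cz hc))) => q [[[_ h1] h2] [dq h3]] h4.
have cz' : corner (bnd c') (z (crd c' q)).
  by move=> j jb; rewrite mxE; case: eqP => // _; exact: chart_corner ch' dq _ jb.
have := h3 cz'; have kq := chart_corner ch' dq kb.
apply: contraPP => /eqP kq0; apply/negP; rewrite -ltNge.
have : 0 < crd c' q 0 k * G k (crd c' q) by rewrite mulr_gt0// lt_neqAle eq_sym kq0.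
by move: h1; rewrite h4 => /eqP; rewrite eq_sym addr_eq0 => /eqP ->; rewrite oppr_lt0.
Qed.

(** Going from [c] to [c'] and back includes [x_i = 0] in [x'_j = 0] and that in [x_l = 0]; moving
    along axis [l] shows [l = i]. Hence [h] vanishes where [x'_j = 0], and only the multiple of
    [x'_j] is left. *)
Lemma chart_face_cmp (c c' : coords X) i : adapted p c -> adapted p c' ->
  i \in bnd c -> exists j G, [/\ j \in bnd c',
    smooth_near p G, 0 < G p & \forall q \near p, crd c q 0 i = crd c' q 0 j * G q].
Proof.
move=> ac ac' ib.
have [j [G [h [jb sG G0 E1 E2]]]] := chart_face_sub ac ac' ib.
have [l [_ [_ [lb _ _ _ E3]]]] := chart_face_sub ac' ac jb.
have [dp e _ p0] := ac; have [dp' e' _ p0'] := ac'.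
have ch := adapted_chart ac; have ch' := adapted_chart ac'.
have li : l = i.
  apply/eqP; apply: contraT => li.
  have cp : corner (bnd c) (crd c p) by move=> k; exact: chart_corner ch dp k.
  have n1 := chart_near_pt ch dp (nearI E2 E3).
  have pos k' : k' \in bnd c -> crd c p 0 k' = 0 -> 0 <= (delta_mx 0 l : 'rV[R]_(sdim X)) 0 k'.
    by move=> _ _; rewrite !mxE ler0n.
  have n5 := corner_near cp pos n1.
  have [t [[h1 h3] t0]] := filter_ex (rightI n5 (@nbhs_right_gt R 0)).
  have [q [dq qw [h5 h6]]] := h1 h3.
  have : crd c q 0 l = 0.
    apply/h6/h5; rewrite qw !mxE p0// eqxx eq_sym (negbTE li) /= mulr0 addr0//.
  by rewrite qw !mxE p0// !eqxx mulr1 add0r => /eqP; rewrite gt_eqF.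
subst l; exists j, G; split=> //.
pose z (u : 'rV[R]_(sdim X)) : 'rV[R]_(sdim X) := \row_k (if k == j then 0 else u 0 k).
have zu0 : z (crd c' p) = crd c' p.
  by apply/rowP => k; rewrite mxE; case: (eqVneq k j) => [->|//]; rewrite p0'.
have cz : z (crd c' q) @[q --> p] --> crd c' p.
  rewrite -[X in _ --> X]zu0; apply: (@rV_cvg _ _ (nbhs p)) => k; rewrite mxE; case: ifP => _; first exact: cvg_cst.
  have := @continuous_comp _ _ _ (crd c') (fun u : 'rV[R]_(sdim X) => u 0 k) p.
  by apply; [exact: embeds_cont e' dp'|exact: coord_continuous].
have n1 := near_cvg cz (chart_near_pt ch' dp' (nearI E1 E3)).
have nd' : nbhs p (dom c') by exact: (embeds_dom e').
apply: filterS (nearI (nearI E1 nd') n1) => q [[[_ h1] dq] h2].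
have cz' : corner (bnd c') (z (crd c' q)).
  by move=> k kb; rewrite mxE; case: eqP => // _; exact: chart_corner ch' dq _ kb.
have [q' [dq' q'z [[h3 _] h4]]] := h2 cz'.
rewrite h1 -/(z _) -q'z -h3 h4 ?add0r//.
by rewrite q'z mxE eqxx.
Qed.

End FaceCmp.

End Charts.

(** * Blow-ups *)

Section EmbedsMore.
Context {R : realType}.
Implicit Types X Y Z : germ_space R.

Lemma embeds_comp X Y Z (U : set X) (V : set Y) (F : X -> Y) (G : Y -> Z) :
  embeds U F -> embeds V G -> embeds (U `&` F @^-1` V) (G \o F).
Proof.
move=> eF eG; have oV := embeds_open eG.
split.
- exact: open_preimage eF oV.
- move=> p q; rewrite !inE => -[Up Vp] [Uq Vq] /(embeds_inj eG Vp Vq).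
  exact: (embeds_inj eF).
- move=> p [Up Vp] A; split=> [nA|[B nB sB]].
    have [B nB sB] := embeds_nbhsE eF Up nA.
    have [C nC sC] := embeds_nbhsE eG Vp nB.
    exists C => // q [[Uq Vq] Cq]; apply: sB; split; [exact: Uq|].
    by apply: sC; split; [exact: Vq|exact: Cq].
  apply: filterS sB _; apply: filterI.
    apply: filterI; first by apply: open_nbhs_nbhs; split; [exact: embeds_open eF|].
    by apply: embeds_nbhs eF Up _; apply: open_nbhs_nbhs.
  exact: embeds_nbhs eF Up (embeds_nbhs eG Vp nB).
- move=> p [Up Vp] f; split.
    move=> /(smooth_emb _ eF Up)[h [/(smooth_emb _ eG Vp)[k [sk hk]] fh]].
    exists k; split=> //.
    have n1 := embeds_nbhs eF Up hk.
    by apply: filterS2 fh n1 => q -> ->.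
  move=> [k [sk fk]]; apply/(smooth_emb _ eF Up); exists (k \o G); split=> //.
  by apply/(smooth_emb _ eG Vp); exists k; split=> //; apply: nearW.
Qed.

Lemma ambient_pull X Y (F : X -> Y) (U : set X) p : ambient Y -> embeds U F -> U p ->
  exists N (psi : X -> euclidean R N) U', U' p /\ embeds U' psi.
Proof.
move=> aY eF Up; have [N [psi [V [Vp e]]]] := aY (F p).
by exists N, (psi \o F), (U `&` F @^-1` V); split=> //; exact: embeds_comp.
Qed.

(** The space [X] with the smooth functions pulled back through [psi]. For compact [X] and
    continuous injective [psi], showing that [psi] is an embedding reduces to comparing this
    structure with the given one. *)
Definition induced_space X N (psi : X -> 'rV[R]_N) : germ_space R :=
  @GermSpace R X (sdim X) (fun p f => exists h, smooth_near_rV (psi p) h /\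
     \forall q \near p, f q = h (psi q)).

Lemma compact_inj_nbhs (X : topologicalType) N (psi : X -> 'rV[R]_N) (p : X) (A : set X) :
  compact [set: X] -> continuous psi -> injective psi ->
  nbhs p A -> exists2 B, nbhs (psi p) B & psi @^-1` B `<=` A.
Proof.
move=> cX cpsi ipsi nA.
have cC : compact (psi @` (~` A^°)).
  apply: continuous_compact; first exact: continuous_subspaceT.
  apply: (subclosed_compact _ cX) => //; apply: open_closedC; exact: open_interior.
have clC : closed (psi @` (~` A^°)) by exact: compact_closed (@norm_hausdorff _ _) cC.
exists (~` (psi @` (~` A^°))).
  apply: open_nbhs_nbhs; split; first exact: closed_openC.
  by move=> [q Aq /ipsi qp]; apply: Aq; rewrite qp.
move=> q Bq; apply: contrapT => Aq; apply: Bq; exists q => // Aq'.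
exact: Aq (interior_subset Aq').
Qed.

Lemma embeds_induced X N (psi : X -> 'rV[R]_N) : compact [set: X] -> continuous psi -> injective psi ->
  embeds setT (psi : induced_space psi -> euclidean R N).
Proof.
move=> cX cpsi ipsi; split=> //; first exact: openT.
- by move=> p q _ _; exact: ipsi.
- move=> p _ A; split=> [nA|[B nB sB]].
    have [B nB sB] := compact_inj_nbhs cX cpsi ipsi nA.
    by exists B => // q [_]; exact: sB.
  have n1 : nbhs p (psi @^-1` B) by exact: (cpsi p).
  by apply: filterS n1 => q Bq; apply: sB.
Qed.

Lemma embeds_of_induced X N (psi : X -> 'rV[R]_N) :
  compact [set: X] -> continuous psi -> injective psi ->
  (forall p (f : X -> R), @smooth_near R X p f <-> @smooth_near R (induced_space psi) p f) ->
  embeds setT (psi : X -> euclidean R N).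
Proof.
move=> cX cpsi ipsi sE; have [oT ij nb sm] := embeds_induced cX cpsi ipsi.
split; [by []|by []|by []|] => p Tp f; split; first by move=> /sE /(sm p Tp).
by move=> h; apply/sE/(sm p Tp).
Qed.

End EmbedsMore.

Lemma fmap_ultra (S T : Type) (f : S -> T) (F : set_system S) : UltraFilter F -> UltraFilter (f @ F).
Proof.
move=> FU; have FP := @ultra_proper _ _ FU; split; first exact: fmap_proper_filter.
move=> G GP sG; apply/seteqP; split=> [A GA|]; last exact: sG.
have [//|FA] := in_ultra_setVsetC (f @^-1` A) FU.
have : G (~` A) by exact: sG.
by move=> /filterI/(_ GA); rewrite setICl => /filter_not_empty.
Qed.

Lemma lim_ge0 (R : realType) (T : Type) (F : set_system T) (FF : ProperFilter F) (f : T -> R) (a : R) :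
  f y @[y --> F] --> a -> (\forall y \near F, 0 <= f y) -> 0 <= a.
Proof.
move=> fa f0; rewrite leNgt; apply/negP => a0.
have f1 : \forall y \near F, f y < 0 by exact: cvgr_lt fa _ a0.
by have [y [h1 h2]] := filter_ex (filterI f0 f1); rewrite ltNge h1 in h2.
Qed.

Lemma vanishing_eq (R : realType) (X : germ_space R) (Z : set X) (c : coords X) A :
  Z `&` dom c = vanishing c A `&` dom c ->
  forall q, dom c q -> Z q <-> forall i, i \in A -> crd c q 0 i = 0.
Proof.
move=> E q dq; have := congr1 (@^~ q) E; rewrite /setI /mkset /vanishing /mkset => /propeqP E2.
by split=> [Zq|h]; [have [] := E2.1 (conj Zq dq)|have [] := E2.2 (conj h dq)].
Qed.

Lemma left_inverse_coord (R : realType) n q (S : {set 'I_n}) (B : 'M[R]_(n, q)) (C : 'M[R]_(q, n))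
    (x : 'I_n -> R) k : (forall i k, i \in S -> k \in S -> (B *m C) i k = (i == k)%:R) -> k \in S ->
  \sum_j (\sum_(i in S) x i * B i j) * C j k = x k.
Proof.
move=> BC kS; under eq_bigr do rewrite mulr_suml.
rewrite exchange_big /= (bigD1 k kS) /= [X in _ + X]big1 => [|i /andP[iS ik]].
  under eq_bigr do rewrite -mulrA.
  rewrite -mulr_sumr; have := BC k k kS kS; rewrite mxE => ->.
  by rewrite eqxx mulr1 addr0.
under eq_bigr do rewrite -mulrA.
rewrite -mulr_sumr; have := BC i k iS kS; rewrite mxE => ->.
by rewrite (negbTE ik) mulr0.
Qed.

Definition boundary_monomial (R : realType) (X : germ_space R) (g : X -> R) :=
  exists (alpha : X -> R) (s : seq ((X -> R) * nat)),
    [/\ forall p, smooth_near p alpha, forall p, 0 < alpha p,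
        (forall e, e \in s -> boundary_defining e.1) &
        forall p, g p = alpha p * \prod_(e <- s) e.1 p ^+ e.2].

Section Blowup.
Context {R : realType} (X X' : germ_space R) (aX : ambient X) (Z : set X) (b : X' -> X).
Hypothesis hb : is_blowup Z b.

Definition polar_chart (x : X) (c : coords X) (A : {set 'I_(sdim X)})
    (Phi : X' -> euclidean R (1 + sdim X)) := [/\ p_submanifold_at Z x c A, embeds (b @^-1` dom c) Phi,
      Phi @` (b @^-1` dom c) = polar_domain A (bnd c) (crd c @` dom c) &
      forall q, dom c (b q) -> crd c (b q) = polar A (Phi q)].

Lemma polar_chart_ex x : Z x -> exists c A Phi, polar_chart x c A Phi.
Proof.
case: hb => _ _ _ _ h /h[c [A [pA [Phi [e1 e2 e3]]]]].
by exists c, A, Phi; split.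
Qed.

Lemma blowup_emb : embeds (b @^-1` (~` Z)) b.
Proof. by case: hb. Qed.

Lemma blowup_ambient : ambient X'.
Proof.
move=> q; have [Zq|Zq] := pselect (Z (b q)); last first.
  exact: ambient_pull aX blowup_emb Zq.
have [c [A [Phi [[[dp _ _ _] _] e _ _]]]] := polar_chart_ex Zq.
by exists _, Phi, (b @^-1` dom c).
Qed.

Section PolarChart.
Variables (x : X) (c : coords X) (A : {set 'I_(sdim X)}).
Variable Phi : X' -> euclidean R (1 + sdim X).
Hypothesis hc : polar_chart x c A Phi.
Let n := sdim X.

Definition prad (q : X') : R := Phi q 0 (lshift n 0).
Definition pang (q : X') (i : 'I_n) : R := Phi q 0 (rshift 1 i).
Let hch : chart c. Proof. by case: hc => -[/adapted_chart]. Qed.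
Let hemb : embeds (b @^-1` dom c) Phi. Proof. by case: hc. Qed.

Lemma Sm_prad q : dom c (b q) -> smooth_near q prad.
Proof. by move=> dq; exact: Sm_embed_coord hemb dq. Qed.

Lemma Sm_pang q i : dom c (b q) -> smooth_near q (pang^~ i).
Proof. by move=> dq; exact: Sm_embed_coord hemb dq. Qed.

Lemma polar_facts q : dom c (b q) -> [/\ 0 <= prad q, \sum_(i in A) pang q i ^+ 2 = 1,
      forall i, i \in A -> i \in bnd c -> 0 <= pang q i &
      forall i, crd c (b q) 0 i = if i \in A then prad q * pang q i else pang q i].
Proof.
move=> dq; have [_ _ E cE] := hc.
have : polar_domain A (bnd c) (crd c @` dom c) (Phi q) by rewrite -E; exists q.
have Er i : rsubmx (Phi q : 'rV[R]_(1 + n)) 0 i = pang q i by rewrite mxE.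
have El : lsubmx (Phi q : 'rV[R]_(1 + n)) 0 0 = prad q by rewrite mxE.
rewrite /polar_domain /= El => -[h1 h2 h3 h4]; split=> //.
- by rewrite -h2; apply: eq_bigr => i _; rewrite Er.
- by move=> i iA iB; rewrite -Er; apply: h3; rewrite inE iA iB.
- move=> i; rewrite cE// mxE El Er; case: ifP => _ //; by rewrite mul1r.
Qed.

Lemma prad_sum q : dom c (b q) -> prad q = \sum_(i in A) pang q i * crd c (b q) 0 i.
Proof.
move=> dq; have [_ h1 _ h2] := polar_facts dq.
rewrite -[LHS]mulr1 -h1 mulr_sumr; apply: eq_bigr => i iA.
by rewrite h2 iA expr2; ring.
Qed.

Lemma prad_eq0 q : dom c (b q) -> Z (b q) <-> prad q = 0.
Proof.
move=> dq; have [_ h1 _ h2] := polar_facts dq.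
have [[_ ZE] _ _ _] := hc.
rewrite (vanishing_eq ZE dq); split=> [h|s0 i iA]; last by rewrite h2 iA s0 mul0r.
by rewrite prad_sum// big1// => i iA; rewrite h// mulr0.
Qed.

Lemma prad_gt0 q : dom c (b q) -> ~ Z (b q) -> 0 < prad q.
Proof.
move=> dq Zq; have [h0 _ _ _] := polar_facts dq.
rewrite lt_neqAle h0 andbT; apply/negP => /eqP s0; apply: Zq.
exact/prad_eq0.
Qed.

Lemma pang_neq0 q : dom c (b q) -> exists2 i, i \in A & pang q i != 0.
Proof.
move=> dq; have [_ h1 _ _] := polar_facts dq; apply: contrapT => h.
have : \sum_(i in A) pang q i ^+ 2 = 0.
  rewrite big1// => i iA; apply/eqP; rewrite sqrf_eq0; apply/negPn/negP => i0.
  by apply: h; exists i.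
by rewrite h1 => /eqP; rewrite oner_eq0.
Qed.

(** Increasing the radius with the direction kept fixed stays in the polar domain. *)
Lemma polar_dense q (P : set X') : dom c (b q) -> nbhs q P ->
  exists q', [/\ P q', dom c (b q') & 0 < prad q'].
Proof.
move=> dq nP; have [B nB sB] := embeds_nbhsE hemb dq nP.
have [h0 h1 h2 h3] := polar_facts dq.
have [_ [Q oQ EQ]] := hch.
have [_ _ EP _] := hc.
pose w0 : 'rV[R]_(1 + n) := Phi q.
pose w t : 'rV[R]_(1 + n) := w0 + t *: delta_mx 0 (lshift n 0).
have cw := @cvg_at_right_filter _ _ _ _ _ (@cvg_line R _ w0 (delta_mx 0 (lshift n 0))).
have wl t : lsubmx (w t) 0 0 = prad q + t by rewrite !mxE !eqxx mulr1.
have wr t i : rsubmx (w t) 0 i = pang q i by rewrite !mxE eq_rlshift andbF mulr0 addr0.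
have n1 : \forall t \near (0 : R)^'+, B (w t) by exact: near_cvg cw nB.
have n2 : \forall t \near (0 : R)^'+, Q (polar A (w t)).
  pose u : 'rV[R]_n := \row_i (if i \in A then pang q i else 0).
  have E t : polar A (w t) = crd c (b q) + t *: u.
    apply/rowP => i; rewrite !mxE.
    move: (wl t) (wr t i); rewrite !mxE => -> ->; rewrite h3.
    by case: ifP => _; rewrite ?mulr0 ?addr0 ?mul1r// mulrDl.
  have cu := @cvg_at_right_filter _ _ _ _ _ (@cvg_line R _ (crd c (b q)) u).
  have Qq : nbhs (crd c (b q)) Q.
    apply: open_nbhs_nbhs; split=> //.
    by have [] : (Q `&` corner (bnd c)) (crd c (b q)) by rewrite -EQ; exists (b q).
  by apply: filterS (near_cvg cu Qq) => t; rewrite E.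
have [t [Bt [Qt t0]]] := filter_ex (rightI n1 (rightI n2 (@nbhs_right_gt R 0))).
have : polar_domain A (bnd c) (crd c @` dom c) (w t).
  split; rewrite ?wl.
  - by rewrite addr_ge0// ltW.
  - by rewrite -h1; apply: eq_bigr => i _; rewrite wr.
  - by move=> i; rewrite inE => /andP[iA iB]; rewrite wr h2.
  - rewrite EQ; split=> // i iB; rewrite mxE wl wr.
    case: ifPn => iA; first by rewrite mulr_ge0 ?h2// addr_ge0// ltW.
    have := chart_corner hch dq iB; by rewrite h3 (negbTE iA) mul1r.
rewrite -EP => -[q' dq' q'w]; exists q'; split=> //.
  by apply: sB; split=> //; rewrite /preimage /= q'w.
by have := wl t; rewrite /prad mxE -q'w => ->; rewrite ltr_wpDl.
Qed.

End PolarChart.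

(** Smoothness of [b] is not a clause of [is_blowup]; over [Z] it follows because the coordinates of
    [b q] are polynomials in the polar coordinates. *)
Lemma blowup_cont_pull q : {for q, continuous b} /\
  forall f, smooth_near (b q) f -> smooth_near q (f \o b).
Proof.
have [Zq|Zq] := pselect (Z (b q)); last first.
  split; first exact: embeds_cont blowup_emb Zq.
  move=> f sf; apply/(smooth_emb _ blowup_emb Zq); exists f; split=> //.
  exact: nearW.
have [c [A [Phi hc]]] := polar_chart_ex Zq.
have [[[dp e _ _] _] e' _ _] := hc.
have nd : \forall q' \near q, dom c (b q').
  by apply: open_nbhs_nbhs; split; [exact: embeds_open e'|].
apply: (smooth_pull blowup_ambient e dp nd) => j.
have a' := blowup_ambient.
apply: (Sm_eq a' (f := fun q => if j \in A then prad Phi q * pang Phi q j else pang Phi q j)).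
  by apply: filterS nd => q' dq'; have [_ _ _ ->] := polar_facts hc dq'.
case: (boolP (j \in A)) => _; last exact: (Sm_pang hc).
by apply: (SmM a'); [exact: (Sm_prad hc)|exact: (Sm_pang hc)].
Qed.

Lemma blowup_dense (q : X') (P : set X') : nbhs q P -> exists q', P q' /\ ~ Z (b q').
Proof.
move=> nP; have [Zq|Zq] := pselect (Z (b q)); last first.
  by exists q; split=> //; exact: nbhs_singleton nP.
have [c [A [Phi hc]]] := polar_chart_ex Zq.
have [[[dp _ _ _] _] _ _ _] := hc.
have [q' [Pq' dq' s0]] := polar_dense hc dp nP.
exists q'; split=> // /(prad_eq0 hc dq') s0'; by rewrite s0' ltxx in s0.
Qed.

(** An ultrafilter on [X'] is pushed to [X], where it converges. Over a point of [Z] its polar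
    coordinates are bounded, hence converge too, and the limit is in the polar domain because the
    sign and norm conditions are closed. *)
Lemma blowup_compact : compact [set: X] -> compact [set: X'].
Proof.
move=> cX; rewrite compact_ultra => F FU _.
have FbU : UltraFilter (b @ F) by exact: fmap_ultra.
have [x [_ bFx]] : [set: X] `&` [set p | b @ F --> p] !=set0.
  by move: cX; rewrite compact_ultra; apply; exact: filterT.
have FP : ProperFilter F by exact: ultra_proper.
have [Zx|Zx] := pselect (Z x); last first.
  have [q _ qx] : range b x by case: hb => _ _ _ h _; exact: h.
  exists q; split=> // A.
  have Zq : ~ Z (b q) by rewrite qx.
  move=> /(embeds_nbhsE blowup_emb Zq)[B nB sB].
  have oZ : open (~` Z) by apply: closed_openC; case: hb.
  have F1 : F (b @^-1` B) by apply: bFx; rewrite -qx.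
  have F2 : F (b @^-1` (~` Z)) by apply: bFx; exact: open_nbhs_nbhs.
  by apply: filterS2 F1 F2 => r Br Zr; apply: sB.
have [c [A [Phi hc]]] := polar_chart_ex Zx.
have [[[dx e _ x0] _] e' EP cE] := hc.
pose n := sdim X.
pose M : R := `|crd c x : 'rV[R]_n| + 1.
have M1 : 1 <= M by rewrite lerDr.
have M0 : 0 <= M by apply: le_trans M1.
have Fd : \forall q \near F, dom c (b q).
  by apply: bFx; exact: (embeds_dom e).
have Fc : crd c (b q) @[q --> F] --> crd c x.
  exact: (@cvg_comp _ _ _ b (crd c) F (nbhs x) _ bFx (embeds_cont e dx)).
have FM : \forall q \near F, forall i, `|crd c (b q) 0 i| <= M.
  have n1 : \forall u \near crd c x, forall i, `|(u : 'rV[R]_n) 0 i| <= M.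
    have : \forall u \near (crd c x : 'rV[R]_n), `|(crd c x : 'rV[R]_n) - u| < 1.
      have := @nbhsx_ballx R _ (crd c x : 'rV[R]_n) 1 ltr01.
    by rewrite mx_norm_ball.
    apply: filterS => u u1 i; apply: le_trans (rV_coord_le _ i) _.
    rewrite -[u](subrK (crd c x : 'rV[R]_n)) addrC; apply: le_trans (ler_normD _ _) _.
    by rewrite lerD2l distrC ltW.
  exact: near_cvg Fc n1.
(* [M *+ n] bounds the radius, which by [prad_sum] is a sum of coordinates with weights of absolute
   value at most 1; [M] bounds the other entries. *)
pose K : R := M *+ n + M.
have FK : F [set q | forall j, `[(-K), K]%classic ((Phi q : 'rV[R]_(1 + n)) 0 j)].
  apply: filterS2 Fd FM => q dq qM j.
  have [s0 h1 _ h2] := polar_facts hc dq.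
  have pA i : i \in A -> `|pang Phi q i| <= 1.
    move=> iA; rewrite -(@expr_le1 _ 2)// real_normK ?num_real//.
    by rewrite -h1 (bigD1 i)//= lerDl sumr_ge0// => ? _; exact: sqr_ge0.
  suff : `|(Phi q : 'rV[R]_(1 + n)) 0 j| <= K by rewrite ler_norml /= in_itv.
  case: (split_ordP j) => k -> /=.
    rewrite (ord1 k) -/(prad Phi q) (prad_sum hc dq).
    apply: le_trans (ler_norm_sum _ _ _) _; apply: (@le_trans _ _ (M *+ n)); last by rewrite lerDl.
    rewrite -[n in M *+ n]card_ord -sumr_const.
    apply: (@le_trans _ _ (\sum_(i in A) M)).
      by apply: ler_sum => i iA; rewrite normrM -[leRHS]mul1r ler_pM ?pA.
    rewrite [leRHS](bigID (mem A))/= lerDl; exact: sumr_ge0.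
  rewrite -/(pang Phi q k).
  apply: (@le_trans _ _ M); last by rewrite lerDr mulrn_wge0.
  have := h2 k; case: ifPn => [kA _|_ <-]; last exact: qM.
  by apply: le_trans M1; exact: pA.
have cK : compact [set w : 'rV[R]_(1 + n) | forall j, `[(-K), K]%classic (w 0 j)].
  by apply: (@rV_compact _ _ (fun=> `[(-K), K]%classic)) => _; exact: segment_compact.
have FPU : UltraFilter (Phi @ F) by exact: fmap_ultra.
have [w [_ Fw]] : [set w : 'rV[R]_(1 + n) | forall j, `[(-K), K]%classic (w 0 j)] `&` [set p | Phi @ F --> p] !=set0.
  by move: cK; rewrite compact_ultra; apply.
have Fwj j : (Phi q : 'rV[R]_(1 + n)) 0 j @[q --> F] --> w 0 j.
  exact: (@cvg_comp _ _ _ Phi (fun u : 'rV[R]_(1+n) => u 0 j) F (nbhs w) _ Fw (@coord_continuous _ _ _ 0 j w)).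
have aE := @ambient_euclidean R (1 + n).
have lim_sm f : smooth_near_rV w f -> f (Phi q) @[q --> F] --> f w.
  move=> /sm_cont cf.
  exact: (@cvg_comp _ _ _ Phi f F (nbhs w) _ Fw cf).
have wP : polar A w = crd c x.
  have lw i : (polar A (Phi q) : 'rV[R]_n) 0 i @[q --> F] --> (polar A w : 'rV[R]_n) 0 i.
    apply: (lim_sm (fun w => (polar A w : 'rV[R]_n) 0 i)).
    apply: (@sm_eq _ _ _ (fun w : 'rV[R]_(1 + n) => (if i \in A then w 0 (lshift n 0) else 1) * w 0 (rshift 1 i))).
      by apply: (@nearW _ (nbhs w)) => u; rewrite !mxE.
    by apply: smM; [case: (i \in A); [exact: sm_coord|exact: sm_cst]|exact: sm_coord].
  apply/rowP => i; apply: (near_eq_lim _ (lw i)).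
    exact: (@cvg_comp _ _ _ _ (fun u : 'rV[R]_n => u 0 i) F (nbhs (crd c x : 'rV[R]_n)) _ Fc (@coord_continuous _ _ _ 0 i _)).
  by apply: filterS Fd => q dq; rewrite cE.
have [q dq qw] : (Phi @` (b @^-1` dom c)) w.
  rewrite EP; split.
  - have -> : lsubmx w 0 0 = w 0 (lshift n 0) by rewrite mxE.
    apply: (lim_ge0 _ (Fwj _)).
    by apply: filterS Fd => q dq; have [] := polar_facts hc dq.
  - have S1 : \sum_(i in A) (Phi q : 'rV[R]_(1+n)) 0 (rshift 1 i) ^+ 2 @[q --> F] --> \sum_(i in A) w 0 (rshift 1 i) ^+ 2.
      apply: (lim_sm (fun w : 'rV[R]_(1+n) => \sum_(i in A) w 0 (rshift 1 i) ^+ 2)).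
      apply: (Sm_sum aE) => i _; apply: (SmX aE); exact: sm_coord.
    under eq_bigr do rewrite mxE.
    have S2 : (1 : R) @[q --> F] --> (1 : R) by exact: cvg_cst.
    apply: (near_eq_lim _ S1 S2).
    by apply: filterS Fd => q dq; have [_ h _ _] := polar_facts hc dq.
  - move=> i; rewrite inE => /andP[iA iB].
    have -> : rsubmx w 0 i = w 0 (rshift 1 i) by rewrite mxE.
    apply: (lim_ge0 _ (Fwj _)).
    by apply: filterS Fd => q dq; have [_ _ h _] := polar_facts hc dq; exact: h.
  - by exists x.
exists q; split=> // V.
move=> /(embeds_nbhsE e' dq)[B nB sB].
have F1 : F (Phi @^-1` B) by apply: Fw; rewrite -qw.
by apply: filterS2 F1 Fd => r Br dr; apply: sB.
Qed.

End Blowup.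

(** * Spaces presented by a dense interior, and their blow-ups *)

Section Presents.
Context {R : realType}.
Implicit Types X : germ_space R.

Definition nrm q (w : 'rV[R]_q) : R := Num.sqrt (\sum_j w 0 j ^+ 2).

Lemma nrm_ge0 q (w : 'rV[R]_q) : 0 <= nrm w.
Proof. exact: sqrtr_ge0. Qed.

Lemma nrm2 q (w : 'rV[R]_q) : nrm w ^+ 2 = \sum_j w 0 j ^+ 2.
Proof. by rewrite sqr_sqrtr// sumr_ge0// => j _; exact: sqr_ge0. Qed.

Lemma nrm_eq0 q (w : 'rV[R]_q) : nrm w = 0 -> w = 0.
Proof.
move=> h; have := nrm2 w; rewrite h expr0n /= => /esym/eqP.
rewrite psumr_eq0 => [/allP h0|j _]; last exact: sqr_ge0.
apply/rowP => j; rewrite mxE; apply/eqP; rewrite -sqrf_eq0.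
by have := h0 j; rewrite mem_index_enum => /(_ isT)/eqP ->.
Qed.

Lemma nrm_gt0 q (w : 'rV[R]_q) : w != 0 -> 0 < nrm w.
Proof.
by move=> w0; rewrite lt_neqAle nrm_ge0 andbT eq_sym; apply: contraNneq w0 => /nrm_eq0 ->.
Qed.

Lemma nrmZ q a (w : 'rV[R]_q) : nrm (a *: w) = `|a| * nrm w.
Proof.
rewrite /nrm; under eq_bigr do rewrite mxE exprMn.
by rewrite -mulr_sumr sqrtrM ?sqr_ge0// sqrtr_sqr.
Qed.

Lemma normalizeZ q a (w : 'rV[R]_q) : 0 < a -> (nrm (a *: w))^-1 *: (a *: w) = (nrm w)^-1 *: w.
Proof.
move=> a0; rewrite nrmZ gtr0_norm// scalerA invfM mulrAC mulVf ?mul1r//.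
by rewrite gt_eqF.
Qed.

Lemma nrm_normalize q (w : 'rV[R]_q) : w != 0 -> nrm ((nrm w)^-1 *: w) = 1.
Proof.
by move=> /nrm_gt0 w0; rewrite nrmZ ger0_norm ?mulVf ?invr_ge0 ?gt_eqF ?ltW.
Qed.

(** [T] plays the role of the interior. Topology and smooth functions of [X] are those of the
    closure of the image of [Psi] in Euclidean space, so everything about [X] can be read off on
    [T]. *)
Definition presents T X (iota : T -> X) N (Psi : T -> 'rV[R]_N) (psi : X -> 'rV[R]_N) :=
  [/\ embeds setT (psi : X -> euclidean R N), range psi = closure (range Psi) &
      forall v, psi (iota v) = Psi v].

Lemma presents_dense T X (iota : T -> X) N (Psi : T -> 'rV[R]_N) psi :
  presents iota Psi psi -> forall (p : X) (A : set X), nbhs p A -> exists v, A (iota v).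
Proof.
move=> [e E h] p A /(embeds_nbhsE e I)[B nB sB].
have : closure (range Psi) (psi p) by rewrite -E; exists p.
by move=> /(_ _ nB)[_ [[v _ <-]] Bv]; exists v; apply: sB; split=> //; rewrite /preimage /= h.
Qed.

Lemma presents_ambient T X (iota : T -> X) N (Psi : T -> 'rV[R]_N) psi :
  presents iota Psi psi -> ambient X.
Proof. by move=> [e _ _]; exact: embeds_ambient e. Qed.

(* Near p the map gamma is the normalized image, under a linear map injective
   on the normal coordinates, of the coordinates normal to Z. *)
Definition normal_data T X (iota : T -> X) (Z : set X) q (gamma : T -> 'rV[R]_q) (p : X)
    (c : coords X) (A : {set 'I_(sdim X)}) (B : 'M[R]_(sdim X, q)) (C : 'M[R]_(q, sdim X)) :=
  [/\ p_submanifold_at Z p c A, forall i k, i \in A -> k \in A -> (B *m C) i k = (i == k)%:R &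
      forall v, dom c (iota v) -> let w := (\row_i (if i \in A then crd c (iota v) 0 i else 0)) *m B in
        gamma v = (nrm w)^-1 *: w].

Lemma Sm_eq_dense T X (iota : T -> X) (p : X) (f g : X -> R) : ambient X ->
  (forall (p : X) (A : set X), nbhs p A -> exists v, A (iota v)) ->
  smooth_near p f -> smooth_near p g ->
  (\forall q \near p, forall v, iota v = q -> f q = g q) -> \forall q \near p, f q = g q.
Proof.
move=> aX dns sf sg fg; have sD := SmB aX sf sg.
apply: filterS (nearI (near_join fg) (Sm_near aX sD)) => q [h sq].
apply: contrapT => /eqP; rewrite -subr_eq0 => ne.
have n1 : \forall s \near q, f s - g s != 0.
  exact: (cvgr_neq0 _ (Sm_cont aX sq) ne).
have [v [/(_ v erefl) -> ]] := dns _ _ (nearI h n1).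
by rewrite subrr eqxx.
Qed.

Section Step.
Variables (X X' : germ_space R) (Z : set X) (b : X' -> X).
Hypothesis hb : is_blowup Z b.
Hypothesis cX : compact [set: X].
Variables (T : Type) (iota : T -> X) (N : nat) (Psi : T -> 'rV[R]_N) (psi : X -> 'rV[R]_N).
Hypothesis pr : presents iota Psi psi.
Hypothesis iotaZ : forall v, ~ Z (iota v).
Variables (q : nat) (gamma : T -> 'rV[R]_q).
Hypothesis hoff : forall p, ~ Z p -> forall j, exists a, xt iota p (fun v => gamma v 0 j) a.
Hypothesis hon : forall p, Z p -> exists c A B C, @normal_data T X iota Z q gamma p c A B C.

Let aX : ambient X := presents_ambient pr.
Let dX := presents_dense pr.
Let aX' : ambient X' := blowup_ambient aX hb.

Lemma lift_iota_ex : exists iota' : T -> X', forall v, b (iota' v) = iota v.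
Proof.
have h v : exists r, b r = iota v.
  have [r _ rv] : range b (iota v) by case: hb => _ _ _ h _; exact/h/iotaZ.
  by exists r.
by have [f hf] := choice h; exists f.
Qed.

Variable iota' : T -> X'.
Hypothesis biota : forall v, b (iota' v) = iota v.

Lemma lift_dense (r : X') (P : set X') : nbhs r P -> exists v, P (iota' v).
Proof.
move=> nP; have [r' [Pr' Zr']] := blowup_dense hb (nbhs_interior nP).
have [B nB sB] := embeds_nbhsE (blowup_emb hb) Zr' (Pr' : nbhs r' P).
have [v Bv] := dX nB.
exists v; apply: sB; split; rewrite /preimage /= biota//; exact: iotaZ.
Qed.

Lemma xt_lift r F a : xt iota (b r) F a -> xt iota' r F a.
Proof.
move=> [h [sh ha hF]]; have [cb pb] := blowup_cont_pull aX hb r.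
exists (h \o b); split; [exact: pb|exact: ha|].
apply: filterS (near_cvg cb hF) => r' h1 v vr'.
by rewrite /= (h1 v)// -biota vr'.
Qed.

Section Local.
Variables (x : X) (c : coords X) (A : {set 'I_(sdim X)}) (Phi : X' -> euclidean R (1 + sdim X)).
Hypothesis hc : polar_chart Z b x c A Phi.
Variables (c0 : coords X) (A0 : {set 'I_(sdim X)}) (B : 'M[R]_(sdim X, q)) (C : 'M[R]_(q, sdim X)).
Hypothesis hn : normal_data iota Z gamma x c0 A0 B C.
Hypothesis Zx : Z x.

Definition nfun (p : X) : 'rV[R]_q := (\row_i (if i \in A0 then crd c0 p 0 i else 0)) *m B.

Let dx : dom c x. Proof. by case: hc => -[[]]. Qed.
Let dx0 : dom c0 x. Proof. by case: hn => -[[]]. Qed.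
Let ch : chart c. Proof. by case: hc => -[/adapted_chart]. Qed.
Let ch0 : chart c0. Proof. by case: hn => -[/adapted_chart]. Qed.

Let ZE (p : X) : dom c p -> Z p <-> forall i, i \in A -> crd c p 0 i = 0.
Proof. by have [[_ E] _ _ _] := hc; exact: (vanishing_eq E). Qed.

Let ZE0 (p : X) : dom c0 p -> Z p <-> forall i, i \in A0 -> crd c0 p 0 i = 0.
Proof. by have [[_ E] _ _] := hn; exact: (vanishing_eq E). Qed.

Lemma nfunE p j : nfun p 0 j = \sum_(i in A0) crd c0 p 0 i * B i j.
Proof.
rewrite /nfun mxE [RHS]big_mkcond; apply: eq_bigr => i _.
by rewrite mxE; case: ifP => _ //; rewrite mul0r.
Qed.

Lemma nfunC p k : k \in A0 -> crd c0 p 0 k = \sum_j nfun p 0 j * C j k.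
Proof.
move=> kA; have [_ BC _] := hn; under eq_bigr do rewrite nfunE.
by rewrite (left_inverse_coord _ BC).
Qed.

Lemma Sm_nfun p j : dom c0 p -> smooth_near p (fun p => nfun p 0 j).
Proof.
move=> dp; apply: (Sm_eq aX (f := fun p => \sum_(i in A0) crd c0 p 0 i * B i j)).
  by apply: nearW => r; rewrite nfunE.
apply: (Sm_sum aX) => i _; apply: (SmM aX); last exact: (Sm_cst aX).
exact: (Sm_embed_coord _ ch0.1 dp).
Qed.

(** The chart [c] of the polar coordinates comes with the blow-up, whereas [c0] is the chart in
    which [gamma] is known. Both systems of coordinates cut out [Z], so by Hadamard's lemma each is
    a combination of the other with smooth coefficients; [C] undoes [B]. *)
Lemma normal_quotients : exists (G : 'I_(sdim X) -> 'I_q -> X -> R) (H : 'I_q -> 'I_(sdim X) -> X -> R),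
  [/\ forall i j, smooth_near x (G i j), forall j i, smooth_near x (H j i),
      \forall p \near x, forall j, nfun p 0 j = \sum_(i in A) crd c p 0 i * G i j p &
      \forall p \near x, forall i, i \in A -> crd c p 0 i = \sum_j nfun p 0 j * H j i p].
Proof.
have nd : \forall p \near x, dom c p /\ dom c0 p.
  apply: filterI; apply: open_nbhs_nbhs; split=> //; first exact: embeds_open ch.1.
  exact: embeds_open ch0.1.
have x0 := (ZE dx).1 Zx; have x00 := (ZE0 dx0).1 Zx.
have /choice[G hG] : forall j, exists g : 'I_(sdim X) -> X -> R, (forall i, smooth_near x (g i)) /\
    \forall p \near x, nfun p 0 j = \sum_(i in A) crd c p 0 i * g i p.
  move=> j; apply: chart_hadamard => //; first exact: Sm_nfun.
  apply: filterS nd => p [dp dp0] /(ZE dp)/(ZE0 dp0) h.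
  by rewrite nfunE big1// => i iA; rewrite h// mul0r.
have /choice[K hK] : forall i, exists g : 'I_(sdim X) -> X -> R, i \in A -> (forall k, smooth_near x (g k)) /\
    \forall p \near x, crd c p 0 i = \sum_(k in A0) crd c0 p 0 k * g k p.
  move=> i; have [iA|] := boolP (i \in A); last by exists (fun _ _ => 0).
  have [||g gE] := @chart_hadamard R X x c0 A0 (fun p => crd c p 0 i) ch0 dx0 x00.
  - exact: Sm_embed_coord ch.1 dx.
  - by apply: filterS nd => p [dp dp0] /(ZE0 dp0)/(ZE dp); apply.
  - by exists g.
exists (fun i j => G j i), (fun j i p => if i \in A then \sum_(k in A0) C j k * K i k p else 0).
split.
- by move=> i j; case: (hG j).
- move=> j i; have [iA|iA] := boolP (i \in A).
    apply: (Sm_eq aX (f := fun p => \sum_(k in A0) C j k * K i k p)); first by apply: nearW => p.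
    by apply: (Sm_sum aX) => k _; apply: (SmZ aX); case: (hK i iA).
  by apply: (Sm_eq aX (f := fun=> 0)); [apply: nearW => p|exact: (Sm_cst aX)].
- by apply: near_forall => j; case: (hG j).
- apply: near_forall => i.
  have [iA|iA] := boolP (i \in A); last by apply: nearW.
  have [_] := hK i iA; apply: filterS => p -> _.
  under [RHS]eq_bigr do rewrite mulr_sumr.
  rewrite exchange_big /=; apply: eq_bigr => k kA.
  by rewrite nfunC// mulr_suml; apply: eq_bigr => j _; rewrite mulrA.
Qed.

Lemma polar_eq_dense (r : X') f g : dom c (b r) -> smooth_near r f -> smooth_near r g ->
  (\forall r' \near r, 0 < prad Phi r' -> f r' = g r') -> \forall r' \near r, f r' = g r'.
Proof.
move=> dr sf sg fg.
have nd : \forall r' \near r, dom c (b r').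
  by apply: open_nbhs_nbhs; split=> //; case: hc => _ /embeds_open.
have sD := SmB aX' sf sg.
apply: filterS (nearI (nearI (near_join fg) nd) (Sm_near aX' sD)) => r' [[h1 dr'] sr'].
apply: contrapT => /eqP; rewrite -subr_eq0 => ne.
have n1 : \forall s \near r', f s - g s != 0.
  exact: (cvgr_neq0 _ (Sm_cont aX' sr') ne).
have [s [[h2 h3] ds s0]] := polar_dense hc dr' (nearI h1 n1).
by move: h3; rewrite h2// subrr eqxx.
Qed.

Variables (G : 'I_(sdim X) -> 'I_q -> X -> R) (H : 'I_q -> 'I_(sdim X) -> X -> R).
Hypothesis sG : forall i j, smooth_near x (G i j).
Hypothesis sH : forall j i, smooth_near x (H j i).
Hypothesis GE : \forall p \near x, forall j, nfun p 0 j = \sum_(i in A) crd c p 0 i * G i j p.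
Hypothesis HE : \forall p \near x, forall i, i \in A -> crd c p 0 i = \sum_j nfun p 0 j * H j i p.

(** The normal coordinates [nfun] divided by the radius, in a form that is smooth up to radius
    zero. *)
Definition mfun (r : X') : 'rV[R]_q := \row_j \sum_(i in A) pang Phi r i * G i j (b r).

Lemma Sm_mfun r j : b r = x -> smooth_near r (fun r => mfun r 0 j).
Proof.
move=> rx; apply: (Sm_eq aX' (f := fun r => \sum_(i in A) pang Phi r i * G i j (b r))).
  by apply: nearW => s; rewrite mxE.
apply: (Sm_sum aX') => i _; apply: (SmM aX').
  by apply: (Sm_pang hc); rewrite rx.
by have [_ h] := blowup_cont_pull aX hb r; apply: h; rewrite rx.
Qed.

Lemma mfun_facts r : b r = x -> (\forall r' \near r, nfun (b r') = prad Phi r' *: mfun r') /\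
  (\forall r' \near r, forall i, i \in A -> pang Phi r' i = \sum_j mfun r' 0 j * H j i (b r')).
Proof.
move=> rx; have [cb pb] := blowup_cont_pull aX hb r.
have dr : dom c (b r) by rewrite rx.
have nd : \forall r' \near r, dom c (b r').
  by apply: open_nbhs_nbhs; split=> //; case: hc => _ /embeds_open.
have GE' := GE; have HE' := HE; rewrite -rx in GE' HE'.
have n1 : \forall r' \near r, nfun (b r') = prad Phi r' *: mfun r'.
  apply: filterS (nearI nd (near_cvg cb GE')) => r' [dr' h].
  have [_ _ _ cE] := polar_facts hc dr'.
  apply/rowP => j; rewrite h !mxE mulr_sumr; apply: eq_bigr => i iA.
  by rewrite cE iA mulrA.
split=> //.
apply: near_forall => i.
have [iA|_] := boolP (i \in A); last by apply: nearW.
have n2 : \forall r' \near r, pang Phi r' i = \sum_j mfun r' 0 j * H j i (b r').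
  apply: polar_eq_dense => //.
  - exact: (Sm_pang hc).
  - apply: (Sm_sum aX') => j _; apply: (SmM aX'); first exact: Sm_mfun.
    by apply: (pb (H j i)); rewrite rx.
  - apply: filterS (nearI (nearI nd n1) (near_cvg cb HE')) => r' [[dr' h] h'] s0.
    have [_ _ _ cE] := polar_facts hc dr'.
    have := h' i iA; rewrite cE iA => E.
    apply: (mulfI (lt0r_neq0 s0)); rewrite E mulr_sumr; apply: eq_bigr => j _.
    by rewrite h mxE mulrA.
by apply: filterS n2.
Qed.

Lemma mfun_neq0 r : b r = x -> mfun r != 0.
Proof.
move=> rx; have [_ /nbhs_singleton h] := mfun_facts rx.
have dr : dom c (b r) by rewrite rx.
have [i iA] := pang_neq0 hc dr.
apply: contra_neq => m0; rewrite h// big1// => j _; by rewrite m0 mxE mul0r.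
Qed.

Lemma Sm_nmfun r j : b r = x -> smooth_near r (fun r => (nrm (mfun r))^-1 * mfun r 0 j).
Proof.
move=> rx; have m0 := mfun_neq0 rx.
apply: (SmM aX'); last exact: Sm_mfun.
apply: (SmV aX'); last by rewrite gt_eqF// nrm_gt0.
apply: (Sm_sqrt aX'); last by rewrite -nrm2 exprn_gt0// nrm_gt0.
by apply: (Sm_sum aX') => k _; apply: (SmX aX'); exact: Sm_mfun.
Qed.

(** At interior points the radius is a positive factor of [nfun] and cancels in the
    normalization. *)
Lemma gamma_lift r : b r = x -> forall j,
  \forall r' \near r, forall v, iota' v = r' -> (nrm (mfun r'))^-1 * mfun r' 0 j = gamma v 0 j.
Proof.
move=> rx j; have [h1 h2] := mfun_facts rx; have m0 := mfun_neq0 rx.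
have [cb _] := blowup_cont_pull aX hb r.
have nd : \forall r' \near r, dom c (b r') /\ dom c0 (b r').
  have dr : dom c (b r) by rewrite rx.
  have dr0 : dom c0 (b r) by rewrite rx.
  apply: nearI; first by apply: open_nbhs_nbhs; split=> //; case: hc => _ /embeds_open.
  apply: (near_cvg cb); exact: (embeds_dom ch0.1).
apply: filterS (nearI h1 nd) => r' [E [dr' dr0']] v vr'.
have bv : b r' = iota v by rewrite -vr' biota.
have Zr : ~ Z (b r') by rewrite bv; exact: iotaZ.
have s0 := prad_gt0 hc dr' Zr.
have [_ _ /(_ v)] := hn; rewrite -bv => /(_ dr0') /= ->.
by rewrite -/(nfun (b r')) E normalizeZ// [RHS]mxE.
Qed.

Lemma gamma_lift_xt r : b r = x -> forall j,
  xt iota' r (fun v => gamma v 0 j) ((nrm (mfun r))^-1 * mfun r 0 j).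
Proof.
move=> rx j; exists (fun r => (nrm (mfun r))^-1 * mfun r 0 j); split=> //.
  exact: Sm_nmfun.
exact: gamma_lift.
Qed.

(** The direction of [mfun] determines the angular coordinates up to a common positive factor, which
    is fixed by their unit norm; the radius then follows from [prad_sum]. *)
Lemma mfun_inj r r' : b r = x -> b r' = x ->
  (nrm (mfun r))^-1 *: mfun r = (nrm (mfun r'))^-1 *: mfun r' -> r = r'.
Proof.
move=> rx rx' E; have dr : dom c (b r) by rewrite rx.
have dr' : dom c (b r') by rewrite rx'.
have [_ e _ _] := hc; apply: (embeds_inj e) => //.
have [_ /nbhs_singleton h] := mfun_facts rx; have [_ /nbhs_singleton h'] := mfun_facts rx'.
have m0 := nrm_gt0 (mfun_neq0 rx); have m0' := nrm_gt0 (mfun_neq0 rx').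
have [_ u1 _ cE] := polar_facts hc dr; have [_ u1' _ cE'] := polar_facts hc dr'.
pose k i := \sum_j ((nrm (mfun r))^-1 *: mfun r) 0 j * H j i x.
have uk i : i \in A -> pang Phi r i = nrm (mfun r) * k i.
  move=> iA; rewrite h// mulr_sumr; apply: eq_bigr => j _.
  by rewrite rx [X in _ = _ * (X * _)]mxE !mulrA mulfV ?mul1r// gt_eqF.
have uk' i : i \in A -> pang Phi r' i = nrm (mfun r') * k i.
  move=> iA; rewrite h'// mulr_sumr; apply: eq_bigr => j _.
  by rewrite E rx' [X in _ = _ * (X * _)]mxE !mulrA mulfV ?mul1r// gt_eqF.
have EE : nrm (mfun r) = nrm (mfun r').
  have h1 : nrm (mfun r) ^+ 2 * \sum_(i in A) k i ^+ 2 = 1.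
    by rewrite -u1 mulr_sumr; apply: eq_bigr => i iA; rewrite uk// exprMn.
  have h2 : nrm (mfun r') ^+ 2 * \sum_(i in A) k i ^+ 2 = 1.
    by rewrite -u1' mulr_sumr; apply: eq_bigr => i iA; rewrite uk'// exprMn.
  have S0 : \sum_(i in A) k i ^+ 2 != 0.
    by apply/eqP => S0; move: h1; rewrite S0 mulr0 => /esym/eqP; rewrite oner_eq0.
  have := etrans h1 (esym h2) => /(mulIf S0) /eqP.
  by rewrite eqrXn2 ?ltW// => /eqP.
have pE i : pang Phi r i = pang Phi r' i.
  have [iA|iA] := boolP (i \in A); first by rewrite uk// uk'// EE.
  by have := cE i; have := cE' i; rewrite (negbTE iA) rx rx' => <- <-.
have sE : prad Phi r = prad Phi r'.
  by rewrite (prad_sum hc dr) (prad_sum hc dr') rx rx'; apply: eq_bigr => i _; rewrite pE.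
apply/rowP => j; case: (split_ordP j) => i -> /=.
  by rewrite (ord1 i); exact: sE.
exact: pE.
Qed.

End Local.

Lemma gamma_ext : exists gb : 'I_q -> X' -> R, forall j, [/\ forall r, smooth_near r (gb j),
    forall v, gb j (iota' v) = gamma v 0 j &
    forall r a, xt iota' r (fun v => gamma v 0 j) a <-> gb j r = a].
Proof.
suff h j : exists g : X' -> R, [/\ forall r, smooth_near r g, forall v, g (iota' v) = gamma v 0 j &
    forall r a, xt iota' r (fun v => gamma v 0 j) a <-> g r = a].
  by have [g hg] := choice h; exists g.
apply: (xt_extend aX' lift_dense) => r.
have [Zr|Zr] := pselect (Z (b r)); last first.
  by have [a ha] := hoff Zr j; exists a; exact: xt_lift.
have [c [A [Phi hc]]] := polar_chart_ex hb Zr.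
have [c0 [A0 [B [C hn]]]] := hon Zr.
have [G [H [sG sH GE HE]]] := normal_quotients hc hn Zr.
by eexists; exact: (gamma_lift_xt hc hn sG sH GE HE erefl).
Qed.

End Step.

(** The new map [psi'] pairs the extension of [gamma] with [psi \o b]. It is injective because over
    [Z] the value of [gamma] determines the direction. The work is in showing that it induces the
    given smooth structure: near [Z] the polar coordinates have to be recovered smoothly from
    [psi']. *)
Theorem presents_blowup (X X' : germ_space R) (Z : set X) (b : X' -> X)
    (T : Type) (iota : T -> X) N (Psi : T -> 'rV[R]_N) (psi : X -> 'rV[R]_N) q (gamma : T -> 'rV[R]_q) :
  is_blowup Z b -> compact [set: X] -> presents iota Psi psi -> (forall v, ~ Z (iota v)) ->
  (forall p, ~ Z p -> forall j, exists a, xt iota p (fun v => gamma v 0 j) a) ->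
  (forall p, Z p -> exists c A B C, normal_data iota Z gamma p c A B C) ->
  exists (iota' : T -> X') (psi' : X' -> 'rV[R]_(q + N)),
    [/\ presents iota' (fun v => row_mx (gamma v) (Psi v)) psi', forall v, b (iota' v) = iota v &
        compact [set: X']].
Proof.
move=> hb cX pr iZ hoff hon.
have [iota' bi] := lift_iota_ex hb iZ.
have aX := presents_ambient pr; have dX := presents_dense pr.
have aX' := blowup_ambient aX hb.
have cX' := blowup_compact hb cX.
have dns' := lift_dense hb pr iZ bi.
have [gb hgb] := gamma_ext hb pr iZ hoff hon bi.
pose psi' r : 'rV[R]_(q + N) := row_mx (\row_j gb j r) (psi (b r)).
have bp r := blowup_cont_pull aX hb r.
have [e Er pi] := pr.
have psi'l r j : psi' r 0 (lshift N j) = gb j r by rewrite row_mxEl mxE.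
have psi'r r j : psi' r 0 (rshift q j) = psi (b r) 0 j by rewrite row_mxEr.
have Sp r j : smooth_near r (fun s => psi' s 0 j).
  case: (split_ordP j) => k -> /=.
    have [sk _ _] := hgb k; apply: (Sm_eq aX' _ (sk r)).
    by apply: nearW => s; rewrite psi'l.
  have /(bp r).2 : smooth_near (b r) (fun p => psi p 0 k) by exact: Sm_embed_coord e I.
  by apply: (Sm_eq aX'); apply: nearW => s; rewrite psi'r.
have cpsi' : continuous psi'.
  move=> r; suff h : (fun s => \row_k psi' s 0 k) s @[s --> r] --> \row_k psi' r 0 k.
    have E s : \row_k psi' s 0 k = psi' s by apply/rowP => k; rewrite mxE.
    by move: h; rewrite E; under eq_fun do rewrite E.
  apply: (@rV_cvg _ _ (nbhs r)) => k.
  by have := Sm_cont aX' (Sp r k); rewrite mxE.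
have ipsi' : injective psi'.
  move=> r r' E.
  have bE : b r = b r'.
    have [_ ie _ _] := e; apply: ie; rewrite ?in_setT//.
    by apply/rowP => j; rewrite -!psi'r E.
  have gE j : gb j r = gb j r' by rewrite -!psi'l E.
  have [Zr|Zr] := pselect (Z (b r)); last first.
    by apply: (embeds_inj (blowup_emb hb)) => //; rewrite /preimage /= -bE.
  have [c [A [Phi hc]]] := polar_chart_ex hb Zr.
  have [c0 [A0 [B [C hn]]]] := hon _ Zr.
  have [G [H [sG sH GE HE]]] := normal_quotients pr hc hn Zr.
  apply: (mfun_inj hb pr hc sG sH GE HE erefl (esym bE)).
  apply/rowP => j; rewrite [LHS]mxE [RHS]mxE.
  have [_ _ h1] := hgb j.
  have /h1 <- := gamma_lift_xt hb pr iZ bi hc hn sG sH GE HE erefl j.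
  by have /h1 <- := gamma_lift_xt hb pr iZ bi hc hn sG sH GE HE (esym bE) j.
have ei := embeds_induced cX' cpsi' ipsi'.
pose X2 := @induced_space R X' _ psi'.
have aX2 : ambient X2 := embeds_ambient ei.
have S2g r j : @smooth_near R X2 r (gb j).
  have := @Sm_embed_coord R X2 _ psi' setT r (lshift N j) ei I.
  by apply: (Sm_eq aX2); apply: nearW => s; rewrite psi'l.
have S2b r (f : X -> R) : smooth_near (b r) f -> @smooth_near R X2 r (f \o b).
  move=> sf; have [h sh hf] := Sm_lift sf I e.
  have sp j : @smooth_near R X2 r (fun s => psi (b s) 0 j).
    have := @Sm_embed_coord R X2 _ psi' setT r (rshift q j) ei I.
    by apply: (Sm_eq aX2); apply: nearW => s; rewrite psi'r.
  have rE (s : X2) : \row_j psi (b s) 0 j = psi (b s) by apply/rowP => j; rewrite mxE.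
  have := @Sm_comp R X2 aX2 N r (fun j s => psi (b s) 0 j) h sp; rewrite rE => /(_ sh).
  apply: (Sm_eq aX2); have [cb _] := bp r.
  by apply: filterS (near_cvg cb hf) => s E; rewrite rE /= E.
have emb : embeds setT (psi' : X' -> euclidean R (q + N)).
  apply: embeds_of_induced => // r f; split=> [sf|[h [sh hf]]]; last first.
    have rE s : \row_j psi' s 0 j = psi' s by apply/rowP => j; rewrite mxE.
    have := @Sm_comp R X' aX' _ r (fun j s => psi' s 0 j) h (Sp r); rewrite rE => /(_ sh).
    by apply: (Sm_eq aX'); apply: filterS hf => s ->; rewrite rE.
  (* What remains is that a function smooth on [X'] is smooth for the structure [X2] induced by
     [psi']. *)
  change (@smooth_near R X2 r f).
  have [Zr|Zr] := pselect (Z (b r)); last first.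
    have [h [sh hf]] : exists h, smooth_near (b r) h /\ \forall s \near r, f s = h (b s).
      by have [_ _ _ /(_ r Zr f)[/(_ sf)]] := blowup_emb hb.
    apply: (Sm_eq aX2 _ (S2b r h sh)); by apply: filterS hf => s ->.
  have [c [A [Phi hc]]] := polar_chart_ex hb Zr.
  have [c0 [A0 [B [C hn]]]] := hon _ Zr.
  have [G [H [sG sH GE HE]]] := normal_quotients pr hc hn Zr.
  have dr : dom c (b r) by case: hc => -[[]].
  have [[[/= _ ec _ _] _] ePhi _ _] := hc.
  pose m := mfun b A Phi G.
  (* Up to the positive factor [1 / nrm (m s)] this is the angular coordinate [i], but written
     through [gb] and [b] only; dividing by its norm removes the factor. *)
  pose ka i s := \sum_j gb j s * H j i (b s).
  have Ska i : @smooth_near R X2 r (ka i).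
    by apply: (Sm_sum aX2) => j _; apply: (SmM aX2) => //; exact: (S2b r (H j i)).
  have [mf1 mf2] := mfun_facts hb pr hc sG sH GE HE erefl.
  have gE : \forall s \near r, forall j, gb j s = (nrm (m s))^-1 * m s 0 j.
    apply: near_forall => j.
    have [sj gj _] := hgb j.
    apply: (Sm_eq_dense aX' dns' (sj r)).
      exact: (Sm_nmfun hb pr hc sG sH GE HE j erefl).
    have gl := gamma_lift hb pr iZ bi hc hn sG sH GE HE erefl j.
    by apply: filterS gl => s h v vs; rewrite (h v vs) -vs gj.
  have nd : \forall s \near r, dom c (b s) by exact: (embeds_dom ePhi).
  have kaE : \forall s \near r, 0 < \sum_(i in A) ka i s ^+ 2 /\ forall i, i \in A ->
      pang Phi s i = (Num.sqrt (\sum_(i in A) ka i s ^+ 2))^-1 * ka i s.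
    apply: filterS (nearI nd (nearI gE mf2)) => s [ds [gs ps]].
    have kE i : i \in A -> ka i s = (nrm (m s))^-1 * pang Phi s i.
      by move=> iA; rewrite ps// mulr_sumr; apply: eq_bigr => j _; rewrite gs mulrA.
    have m0 : 0 < nrm (m s).
      apply: nrm_gt0; have [i iA] := pang_neq0 hc ds; apply: contra_neq => ms.
      by rewrite ps// big1// => j _; rewrite -/(m s) ms mxE mul0r.
    have [_ p1 _ _] := polar_facts hc ds.
    have SE : \sum_(i in A) ka i s ^+ 2 = (nrm (m s))^-1 ^+ 2.
      rewrite -[RHS]mulr1 -p1 mulr_sumr; apply: eq_bigr => i iA.
      by rewrite kE// exprMn.
    have i0 : 0 < (nrm (m s))^-1 by rewrite invr_gt0.
    rewrite SE; split; first by rewrite exprn_gt0.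
    move=> i iA; rewrite kE// sqrtr_sqr gtr0_norm// mulrA mulVf ?mul1r//.
    by rewrite gt_eqF.
  have Spang i : @smooth_near R X2 r (pang Phi ^~ i).
    have [iA|iA] := boolP (i \in A).
      apply: (Sm_eq aX2 (f := fun s => (Num.sqrt (\sum_(i in A) ka i s ^+ 2))^-1 * ka i s)).
        by apply: filterS kaE => s [_ ->].
      have [k0 _] := nbhs_singleton kaE.
      apply: (SmM aX2) => //; apply: (SmV aX2); last by rewrite gt_eqF// sqrtr_gt0.
      apply: (Sm_sqrt aX2) => //.
      by apply: (Sm_sum aX2) => k _; apply: (SmX aX2).
    apply: (Sm_eq aX2 (f := (fun p => crd c p 0 i) \o b)).
      apply: filterS nd => s ds; have [_ _ _ /= ->] := polar_facts hc ds.
      by rewrite (negbTE iA).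
    by apply: S2b; exact: Sm_embed_coord ec dr.
  have Sprad : @smooth_near R X2 r (prad Phi).
    apply: (Sm_eq aX2 (f := fun s => \sum_(i in A) pang Phi s i * crd c (b s) 0 i)).
      by apply: filterS nd => s ds; rewrite -(prad_sum hc ds).
    apply: (Sm_sum aX2) => i _; apply: (SmM aX2) => //.
    apply: (S2b r (fun p => crd c p 0 i)); exact: Sm_embed_coord ec dr.
  have [h sh hf] := Sm_lift sf dr ePhi.
  have sp j : @smooth_near R X2 r (fun s => Phi s 0 j).
    case: (split_ordP j) => k -> /=; last exact: Spang.
    by rewrite (ord1 k); exact: Sprad.
  have rE (s : X2) : \row_j Phi s 0 j = Phi s by apply/rowP => j; rewrite mxE.
  have := @Sm_comp R X2 aX2 _ r (fun j s => Phi s 0 j) h sp; rewrite rE => /(_ sh).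
  by apply: (Sm_eq aX2); apply: filterS hf => s E; rewrite rE E.
exists iota', psi'; split=> //; split=> //; last first.
  move=> v; rewrite /psi' bi pi; congr row_mx; apply/rowP => j; rewrite mxE.
  by have [_ -> _] := hgb j.
have pv v : psi' (iota' v) = row_mx (gamma v) (Psi v).
  rewrite /psi' bi pi; congr row_mx; apply/rowP => j; rewrite mxE.
  by have [_ -> _] := hgb j.
apply/seteqP; split=> [_ [r _ <-]|w].
  move=> B nB; have [v Bv] := dns' r _ (cpsi' r _ nB).
  by exists (row_mx (gamma v) (Psi v)); split; [exists v|rewrite -pv].
have cl : closed (range psi').
  apply: compact_closed; first exact: norm_hausdorff.
  by apply: continuous_compact => //; exact: continuous_subspaceT.
move=> h; apply: cl; apply: closure_subset h => _ [v _ <-].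
by exists (iota' v).
Qed.

End Presents.

(** * A criterion for embeddings *)

Section EmbedsCriterion.
Context {R : realType}.
Implicit Types X Y : germ_space R.

Lemma near_all (U : topologicalType) (p : U) (P : U -> Prop) : (forall x, P x) -> \forall x \near p, P x.
Proof. by move=> h; apply: (@nearW _ (nbhs p)). Qed.

Lemma rV_row n (u : 'rV[R]_n) : \row_j u 0 j = u.
Proof. by apply/rowP => j; rewrite mxE. Qed.

Lemma row_mx_coord n m (u : 'rV[R]_n) (w : 'rV[R]_m) (F : 'I_(n + m) -> R) :
  (forall j, F (lshift m j) = u 0 j) -> (forall j, F (rshift n j) = w 0 j) -> \row_j F j = row_mx u w.
Proof.
move=> hl hr; apply/rowP => j; rewrite mxE; case: (split_ordP j) => k -> /=.
  by rewrite row_mxEl.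
by rewrite row_mxEr.
Qed.

Lemma Sm_row_cvg X (aX : ambient X) n (g : 'I_n -> X -> R) p : (forall j, smooth_near p (g j)) ->
  (\row_j g j q : 'rV[R]_n) @[q --> p] --> (\row_j g j p : 'rV[R]_n).
Proof.
move=> sg; apply: (@rV_cvg _ _ (nbhs p)) => j; rewrite mxE; exact: Sm_cont aX _ _ (sg j).
Qed.

(** Once the coordinates [psi] of the source are smooth functions of the image point, a smooth
    inverse exists locally; injectivity and the conditions on neighbourhoods and germs follow. *)
Lemma embeds_intro X Y (aY : ambient Y) (U : set X) (F : X -> Y) N (psi : X -> 'rV[R]_N) :
  embeds setT (psi : X -> euclidean R N) -> open U -> (forall p, U p -> {for p, continuous F} /\
     forall f, smooth_near (F p) f -> smooth_near p (f \o F)) ->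
  (forall p, U p -> forall j, exists2 h : Y -> R, smooth_near (F p) h &
     \forall y \near F p, forall q, U q -> F q = y -> psi q 0 j = h y) -> embeds U F.
Proof.
move=> e oU cp hh.
have aX : ambient X := embeds_ambient e.
have hP p : U p -> exists h : 'I_N -> Y -> R, (forall j, smooth_near (F p) (h j)) /\
    \forall y \near F p, forall q, U q -> F q = y -> psi q = \row_j h j y.
  move=> Up; have h1 j : exists h, smooth_near (F p) h /\
     \forall y \near F p, forall q, U q -> F q = y -> psi q 0 j = h y.
    by have [h] := hh p Up j; exists h.
  have [h hP] := choice h1; exists h; split=> [j|]; first by case: (hP j).
  have : \forall y \near F p, forall j, forall q, U q -> F q = y -> psi q 0 j = h j y.
    apply: (@filter_forall _ _ (fun j y => forall q, U q -> F q = y -> psi q 0 j = h j y) (nbhs (F p))) => j.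
    by case: (hP j).
  by apply: filterS => y E q Uq Fq; apply/rowP => j; rewrite mxE; exact: E.
split=> //.
- move=> p p' /set_mem Up /set_mem Up' FE; have [h [_ /nbhs_singleton E]] := hP p Up.
  by apply: (embeds_inj e) => //; rewrite (E p)// (E p').
- move=> p Up A; split=> [nA|[B nB sB]]; last first.
    have [cF _] := cp p Up.
    apply: filterS (nearI (open_nbhs_nbhs (conj oU Up)) (cF _ nB)) => q [Uq Bq].
    exact: sB.
  have [h [sh E]] := hP p Up; have [B nB sB] := embeds_nbhsE e I nA.
  have rp : \row_j h j (F p) = psi p by have := nbhs_singleton E p Up erefl.
  have c : nbhs (F p) [set y | B (\row_j h j y)].
    by apply: (Sm_row_cvg aY sh); rewrite rp.
  exists ([set y | B (\row_j h j y)] `&` [set y | forall q, U q -> F q = y -> psi q = \row_j h j y]).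
    exact: nearI c E.
  by move=> q [Uq [/= Bq Eq]]; apply: sB; split=> //; rewrite /preimage /= (Eq q).
- move=> p Up f; split=> [sf|[g [sg fg]]]; last first.
    have [_ pF] := cp p Up; apply: (Sm_eq aX _ (pF g sg)).
    by apply: filterS fg => q ->.
  have [h [sh E]] := hP p Up; have [g sg fg] := Sm_lift sf I e.
  have rp : \row_j h j (F p) = psi p by have := nbhs_singleton E p Up erefl.
  exists (fun y => g (\row_j h j y)); split.
    by apply: (Sm_comp aY) => //; rewrite rp.
  have [cF _] := cp p Up.
  apply: filterS (nearI (nearI (open_nbhs_nbhs (conj oU Up)) (near_cvg cF E)) fg) => q [[Uq Eq] fq].
  by rewrite fq (Eq q).
Qed.

Lemma embeds_submanifold N (S : set (euclidean R N)) n :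
  embeds setT (set_val : submanifold_space S n -> euclidean R N).
Proof.
split; first exact: openT.
- by move=> p p' _ _; exact: val_inj.
- move=> p _ A; split=> [nA|[B nB sB]].
    move: nA; rewrite nbhsE; case=> W [[B oB BO] Op] OA.
    exists B; first by apply: open_nbhs_nbhs; split=> //; move: Op; rewrite -BO.
    by move=> q [_ Bq]; apply: OA; rewrite -BO.
  have nB' : nbhs p (set_val @^-1` B).
    exact: (@initial_continuous _ _ (set_val : set_type S -> euclidean R N) p B nB).
  by apply: filterS nB' => q Bq; exact: sB.
- by move=> p _ f; split.
Qed.

Lemma Sm_ge_dense X T (iota : T -> X) (p : X) (f : X -> R) : ambient X ->
  (forall (p : X) (A : set X), nbhs p A -> exists v, A (iota v)) -> smooth_near p f ->
  (\forall q \near p, forall v, iota v = q -> 0 <= f q) -> 0 <= f p.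
Proof.
move=> aX dns sf h; rewrite leNgt; apply/negP => f0.
have n1 : \forall q \near p, f q < 0 by apply: (cvgr_lt _ (Sm_cont aX sf)).
have [v [h1 h2]] := dns _ _ (nearI h n1).
by have := h1 v erefl; rewrite leNgt h2.
Qed.

End EmbedsCriterion.

(** * Existence of the blow-up *)

Section Model.
Context {R : realType} (X : germ_space R) (Z : set X).
Variables (T : Type) (iota : T -> X) (N : nat) (Psi : T -> 'rV[R]_N) (psi : X -> 'rV[R]_N).
Hypothesis pr : presents iota Psi psi.
Hypothesis iotaZ : forall v, ~ Z (iota v).
Hypothesis cZ : closed Z.
Variables (q : nat) (gamma : T -> 'rV[R]_q).
Hypothesis hoff : forall p, ~ Z p -> forall j, exists a, xt iota p (fun v => gamma v 0 j) a.
Hypothesis hon : forall p, Z p -> exists c A B C, @normal_data R T X iota Z q gamma p c A B C.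

Let aX : ambient X := presents_ambient pr.
Let dX := presents_dense pr.
Let epsi : embeds setT (psi : X -> euclidean R N). Proof. by case: pr. Qed.

(** By [presents_blowup] a blow-up has to be this closure; here the closure is taken as the
    definition of the space. *)
Definition model_range : set (euclidean R (q + N)) :=
  closure (range (fun v => row_mx (gamma v) (Psi v))).

Definition model : germ_space R := submanifold_space model_range (sdim X).

Definition to_model u (h : model_range u) : model := exist (fun x => x \in model_range) u (mem_set h).

Let eval := @embeds_submanifold R (q + N) model_range (sdim X).
Let aM : ambient model := embeds_ambient eval.

Let mdir (w : model) : 'rV[R]_q := lsubmx (set_val w : 'rV[R]_(q + N)).
Let mpos (w : model) : 'rV[R]_N := rsubmx (set_val w : 'rV[R]_(q + N)).

Let mE (w : model) : set_val w = row_mx (mdir w) (mpos w).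
Proof. by rewrite hsubmxK. Qed.

Let Sm_mdir (w : model) j : smooth_near w (fun w => mdir w 0 j).
Proof.
have := @Sm_embed_coord R model _ _ setT w (lshift N j) eval I.
by apply: (Sm_eq aM); apply: near_all => s; rewrite mE row_mxEl.
Qed.

Let Sm_mpos (w : model) j : smooth_near w (fun w => mpos w 0 j).
Proof.
have := @Sm_embed_coord R model _ _ setT w (rshift q j) eval I.
by apply: (Sm_eq aM); apply: near_all => s; rewrite mE row_mxEr.
Qed.

Lemma model_base (w : model) : exists p, psi p = mpos w.
Proof.
have [_ E _] := pr; suff : closure (range Psi) (mpos w) by rewrite -E => -[p _ pw]; exists p.
move=> B nB; have cw : (fun w => \row_j mpos w 0 j) s @[s --> w] --> \row_j mpos w 0 j.
  exact: (Sm_row_cvg aM (Sm_mpos w)).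
have nw : \forall s \near w, B (mpos s).
  by move: cw; rewrite rV_row; under eq_fun do rewrite rV_row; exact.
have [B' nB' sB'] := embeds_nbhsE eval I nw.
have := set_valP w => /(_ _ nB')[_ [[v _ <-]] Bv].
have Sv : model_range (row_mx (gamma v) (Psi v)) by apply: subset_closure; exists v.
have := sB' (to_model Sv) (conj I Bv).
by rewrite /mpos /= row_mxKr => Bp; exists (Psi v); split=> //; exists v.
Qed.

Definition model_map (w : model) : X := projT1 (cid (model_base w)).

Let mmE w : psi (model_map w) = mpos w.
Proof. exact: (projT2 (cid (model_base w))). Qed.

Definition model_iota (v : T) : model :=
  to_model (subset_closure (imageT (fun v => row_mx (gamma v) (Psi v)) v)).

Let miE v : set_val (model_iota v) = row_mx (gamma v) (Psi v). Proof. by []. Qed.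

Let miota v : model_map (model_iota v) = iota v.
Proof.
apply: (embeds_inj epsi) => //; rewrite mmE; have [_ _ ->] := pr.
by rewrite /mpos miE row_mxKr.
Qed.

Let mdirI v : mdir (model_iota v) = gamma v.
Proof. by rewrite /mdir miE row_mxKl. Qed.

Let dM (w : model) (A : set model) : nbhs w A -> exists v, A (model_iota v).
Proof.
move=> /(embeds_nbhsE eval I)[B nB sB].
have := set_valP w => /(_ _ nB)[_ [[v _ <-]] Bv].
by exists v; apply: sB; split=> //; rewrite /preimage /= miE.
Qed.

Let mcp (w : model) : {for w, continuous model_map} /\
  forall f, smooth_near (model_map w) f -> smooth_near w (f \o model_map).
Proof.
apply: (smooth_pull aM epsi I); first exact: near_all.
by move=> j; apply: (Sm_eq aM _ (Sm_mpos w j)); apply: near_all => s; rewrite mmE.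
Qed.

Let xt_model (w : model) F a : xt iota (model_map w) F a -> xt model_iota w F a.
Proof.
move=> [h [sh ha hF]]; have [cb pb] := mcp w.
exists (h \o model_map); split; [exact: pb|exact: ha|].
by apply: filterS (near_cvg cb hF) => r' h1 v vr'; rewrite /= (h1 v)// -miota vr'.
Qed.

Let mdir_xt (w : model) j : xt model_iota w (fun v => gamma v 0 j) (mdir w 0 j).
Proof. by apply: (@xt_of_smooth R model T model_iota w (fun w => mdir w 0 j)) => [|v]; [exact: Sm_mdir|rewrite mdirI]. Qed.

(** Off [Z] the direction [gamma] extends smoothly to the base, so it is a smooth function of the
    base point. *)
Lemma model_off : embeds (model_map @^-1` (~` Z)) model_map.
Proof.
apply: (@embeds_intro R model X aX _ _ _ set_val eval).
- have oZ : open (~` Z) by apply: closed_openC.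
  by apply: open_comp oZ => w _; case: (mcp w).
- by move=> w _; exact: mcp.
move=> w Zw j; case: (split_ordP j) => k -> /=; last first.
  exists (fun p => psi p 0 k); first exact: Sm_embed_coord epsi I.
  by apply: near_all => y s _ <-; rewrite mE row_mxEr mmE.
have [a /(xt_near aX)[h sh [_ hx]]] := hoff Zw k.
exists h => //; apply: filterS hx => y hy s _ ys; rewrite mE row_mxEl.
apply: (xt_uniq aM dM (mdir_xt s k)); apply: xt_model; by rewrite ys.
Qed.

Lemma model_onto : ~` Z `<=` range model_map.
Proof.
move=> p Zp.
have h1 j : exists h, smooth_near p h /\ \forall y \near p, forall v, iota v = y -> h y = gamma v 0 j.
  by have [a [h [sh _ hh]]] := hoff Zp j; exists h.
have [h hP] := choice h1.
have sh j : smooth_near p (h j) by case: (hP j).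
have E : \forall y \near p, forall v, iota v = y -> \row_j h j y = gamma v.
  have : \forall y \near p, forall j v, iota v = y -> h j y = gamma v 0 j.
    apply: near_forall => j.
    by case: (hP j).
  by apply: filterS => y hy v vy; apply/rowP => j; rewrite mxE; exact: hy.
pose g j y : R := match fintype.split j with inl k => h k y | inr k => psi y 0 k end.
have gE y : \row_j g j y = row_mx (\row_j h j y) (psi y).
  apply: row_mx_coord => j; rewrite /g; first by rewrite (unsplitK (inl j)) mxE.
  by rewrite (unsplitK (inr j)).
have sg j : smooth_near p (g j).
  rewrite /g; case: (fintype.split j) => k; first exact: sh.
  exact: Sm_embed_coord epsi I.
have Sp : model_range (row_mx (\row_j h j p) (psi p)).
  move=> B nB; have nb : nbhs p [set y | B (\row_j g j y)].
    by apply: (Sm_row_cvg aX sg); rewrite gE.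
  have [v [Bv /(_ v erefl) hv]] := dX (nearI nb E).
  exists (row_mx (gamma v) (Psi v)); split; first by exists v.
  by move: Bv; rewrite /= gE hv; have [_ _ ->] := pr.
exists (to_model Sp) => //.
by apply: (embeds_inj epsi) => //; rewrite mmE /mpos /= row_mxKr.
Qed.

Section Polar.
Variables (x : X) (c : coords X) (A : {set 'I_(sdim X)}).
Variables (B : 'M[R]_(sdim X, q)) (C : 'M[R]_(q, sdim X)).
Hypothesis hn : normal_data iota Z gamma x c A B C.
Let n := sdim X.
Let ch : chart c. Proof. by case: hn => -[/adapted_chart]. Qed.

Let ZE (p : X) : dom c p -> Z p <-> forall i, i \in A -> crd c p 0 i = 0.
Proof. by have [[_ E] _ _] := hn; exact: (vanishing_eq E). Qed.

Let U : set model := model_map @^-1` dom c.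
Let oU : open U.
Proof. by apply: open_comp (embeds_open ch.1) => w _; case: (mcp w). Qed.
Let nU w : U w -> \forall s \near w, U s.
Proof. by move=> Uw; apply: open_nbhs_nbhs. Qed.

Let x_ (w : model) i : R := crd c (model_map w) 0 i.
Let k_ (w : model) i : R := \sum_j mdir w 0 j * C j i.

Let Sm_x w i : U w -> smooth_near w (x_ ^~ i).
Proof.
move=> Uw; have [_ p] := mcp w; apply: (p (fun p => crd c p 0 i)).
exact: Sm_embed_coord ch.1 Uw.
Qed.

Let Sm_k w i : smooth_near w (k_ ^~ i).
Proof. by apply: (Sm_sum aM) => j _; apply: (SmM aM); [exact: Sm_mdir|exact: (Sm_cst aM)]. Qed.

(** At interior points the normal coordinates are a positive factor [a] times [k_]. The facts below
    are the consequences that do not mention [a], which pass to the closure by density; in [factX]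
    the factor is eliminated by cross-multiplication, because it tends to 0 over [Z]. *)
Let dense_facts v : dom c (iota v) -> let w := model_iota v in exists2 a : R, 0 < a &
  [/\ forall i, i \in A -> x_ w i = a * k_ w i, nrm (mdir w) = 1 &
      forall j, mdir w 0 j = \sum_(i in A) k_ w i * B i j].
Proof.
move=> dv w; have [_ BC /(_ v dv)] := hn.
set xA := \row_i _; set W := xA *m B => /= gE.
have wE j : W 0 j = \sum_(i in A) x_ w i * B i j.
  rewrite mxE [RHS]big_mkcond; apply: eq_bigr => i _.
  by rewrite mxE /x_ miota; case: (i \in A) => //; rewrite mul0r.
have xW k : k \in A -> x_ w k = \sum_j W 0 j * C j k.
  by move=> kA; under eq_bigr do rewrite wE; rewrite (left_inverse_coord _ BC).
have W0 : W != 0.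
  apply/eqP => W0; apply: (@iotaZ v); apply/(ZE dv) => i iA.
  have := xW i iA; rewrite /x_ miota => ->; rewrite big1// => j _.
  by rewrite W0 mxE mul0r.
have a0 := nrm_gt0 W0; have mw : mdir w = (nrm W)^-1 *: W by rewrite mdirI.
have xk i : i \in A -> x_ w i = nrm W * k_ w i.
  move=> iA; rewrite xW// mulr_sumr; apply: eq_bigr => j _.
  by rewrite mw [X in _ = _ * (X * _)]mxE !mulrA mulfV ?mul1r// gt_eqF.
exists (nrm W) => //; split=> //; first by rewrite mw nrm_normalize.
move=> j; rewrite mw [LHS]mxE wE mulr_sumr; apply: eq_bigr => i iA.
by rewrite xk// !mulrA mulVf ?mul1r// gt_eqF.
Qed.

Let denseP w (P : model -> Prop) : U w -> (forall v, dom c (iota v) -> P (model_iota v)) ->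
  \forall s \near w, forall v, model_iota v = s -> P s.
Proof.
move=> Uw h; apply: filterS (nU Uw) => s Us v vs; rewrite -vs; apply: h.
by rewrite -miota vs.
Qed.

Let n2 w := \sum_(i in A) k_ w i ^+ 2.
Let kx w := \sum_(i in A) k_ w i * x_ w i.

Let Sm_n2 w : smooth_near w n2.
Proof. by apply: (Sm_sum aM) => i _; apply: (SmX aM); exact: Sm_k. Qed.

Let Sm_kx w : U w -> smooth_near w kx.
Proof. by move=> Uw; apply: (Sm_sum aM) => i _; apply: (SmM aM); [exact: Sm_k|exact: Sm_x]. Qed.

Let factB w j : U w -> mdir w 0 j = \sum_(i in A) k_ w i * B i j.
Proof.
move=> Uw; suff /nbhs_singleton : \forall s \near w, mdir s 0 j = \sum_(i in A) k_ s i * B i j by [].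
apply: (Sm_eq_dense aM dM); first exact: Sm_mdir.
  by apply: (Sm_sum aM) => i _; apply: (SmM aM); [exact: Sm_k|exact: (Sm_cst aM)].
by apply: (denseP (P := fun s => mdir s 0 j = \sum_(i in A) k_ s i * B i j)) => // v /dense_facts[a _ []].
Qed.

Let factN w : U w -> \sum_j mdir w 0 j ^+ 2 = 1.
Proof.
move=> Uw; suff /nbhs_singleton : \forall s \near w, \sum_j mdir s 0 j ^+ 2 = 1 by [].
apply: (Sm_eq_dense aM dM).
- by apply: (Sm_sum aM) => j _; apply: (SmX aM); exact: Sm_mdir.
- exact: (Sm_cst aM).
apply: (denseP (P := fun s => \sum_j mdir s 0 j ^+ 2 = 1)) => // v /dense_facts[a _ [_ h _]].
by rewrite -nrm2 h expr1n.
Qed.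

Let factX w i : U w -> i \in A -> x_ w i * n2 w = kx w * k_ w i.
Proof.
move=> Uw iA; suff /nbhs_singleton : \forall s \near w, x_ s i * n2 s = kx s * k_ s i by [].
apply: (Sm_eq_dense aM dM).
- by apply: (SmM aM); [exact: Sm_x|exact: Sm_n2].
- by apply: (SmM aM); [exact: Sm_kx|exact: Sm_k].
apply: (denseP (P := fun s => x_ s i * n2 s = kx s * k_ s i)) => // v /dense_facts[a _ [h _ _]].
rewrite h// mulrAC; congr (_ * _); rewrite mulr_sumr; apply: eq_bigr => l lA.
by rewrite h//; ring.
Qed.

Let factS w : U w -> 0 <= kx w.
Proof.
move=> Uw; apply: (Sm_ge_dense aM dM); first exact: Sm_kx.
apply: (denseP (P := fun s => 0 <= kx s)) => // v /dense_facts[a a0 [h _ _]].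
apply: sumr_ge0 => l lA; rewrite h// mulrCA; apply: mulr_ge0; first exact: ltW.
by rewrite -expr2 sqr_ge0.
Qed.

Let factK w i : U w -> i \in A -> i \in bnd c -> 0 <= k_ w i.
Proof.
move=> Uw iA ib; apply: (Sm_ge_dense (f := k_ ^~ i) aM dM); first exact: Sm_k.
apply: (denseP (P := fun s => 0 <= k_ s i)) => // v dv; have /dense_facts[a a0 [h _ _]] := dv.
have := chart_corner ch dv ib; rewrite -miota -/(x_ (model_iota v) i) h//.
by rewrite pmulr_rge0.
Qed.

Let n2_gt0 w : U w -> 0 < n2 w.
Proof.
move=> Uw; rewrite lt_neqAle sumr_ge0 ?andbT => [|i _]; last exact: sqr_ge0.
apply/eqP => /esym/eqP; rewrite psumr_eq0 => [/allP h|i _]; last exact: sqr_ge0.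
have k0 i : i \in A -> k_ w i = 0.
  move=> iA; apply/eqP; rewrite -sqrf_eq0; have := h i; rewrite mem_index_enum => /(_ isT).
  by rewrite iA.
have := factN Uw; rewrite big1 => [/esym/eqP|j _]; first by rewrite oner_eq0.
by rewrite factB// big1 ?expr0n// => i iA; rewrite k0// mul0r.
Qed.

Let nk w := (Num.sqrt (n2 w))^-1.
Let nk_gt0 w : U w -> 0 < nk w.
Proof. by move=> Uw; rewrite invr_gt0 sqrtr_gt0 n2_gt0. Qed.
Let nk2 w : U w -> nk w ^+ 2 * n2 w = 1.
Proof.
by move=> Uw; rewrite exprVn sqr_sqrtr ?mulVf ?gt_eqF ?ltW ?n2_gt0.
Qed.
Let Sm_nk w : U w -> smooth_near w nk.
Proof.
move=> Uw; apply: (SmV aM); last by rewrite gt_eqF// sqrtr_gt0 n2_gt0.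
by apply: (Sm_sqrt aM); [exact: Sm_n2|exact: n2_gt0].
Qed.

Let ang w i : R := if i \in A then nk w * k_ w i else x_ w i.
Let rad w : R := nk w * kx w.
Definition model_polar (w : model) : euclidean R (1 + n) := row_mx (rad w)%:M (\row_i ang w i).

Let radE w : lsubmx (model_polar w : 'rV[R]_(1 + n)) 0 0 = rad w.
Proof. by rewrite /model_polar row_mxKl !mxE. Qed.
Let angE w i : rsubmx (model_polar w : 'rV[R]_(1 + n)) 0 i = ang w i.
Proof. by rewrite /model_polar row_mxKr !mxE. Qed.

Let Sm_ang w i : U w -> smooth_near w (ang ^~ i).
Proof.
move=> Uw; rewrite /ang; case: (i \in A); last exact: Sm_x.
by apply: (SmM aM); [exact: Sm_nk|exact: Sm_k].
Qed.
Let Sm_rad w : U w -> smooth_near w rad.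
Proof. by move=> Uw; apply: (SmM aM); [exact: Sm_nk|exact: Sm_kx]. Qed.

Lemma model_polarE w : U w -> crd c (model_map w) = polar A (model_polar w).
Proof.
move=> Uw; apply/rowP => i; rewrite [RHS]mxE radE angE /ang.
have [iA|iA] := boolP (i \in A); last by rewrite mul1r.
rewrite /rad mulrACA -expr2 -factX// mulrCA nk2// mulr1.
by [].
Qed.

Let ang1 w : U w -> \sum_(i in A) ang w i ^+ 2 = 1.
Proof.
move=> Uw; rewrite -(nk2 Uw) mulr_sumr; apply: eq_bigr => i iA.
by rewrite /ang iA exprMn.
Qed.

Let mdir_ang w : U w -> mdir w = (nrm ((\row_i (if i \in A then ang w i else 0)) *m B))^-1 *:
   ((\row_i (if i \in A then ang w i else 0)) *m B).
Proof.
move=> Uw; set W := _ *m B.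
have WE : W = nk w *: mdir w.
  apply/rowP => j; rewrite mxE [RHS]mxE factB// mulr_sumr [RHS]big_mkcond.
  apply: eq_bigr => i _; rewrite mxE /ang; case: (i \in A); last by rewrite mul0r.
  by rewrite mulrA.
rewrite WE normalizeZ ?nk_gt0// -[LHS]scale1r; congr (_ *: _).
by rewrite /nrm factN// sqrtr1 invr1.
Qed.

Lemma model_polar_domain w : U w -> polar_domain A (bnd c) (crd c @` dom c) (model_polar w).
Proof.
move=> Uw; split.
- by rewrite radE /rad mulr_ge0 ?factS// ltW// nk_gt0.
- by under eq_bigr do rewrite angE; exact: ang1.
- move=> i; rewrite finset.inE => /andP[iA ib]; rewrite angE /ang iA.
  by rewrite mulr_ge0 ?factK// ltW// nk_gt0.
- by rewrite -model_polarE//; exists (model_map w).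
Qed.

(** Off [Z] the radius is the positive root of the sum of squares of the normal coordinates, so
    radius and direction are determined by the point. *)
Let polar_pos w p u : U w -> model_map w = p -> ~ Z p ->
  polar_domain A (bnd c) (crd c @` dom c) u -> crd c p = polar A u -> model_polar w = u.
Proof.
move=> Uw wp Zp [u0 u1 u2 u3] E.
have xE i : i \in A -> x_ w i = lsubmx u 0 0 * rsubmx u 0 i.
  by move=> iA; rewrite /x_ wp E mxE iA.
have yE i : i \notin A -> x_ w i = rsubmx u 0 i.
  by move=> iA; rewrite /x_ wp E mxE (negbTE iA) mul1r.
have sa i : i \in A -> x_ w i = rad w * ang w i.
  by move=> iA; have := congr1 (fun r : 'rV[R]_n => r 0 i) (model_polarE Uw); rewrite [RHS]mxE radE angE iA.
have S2 : rad w ^+ 2 = lsubmx u 0 0 ^+ 2.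
  rewrite -[LHS]mulr1 -(ang1 Uw) -[RHS]mulr1 -[in RHS]u1 !mulr_sumr; apply: eq_bigr => i iA.
  by rewrite -!exprMn -sa// -xE.
have r0 : 0 <= rad w by have [] := model_polar_domain Uw; rewrite radE.
have SE : rad w = lsubmx u 0 0 by move: S2 => /eqP; rewrite eqrXn2// => /eqP.
have rn0 : rad w != 0.
  apply/eqP => r00; apply: Zp; rewrite -wp; apply/(ZE Uw) => i iA.
  by rewrite -/(x_ w i) sa// r00 mul0r.
apply/rowP => j; case: (split_ordP j) => i -> /=.
  rewrite (ord1 i); have := radE w; rewrite mxE => ->; rewrite SE mxE.
  by congr (u _ _); apply/val_inj.
have := angE w i; rewrite mxE => ->; rewrite [RHS](_ : _ = rsubmx u 0 i); last by rewrite mxE.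
have [iA|iA] := boolP (i \in A); last by rewrite /ang (negbTE iA) yE.
by apply: (mulfI rn0); rewrite -sa// xE// SE.
Qed.

(** Off [Z] a row of the polar domain comes from the point with coordinates [polar A u]. A row of
    radius 0 is a limit of the rows [ut t] of positive radius; all of these have the same direction
    [g], and the limit lies in the model because [model_range] is closed. *)
Lemma model_polar_onto u : polar_domain A (bnd c) (crd c @` dom c) u ->
  exists2 w, U w & model_polar w = u.
Proof.
move=> pu; have [u0 u1 u2 [p dp E]] := pu.
have [Zp|Zp] := pselect (Z p); last first.
  have [w _ wp] := model_onto Zp.
  have Uw : U w by rewrite /U /preimage /= wp.
  by exists w => //; apply: polar_pos wp Zp pu E.
have s0 : lsubmx u 0 0 = 0.
  have ZA := (ZE dp).1 Zp.
  rewrite -[LHS]mulr1 -u1 mulr_sumr big1// => i iA.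
  have := congr1 (fun r : 'rV[R]_n => r 0 i) E; rewrite [RHS]mxE iA ZA// => /esym e.
  by rewrite expr2 mulrA e mul0r.
pose ut (t : R) : 'rV[R]_(1 + n) := row_mx t%:M (rsubmx u).
have utl t : lsubmx (ut t) 0 0 = t by rewrite /ut row_mxKl !mxE.
have utr t : rsubmx (ut t) = rsubmx u by rewrite /ut row_mxKr.
pose d : 'rV[R]_n := \row_i (if i \in A then rsubmx u 0 i else 0).
have put t : polar A (ut t) = crd c p + t *: d.
  apply/rowP => i; rewrite E [LHS]mxE [RHS]mxE [X in _ = X + _]mxE utl utr s0 [X in _ = _ + X]mxE [X in _ + _ * X]mxE.
  by case: (i \in A); rewrite ?mul0r ?add0r ?mulr0 ?addr0.
pose W := d *m B.
pose g := (nrm W)^-1 *: W.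
have near0 (P : X -> Prop) : (\forall y \near p, P y) -> exists y t, [/\ dom c y, 0 < t, crd c y = polar A (ut t) & P y].
  move=> nP; have n1 := chart_near_pt ch dp nP.
  have cp : corner (bnd c) (crd c p) by exact: (chart_corner ch dp).
  have n2' := corner_near (w := d) cp _ n1.
  have d0 i : i \in bnd c -> crd c p 0 i = 0 -> 0 <= d 0 i.
    move=> ib _; rewrite mxE; case: (boolP (i \in A)) => // iA; apply: u2.
    by rewrite finset.inE iA.
  have [t [[h hc] t0]] := filter_ex (rightI (n2' d0) (nbhs_right_gt 0)).
  by have [y [dy yE Py]] := h hc; exists y, t; split=> //; rewrite put.
have Sg : model_range (row_mx g (psi p)).
  suff : closure (closure (range (fun v => row_mx (gamma v) (Psi v)))) (row_mx g (psi p)).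
    by apply: closed_closure.
  move=> D nD.
  pose f j (y : X) : R := match fintype.split j with inl k => g 0 k | inr k => psi y 0 k end.
  have fE y : \row_j f j y = row_mx g (psi y).
    apply: row_mx_coord => j; rewrite /f; first by rewrite (unsplitK (inl j)).
    by rewrite (unsplitK (inr j)).
  have sf j : smooth_near p (f j).
    rewrite /f; case: (fintype.split j) => k; first exact: (Sm_cst aX).
    exact: Sm_embed_coord epsi I.
  have : \forall y \near p, D (\row_j f j y) by apply: (Sm_row_cvg aX sf); rewrite fE.
  move=> /near0[y [t [dy t0 yE Dy]]].
  have Zy : ~ Z y.
    move=> /(ZE dy) h; have := u1; rewrite big1 => [/esym/eqP|i iA]; first by rewrite oner_eq0.
    have := h i iA; rewrite yE mxE iA utl utr => /eqP.
    by rewrite mulf_eq0 gt_eqF//= => /eqP ->; rewrite expr0n.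
  have [w _ wy] := model_onto Zy.
  have Uw : U w by rewrite /U /preimage /= wy.
  have pw : model_polar w = ut t.
    apply: polar_pos wy Zy _ (yE) => //; split; rewrite ?utl ?utr//; first exact: ltW.
    by exists y.
  exists (row_mx g (psi y)); split; last by rewrite -fE.
  have -> : row_mx g (psi y) = set_val w; last exact: set_valP.
  rewrite mE -mmE wy; congr row_mx; rewrite mdir_ang// /g /W; congr (_^-1 *: _); [congr nrm|];
    congr (_ *m _); apply/rowP => i; rewrite [LHS]mxE [RHS]mxE; case: (i \in A) => //;
    by rewrite -angE pw utr.
have wp : model_map (to_model Sg) = p.
  by apply: (embeds_inj epsi) => //; rewrite mmE /mpos /= row_mxKr.
have Uw : U (to_model Sg) by rewrite /U /preimage /= wp.
exists (to_model Sg) => //.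
have rA i : i \in A -> ang (to_model Sg) i = nk (to_model Sg) * k_ (to_model Sg) i by rewrite /ang => ->.
have d1 : \sum_(i in A) d 0 i ^+ 2 = 1 by rewrite -u1; apply: eq_bigr => i iA; rewrite mxE iA.
have dB k : k \in A -> d 0 k = \sum_j W 0 j * C j k.
  move=> kA; have [_ BC _] := hn.
  transitivity ((d *m (B *m C)) 0 k); last by rewrite mulmxA mxE.
  rewrite [RHS]mxE (bigD1 k)//= BC// eqxx mulr1 big1 ?addr0// => i ik.
  have [iA|iA] := boolP (i \in A); first by rewrite BC// (negbTE ik) mulr0.
  by rewrite [X in X * _]mxE (negbTE iA) mul0r.
have W0 : W != 0.
  apply/eqP => W0; move: d1; rewrite big1 => [/esym/eqP|i iA]; first by rewrite oner_eq0.
  by rewrite dB// big1 ?expr0n// => j _; rewrite W0 mxE mul0r.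
have kE i : i \in A -> k_ (to_model Sg) i = (nrm W)^-1 * rsubmx u 0 i.
  move=> iA; have -> : rsubmx u 0 i = d 0 i by rewrite [RHS]mxE iA.
  rewrite dB// mulr_sumr; apply: eq_bigr => j _.
  by rewrite /mdir /= row_mxKl [X in X * _]mxE mulrA.
have n2E : n2 (to_model Sg) = (nrm W)^-1 ^+ 2.
  by rewrite -[RHS]mulr1 -u1 mulr_sumr; apply: eq_bigr => i iA; rewrite kE// exprMn.
have nkE : nk (to_model Sg) = nrm W by rewrite /nk n2E sqrtr_sqr gtr0_norm ?invr_gt0 ?nrm_gt0// invrK.
apply/rowP => j; case: (split_ordP j) => i -> /=.
  rewrite (ord1 i); have := radE (to_model Sg); rewrite mxE => ->.
  rewrite [RHS](_ : _ = 0); last by rewrite -s0 mxE.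
  rewrite /rad /kx big1 ?mulr0// => l lA.
  by rewrite /x_ wp (ZE dp).1// mulr0.
have := angE (to_model Sg) i; rewrite mxE => ->; rewrite [RHS](_ : _ = rsubmx u 0 i); last by rewrite mxE.
have [iA|iA] := boolP (i \in A).
  by rewrite rA// kE// nkE mulrA mulfV ?mul1r// gt_eqF// nrm_gt0.
by rewrite /ang (negbTE iA) /x_ wp E mxE (negbTE iA) mul1r.
Qed.

Let Sm_polar w j : U w -> smooth_near w (fun w => model_polar w 0 j).
Proof.
move=> Uw; case: (split_ordP j) => i -> /=.
  apply: (Sm_eq aM _ (Sm_rad Uw)); apply: near_all => s.
  by rewrite -radE mxE (ord1 i).
apply: (Sm_eq aM _ (Sm_ang i Uw)); apply: near_all => s.
by rewrite -angE mxE.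
Qed.

(** The direction is the normalized image of the angular coordinates under [B], and the base point
    is a function of [polar A]; so both are smooth functions of the polar coordinates. *)
Lemma model_polar_embeds : embeds U model_polar.
Proof.
have aP := @ambient_euclidean R (1 + n).
apply: (@embeds_intro R model (euclidean R (1 + n)) aP _ _ _ set_val eval) => //.
  move=> w Uw; apply: (smooth_pull aM (@embeds_id R (1 + n)) I); first exact: near_all.
  by move=> j; exact: Sm_polar.
move=> w Uw j.
pose d (y : 'rV[R]_(1 + n)) : 'rV[R]_n := \row_i (if i \in A then rsubmx y 0 i else 0).
pose W y := d y *m B.
have dE s : W (model_polar s) = (\row_i (if i \in A then ang s i else 0)) *m B.
  congr (_ *m _); apply/rowP => i; rewrite [LHS]mxE [RHS]mxE.
  by case: (i \in A) => //; rewrite angE.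
have sr i y : smooth_near_rV y (fun y : 'rV[R]_(1 + n) => rsubmx y 0 i).
  apply: (@Sm_eq R (euclidean R (1 + n)) aP y (fun y : 'rV[R]_(1 + n) => y 0 (rshift 1 i))); last exact: sm_coord.
  by apply: near_all => z; rewrite mxE.
have sl y : smooth_near_rV y (fun y : 'rV[R]_(1 + n) => lsubmx y 0 0).
  apply: (@Sm_eq R (euclidean R (1 + n)) aP y (fun y : 'rV[R]_(1 + n) => y 0 (lshift n 0))); last exact: sm_coord.
  by apply: near_all => z; rewrite mxE.
have sW k y : smooth_near_rV y (fun y => W y 0 k).
  apply: (@Sm_eq R (euclidean R (1 + n)) aP y (fun y : 'rV[R]_(1 + n) => \sum_i (if i \in A then rsubmx y 0 i else 0) * B i k)).
    by apply: near_all => z; rewrite /W [RHS]mxE; apply: eq_bigr => i _; rewrite [in RHS]mxE.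
  apply: (Sm_sum aP) => i _; apply: (SmM aP); last exact: (Sm_cst aP).
  by case: (i \in A); [exact: sr|exact: (Sm_cst aP)].
case: (split_ordP j) => k -> /=.
  have W1 : 0 < nrm (W (model_polar w)).
    apply: nrm_gt0; apply/eqP => W0; have := mdir_ang Uw; rewrite -dE W0 scaler0 => m0.
    have := factN Uw; rewrite m0 big1 => [/esym/eqP|i _]; first by rewrite oner_eq0.
    by rewrite mxE expr0n.
  exists (fun y => (nrm (W y))^-1 * W y 0 k).
    apply: (SmM aP); last exact: sW.
    apply: (SmV aP); last by rewrite gt_eqF.
    apply: (Sm_sqrt aP); last by rewrite -nrm2 exprn_gt0.
    by apply: (Sm_sum aP) => l _; apply: (SmX aP); exact: sW.
  apply: near_all => y s Us <-; rewrite mE row_mxEl mdir_ang// -dE.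
  by rewrite [LHS]mxE.
have [h sh hE] := Sm_lift (Sm_embed_coord k epsi (I : setT (model_map w))) Uw ch.1.
have [B0 nB0 sB0] := embeds_nbhsE ch.1 Uw hE.
have pP : {for model_polar w, continuous (fun y : euclidean R (1 + n) => (\row_i polar A y 0 i : euclidean R n))} /\
    forall i, @smooth_near R (euclidean R (1 + n)) (model_polar w) (fun y => polar A y 0 i).
  have sp i : @smooth_near R (euclidean R (1 + n)) (model_polar w) (fun y => polar A y 0 i).
    apply: (@Sm_eq R (euclidean R (1 + n)) aP _ (fun y : 'rV[R]_(1 + n) => (if i \in A then lsubmx y 0 0 else 1) * rsubmx y 0 i)).
      by apply: near_all => z; rewrite [RHS]mxE.
    apply: (SmM aP); last exact: sr.
    by case: (i \in A); [exact: sl|exact: (Sm_cst aP)].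
  by split=> //; exact: (Sm_row_cvg aP sp).
have [cp sp] := pP.
exists (fun y => h (\row_i polar A y 0 i)).
  apply: (Sm_comp aP) => //.
  by rewrite rV_row -model_polarE.
have nB : \forall y \near model_polar w, B0 (\row_i polar A y 0 i).
  by apply: cp; rewrite rV_row -model_polarE.
apply: filterS nB => y By s Us ys; rewrite mE row_mxEr -mmE rV_row -ys -model_polarE//.
by apply: (sB0 (model_map s)); split=> //; rewrite /preimage /= model_polarE// ys -[polar A y]rV_row.
Qed.

End Polar.

Theorem model_blowup : is_blowup Z model_map.
Proof.
split=> //; [exact: model_off|exact: model_onto|].
move=> p Zp; have [c [A [B [C hn]]]] := hon Zp.
exists c, A; split; first by case: hn.
exists (model_polar c A C); split.
- exact: (model_polar_embeds hn).
- apply/seteqP; split=> [_ [w Uw <-]|u pu]; first exact: (model_polar_domain hn Uw).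
  by have [w Uw wu] := model_polar_onto hn pu; exists w.
- by move=> w Uw; exact: (model_polarE hn Uw).
Qed.

End Model.

(** * Adapted bases of functionals *)

Section Flag.
Context {R : realType} (n m : nat) (Ac : nat -> 'M[R]_n) (E : nat -> 'cV[R]_n).
Hypothesis Ac0 : row_full (Ac 0).
Hypothesis AcS : forall i, (Ac i.+1 <= Ac i)%MS.
Hypothesis Acm : forall i, (m < i)%N -> Ac i = 0.
Hypothesis AE : forall i, (i < m)%N -> Ac i.+1 *m E i = 0.
Hypothesis EN : forall i, (i < m)%N -> exists f : 'rV[R]_n, (f <= Ac i)%MS /\ (f *m E i) 0 0 != 0.

Lemma flag_mono i j : (i <= j)%N -> (Ac j <= Ac i)%MS.
Proof.
move=> /subnK <-; elim: (j - i)%N => [|k IH]; first exact: submx_refl.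
exact: submx_trans (AcS _) IH.
Qed.

(** [dm] marks the rows of maximal growth, with the sign that makes the limit [E] positive. The last
    clause asks for a marked row only if some row of that level has maximal growth, so that partial
    systems, such as a basis of one flat or a pulled-back basis, can be completed without changing
    their rows. *)
Definition graded k (K : 'M[R]_(k, n)) (lev : 'I_k -> nat) (dm : {set 'I_k}) :=
  [/\ forall c, (lev c <= m)%N /\ (row c K <= Ac (lev c))%MS,
      forall i (a : 'rV_k), (forall c, lev c != i -> a 0 c = 0) -> (a *m K <= Ac i.+1)%MS -> a = 0,
      forall c, c \in dm -> (lev c < m)%N /\ 0 < (row c K *m E (lev c)) 0 0, {in dm &, injective lev} &
      forall c, (lev c < m)%N -> (row c K *m E (lev c)) 0 0 != 0 -> exists2 c', c' \in dm & lev c' = lev c].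

(** Rows of other levels are replaced by 0, which keeps the number of rows equal to [k]. *)
Definition level_rows k (K : 'M[R]_(k, n)) (lev : 'I_k -> nat) i : 'M[R]_(k, n) :=
  \matrix_(c, j) (if lev c == i then K c j else 0).

Lemma mul_level_rows k (K : 'M[R]_(k, n)) lev i (a : 'rV_k) :
  (forall c, lev c != i -> a 0 c = 0) -> a *m K = a *m level_rows K lev i.
Proof.
move=> ha; apply/rowP => j; rewrite !mxE; apply: eq_bigr => c _; rewrite mxE.
by case: eqP => // /eqP /ha ->; rewrite !mul0r.
Qed.

Lemma mul_level_rows' k (K : 'M[R]_(k, n)) lev i (a : 'rV_k) :
  a *m level_rows K lev i = (\row_c (if lev c == i then a 0 c else 0)) *m K.
Proof.
apply/rowP => j; rewrite !mxE; apply: eq_bigr => c _; rewrite !mxE.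
by case: eqP; rewrite ?mul0r ?mulr0.
Qed.

Lemma level_rows_sub k (K : 'M[R]_(k, n)) lev i : (level_rows K lev i <= K)%MS.
Proof.
apply/row_subP => c; have -> : row c (level_rows K lev i) = (lev c == i)%:R *: row c K.
  by apply/rowP => j; rewrite !mxE; case: eqP; rewrite ?mul1r ?mul0r.
by apply: scalemx_sub; exact: row_sub.
Qed.

Lemma rows_sub k (K : 'M[R]_(k, n)) lev dm i (a : 'rV_k) : graded K lev dm ->
  (forall c, (lev c < i)%N -> a 0 c = 0) -> (a *m K <= Ac i)%MS.
Proof.
move=> [h1 _ _ _ _] ha; rewrite mulmx_sum_row; apply: summx_sub => c _.
have [ci|ci] := ltnP (lev c) i; first by rewrite ha// scale0r sub0mx.
by apply: scalemx_sub; apply: submx_trans (flag_mono ci); case: (h1 c).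
Qed.

Lemma graded_free k (K : 'M[R]_(k, n)) lev dm : graded K lev dm -> row_free K.
Proof.
move=> g; apply: inj_row_free => a aK.
have h i c : (lev c < i)%N -> a 0 c = 0.
  elim: i c => // i IH c; rewrite ltnS leq_eqVlt => /orP[/eqP ci|]; last exact: IH.
  have [_ h2 _ _ _] := g.
  pose a1 : 'rV_k := \row_c (if lev c == i then a 0 c else 0).
  have : a1 = 0.
    apply: (h2 i) => [c' /negbTE c'i|]; first by rewrite mxE c'i.
    have -> : a1 *m K = - ((a - a1) *m K) by rewrite mulmxBl aK sub0r opprK.
    rewrite eqmx_opp; apply: (rows_sub g) => c'.
    rewrite ltnS leq_eqVlt !mxE => /orP[->|c'i]; first by rewrite subrr.
    by rewrite IH// (ltn_eqF c'i) subr0.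
  by move/rowP/(_ c); rewrite !mxE ci eqxx.
by apply/rowP => c; rewrite mxE (h (lev c).+1).
Qed.

Lemma graded_step k (K : 'M[R]_(k, n)) lev dm i (f : 'rV[R]_n) : graded K lev dm ->
  (i <= m)%N -> (f <= Ac i)%MS -> ~~ (f <= Ac i.+1 + level_rows K lev i)%MS ->
  exists (K' : 'M[R]_(k + 1, n)) lev' dm', graded K' lev' dm' /\
   forall c, [/\ row (lshift 1 c) K' = row c K, lev' (lshift 1 c) = lev c &
     (lshift 1 c \in dm') = (c \in dm)].
Proof.
move=> g im fi fn; have [h1 h2 h3 h4 h5] := g.
(* The new row is marked exactly if [E i] does not vanish on it and no row of its level is marked
   yet; [s] then makes the value positive. *)
pose nd := [&& (i < m)%N, (f *m E i) 0 0 != 0 & ~~ [exists c in dm, lev c == i]].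
pose s : R := if nd then Num.sg ((f *m E i) 0 0) else 1.
have s0 : s != 0.
  rewrite /s /nd; case: and3P => [[_ fE _]|_]; first by rewrite sgr_eq0.
  exact: oner_neq0.
pose K' := col_mx K (s *: f).
pose lev' (c : 'I_(k + 1)) := match fintype.split c with inl a => lev a | inr _ => i end.
pose dm' : {set 'I_(k + 1)} := [set c | match fintype.split c with inl a => a \in dm | inr _ => nd end]%SET.
have lL c : lev' (lshift 1 c) = lev c by rewrite /lev' (unsplitK (inl c)).
have lR : lev' (rshift k 0) = i by rewrite /lev' (unsplitK (inr 0)).
have dL c : (lshift 1 c \in dm') = (c \in dm) by rewrite finset.inE (unsplitK (inl c)).
have dR : (rshift k 0 \in dm') = nd by rewrite finset.inE (unsplitK (inr 0)).
have rL c : row (lshift 1 c) K' = row c K.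
  by apply/rowP => j; rewrite !mxE (unsplitK (inl c)).
have rR : row (rshift k 0) K' = s *: f.
  by apply/rowP => j; rewrite !mxE (unsplitK (inr 0)) mxE.
have cs (P : 'I_(k + 1) -> Prop) : (forall c, P (lshift 1 c)) -> P (rshift k 0) -> forall c, P c.
  by move=> pl pr c; case: (split_ordP c) => a -> //=; rewrite (ord1 a).
have exd c : c \in dm -> lev c = i -> ~~ nd.
  by move=> cd ci; apply/negP => /and3P[_ _ /existsP]; apply; exists c; rewrite cd ci eqxx.
exists K', lev', dm'; split; last by move=> c; split.
split.
- apply: cs => [c|]; first by rewrite lL rL.
  by rewrite lR rR; split=> //; apply: scalemx_sub.
- move=> j a ha aK.
  pose al : 'rV_k := lsubmx a; pose ar := a 0 (rshift k 0).
  have aE : a *m K' = al *m K + ar * s *: f.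
    rewrite -{1}(hsubmxK a) mul_row_col -/al; congr (_ + _).
    have -> : rsubmx a = ar%:M by apply/matrixP => x y; rewrite !ord1 !mxE eqxx mulr1n.
    by rewrite mul_scalar_mx scalerA.
  have hl c : lev c != j -> al 0 c = 0 by move=> cj; rewrite mxE; apply: ha; rewrite lL.
  have r0 : ar = 0.
    have [ij|/ha//] := eqVneq (lev' (rshift k 0)) j.
    apply/eqP; apply: contraNT fn => r0.
    rewrite lR in ij; subst j.
    have -> : f = (ar * s)^-1 *: (a *m K' - al *m K).
      by rewrite aE addrC addKr scalerA mulVf ?scale1r// mulf_neq0.
    apply: scalemx_sub; apply: addmx_sub.
      exact: submx_trans aK (addsmxSl _ _).
    rewrite eqmx_opp (mul_level_rows K hl).
    by apply: submx_trans (addsmxSr _ _); exact: submxMl.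
  have l0 : al = 0.
    by apply: (h2 j) => //; move: aK; rewrite aE r0 mul0r scale0r addr0.
  apply/rowP; apply: cs => [c|]; last by rewrite mxE.
  by have /rowP/(_ c) := l0; rewrite !mxE.
- apply: cs => [c|]; first by rewrite dL lL rL => /h3.
  rewrite dR lR rR => nd1; have /and3P[im' fE _] := nd1; split=> //.
  by rewrite /s nd1 -scalemxAl mxE -normrEsg normr_gt0.
- apply: (cs) => [c|]; apply: (cs) => [c'|].
  + by rewrite !dL !lL => cd cd' /(h4 _ _ cd cd') ->.
  + rewrite dL dR lL lR => cd nd1 ci; by have := exd _ cd ci; rewrite nd1.
  + rewrite dL dR lL lR => nd1 cd ci; by have := exd _ cd (esym ci); rewrite nd1.
  + by [].
- apply: cs => [c|].
    by rewrite lL rL => cm /(h5 _ cm)[c' cd cc]; exists (lshift 1 c'); rewrite ?dL ?lL.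
  rewrite lR rR => im' fE; have fE' : (f *m E i) 0 0 != 0.
    by move: fE; rewrite -scalemxAl mxE mulf_eq0 negb_or => /andP[].
  have [nd1|nd0] := boolP nd; first by exists (rshift k 0); rewrite ?dR ?lR.
  move: nd0; rewrite /nd im' fE' /= negbK => /existsP[c /andP[cd /eqP ci]].
  by exists (lshift 1 c); rewrite ?dL ?lL.
Qed.

Definition complete_graded k (K : 'M[R]_(k, n)) (lev : 'I_k -> nat) (dm : {set 'I_k}) :=
  graded K lev dm /\ forall i, (i < m)%N -> exists2 c, c \in dm & lev c = i.

(** Rows are added until every [Ac i] is spanned by [Ac i.+1] and the rows of level [i]. The rows
    then span everything, and since [E i] kills [Ac i.+1] but not [Ac i], some row of level [i] has
    maximal growth, which forces a marked row. *)
Theorem graded_extend k (K : 'M[R]_(k, n)) lev dm : graded K lev dm ->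
  exists (K' : 'M[R]_n) lev' dm' (g : 'I_k -> 'I_n), complete_graded K' lev' dm' /\
    [/\ injective g, forall c, row (g c) K' = row c K, forall c, lev' (g c) = lev c &
        forall c, (g c \in dm') = (c \in dm)].
Proof.
have [d] := ubnP (n - k)%N; elim: d k K lev dm => // d IH k K lev dm dk g.
have kn : (k <= n)%N by have := graded_free g; rewrite /row_free => /eqP <-; exact: rank_leq_col.
have [[i [f [im fi fn]]]|ne] := pselect (exists i (f : 'rV[R]_n), [/\ (i <= m)%N, (f <= Ac i)%MS &
    ~~ (f <= Ac i.+1 + level_rows K lev i)%MS]).
  have [K1 [lev1 [dm1 [g1 h]]]] := graded_step g im fi fn.
  have kn1 : (k + 1 <= n)%N.
    by have := graded_free g1; rewrite /row_free => /eqP <-; exact: rank_leq_col.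
  have lt : (n - (k + 1) < d)%N by rewrite ltnS in dk; apply: leq_trans dk; rewrite addn1 ltn_sub2l// -addn1.
  have [K' [lev' [dm' [g' [c1 [c2 c3 c4 c5]]]]]] := IH _ _ _ _ lt g1.
  exists K', lev', dm', (g' \o lshift 1); split=> //; split.
  - by move=> a b /c2 /lshift_inj.
  - by move=> c; rewrite c3; case: (h c).
  - by move=> c; rewrite c4; case: (h c).
  - by move=> c; rewrite c5; case: (h c).
have sp i : (i <= m)%N -> (Ac i <= Ac i.+1 + level_rows K lev i)%MS.
  move=> im; apply/row_subP => j; apply: contrapT => fn; apply: ne.
  by exists i, (row j (Ac i)); split=> //; [exact: row_sub|exact/negP].
have full : row_full K.
  rewrite -sub1mx; apply: submx_trans (_ : (1%:M <= Ac 0)%MS) _; first by rewrite sub1mx.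
  have h j : (Ac (m.+1 - j) <= K)%MS.
    elim: j => [|j IHj]; first by rewrite subn0 Acm// sub0mx.
    have [jm|jm] := leqP j m; last first.
      by move: IHj; rewrite (eqP (_ : m.+1 - j == 0)%N) ?subn_eq0// (eqP (_ : m.+1 - j.+1 == 0)%N) ?subn_eq0// ltnW.
    rewrite subSS; apply: submx_trans (sp _ (leq_subr _ _)) _.
    rewrite addsmx_sub level_rows_sub andbT; by rewrite -subSn.
  by have := h m.+1; rewrite subnn.
have kE : k = n.
  by have /eqP <- := graded_free g; apply/eqP.
subst k; exists K, lev, dm, id; split; last by split.
split=> // i im; have [f [fi fE]] := EN im.
have /sub_addsmxP[[u1 u2] /= fE'] := submx_trans fi (sp _ (ltnW im)).
have [_ _ _ _ h5] := g.
have [c /andP[/eqP ci cE]] : exists c, (lev c == i) && ((row c K *m E i) 0 0 != 0).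
  apply/existsP; apply: contraNT fE => /existsPn h; apply/eqP.
  rewrite fE' mulmxDl -mulmxA AE// mulmx0 add0r mul_level_rows' [_ *m K]mulmx_sum_row mulmx_suml.
  rewrite summxE big1// => c _; rewrite -scalemxAl [LHS]mxE [X in X * _]mxE.
  case: eqP => [ci|_]; last by rewrite mul0r.
by have := h c; rewrite ci eqxx /= negbK => /eqP ->; rewrite mulr0.
by rewrite -ci in im cE; have [c' cd cc] := h5 c im cE; exists c' => //; rewrite cc.
Qed.

End Flag.

Section Functionals.
Context {R : realType} (n : nat).
Implicit Types (f v : 'rV[R]_n) (A : 'M[R]_n).

(* A row vector f stands for the functional v |-> (v *m f^T) 0 0. *)
Definition fe f v : R := (v *m f^T) 0 0.

Lemma feE f v : fe f v = \sum_j v 0 j * f 0 j.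
Proof. by rewrite /fe mxE; apply: eq_bigr => j _; rewrite mxE. Qed.

Lemma fe_row k (A : 'M[R]_(k, n)) v j : (v *m A^T) 0 j = fe (row j A) v.
Proof. by rewrite feE mxE; apply: eq_bigr => i _; rewrite !mxE. Qed.

Lemma fe_mul k (a : 'rV[R]_k) (A : 'M[R]_(k, n)) v : fe (a *m A) v = \sum_j a 0 j * fe (row j A) v.
Proof.
rewrite {1}/fe trmx_mul mulmxA mxE; apply: eq_bigr => j _.
by rewrite fe_row [X in _ * X]mxE mulrC.
Qed.

Lemma fe0 v : fe 0 v = 0.
Proof. by rewrite /fe trmx0 mulmx0 mxE. Qed.

Definition hom_row A v : 'rV[R]_(1 + n) := row_mx (const_mx 1) (v *m A^T).
Definition NA A v : R := nrm (hom_row A v).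
Definition theta A v : 'rV[R]_(1 + n) := (NA A v)^-1 *: hom_row A v.

Lemma hom_rowl A v : hom_row A v 0 (lshift n 0) = 1.
Proof. by rewrite row_mxEl mxE. Qed.

Lemma hom_rowr A v j : hom_row A v 0 (rshift 1 j) = fe (row j A) v.
Proof. by rewrite row_mxEr fe_row. Qed.

Lemma NA2 A v : NA A v ^+ 2 = 1 + \sum_j fe (row j A) v ^+ 2.
Proof.
rewrite /NA nrm2 big_split_ord /= big_ord1; congr (_ + _); first by rewrite hom_rowl expr1n.
by apply: eq_bigr => j _; rewrite hom_rowr.
Qed.

Lemma NA_gt0 A v : 0 < NA A v.
Proof.
apply: nrm_gt0; apply/eqP => /rowP/(_ (lshift n 0)); rewrite hom_rowl mxE => /eqP.
by rewrite oner_eq0.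
Qed.

Lemma NA_neq0 A v : NA A v != 0.
Proof. by rewrite gt_eqF// NA_gt0. Qed.

Lemma thetal A v : theta A v 0 (lshift n 0) = (NA A v)^-1.
Proof. by rewrite mxE hom_rowl mulr1. Qed.

Lemma thetar A v j : theta A v 0 (rshift 1 j) = fe (row j A) v / NA A v.
Proof. by rewrite mxE hom_rowr mulrC. Qed.

Lemma theta1 A v : \sum_k theta A v 0 k ^+ 2 = 1.
Proof.
rewrite -nrm2 nrm_normalize ?expr1n//; apply/eqP => h.
by have := NA_neq0 A v; rewrite /NA h /nrm big1 ?sqrtr0 ?eqxx// => j _; rewrite mxE expr0n.
Qed.

End Functionals.

(** * Coordinates on a stage *)

Section Stage.
Context {R : realType} (n : nat) (X : germ_space R) (iota : 'rV[R]_n -> X).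
Variables (N : nat) (Psi : 'rV[R]_n -> 'rV[R]_N) (psi : X -> 'rV[R]_N).
Hypothesis pr : presents iota Psi psi.
Variable F : seq 'M[R]_n.
Hypothesis F1 : 1%:M \in F.
Hypothesis F0 : 0 \in F.
Hypothesis Fsum : forall A B, A \in F -> B \in F -> exists2 C, C \in F & (C :=: A + B)%MS.
Hypothesis Fxt : forall A, A \in F -> forall p k, exists a, xt iota p (fun v => theta A v 0 k) a.
Hypothesis Fpsi : forall j, exists A k, A \in F /\ forall v, Psi v 0 j = theta A v 0 k.
Implicit Types (p q : X) (A B : 'M[R]_n) (f v : 'rV[R]_n).

Let aX : ambient X := presents_ambient pr.
Let dX := presents_dense pr.
Let epsi : embeds setT (psi : X -> euclidean R N). Proof. by case: pr. Qed.

Definition th p A k : R := match pselect (exists a, xt iota p (fun v => theta A v 0 k) a) with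
  | left e => projT1 (cid e) | right _ => 0 end.

Lemma thP p A k : A \in F -> xt iota p (fun v => theta A v 0 k) (th p A k).
Proof.
move=> AF; rewrite /th; case: pselect => [e|]; first exact: (projT2 (cid e)).
by move=> /(_ (Fxt AF p k)).
Qed.

Lemma th1 p A : A \in F -> \sum_k th p A k ^+ 2 = 1.
Proof.
move=> AF; apply: (xt_uniq aX dX (p := p) (F := fun v => \sum_k theta A v 0 k ^+ 2)).
  by apply: (xt_sum aX) => k _; apply: (xtM aX); exact: thP.
apply: xt_eq (xt_cst aX iota p 1); apply: nearTW => v; by rewrite theta1.
Qed.

(* tau p A > 0 if and only if the functionals in A stay bounded near p. *)
Definition tau p A : R := th p A (lshift n 0).

Lemma tau_xt p A : A \in F -> xt iota p (fun v => (NA A v)^-1) (tau p A).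
Proof. by move=> AF; apply: xt_eq (thP p (lshift n 0) AF); apply: nearTW => v; rewrite thetal. Qed.

Lemma tau_ge0 p A : A \in F -> 0 <= tau p A.
Proof.
move=> AF; apply: (xt_ge aX dX (tau_xt p AF)); apply: nearTW => v.
by rewrite invr_ge0 ltW// NA_gt0.
Qed.

(* The limit at p of v / NA A v, as a functional on the row space of A. *)
Definition ev p A : 'cV[R]_n := pinvmx A *m \col_j th p A (rshift 1 j).

Lemma ev_xt p A f : A \in F -> (f <= A)%MS -> xt iota p (fun v => fe f v / NA A v) ((f *m ev p A) 0 0).
Proof.
move=> AF fA; have -> : (f *m ev p A) 0 0 = \sum_j (f *m pinvmx A) 0 j * th p A (rshift 1 j).
  by rewrite /ev mulmxA [LHS]mxE; apply: eq_bigr => j _; rewrite [X in _ * X]mxE.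
apply: (@xt_eq _ _ _ _ _ (fun v => \sum_j (f *m pinvmx A) 0 j * theta A v 0 (rshift 1 j))).
  apply: nearTW => v; rewrite -{2}(mulmxKpV fA) fe_mul mulr_suml.
  by apply: eq_bigr => j _; rewrite thetar mulrA.
by apply: (xt_sum aX) => j _; apply: (xtZ aX); exact: thP.
Qed.

(** [theta A] has unit norm, which survives in the limit; when its first entry tends to 0, some
    other entry does not. *)
Lemma ev_neq0 p A : A \in F -> tau p A = 0 -> exists2 f : 'rV[R]_n, (f <= A)%MS & (f *m ev p A) 0 0 != 0.
Proof.
move=> AF t0; have := th1 p AF; rewrite big_split_ord /= big_ord1 -/(tau p A) t0 expr0n /= add0r => s1.
have [j tj] : exists j, th p A (rshift 1 j) != 0.
  apply: contrapT => /forallNP h; move: s1; rewrite big1 => [/esym/eqP|j _].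
    by rewrite oner_eq0.
  by have := h j => /negP; rewrite negbK => /eqP ->; rewrite expr0n.
exists (row j A); first exact: row_sub.
suff -> : (row j A *m ev p A) 0 0 = th p A (rshift 1 j) by [].
apply: (xt_uniq aX dX (ev_xt p AF (row_sub j A))).
by apply: xt_eq (thP p (rshift 1 j) AF); apply: nearTW => v; rewrite thetar.
Qed.

(* Ac i.+1 is the largest flat of functionals that are o(NA (Ac i)) at p. *)
Definition is_chain p m (Ac : nat -> 'M[R]_n) A0 :=
  [/\ Ac 0 = A0, forall i, (i <= m)%N -> Ac i \in F, forall i, (m < i)%N -> Ac i = 0,
      (forall i, (i < m)%N -> tau p (Ac i) = 0) /\ 0 < tau p (Ac m) &
      forall i, (i < m)%N -> [/\ (Ac i.+1 <= Ac i)%MS, Ac i.+1 *m ev p (Ac i) = 0 &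
        forall B, B \in F -> (B <= Ac i)%MS -> B *m ev p (Ac i) = 0 -> (B <= Ac i.+1)%MS]].

(** The flats inside [A] that are killed by [ev p A] are closed under sums, so one of maximal rank
    contains all others. *)
Lemma max_kernel p A : A \in F -> exists A', [/\ A' \in F, (A' <= A)%MS, A' *m ev p A = 0 &
  forall B, B \in F -> (B <= A)%MS -> B *m ev p A = 0 -> (B <= A')%MS].
Proof.
move=> AF; suff [A' [h1 h2 h3 h4]] : exists A', [/\ A' \in F, (A' <= A)%MS, A' *m ev p A = 0 &
  forall B, B \in F -> (B <= A)%MS -> B *m ev p A = 0 -> (\rank B <= \rank A')%N].
  exists A'; split=> // B BF BA Be; have [C CF CE] := Fsum h1 BF.
  have CA : (C <= A)%MS by rewrite CE addsmx_sub h2.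
  have Ce : C *m ev p A = 0.
    have /submxP[D ->] : (C <= col_mx A' B)%MS by rewrite CE addsmxE.
    by rewrite -mulmxA mul_col_mx h3 Be col_mx0 mulmx0.
  have A'C : (A' <= C)%MS by rewrite CE addsmxSl.
  have : (C <= A')%MS by rewrite -(geq_leqif (mxrank_leqif_sup A'C)) h4.
  by apply: submx_trans; rewrite CE addsmxSr.
pose P B := [&& B \in F, (B <= A)%MS & B *m ev p A == 0].
have [r [B0 [B0P B0r]] mx] : exists2 r, exists B, P B /\ \rank B = r & forall B, P B -> (\rank B <= r)%N.
  pose Q r := `[< exists B, P B /\ \rank B = r >].
  have ex : exists r, Q r by exists (\rank (0 : 'M[R]_n)); apply/asboolP; exists 0; rewrite /P F0 sub0mx mul0mx eqxx.
  have ub r : Q r -> (r <= n)%N by move=> /asboolP[B [_ <-]]; exact: rank_leq_row.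
  exists (ex_maxn ex ub); case: ex_maxnP => r /asboolP Qr h //.
  by move=> B PB; apply: h; apply/asboolP; exists B.
have /and3P[h1 h2 /eqP h3] := B0P.
by exists B0; split=> // B BF BA Be; rewrite B0r; apply: mx; rewrite /P BF BA Be eqxx.
Qed.

(** The rank drops at each step, since [ev p A] is not zero on [A] as long as [tau p A = 0]; the
    chain stops at the first flat whose functionals stay bounded near [p]. *)
Lemma chain_ex_from p A : A \in F -> exists m Ac, is_chain p m Ac A.
Proof.
have [d] := ubnP (\rank A); elim: d A => // d IH A Ad AF.
have [t0|t0] := eqVneq (tau p A) 0; last first.
  exists 0%N, (fun i => if i is 0%N then A else 0); split=> //; [by case|by case|].
  by split=> //; rewrite lt_neqAle eq_sym t0 tau_ge0.
have [A' [h1 h2 h3 h4]] := max_kernel p AF.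
have rk : (\rank A' < \rank A)%N.
  rewrite (ltn_leqif (mxrank_leqif_sup h2)); apply/negP => AA'.
  have [f fA] := ev_neq0 AF t0.
  by have /submxP[D ->] := submx_trans fA AA'; rewrite -mulmxA h3 mulmx0 mxE eqxx.
have [m [Ac [c1 c2 c3 [c4 c4'] c5]]] := IH _ (leq_trans rk (Ad : (\rank A <= d)%N)) h1.
exists m.+1, (fun i => if i is i'.+1 then Ac i' else A); split=> //.
- by case=> // i; exact: c2.
- by case=> // i; exact: c3.
- by split=> //; case=> // i; exact: c4.
- case=> [_|i]; first by rewrite c1.
  exact: c5.
Qed.

Section Chart.
Variables (p : X) (m : nat) (Ac : nat -> 'M[R]_n).
Hypothesis ch : is_chain p m Ac 1%:M.
Let E i : 'cV[R]_n := ev p (Ac i).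
Variables (K : 'M[R]_n) (lev : 'I_n -> nat) (dm : {set 'I_n}).
Hypothesis cg : complete_graded m Ac E K lev dm.

Let c0 : Ac 0 = 1%:M. Proof. by case: ch. Qed.
Let cF i : (i <= m)%N -> Ac i \in F. Proof. by case: ch => _ h _ _ _; exact: h. Qed.
Let cm i : (m < i)%N -> Ac i = 0. Proof. by case: ch => _ _ h _ _; exact: h. Qed.
Let cS i : (Ac i.+1 <= Ac i)%MS.
Proof.
have [im|im] := ltnP i m; first by case: ch => _ _ _ _ /(_ i im)[].
by rewrite (cm (leq_trans _ im : (m < i.+1)%N)) ?ltnS ?sub0mx.
Qed.
Let ct i : (i < m)%N -> tau p (Ac i) = 0.
Proof. by case: ch => _ _ _ [h _] _; exact: h. Qed.
Let ctm : 0 < tau p (Ac m). Proof. by case: ch => _ _ _ [_ h] _. Qed.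

Lemma chain_kernel i B : (i < m)%N -> B \in F -> (B <= Ac i)%MS -> B *m E i = 0 -> (B <= Ac i.+1)%MS.
Proof. by move=> im BF Bi Be; case: ch => _ _ _ _ /(_ i im)[_ _]; exact. Qed.

Lemma chain_kernelS i : (i < m)%N -> Ac i.+1 *m E i = 0.
Proof. by move=> im; case: ch => _ _ _ _ /(_ i im)[_ ->]. Qed.

(* Only one index c in dm has a given level, so Rf i is a single functional. *)
Definition f_ c v : R := fe (row c K) v.
Definition Rf i v : R := if (i < m)%N then \sum_(c in dm | lev c == i) f_ c v else 1.
Definition kap c v : R := if c \in dm then Rf (lev c).+1 v / Rf (lev c) v else f_ c v / Rf (lev c) v.
Definition kapv v : 'rV[R]_n := \row_c kap c v.

Let lev_dm c : c \in dm -> (lev c < m)%N.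
Proof. by case: cg => -[_ _ h _ _ _] /h[]. Qed.
Let lev_le c : (lev c <= m)%N. Proof. by case: cg => -[h _ _ _ _ _]; case: (h c). Qed.
Let row_lev c : (row c K <= Ac (lev c))%MS. Proof. by case: cg => -[h _ _ _ _ _]; case: (h c). Qed.
Let lev_inj : {in dm &, injective lev}. Proof. by case: cg => -[]. Qed.

Lemma sum_dm (G : 'I_n -> R) c : c \in dm -> \sum_(c' in dm | lev c' == lev c) G c' = G c.
Proof.
move=> cd; rewrite (bigD1 c) /=; last by rewrite cd eqxx.
rewrite big1 ?addr0// => c' /andP[/andP[cd' /eqP ll] ne].
by move: ne; rewrite (lev_inj cd' cd ll) eqxx.
Qed.

Lemma Rf_dm c v : c \in dm -> Rf (lev c) v = f_ c v.
Proof. by move=> cd; rewrite /Rf lev_dm// sum_dm. Qed.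

Lemma Rf_ge i v : (m <= i)%N -> Rf i v = 1.
Proof. by rewrite /Rf ltnNge => ->. Qed.

Lemma dm_ex i : (i < m)%N -> exists2 c, c \in dm & lev c = i.
Proof. by case: cg => _; exact. Qed.

(** For [i < m] the limit is the value of [E i] on the marked row, positive by the choice of sign;
    for [i = m] it is [tau p (Ac m)]. *)
Lemma RN_xt i : (i <= m)%N -> exists2 a : R, 0 < a & xt iota p (fun v => Rf i v / NA (Ac i) v) a.
Proof.
rewrite leq_eqVlt => /orP[/eqP ->|im].
  exists (tau p (Ac m)) => //; apply: xt_eq (tau_xt p (cF (leqnn m))).
  by apply: nearTW => v; rewrite Rf_ge// mul1r.
have [c cd ci] := dm_ex im; subst i.
exists ((row c K *m E (lev c)) 0 0); first by case: cg => -[_ _ /(_ c cd)[]].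
apply: xt_eq (ev_xt p (cF (lev_le c)) (row_lev c)).
by apply: nearTW => v; rewrite Rf_dm.
Qed.

Lemma fR_xt i f : (i <= m)%N -> (f <= Ac i)%MS ->
  exists2 a : R, xt iota p (fun v => fe f v / Rf i v) a & a = 0 <-> (f *m E i) 0 0 = 0.
Proof.
move=> im fi; have [a a0 ha] := RN_xt im.
exists ((f *m E i) 0 0 / a); last first.
  split=> [/eqP|->]; last by rewrite mul0r.
  by rewrite mulf_eq0 invr_eq0 (gt_eqF a0) orbF => /eqP.
apply: xt_eq (xt_div aX (lt0r_neq0 a0) (ev_xt p (cF im) fi) ha).
by apply: nearTW => v; rewrite invf_div mulrA divfK ?NA_neq0.
Qed.

Lemma iR_xt i : (i <= m)%N -> exists2 a : R, xt iota p (fun v => (Rf i v)^-1) a &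
  ((i < m)%N -> a = 0) /\ (i = m -> 0 < a).
Proof.
move=> im; have [a a0 ha] := RN_xt im.
exists (tau p (Ac i) / a).
  apply: xt_eq (xt_div aX (lt0r_neq0 a0) (tau_xt p (cF im)) ha).
  by apply: nearTW => v; rewrite invf_div mulrA mulVf ?mul1r ?NA_neq0.
by split=> [/ct ->|->]; rewrite ?mul0r// divr_gt0.
Qed.

Lemma R_pos : nearT iota p (fun v => forall i, 0 < Rf i v).
Proof.
have : \forall q \near p, forall i : 'I_m, forall v, iota v = q -> 0 < Rf i v.
  apply: near_forall => i.
  have [a a0 ha] := RN_xt (ltnW (ltn_ord i)).
  have := nearT_gt aX ha a0; rewrite /nearT; apply: filterS => q h v /h.
  by rewrite pmulr_lgt0// invr_gt0 NA_gt0.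
apply: filterS => q h v vq i; have [im|im] := ltnP i m; first exact: (h (Ordinal im)).
by rewrite Rf_ge// ltr01.
Qed.

Lemma RR_xt i : (i < m)%N -> xt iota p (fun v => Rf i.+1 v / Rf i v) 0.
Proof.
move=> im; have [lt|ge] := ltnP i.+1 m.
  have [c cd ci] := dm_ex lt.
  have [|a ha [_ h]] := @fR_xt i (row c K) (ltnW im).
    by apply: submx_trans (row_lev c) _; rewrite ci; exact: cS.
  rewrite -h; first by apply: xt_eq ha; apply: nearTW => v; rewrite -ci Rf_dm.
  have : (row c K <= Ac i.+1)%MS by rewrite -ci; exact: row_lev.
  by move=> /submxP[D ->]; rewrite -mulmxA chain_kernelS// mulmx0 mxE.
have [a ha [h _]] := iR_xt (ltnW im); rewrite -(h im).
by apply: xt_eq ha; apply: nearTW => v; rewrite (Rf_ge _ ge) mul1r.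
Qed.

Lemma kap_xt c : exists2 a : R, xt iota p (kap c) a & c \in dm -> a = 0.
Proof.
rewrite /kap; case: (boolP (c \in dm)) => cd; first by exists 0 => //; exact: RR_xt (lev_dm cd).
by have [a ha _] := fR_xt (lev_le c) (row_lev c); exists a.
Qed.

(** Monomials in the boundary coordinates. On the interior, where [u = kapv v], the products
    telescope to [rr i = 1 / R_i] and [qq i j = R_j / R_i], while [hat u c] is [f_c / R_(lev c)],
    with the value 1 for a marked row. *)
Definition rr i (u : 'rV[R]_n) : R := \prod_(c in dm | (i <= lev c)%N) u 0 c.
Definition qq i j (u : 'rV[R]_n) : R := \prod_(c in dm | (i <= lev c < j)%N) u 0 c.
Definition hat (u : 'rV[R]_n) c : R := if c \in dm then 1 else u 0 c.

Lemma qq_ge i j u : (j <= i)%N -> qq i j u = 1.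
Proof.
move=> ji; rewrite /qq big_pred0// => c; case: (c \in dm) => //=.
by apply/negbTE; rewrite negb_and -ltnNge -leqNgt; case: (ltnP (lev c) i) => // h; rewrite (leq_trans ji h).
Qed.

Lemma rr_qq i j u : (i <= j)%N -> rr i u = qq i j u * rr j u.
Proof.
move=> ij; rewrite /rr /qq (bigID (fun c => (lev c < j)%N)) /=; congr (_ * _).
  by apply: eq_bigl => c; rewrite andbA.
apply: eq_bigl => c; rewrite -leqNgt -andbA; congr (_ && _).
by case: (leqP j (lev c)) => h; rewrite ?andbF// andbT (leq_trans ij h).
Qed.

Lemma rr_ge i u : (m <= i)%N -> rr i u = 1.
Proof.
move=> mi; rewrite /rr big_pred0// => c; case: (boolP (c \in dm)) => // cd /=.
by rewrite leqNgt (leq_trans (lev_dm cd) mi).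
Qed.

Lemma rr_S c u : c \in dm -> rr (lev c) u = u 0 c * rr (lev c).+1 u.
Proof.
move=> cd; rewrite (rr_qq u (leqnSn _)); congr (_ * _); rewrite /qq.
rewrite (bigD1 c) /=; last by rewrite cd leqnn ltnSn.
rewrite big1 ?mulr1// => c' /andP[/andP[cd' h] ne].
move: h; rewrite ltnS -eqn_leq => /eqP ll.
by move: ne; rewrite (lev_inj cd' cd (esym ll)) eqxx.
Qed.

Lemma rr_kap i v : (forall i, 0 < Rf i v) -> rr i (kapv v) = (Rf i v)^-1.
Proof.
move=> Rp; have [d] := ubnP (m - i)%N; elim: d i => // d IH i di.
have [im|im] := ltnP i m; last by rewrite rr_ge// Rf_ge// invr1.
have [c cd ci] := dm_ex im; rewrite -ci rr_S// mxE /kap cd ci IH; last first.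
  by rewrite ltnS in di; apply: leq_trans di; rewrite ltn_sub2l.
by rewrite mulrC mulrA mulVf ?mul1r// gt_eqF.
Qed.

Lemma qq_kap i j v : (i <= j)%N -> (forall i, 0 < Rf i v) -> qq i j (kapv v) = Rf j v / Rf i v.
Proof.
move=> ij Rp; have := rr_qq (kapv v) ij; rewrite !rr_kap// => h.
by rewrite h mulrCA mulfV ?mulr1// gt_eqF.
Qed.

Lemma hat_kap c v : (forall i, 0 < Rf i v) -> hat (kapv v) c = f_ c v / Rf (lev c) v.
Proof.
move=> Rp; rewrite /hat mxE /kap; case: (boolP (c \in dm)) => // cd.
by rewrite -Rf_dm// mulfV// gt_eqF.
Qed.

Let Kfull : row_full K.
Proof.
have h : row_free K by apply: (graded_free cS cg.1).
by rewrite row_full_unit -row_free_unit.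
Qed.

Definition coef A : 'M[R]_n := A *m pinvmx K.

Lemma coefK A : coef A *m K = A.
Proof. by rewrite /coef mulmxKpV// submx_full. Qed.

(** Triangularity: a functional in [Ac i] is a combination of rows of level at least [i]. The
    coefficients of lower level vanish one level after the other by independence. *)
Lemma coef_lev i A j c : (A <= Ac i)%MS -> (lev c < i)%N -> coef A j c = 0.
Proof.
move=> Ai ci; set a := row j (coef A).
have aK : (a *m K <= Ac i)%MS.
  by rewrite -row_mul coefK; apply: submx_trans (row_sub j A) Ai.
have h i' c' : (i' <= i)%N -> (lev c' < i')%N -> a 0 c' = 0.
  elim: i' c' => // i' IH c' i'i; rewrite ltnS leq_eqVlt => /orP[/eqP ci'|]; last exact: IH (ltnW i'i).
  have [[_ h2 _ _ _] _] := cg.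
  pose a1 : 'rV[R]_n := \row_c (if lev c == i' then a 0 c else 0).
  have : a1 = 0.
    apply: (h2 i') => [c2 /negbTE c'i|]; first by rewrite mxE c'i.
    have -> : a1 *m K = a *m K - (a - a1) *m K by rewrite mulmxBl opprB addrC subrK.
    apply: addmx_sub; first exact: submx_trans aK (flag_mono cS i'i).
    rewrite eqmx_opp; apply: (rows_sub cS cg.1) => c2.
    rewrite ltnS leq_eqVlt => /orP[c2i|c2i].
      by rewrite !mxE c2i subrr.
    by rewrite mxE IH ?(ltnW i'i)// !mxE (ltn_eqF c2i) subr0.
  by move/rowP/(_ c'); rewrite !mxE ci' eqxx.
by have := h i c (leqnn i) ci; rewrite mxE.
Qed.

(** This is [hom_row A v] divided by [R_i], rewritten as a polynomial in the coordinates;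
    normalizing it gives [theta A] without reference to [v]. *)
Definition cnum A i (u : 'rV[R]_n) : 'rV[R]_(1 + n) :=
  row_mx (const_mx (rr i u)) (\row_j \sum_c coef A j c * (hat u c * qq i (lev c) u)).

Lemma num_kap A i v : (forall i, 0 < Rf i v) -> (A <= Ac i)%MS ->
  cnum A i (kapv v) = (Rf i v)^-1 *: hom_row A v.
Proof.
move=> Rp Ai; apply/rowP => k; case: (split_ordP k) => j -> /=.
  by rewrite row_mxEl [LHS]mxE [RHS]mxE (ord1 j) hom_rowl rr_kap// mulr1.
rewrite row_mxEr [RHS]mxE hom_rowr [LHS]mxE.
rewrite -{2}(coefK A) row_mul fe_mul mulr_sumr; apply: eq_bigr => c _.
rewrite [X in _ = _ * (X * _)]mxE.
have [ci|ci] := ltnP (lev c) i; first by rewrite (coef_lev _ Ai ci) !(mul0r, mulr0).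
rewrite [RHS]mulrCA; congr (_ * _); rewrite hat_kap// qq_kap// mulrA mulrAC -/(f_ c v).
by rewrite mulrAC divfK ?gt_eqF// mulrC.
Qed.

(** The position in the chain at which [NA A] grows like [R_i]; for a member of [F] this keeps
    [cnum A i] away from 0 near [p]. *)
Definition leveled A i := [/\ (i <= m)%N, (A <= Ac i)%MS & (i < m)%N -> A *m E i != 0].

Lemma leveled_ex A : A \in F -> exists i, leveled A i.
Proof.
move=> AF.
have ex : exists i, (i <= m)%N && (A <= Ac i)%MS by exists 0%N; rewrite c0 submx1.
have ub i : (i <= m)%N && (A <= Ac i)%MS -> (i <= m)%N by case/andP.
case: (ex_maxnP ex ub) => i /andP[im Ai] h; exists i; split=> // im'.
apply/eqP => /(chain_kernel im' AF Ai) Ai'.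
by have := h i.+1; rewrite im' Ai' ltnn => /(_ isT).
Qed.

(** The limit of the squared ratio is a sum of squares, and by the choice of [i] not all of them
    vanish. *)
Lemma leveled_pos A i : A \in F -> leveled A i ->
  exists2 a : R, 0 < a & xt iota p (fun v => NA A v ^+ 2 / Rf i v ^+ 2) a.
Proof.
move=> AF [im Ai Ae].
have [a0 h0 [h0l h0m]] := iR_xt im.
have /choice[a ha] : forall j, exists a, xt iota p (fun v => fe (row j A) v / Rf i v) a /\
    (a = 0 <-> (row j A *m E i) 0 0 = 0).
  move=> j; have [|a h1 h2] := @fR_xt i (row j A) im; last by exists a.
  exact: submx_trans (row_sub j A) Ai.
exists (a0 ^+ 2 + \sum_j a j ^+ 2); last first.
  apply: (@xt_eq _ _ _ _ _ (fun v => (Rf i v)^-1 * (Rf i v)^-1 + \sum_j (fe (row j A) v / Rf i v) * (fe (row j A) v / Rf i v))).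
    apply: nearTW => v; rewrite NA2 mulrDl mul1r; congr (_ + _); first by rewrite -expr2 exprVn.
    by rewrite mulr_suml; apply: eq_bigr => j _; rewrite -expr2 expr_div_n.
  apply: (xtD aX); first exact: (xtM aX).
  by apply: (xt_sum aX) => j _; rewrite expr2; apply: (xtM aX); case: (ha j).
have [im'|im'] := eqVneq i m.
  by apply: ltr_wpDr; [apply: sumr_ge0 => j _; exact: sqr_ge0|rewrite exprn_gt0// h0m].
have lt : (i < m)%N by rewrite ltn_neqAle im'.
apply: ltr_wpDl; first exact: sqr_ge0.
rewrite lt_neqAle sumr_ge0 ?andbT => [|j _]; last exact: sqr_ge0.
apply/eqP => /esym/eqP; rewrite psumr_eq0 => [/allP hz|j _]; last exact: sqr_ge0.
move: (Ae lt) => /eqP; apply; apply/row_matrixP => j; rewrite row_mul row0.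
apply/matrixP => x y; rewrite !ord1 [RHS]mxE; apply/(ha j).2.
by apply/eqP; rewrite -sqrf_eq0; have := hz j; rewrite mem_index_enum => /(_ isT).
Qed.

Let aP := @ambient_euclidean R n.

Lemma Sm_hat c (u : 'rV[R]_n) : smooth_near_rV u (fun u => hat u c).
Proof.
rewrite /hat; case: (c \in dm); first exact: (Sm_cst aP).
exact: sm_coord.
Qed.

Lemma Sm_qq i j (u : 'rV[R]_n) : smooth_near_rV u (qq i j).
Proof. by apply: (Sm_prod aP) => c _; exact: sm_coord. Qed.

Lemma Sm_num A i (u : 'rV[R]_n) k : smooth_near_rV u (fun u => cnum A i u 0 k).
Proof.
case: (split_ordP k) => j -> /=.
  apply: (@Sm_eq R (euclidean R n) aP u (rr i)); first by apply: near_all => w; rewrite row_mxEl mxE.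
  by apply: (Sm_prod aP) => c _; exact: sm_coord.
apply: (@Sm_eq R (euclidean R n) aP u (fun u => \sum_c coef A j c * (hat u c * qq i (lev c) u))).
  by apply: near_all => w; rewrite row_mxEr mxE.
apply: (Sm_sum aP) => c _; apply: (SmZ aP).
by apply: (SmM aP); [exact: Sm_hat|exact: Sm_qq].
Qed.

Lemma Sm_nrm_num A i (u : 'rV[R]_n) : cnum A i u != 0 -> smooth_near_rV u (fun u => nrm (cnum A i u)).
Proof.
move=> n0; apply: (Sm_sqrt aP); last by rewrite -nrm2 exprn_gt0// nrm_gt0.
by apply: (Sm_sum aP) => k _; apply: (SmX aP); exact: Sm_num.
Qed.

Lemma Sm_dir A i (u : 'rV[R]_n) k : cnum A i u != 0 ->
  smooth_near_rV u (fun u => (nrm (cnum A i u))^-1 * cnum A i u 0 k).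
Proof.
move=> n0; apply: (SmM aP); last exact: Sm_num.
by apply: (SmV aP); [exact: Sm_nrm_num|rewrite gt_eqF// nrm_gt0].
Qed.

(** Inverse of the coordinates where the boundary coordinates are positive: it solves
    [f_c v = hat u c / rr (lev c) u] for [v], using that [K] is invertible. *)
Definition chart_inv (u : 'rV[R]_n) : 'rV[R]_n := (\row_c (hat u c / rr (lev c) u)) *m invmx K^T.

Lemma f_chart_inv u c : f_ c (chart_inv u) = hat u c / rr (lev c) u.
Proof.
rewrite /f_ -fe_row /chart_inv mulmxKV ?mxE//.
by rewrite unitmx_tr -row_full_unit.
Qed.

Lemma rr_gt0 (u : 'rV[R]_n) i : (forall c, c \in dm -> 0 < u 0 c) -> 0 < rr i u.
Proof. by move=> h; apply: prodr_gt0 => c /andP[/h]. Qed.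

Lemma Rf_chart_inv u i : Rf i (chart_inv u) = (rr i u)^-1.
Proof.
have [im|im] := ltnP i m; last by rewrite Rf_ge// rr_ge// invr1.
have [c cd ci] := dm_ex im.
by rewrite -ci Rf_dm// f_chart_inv /hat cd mul1r.
Qed.

Lemma kap_chart_inv (u : 'rV[R]_n) : (forall c, c \in dm -> 0 < u 0 c) ->
  (forall i, 0 < Rf i (chart_inv u)) /\ kapv (chart_inv u) = u.
Proof.
move=> up; split=> [i|]; first by rewrite Rf_chart_inv invr_gt0 rr_gt0.
apply/rowP => c; rewrite mxE /kap; case: (boolP (c \in dm)) => cd.
  rewrite !Rf_chart_inv invrK (rr_S _ cd) mulrCA mulVf ?mulr1//.
  by rewrite gt_eqF// rr_gt0.
rewrite Rf_chart_inv f_chart_inv invrK /hat (negbTE cd) mulrVK//.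
by rewrite unitfE gt_eqF// rr_gt0.
Qed.

(** Since each [theta A] is a normalized [cnum], the ambient map [psi] is a smooth function [G] of
    the coordinates [kb], which makes [kb] an embedding near [p]. That its image fills a
    neighbourhood in the corner is shown with the explicit inverse on the interior and a limit. *)
Theorem stage_chart (W : set X) : nbhs p W -> exists (U : set X) (kb : X -> 'rV[R]_n),
  [/\ U p /\ U `<=` W, embeds U (kb : X -> euclidean R n),
      exists2 O, open O & kb @` U = O `&` @corner R n dm, forall c, c \in dm -> kb p 0 c = 0 &
      forall q, U q -> (forall v, iota v = q -> (forall i, 0 < Rf i v) /\ kb q = kapv v) /\
        forall A i, A \in F -> leveled A i -> cnum A i (kb q) != 0].
Proof.
move=> nW.
have /choice[h hh] : forall c, exists h : X -> R, [/\ smooth_near p h, c \in dm -> h p = 0 &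
    \forall q \near p, forall v, iota v = q -> h q = kap c v].
  move=> c; have [a [h [sh ha hF]] a0] := kap_xt c; exists h; split=> //.
  by rewrite ha.
pose kb q : 'rV[R]_n := \row_c h c q.
have /choice[lv hlv] : forall A, exists i, A \in F -> leveled A i.
  move=> A; have [AF|_] := boolP (A \in F); last by exists 0%N.
  by have [i hi] := leveled_ex AF; exists i.
have /choice[AK hAK] : forall j, exists AK, AK.1 \in F /\ forall v, Psi v 0 j = theta AK.1 v 0 AK.2.
  by move=> j; have [A [k hk]] := Fpsi j; exists (A, k).
pose cnum' j := cnum (AK j).1 (lv (AK j).1).
pose G (u : 'rV[R]_n) : 'rV[R]_N := \row_j ((nrm (cnum' j u))^-1 * cnum' j u 0 (AK j).2).
have n1 : \forall q \near p, forall c, smooth_near q (h c).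
  apply: near_forall => c.
  by have [sh _ _] := hh c; exact: Sm_near aX _ _ sh.
have n2 : \forall q \near p, forall v, iota v = q -> (forall i, 0 < Rf i v) /\ kb q = kapv v.
  have n2 : \forall q \near p, forall c, forall v, iota v = q -> h c q = kap c v.
    apply: near_forall => c.
    by case: (hh c).
  apply: filterS (nearI R_pos n2) => q [h1 h2] v vq; split; first exact: h1.
  by apply/rowP => c; rewrite !mxE; exact: h2.
have skb q : (forall c, smooth_near q (h c)) -> forall j, smooth_near q (fun q => kb q 0 j).
  by move=> sq j; apply: (Sm_eq aX _ (sq j)); apply: near_all => s; rewrite mxE.
have num0 A i : A \in F -> leveled A i -> cnum A i (kb p) != 0.
  move=> AF Al; have [a a0 ha] := leveled_pos AF Al.
  have : xt iota p (fun v => NA A v ^+ 2 / Rf i v ^+ 2) (nrm (cnum A i (kb p)) ^+ 2).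
    exists (fun q => nrm (cnum A i (\row_c h c q)) ^+ 2); split=> //.
      apply: (Sm_eq aX (f := fun q => \sum_k (cnum A i (\row_c h c q)) 0 k ^+ 2)).
        by apply: near_all => s; rewrite nrm2.
      apply: (Sm_sum aX) => k _; apply: (SmX aX).
      apply: (Sm_comp aX (h := fun u => cnum A i u 0 k)) => [c|]; first by case: (hh c).
      exact: Sm_num.
    apply: filterS n2 => q h2 v vq; have [Rp /= E'] := h2 v vq.
    have [_ Ai _] := Al; rewrite -/(kb q) E' num_kap// nrmZ gtr0_norm ?invr_gt0//.
    by rewrite exprMn exprVn mulrC.
  move=> /(xt_uniq aX dX ha) aE; apply/eqP => n0.
  by move: a0; rewrite aE n0 /nrm big1 ?sqrtr0 ?expr0n ?ltxx// => k _; rewrite mxE expr0n.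
have openum A i : open [set u : 'rV[R]_n | cnum A i u != 0].
  rewrite openE => u /= u0; have [k uk] : exists k, cnum A i u 0 k != 0.
    apply: contrapT => /forallNP hk; move/eqP: u0; apply; apply/rowP => k; rewrite [RHS]mxE.
    by have := hk k => /negP; rewrite negbK => /eqP.
  have := near_cvg (sm_cont (Sm_num A i u k)) (open_nbhs_nbhs (conj (@open_neq R 0) uk)).
  by apply: filterS => w; apply: contraNneq => ->; rewrite mxE.
pose VN : set 'rV[R]_n := [set u | forall A i, A \in F -> leveled A i -> cnum A i u != 0].
have nVN u : VN u -> \forall w \near u, VN w.
  move=> Vu.
  have : \forall w \near u, forall (j : 'I_(size F)) (i : 'I_m.+1), leveled (nth 0 F j) i -> cnum (nth 0 F j) i w != 0.
    apply: (@filter_forall _ _ (fun (j : 'I_(size F)) w => forall i : 'I_m.+1, leveled (nth 0 F j) i -> cnum (nth 0 F j) i w != 0) (nbhs u)) => j.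
    apply: (@filter_forall _ _ (fun (i : 'I_m.+1) w => leveled (nth 0 F j) i -> cnum (nth 0 F j) i w != 0) (nbhs u)) => i.
    have [Al|nAl] := pselect (leveled (nth 0 F j) i); last by apply: (@nearW _ (nbhs u)) => w /nAl.
    have : cnum (nth 0 F j) i u != 0 by apply: Vu => //; rewrite mem_nth.
    by move=> u0; apply: filterS (open_nbhs_nbhs (conj (openum _ _) u0)) => w.
  apply: filterS => w hw A i AF Al; have [im _ _] := Al.
  have jF : (index A F < size F)%N by rewrite index_mem.
  have := hw (Ordinal jF) (Ordinal (im : (i < m.+1)%N)).
  by rewrite /= nth_index// => /(_ Al).
have VN0 : VN (kb p) by move=> A i; exact: num0.
have ckb q : (forall c, smooth_near q (h c)) -> kb s @[s --> q] --> kb q.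
  by move=> sq; exact: (Sm_row_cvg aX sq).
have n3 : \forall q \near p, VN (kb q).
  exact: near_cvg (ckb p (nbhs_singleton n1)) (nVN _ VN0).
have sG u j : VN u -> smooth_near_rV u (fun u => G u 0 j).
  move=> Vu; have [AF _] := hAK j.
  apply: (@Sm_eq R (euclidean R n) aP u (fun u => (nrm (cnum' j u))^-1 * cnum' j u 0 (AK j).2)).
    by apply: near_all => w; rewrite [RHS]mxE.
  by apply: Sm_dir; apply: Vu => //; exact: hlv.
have GE v : (forall i, 0 < Rf i v) -> G (kapv v) = Psi v.
  move=> Rp; apply/rowP => j; rewrite [LHS]mxE; have [AF ->] := hAK j.
  have [_ Ai _] := hlv _ AF; rewrite /cnum' num_kap//.
  have := @normalizeZ R _ (Rf (lv (AK j).1) v)^-1 (hom_row (AK j).1 v).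
  by rewrite invr_gt0 => /(_ (Rp _))/rowP/(_ (AK j).2); rewrite [LHS]mxE.
have n4 : \forall q \near p, psi q = G (kb q).
  have : \forall q \near p, forall j, psi q 0 j = G (\row_c h c q) 0 j.
    apply: near_forall => j.
    apply: (Sm_eq_dense aX dX); first exact: Sm_embed_coord epsi I.
      apply: (Sm_comp aX (h := fun u => G u 0 j)) => [c|]; first by case: (hh c).
      exact: sG.
    apply: filterS n2 => q h2 v vq; have [Rp E'] := h2 v vq.
    by rewrite -/(kb q) E' GE// -vq; have [_ _ ->] := pr.
  by apply: filterS => q hq; apply/rowP => j; exact: hq.
pose U1 := interior [set q | [/\ W q, forall c, smooth_near q (h c), forall v, iota v = q -> (forall i, 0 < Rf i v) /\ kb q = kapv v, VN (kb q) & psi q = G (kb q)]].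
have U1p : U1 p by apply: filterS (nearI nW (nearI (nearI n1 n2) (nearI n3 n4))) => q [? [[? ?] [? ?]]].
have oU1 : open U1 by exact: open_interior.
have U1E q : U1 q -> [/\ W q, forall c, smooth_near q (h c), forall v, iota v = q -> (forall i, 0 < Rf i v) /\ kb q = kapv v, VN (kb q) & psi q = G (kb q)].
  exact: interior_subset.
have U1c q : U1 q -> @corner R n dm (kb q).
  move=> Uq c cd; rewrite mxE; have [_ sq _ _ _] := U1E q Uq.
  apply: (Sm_ge_dense aX dX (sq c)).
  apply: filterS (open_nbhs_nbhs (conj oU1 Uq)) => q' Uq' v vq.
  have [_ _ /(_ v vq)[Rp E'] _ _] := U1E _ Uq'.
  have := congr1 (fun u : 'rV[R]_n => u 0 c) E'; rewrite !mxE => ->.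
  by rewrite /kap cd divr_ge0// ltW.
(* A row [u] of the corner is approached by [u + t *: eps], whose boundary coordinates are positive
   and which therefore comes from an interior point; as the range of [psi] is closed, there is a
   point over [u]. *)
have claim : \forall u \near kb p, corner dm u -> exists2 q, U1 q & kb q = u.
  have [B nB sB] := embeds_nbhsE epsi I (open_nbhs_nbhs (conj oU1 U1p)).
  have [B' [oB' B'p] sB'] : exists2 B', open B' /\ B' (psi p) & B' `<=` B.
    by move: nB; rewrite nbhsE; case=> B' [? ?] ?; exists B'.
  have cG u : VN u -> G w @[w --> u] --> G u.
    move=> Vu; have := @Sm_row_cvg R (euclidean R n) aP N (fun j u => G u 0 j) u (fun j => sG u j Vu).
    by rewrite rV_row; under eq_fun do rewrite rV_row.
  have pG : psi p = G (kb p) by have [] := U1E p U1p.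
  have nB' : \forall u \near kb p, B' (G u).
    by apply: (near_cvg (cG _ VN0)); apply: open_nbhs_nbhs; rewrite -pG.
  apply: filterS (nearI nB' (nVN _ VN0)) => u [Bu Vu] cu.
  pose eps : 'rV[R]_n := \row_c (c \in dm)%:R.
  have lim0 : u + t *: eps @[t --> (0:R)^'+] --> u.
    by apply: cvg_at_right_filter; exact: cvg_line.
  have pos t : 0 < t -> forall c, c \in dm -> 0 < (u + t *: eps) 0 c.
    by move=> t0 c cd; rewrite !mxE cd mulr1 ltr_wpDl//; exact: cu.
  have PE t : 0 < t -> Psi (chart_inv (u + t *: eps)) = G (u + t *: eps).
    by move=> /pos/kap_chart_inv[Rp E']; rewrite -GE// E'.
  have Gl : G (u + t *: eps) @[t --> (0:R)^'+] --> G u.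
    exact: (@cvg_comp _ _ _ (fun t => u + t *: eps) G _ (nbhs u) _ lim0 (cG u Vu)).
  have [q qE] : exists q, psi q = G u.
    have [_ Er _] := pr; have : closure (range Psi) (G u).
      move=> D nD; have nD' : \forall t \near (0:R)^'+, D (G (u + t *: eps)) by exact: Gl nD.
      have [t [t0 Dt]] := filter_ex (rightI (nbhs_right_gt 0) nD').
      by exists (G (u + t *: eps)); split=> //; rewrite -PE//; exists (chart_inv (u + t *: eps)).
    by rewrite -Er => -[q _ qE]; exists q.
  have Uq : U1 q by apply: sB; split=> //; apply: sB'; rewrite qE.
  exists q => //.
  have il : iota (chart_inv (u + t *: eps)) @[t --> (0:R)^'+] --> q.
    move=> D /(embeds_nbhsE epsi I)[D' nD' sD].
    have nD2 : \forall t \near (0:R)^'+, D' (G (u + t *: eps)) by apply: Gl; rewrite -qE.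
    apply: filterS (rightI (nbhs_right_gt 0) nD2) => t [t0 Dt]; apply: sD; split=> //.
    by rewrite /preimage /=; have [_ _ ->] := pr; rewrite PE.
  have [_ sq _ _ _] := U1E q Uq.
  have kl : kb (iota (chart_inv (u + t *: eps))) @[t --> (0:R)^'+] --> kb q.
    exact: (@cvg_comp _ _ _ (fun t => iota (chart_inv (u + t *: eps))) kb _ (nbhs q) _ il (ckb q sq)).
  have nU1 : \forall t \near (0:R)^'+, U1 (iota (chart_inv (u + t *: eps))).
    by apply: (near_cvg il); apply: open_nbhs_nbhs.
  apply/rowP => c.
  apply: (near_eq_lim (at_right_proper_filter (0:R)) (f := fun t => kb (iota (chart_inv (u + t *: eps))) 0 c) (g := fun t => (u + t *: eps) 0 c)).
  - exact: (@cvg_comp _ _ _ _ (fun w : 'rV[R]_n => w 0 c) _ _ _ kl (@coord_continuous _ _ _ 0 c _)).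
  - exact: (@cvg_comp _ _ _ _ (fun w : 'rV[R]_n => w 0 c) _ _ _ lim0 (@coord_continuous _ _ _ 0 c _)).
  apply: filterS (rightI (nbhs_right_gt 0) nU1) => t [t0 Ut].
  have [_ _ /(_ _ erefl)[_ ->] _ _] := U1E _ Ut.
  by rewrite (kap_chart_inv (pos t t0)).2.
have {}claim : nbhs (kb p) [set u | corner dm u -> exists2 q, U1 q & kb q = u] by exact: claim.
move: claim; rewrite nbhsE; case=> Q [oO Op] sO.
pose U := U1 `&` kb @^-1` Q.
have oU : open U.
  rewrite openE => q [Uq Oq]; have [_ sq _ _ _] := U1E q Uq.
  apply: nearI; first exact: open_nbhs_nbhs.
  by apply: (near_cvg (ckb q sq)); apply: open_nbhs_nbhs.
exists U, kb; split.
- by split=> [//|q [/U1E[]]].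
- apply: (embeds_intro aP epsi oU).
    move=> q [Uq _]; have [_ sq _ _ _] := U1E q Uq.
    by apply: (smooth_pull aX (@embeds_id R n) I); [exact: near_all|exact: skb].
  move=> q [Uq _] j; have [_ _ _ Vq _] := U1E q Uq.
  exists (fun u => G u 0 j); first exact: sG.
  by apply: near_all => u s [/U1E[_ _ _ _ ->] _] <-.
- exists Q => //; apply/seteqP; split=> [_ [q [Uq Oq] <-]|u [Ou cu]].
    by split=> //; exact: U1c.
  by have [q Uq qu] := sO u Ou cu; exists q => //; split=> //; rewrite /preimage /= qu.
- by move=> c cd; rewrite mxE; have [_ ->] := hh c.
- by move=> q [/U1E[_ _ h2 h3 _] _]; split.
Qed.

End Chart.

End Stage.

(** * Iterated blow-ups *)

Section StageFaces.
Context {R : realType} (n : nat).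
Implicit Types (A B C : 'M[R]_n) (F : seq 'M[R]_n).

(* F lists 0, 1 and the flats blown up so far; X is the closure of the image of
   the maps theta A, A in F. *)
Definition is_stage (X : germ_space R) (iota : 'rV[R]_n -> X) N (Psi : 'rV[R]_n -> 'rV[R]_N)
    (psi : X -> 'rV[R]_N) F := [/\ presents iota Psi psi, 1%:M \in F /\ 0 \in F,
      forall A B, A \in F -> B \in F -> exists2 C, C \in F & (C :=: A + B)%MS,
      forall A, A \in F -> forall p k, exists a, xt iota p (fun v => theta A v 0 k) a &
      forall j, exists A k, A \in F /\ forall v, Psi v 0 j = theta A v 0 k].

(** Squares are used so that the quotient is rational in the functionals; [NA] itself involves a
    square root. *)
Definition q2 A B (v : 'rV[R]_n) : R := NA A v ^+ 2 / NA B v ^+ 2.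

Lemma q2_gt0 A B v : 0 < q2 A B v.
Proof. by rewrite divr_gt0// exprn_gt0// NA_gt0. Qed.

(* The lift of the center of A: NA A is negligible against every larger NA B. *)
Definition face (X : germ_space R) (iota : 'rV[R]_n -> X) F A : set X :=
  [set p | forall B, B \in F -> (A <= B)%MS -> ~~ (B <= A)%MS -> xt iota p (q2 A B) 0].

(** Adapted coordinates indexed by ['I_n] instead of ['I_(sdim X)], which spares transports along
    [sdim X = n]. *)
Definition kchart (X : germ_space R) (p : X) (U : set X) (kb : X -> 'rV[R]_n) (D : {set 'I_n}) :=
  [/\ U p, embeds U (kb : X -> euclidean R n), exists2 O, open O & kb @` U = O `&` @corner R n D &
      forall c, c \in D -> kb p 0 c = 0].

Lemma kchart_near (X : germ_space R) (p q : X) U kb D (P : X -> Prop) : kchart p U kb D -> U q ->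
  (\forall s \near q, P s) -> \forall u \near kb q, corner D u -> exists s, [/\ U s, kb s = u & P s].
Proof.
move=> [_ e [Q oQ E] _] Uq nP; have [B nB sB] := embeds_nbhsE e Uq nP.
have Qq : Q (kb q) by have [] : (Q `&` corner D) (kb q) by rewrite -E; exists q.
have nQ : nbhs (kb q) Q by exact: open_nbhs_nbhs.
apply: filterS (nearI nB nQ) => u [Bu Qu] cu.
have [s Us su] : (kb @` U) u by rewrite E.
by exists s; split=> //; apply: sB; split=> //; rewrite /preimage /= su.
Qed.

Lemma kchart_perturb (X : germ_space R) (p q : X) U kb D (P : X -> Prop) i : kchart p U kb D -> U q ->
  (\forall s \near q, P s) -> exists (t : R) s, [/\ 0 < t, U s, kb s = kb q + t *: delta_mx 0 i & P s].
Proof.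
move=> kc Uq nP; have n1 := kchart_near kc Uq nP.
have cq : corner D (kb q).
  by have [_ _ [Q oQ E] _] := kc; have [] : (Q `&` corner D) (kb q) by rewrite -E; exists q.
have d0 j : j \in D -> kb q 0 j = 0 -> 0 <= (delta_mx 0 i : 'rV[R]_n) 0 j.
  by move=> _ _; rewrite mxE ler0n.
have n2 := corner_near cq d0 n1.
have [t [[h hc] t0]] := filter_ex (rightI n2 (nbhs_right_gt 0)).
by have [s [Us sE Ps]] := h hc; exists t, s.
Qed.

Section OneStage.
Variables (X : germ_space R) (iota : 'rV[R]_n -> X) (N : nat) (Psi : 'rV[R]_n -> 'rV[R]_N).
Variables (psi : X -> 'rV[R]_N) (F : seq 'M[R]_n).
Hypothesis st : is_stage iota Psi psi F.

Let pr : presents iota Psi psi. Proof. by case: st. Qed.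
Let F1 : 1%:M \in F. Proof. by case: st => _ []. Qed.
Let F0 : 0 \in F. Proof. by case: st => _ []. Qed.
Let Fsum A B : A \in F -> B \in F -> exists2 C, C \in F & (C :=: A + B)%MS.
Proof. by case: st => _ _ h _ _; exact: h. Qed.
Let Fxt A : A \in F -> forall p k, exists a, xt iota p (fun v => theta A v 0 k) a.
Proof. by case: st => _ _ _ h _; exact: h. Qed.
Let aX : ambient X := presents_ambient pr.
Let dX := presents_dense pr.

Local Notation tau := (tau iota).
Local Notation ev := (ev iota).
Local Notation chain p m Ac := (is_chain iota F p m Ac 1%:M).

Lemma chain_ex p : exists m Ac, chain p m Ac.
Proof. exact: (chain_ex_from pr F0 Fsum Fxt). Qed.

Lemma q2_xt p A B : B \in F -> (A <= B)%MS ->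
  xt iota p (q2 A B) (tau p B ^+ 2 + \sum_j (row j A *m ev p B) 0 0 ^+ 2).
Proof.
move=> BF AB.
apply: (@xt_eq _ _ _ _ _ (fun v => (NA B v)^-1 * (NA B v)^-1 + \sum_j (fe (row j A) v / NA B v) * (fe (row j A) v / NA B v))).
  apply: nearTW => v; rewrite /q2 NA2 mulrDl mul1r; congr (_ + _); first by rewrite -expr2 exprVn.
  by rewrite mulr_suml; apply: eq_bigr => j _; rewrite -expr2 expr_div_n.
apply: (xtD aX); first by rewrite expr2; apply: (xtM aX); exact: (tau_xt Fxt).
apply: (xt_sum aX) => j _; rewrite expr2; apply: (xtM aX); apply: (ev_xt pr Fxt) => //;
  exact: submx_trans (row_sub j A) AB.
Qed.

Lemma q2_zero p A B : B \in F -> (A <= B)%MS -> xt iota p (q2 A B) 0 -> tau p B = 0 /\ A *m ev p B = 0.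
Proof.
move=> BF AB /(xt_uniq aX dX (q2_xt p BF AB)) /eqP.
rewrite paddr_eq0 ?sqr_ge0 ?sumr_ge0// => [|j _]; last exact: sqr_ge0.
rewrite sqrf_eq0 => /andP[/eqP t0]; rewrite psumr_eq0 => [/allP h|j _]; last exact: sqr_ge0.
split=> //; apply/row_matrixP => j; rewrite row_mul row0; apply/matrixP => x y; rewrite !ord1 [RHS]mxE.
by apply/eqP; rewrite -sqrf_eq0; have := h j; rewrite mem_index_enum => /(_ isT).
Qed.

Lemma face_closed A : closed (face iota F A).
Proof.
have cl B : B \in F -> (A <= B)%MS -> closed [set p | xt iota p (q2 A B) 0].
  move=> BF AB; have [|Fb [sF _ hF]] := @xt_extend _ _ aX _ iota dX (q2 A B).
    by move=> p; eexists; exact: q2_xt.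
  have -> : [set p | xt iota p (q2 A B) 0] = Fb @^-1` [set 0].
    by apply/seteqP; split=> p /= /hF.
  apply: closed_comp (@closed_eq _ 0) => p _; exact: Sm_cont aX _ _ (sF p).
have -> : face iota F A = \bigcap_(B in [set B | [/\ B \in F, (A <= B)%MS & ~~ (B <= A)%MS]])
    [set p | xt iota p (q2 A B) 0].
  by apply/seteqP; split=> p h B; [case=> b1 b2 b3; exact: h|move=> b1 b2 b3; apply: h].
by apply: closed_bigI => B [BF AB _]; exact: cl.
Qed.

Lemma face_iota A v : ~~ (1%:M <= A)%MS -> ~ face iota F A (iota v).
Proof.
move=> A1 fA; have h := xt_iota (fA _ F1 (submx1 A) A1).
by have := q2_gt0 A 1%:M v; rewrite -h ltxx.
Qed.

Lemma off_face A p : ~ face iota F A p -> forall k, exists a, xt iota p (fun v => theta A v 0 k) a.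
Proof.
move=> np k; have [B [BF AB BA nx]] : exists B, [/\ B \in F, (A <= B)%MS, ~~ (B <= A)%MS & ~ xt iota p (q2 A B) 0].
  by apply: contrapT => h; apply: np => B BF AB BA; apply: contrapT => nx; apply: h; exists B.
have hq := q2_xt p BF AB; set a := (X in xt _ _ _ X) in hq.
have a0 : a != 0 by apply/eqP => a0; apply: nx; rewrite -a0.
have a1 : 0 < a by rewrite lt_neqAle eq_sym a0 addr_ge0 ?sqr_ge0 ?sumr_ge0// => j _; exact: sqr_ge0.
have hs : xt iota p (fun v => NA A v / NA B v) (Num.sqrt a).
  apply: xt_eq (xt_sqrt aX a1 hq); apply: nearTW => v.
  by rewrite /q2 -expr_div_n sqrtr_sqr ger0_norm// divr_ge0 ?ltW ?NA_gt0.
have s0 : Num.sqrt a != 0 by rewrite gt_eqF// sqrtr_gt0.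
case: (split_ordP k) => j -> /=.
  eexists; apply: xt_eq (xt_div aX s0 (tau_xt Fxt p BF) hs); apply: nearTW => v.
  by rewrite (ord1 j) thetal invf_div mulrA mulVf ?mul1r ?NA_neq0.
have rB : (row j A <= B)%MS := submx_trans (row_sub j A) AB.
eexists; apply: xt_eq (xt_div aX s0 (ev_xt pr Fxt p BF rB) hs); apply: nearTW => v.
by rewrite thetar invf_div mulrA divfK ?NA_neq0.
Qed.

Section AtPoint.
Variables (p : X) (m : nat) (Ac : nat -> 'M[R]_n).
Hypothesis ch : chain p m Ac.

Let cF i : (i <= m)%N -> Ac i \in F. Proof. by case: ch => _ h _ _ _; exact: h. Qed.
Let cm i : (m < i)%N -> Ac i = 0. Proof. by case: ch => _ _ h _ _; exact: h. Qed.
Let c0 : Ac 0 = 1%:M. Proof. by case: ch. Qed.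
Let ctm : 0 < tau p (Ac m). Proof. by case: ch => _ _ _ []. Qed.
Let ct i : (i < m)%N -> tau p (Ac i) = 0. Proof. by case: ch => _ _ _ [h _] _; exact: h. Qed.

Lemma chain_flag : [/\ row_full (Ac 0), forall i, (Ac i.+1 <= Ac i)%MS,
  forall i, (i < m)%N -> Ac i.+1 *m ev p (Ac i) = 0 &
  forall i, (i < m)%N -> exists f : 'rV[R]_n, (f <= Ac i)%MS /\ (f *m ev p (Ac i)) 0 0 != 0].
Proof.
split.
- by rewrite c0 row_full_unit unitmx1.
- move=> i; have [im|im] := ltnP i m; first by case: ch => _ _ _ _ /(_ i im)[].
  by rewrite (cm (leq_trans _ im : (m < i.+1)%N)) ?ltnS ?sub0mx.
- by move=> i im; case: ch => _ _ _ _ /(_ i im)[].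
- move=> i im; have [f f1 f2] := ev_neq0 pr Fxt (cF (ltnW im)) (ct im).
  by exists f.
Qed.

Lemma chain_next i B : (i < m)%N -> B \in F -> (B <= Ac i)%MS -> B *m ev p (Ac i) = 0 -> (B <= Ac i.+1)%MS.
Proof. by move=> im BF Bi Be; case: ch => _ _ _ _ /(_ i im)[_ _]; exact. Qed.

Lemma tau0_gt0 : tau p (0 : 'M[R]_n) = 1.
Proof.
apply: (xt_uniq aX dX (tau_xt Fxt p F0)); apply: xt_eq (xt_cst aX iota p 1); apply: nearTW => v.
apply/esym/eqP; rewrite invr_eq1; have := NA2 (0 : 'M[R]_n) v.
rewrite big1 ?addr0 => [/eqP|j _]; last by rewrite row0 fe0 expr0n.
by rewrite sqrp_eq1// ltW// NA_gt0.
Qed.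

Lemma face_step A i : (i <= m)%N -> (A <= Ac i)%MS -> ~~ (Ac i <= A)%MS -> face iota F A p ->
  (i < m)%N /\ A *m ev p (Ac i) = 0.
Proof.
move=> im Ai nA fA; have [t0 e0] := q2_zero (cF im) Ai (fA _ (cF im) Ai nA).
split=> //; rewrite ltn_neqAle im andbT; apply/eqP => ii.
by move: ctm; rewrite -ii t0 ltxx.
Qed.

(** As long as [Ac i] is strictly larger than [A], the condition at [B = Ac i] says that [A] is
    negligible against it, hence [A <= Ac i.+1]. The descent can only end at [A] itself. *)
Lemma face_in_chain A : A \in F -> face iota F A p -> exists j, (j <= m)%N /\ (Ac j :=: A)%MS.
Proof.
move=> AF fA.
have h d i : (m - i < d)%N -> (i <= m)%N -> (A <= Ac i)%MS -> exists j, (j <= m)%N /\ (Ac j :=: A)%MS.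
  elim: d i => // d IH i di im Ai.
  have [iA|iA] := boolP (Ac i <= A)%MS; first by exists i; split=> //; apply/eqmxP; rewrite iA.
  have [im' e0] := face_step im Ai iA fA.
  apply: (IH i.+1) => //; last exact: chain_next.
  by rewrite ltnS in di; apply: leq_trans di; rewrite ltn_sub2l.
by apply: (h m.+1 0%N) => //; rewrite ?subn0 ?c0 ?submx1.
Qed.

Lemma leveled_chain j : (j < m)%N -> leveled iota p m Ac (Ac j) j.
Proof.
move=> jm; split; [exact: ltnW|exact: submx_refl|move=> _].
have [_ _ _ /(_ j jm)[f [/submxP[D ->] fe]]] := chain_flag.
by apply: contraNneq fe => e0; rewrite -mulmxA e0 mulmx0 mxE.
Qed.

Section WithChart.
Variables (K : 'M[R]_n) (lev : 'I_n -> nat) (dm : {set 'I_n}).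
Hypothesis cg : complete_graded m Ac (fun i => ev p (Ac i)) K lev dm.
Variables (U : set X) (kb : X -> 'rV[R]_n).
Hypothesis kc : kchart p U kb dm.
Hypothesis hU : forall q, U q -> (forall v, iota v = q -> (forall i, 0 < Rf m K lev dm i v) /\ kb q = kapv m K lev dm v) /\
        forall A i, A \in F -> leveled iota p m Ac A i -> cnum K lev dm A i (kb q) != 0.

(** [NA A] is [R_i] times the norm of [cnum A i], likewise for [B], and [qq j i] is [R_i / R_j]. The
    formula holds up to the boundary since the norm in the denominator does not vanish there. *)
Lemma q2_chart q A i B j : U q -> (A <= Ac i)%MS -> B \in F -> leveled iota p m Ac B j -> (j <= i)%N ->
  xt iota q (q2 A B) ((nrm (cnum K lev dm A i (kb q)) / nrm (cnum K lev dm B j (kb q)) * qq lev dm j i (kb q)) ^+ 2).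
Proof.
move=> Uq Ai BF Bj ji.
have [_ e _ _] := kc.
have skb k : smooth_near q (fun q => kb q 0 k) by exact: Sm_embed_coord e Uq.
have nu0 : cnum K lev dm B j (kb q) != 0 by case: (hU Uq) => _; exact.
have sc (G : 'rV[R]_n -> R) : smooth_near_rV (kb q) G -> smooth_near q (fun s => G (kb s)).
  move=> sG; have := @Sm_comp R X aX n q (fun k s => kb s 0 k) G skb.
  by rewrite rV_row => /(_ sG); apply: (Sm_eq aX); apply: near_all => s; rewrite rV_row.
have sn C l : smooth_near q (fun s => nrm (cnum K lev dm C l (kb s)) ^+ 2).
  apply: (Sm_eq aX (f := fun s => \sum_k cnum K lev dm C l (kb s) 0 k ^+ 2)); first by apply: near_all => s; rewrite nrm2.
  apply: (Sm_sum aX) => k _; apply: (SmX aX); apply: (sc (fun u => cnum K lev dm C l u 0 k)); exact: Sm_num.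
exists (fun s => nrm (cnum K lev dm A i (kb s)) ^+ 2 / nrm (cnum K lev dm B j (kb s)) ^+ 2 * qq lev dm j i (kb s) ^+ 2); split.
- apply: (SmM aX); last by apply: (SmX aX); apply: (sc (qq lev dm j i)); exact: Sm_qq.
  by apply: (Sm_div aX) => //; rewrite expf_neq0// gt_eqF// nrm_gt0.
- by rewrite exprMn expr_div_n.
have nU : \forall s \near q, U s by exact: (embeds_dom e).
have [f0 fS fE fN] := chain_flag.
apply: filterS nU => s Us v vs; have [/(_ v vs)[Rp kE] _] := hU Us.
have [_ Bj' _] := Bj.
rewrite kE (num_kap ch cg Rp Ai) (num_kap ch cg Rp Bj') (qq_kap cg) //.
rewrite !nrmZ !gtr0_norm ?invr_gt0// -expr_div_n -exprMn /q2 -expr_div_n; congr (_ ^+ 2).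
rewrite -/(NA A v) -/(NA B v).
have := gt_eqF (Rp i); have := gt_eqF (Rp j); have := NA_neq0 B v.
move: (NA A v) (NA B v) (Rf _ _ _ _ i v) (Rf _ _ _ _ j v) => a b ri rj b0 rj0 ri0.
by field; rewrite b0 ri0 rj0.
Qed.

Lemma dm_at i c : (i < m)%N -> c \in dm -> lev c = i -> forall u : 'rV[R]_n, qq lev dm i i.+1 u = u 0 c.
Proof.
move=> im cd ci u; have h := rr_S cg u cd; have := rr_qq lev dm u (leqnSn i).
rewrite -ci h /qq (bigD1 c) /= ?cd ?leqnn ?ltnSn// big1 ?mulr1// => c' /andP[/andP[cd' /andP[h1 h2]] ne].
have ll : lev c' = lev c by apply/eqP; rewrite eqn_leq h1 -ltnS h2.
by move: ne; have [[_ _ _ inj _] _] := cg; rewrite (inj _ _ cd' cd ll) eqxx.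
Qed.

End WithChart.
End AtPoint.

Theorem chart_ex p m Ac k (K : 'M[R]_(k, n)) lev dm (W : set X) : chain p m Ac ->
  graded m Ac (fun i => ev p (Ac i)) K lev dm -> nbhs p W ->
  exists (K' : 'M[R]_n) lev' dm' (g : 'I_k -> 'I_n) U kb,
  [/\ complete_graded m Ac (fun i => ev p (Ac i)) K' lev' dm',
      [/\ injective g, forall c, row (g c) K' = row c K, forall c, lev' (g c) = lev c &
        forall c, (g c \in dm') = (c \in dm)], kchart p U kb dm', U `<=` W &
      forall q, U q -> (forall v, iota v = q -> (forall i, 0 < Rf m K' lev' dm' i v) /\ kb q = kapv m K' lev' dm' v) /\
        forall A i, A \in F -> leveled iota p m Ac A i -> cnum K' lev' dm' A i (kb q) != 0].
Proof.
move=> ch g nW; have [f0 fS fE fN] := chain_flag ch.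
have fm i : (m < i)%N -> Ac i = 0 by case: ch => _ _ h _ _; exact: h.
have [K' [lev' [dm' [g' [cg h]]]]] := graded_extend f0 fS fm fE fN g.
have [_ _ _ _ Fpsi] := st.
have [U [kb [[Up UW] e im z hU]]] := stage_chart pr Fxt Fpsi ch cg nW.
by exists K', lev', dm', g', U, kb; split.
Qed.

(* Nothing in F lies strictly between 0 and A, so that in the
   chart the lift of A is cut out by the last coordinates only. *)
Definition next_center A := [/\ A != 0, forall B, B \in F -> (B <= A)%MS -> B = 0 &
      forall B, B \in F -> B != 0 -> exists2 C, C \in F & (C :=: A + B)%MS].

Lemma next_not_full A : next_center A -> ~~ (1%:M <= A)%MS.
Proof.
move=> [A0 h _]; apply/negP => /(h _ F1) z; move: A0.
by rewrite -[A]mulmx1 z mulmx0 eqxx.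
Qed.

(** As long as [Ac i.+1] is not 0, its sum with [A] is a member of [F] negligible against [Ac i], so
    it lies in [Ac i.+1] by maximality. Hence [A] lies in the last nonzero member of the chain. *)
Lemma face_chain p m Ac A : chain p m Ac -> next_center A -> face iota F A p ->
  exists i, [/\ m = i.+1, Ac m = 0, (A <= Ac i)%MS & A *m ev p (Ac i) = 0].
Proof.
move=> ch [A0 N1 N2] fA.
have c0 : Ac 0 = 1%:M by case: ch.
have cF i : (i <= m)%N -> Ac i \in F by case: ch => _ h _ _ _; exact: h.
have h d i : (m - i < d)%N -> (i <= m)%N -> (A <= Ac i)%MS ->
   exists i, [/\ m = i.+1, Ac m = 0, (A <= Ac i)%MS & A *m ev p (Ac i) = 0].
  elim: d i => // d IH i di im Ai.
  have An : ~~ (Ac i <= A)%MS.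
    apply/negP => /(N1 _ (cF i im)) z; move: A0.
    by move: Ai; rewrite z submx0 => ->.
  have [im' e0] := face_step ch im Ai An fA.
  have [z|z] := eqVneq (Ac i.+1) 0.
    exists i; split=> //.
      apply/eqP; rewrite eqn_leq im' andbT leqNgt; apply/negP => lt.
      have : tau p (Ac i.+1) = 0 by case: ch => _ _ _ [h _] _; exact: h.
      by rewrite z tau0_gt0 => /eqP; rewrite oner_eq0.
    have [<-//|] := eqVneq i.+1 m; rewrite neq_ltn => /orP[lt|]; last by rewrite ltnNge im'.
    have : tau p (Ac i.+1) = 0 by case: ch => _ _ _ [h _] _; exact: h.
    by rewrite z tau0_gt0 => /eqP; rewrite oner_eq0.
  have [C CF CE] := N2 _ (cF _ im') z.
  have [_ fS fE _] := chain_flag ch.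
  have CAi : (C <= Ac i)%MS by rewrite CE addsmx_sub Ai fS.
  have Ce : C *m ev p (Ac i) = 0.
    have /submxP[D ->] : (C <= col_mx A (Ac i.+1))%MS by rewrite CE addsmxE.
    by rewrite -mulmxA mul_col_mx e0 (fE i im') col_mx0 mulmx0.
  apply: (IH i.+1) => //; first by rewrite ltnS in di; apply: leq_trans di; rewrite ltn_sub2l.
  by apply: submx_trans (chain_next ch im' CF CAi Ce); rewrite CE addsmxSl.
by apply: (h m.+1 0%N) => //; rewrite ?subn0 ?c0 ?submx1.
Qed.

(** Since [A] is negligible against the last nonzero flat, a basis of it is a graded system of level
    [i] in which no row is marked. *)
Lemma graded_last p i Ac A : chain p i.+1 Ac -> Ac i.+1 = 0 -> (A <= Ac i)%MS -> A *m ev p (Ac i) = 0 ->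
  graded i.+1 Ac (fun i => ev p (Ac i)) (row_base A) (fun=> i) finset.set0.
Proof.
move=> ch z Ai e0; split.
- move=> c; split=> //; apply: submx_trans (row_sub _ _) _; by rewrite eq_row_base.
- move=> j a ha; have [->|ij] := eqVneq j i; last first.
    by move=> _; apply/rowP => c; rewrite mxE ha// eq_sym.
  rewrite z submx0 => /eqP aK; apply: (row_free_inj (row_base_free A)).
  by rewrite aK mul0mx.
- by move=> c; rewrite finset.inE.
- by move=> c; rewrite finset.inE.
- move=> c _; have /submxP[D ->] : (row c (row_base A) <= A)%MS by apply: submx_trans (row_sub _ _) _; rewrite eq_row_base.
  by rewrite -mulmxA e0 mulmx0 mxE eqxx.
Qed.

(* S indexes the coordinates cutting out the lift of A; left multiplication of
   the coordinate row by B gives a positive multiple of (1, A v). *)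
Lemma face_chart p A (W : set X) : next_center A -> face iota F A p -> nbhs p W ->
  exists U kb (D S : {set 'I_n}) (B : 'M[R]_(n, 1 + n)) (C : 'M[R]_(1 + n, n)),
  [/\ kchart p U kb D, U `<=` W, #|S| = (\rank A).+1,
      forall i k, i \in S -> k \in S -> (B *m C) i k = (i == k)%:R &
      forall q, U q -> (face iota F A q <-> forall i, i \in S -> kb q 0 i = 0) /\
        forall v, iota v = q ->
        let w := (\row_i (if i \in S then kb q 0 i else 0)) *m B in theta A v = (nrm w)^-1 *: w].
Proof.
move=> nA fA nW; have [m [Ac ch]] := chain_ex p.
have [i [mi z Ai e0]] := face_chain ch nA fA; subst m.
have gl := graded_last ch z Ai e0.
have [K [lev [dm [g [U [kb [cg [gi gK gl' gd] kc UW hU]]]]]]] := chart_ex ch gl nW.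
have [f0 fS fE fN] := chain_flag ch.
have [d dd dl] : exists2 c, c \in dm & lev c = i by case: cg => _; exact.
(* [d] is the boundary coordinate [1 / R_i], as [R_(i+1) = 1], and the [g c] are the coordinates
   [f / R_i] for a basis of [A]; the entries of [hom_row A v / R_i] are combinations of these. *)
pose S : {set 'I_n} := (d |: [set g c | c in 'I_(\rank A)])%SET.
have gdm c : g c \notin dm by rewrite gd finset.inE.
have dg c : d != g c by apply/eqP => dgc; move: (gdm c); rewrite -dgc dd.
have gS c : g c \in S by rewrite !finset.inE; apply/orP; right; apply/imsetP; exists c.
have dS : d \in S by rewrite !finset.inE eqxx.
pose G : 'M[R]_(\rank A, n) := \matrix_(c, j) (j == g c)%:R.
have GK : G *m K = row_base A.
  apply/row_matrixP => c; rewrite row_mul -gK [in RHS]rowE; congr (_ *m _).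
  by apply/rowP => j; rewrite !mxE.
have coefE : coef K A = col_base A *m G.
  have Kf : row_free K by have [cg1 _] := cg; apply: (graded_free fS cg1).
  apply: (row_free_inj Kf); rewrite (coefK ch cg) -mulmxA GK mulmx_base //.
have colG (M : 'M[R]_(n, \rank A)) j c : (M *m G) j (g c) = M j c.
  rewrite mxE (bigD1 c)//= mxE eqxx mulr1 big1 ?addr0// => c' cc.
  by rewrite mxE (inj_eq gi) eq_sym (negbTE cc) mulr0.
have coef_out j c : c \notin S -> coef K A j c = 0.
  move=> cS; rewrite coefE [LHS]mxE big1// => c' _; rewrite [X in _ * X]mxE.
  case: eqP => [cg'|]; last by rewrite mulr0.
  by move: cS; rewrite cg' gS.
have coef_d j : coef K A j d = 0.
  rewrite coefE [LHS]mxE big1// => c' _; rewrite [X in _ * X]mxE (negbTE (dg c')) mulr0//.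
have SE j : j \in S -> j = d \/ exists c, j = g c.
  by rewrite !finset.inE => /orP[/eqP|/imsetP[c _]] ->; [left|right; exists c].
have /row_fullP[Dl DlE] := col_base_full A.
pose B : 'M[R]_(n, 1 + n) := row_mx (\col_j (j == d)%:R) (coef K A)^T.
pose C : 'M[R]_(1 + n, n) := col_mx (\row_j (j == d)%:R) (Dl^T *m G).
have rri (u : 'rV[R]_n) : rr lev dm i u = u 0 d by rewrite -dl (rr_S cg u dd) dl (rr_ge cg) ?mulr1.
have numE (u : 'rV[R]_n) : cnum K lev dm A i u = (\row_j (if j \in S then u 0 j else 0)) *m B.
  apply/rowP => k; rewrite [RHS]mxE; case: (split_ordP k) => j -> /=.
    rewrite row_mxEl mxE rri (bigD1 d)//= row_mxEl !mxE dS eqxx mulr1 big1 ?addr0// => l ld.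
    by rewrite row_mxEl !mxE (negbTE ld) mulr0.
  rewrite row_mxEr mxE; apply: eq_bigr => l _; rewrite row_mxEr [X in _ = X * _]mxE [X in _ = _ * X]mxE.
  have [lS|lS] := boolP (l \in S); last by rewrite (coef_out j l lS) mul0r mulr0.
  have [ld|[c lc]] := SE l lS; first by rewrite ld coef_d mul0r mulr0.
  rewrite mulrC; congr (_ * _); rewrite /hat lc (negbTE (gdm c)).
  by rewrite qq_ge ?mulr1// gl'.
have BC j k : j \in S -> k \in S -> (B *m C) j k = (j == k)%:R.
  move=> jS kS; rewrite mul_row_col mxE.
  have -> : ((\col_j (j == d)%:R : 'cV[R]_n) *m (\row_j (j == d)%:R : 'rV[R]_n)) j k = ((j == d) && (k == d))%:R.
    by rewrite mxE big_ord1 !mxE -natrM mulnb.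
  have -> : (coef K A)^T *m (Dl^T *m G) = G^T *m G.
    rewrite coefE trmx_mul -[G^T *m _ *m _]mulmxA (mulmxA _ Dl^T) -trmx_mul DlE trmx1 mul1mx //.
  have [-> {j jS}|[c -> {j jS}]] := SE j jS; have [-> {k kS}|[c' -> {k kS}]] := SE k kS.
  - by rewrite !eqxx [X in _ + X]mxE big1 ?addr0// => c _; rewrite !mxE (negbTE (dg c)) mul0r.
  - by rewrite eqxx [g c' == d]eq_sym (negbTE (dg c')) add0r colG !mxE (negbTE (dg c')).
  - rewrite [g c == d]eq_sym (negbTE (dg c)) add0r [LHS]mxE big1// => c'' _.
    by rewrite !mxE (negbTE (dg c'')) mulr0.
  - by rewrite [g c == d]eq_sym (negbTE (dg c)) add0r colG !mxE (inj_eq gi) eq_sym.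
exists U, kb, dm, S, B, C; split=> //.
  rewrite cardsU1 card_imset// card_ord.
  by case: imsetP => // -[c _ dgc]; move: (dg c); rewrite dgc eqxx.
move=> q Uq; split; last first.
  move=> v vq; have [/(_ v vq)[Rp kE] _] := hU q Uq.
  rewrite /= -numE kE (num_kap ch cg Rp Ai) normalizeZ ?invr_gt0//.
have Ail : leveled iota p i.+1 Ac (Ac i) i by apply: (leveled_chain ch); exact: ltnSn.
have AiF : Ac i \in F by case: ch => _ h _ _ _; apply: h; exact: leqW.
have An : ~~ (Ac i <= A)%MS.
  case: nA => A0 N1 _; apply/negP => /(N1 _ AiF) z'; move: A0; by move: Ai; rewrite z' submx0 => ->.
split=> [fq|zS].
  have := q2_chart ch cg kc hU Uq Ai AiF Ail (leqnn i).
  rewrite qq_ge// mulr1 => /(xt_uniq aX dX (fq _ AiF Ai An))/esym/eqP.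
  have n0 : cnum K lev dm (Ac i) i (kb q) != 0 by case: (hU q Uq) => _; exact.
  rewrite sqrf_eq0 mulf_eq0 invr_eq0 (gt_eqF (nrm_gt0 n0)) orbF => /eqP /nrm_eq0.
  rewrite numE => w0 j jS.
  have : ((\row_j (if j \in S then kb q 0 j else 0)) *m (B *m C)) 0 j = 0 by rewrite mulmxA w0 mul0mx mxE.
  rewrite mxE (bigD1 j)//= BC// eqxx mulr1 mxE jS big1 ?addr0// => l lj.
  rewrite mxE; case: (boolP (l \in S)) => lS; last by rewrite mul0r.
  by rewrite BC// (negbTE lj) mulr0.
have n0 : cnum K lev dm A i (kb q) = 0.
  rewrite numE; apply/rowP => k; rewrite [LHS]mxE big1 ?mxE// => l _.
  by rewrite mxE; case: (boolP (l \in S)) => [/zS ->|_]; rewrite mul0r.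
move=> B' BF AB BA; have [j Bj] := leveled_ex ch BF.
have ji : (j <= i)%N.
  have [jm Bl _] := Bj; rewrite leqNgt; apply/negP => ij.
  have jE : j = i.+1 by apply/eqP; rewrite eqn_leq jm ij.
  move: Bl; rewrite jE z submx0 => /eqP B0; move: AB; rewrite B0 submx0.
  by case: nA => /negbTE ->.
have := q2_chart ch cg kc hU Uq Ai BF Bj ji.
by rewrite n0 /nrm big1 ?sqrtr0 ?mul0r ?mul0r ?expr0n// => l _; rewrite mxE expr0n.
Qed.

End OneStage.
End StageFaces.

(** * Blowing up one flat and lifting the other centers *)

Section StageStep.
Context {R : realType} (n : nat).
Implicit Types (A B C : 'M[R]_n) (F : seq 'M[R]_n).

Lemma kchart_coords (X : germ_space R) (p : X) U kb (D : {set 'I_n}) : sdim X = n -> kchart p U kb D ->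
  exists (c : coords X) (s : 'I_n -> 'I_(sdim X)), [/\ bijective s, adapted p c, dom c = U,
    forall q a, crd c q 0 (s a) = kb q 0 a & forall a, (s a \in bnd c) = (a \in D)].
Proof.
case: X p U kb => T d sm p U kb /= dn; subst d => -[Up e im z].
exists (@Coords R (@GermSpace R T n sm) U kb D), id; split=> //; exact: inv_bij.
Qed.

Lemma kchart_normal (X : germ_space R) (p : X) U kb (D S : {set 'I_n}) (Z : set X)
    (iota : 'rV[R]_n -> X) q (gamma : 'rV[R]_n -> 'rV[R]_q) (B : 'M[R]_(n, q)) (C : 'M[R]_(q, n)) :
  sdim X = n -> kchart p U kb D -> (forall q, U q -> Z q <-> forall i, i \in S -> kb q 0 i = 0) ->
  (forall i k, i \in S -> k \in S -> (B *m C) i k = (i == k)%:R) -> (forall v, U (iota v) ->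
        let w := (\row_i (if i \in S then kb (iota v) 0 i else 0)) *m B in gamma v = (nrm w)^-1 *: w) ->
  exists (c : coords X) (S' : {set 'I_(sdim X)}) M1 M2, normal_data iota Z gamma p c S' M1 M2 /\ #|S'| = #|S|.
Proof.
case: X p U kb Z iota => T d sm p U kb Z iota /= dn; subst d => -[Up e im z] ZE BC gE.
exists (@Coords R (@GermSpace R T n sm) U kb D), S, B, C; split=> //; split=> //.
split; first by split.
apply/seteqP; split=> r [h Ur]; split=> //; [exact/ZE|exact/ZE].
Qed.

Section Step.
Variables (X : germ_space R) (iota : 'rV[R]_n -> X) (N : nat) (Psi : 'rV[R]_n -> 'rV[R]_N).
Variables (psi : X -> 'rV[R]_N) (F : seq 'M[R]_n).
Hypothesis st : is_stage iota Psi psi F.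

Let pr : presents iota Psi psi. Proof. by case: st. Qed.
Let F1 : 1%:M \in F. Proof. by case: st => _ []. Qed.
Let F0 : 0 \in F. Proof. by case: st => _ []. Qed.
Let aX : ambient X := presents_ambient pr.
Let dX := presents_dense pr.

Lemma face_normal p A : sdim X = n -> next_center F A -> face iota F A p ->
  exists (c : coords X) (S : {set 'I_(sdim X)}) M1 M2, normal_data iota (face iota F A) (theta A) p c S M1 M2 /\ #|S| = (\rank A).+1.
Proof.
move=> sd nA fA; have [U [kb [D [S [B [C [kc _ cS BC h]]]]]]] := face_chart st nA fA (@filterT _ (nbhs p) _).
have [|||c [A' [B' [C' [nd cA]]]]] := @kchart_normal X p U kb D S (face iota F A) iota _ (theta A) B C sd kc.
- by move=> q Uq; case: (h q Uq).
- exact: BC.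
- by move=> v Uv; case: (h _ Uv) => _; exact.
by exists c, A', B', C'; split=> //; rewrite cA.
Qed.

Lemma face_data A : sdim X = n -> next_center F A ->
  [/\ forall v, ~ face iota F A (iota v),
      forall p, ~ face iota F A p -> forall j, exists a, xt iota p (fun v => theta A v 0 j) a &
      forall p, face iota F A p -> exists c S M1 M2, normal_data iota (face iota F A) (theta A) p c S M1 M2].
Proof.
move=> sd nA; split=> [v|p np|p fA].
- by apply: (face_iota st); exact: (next_not_full st nA).
- exact: (off_face st np).
- by have [c [A' [B [C [h _]]]]] := face_normal sd nA fA; exists c, A', B, C.
Qed.

Lemma face_blowup_ex A : sdim X = n -> next_center F A ->
  exists (X' : germ_space R) (b : X' -> X), is_blowup (face iota F A) b.
Proof.
move=> sd nA.
have [iZ hoff hon] := face_data sd nA.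
have cl : closed (face iota F A) by apply: (face_closed st).
by exists (model X Psi (theta A)); eexists; apply: (model_blowup pr iZ cl hoff hon).
Qed.

(** The old [theta B] extend by pull-back through [b], the new one is part of [psi']; sums with [A]
    stay in the list because [A] is a next center. *)
Theorem face_blowup_stage A (X' : germ_space R) (b : X' -> X) : sdim X = n -> compact [set: X] ->
  next_center F A -> is_blowup (face iota F A) b -> exists (iota' : 'rV[R]_n -> X') psi',
   [/\ is_stage iota' (fun v => row_mx (theta A v) (Psi v)) psi' (A :: F),
       forall v, b (iota' v) = iota v, compact [set: X'] & sdim X' = n].
Proof.
move=> sd cX nA hb.
have [iZ hoff hon] := face_data sd nA.
have [iota' [psi' [pr' bi cX']]] := presents_blowup hb cX pr iZ hoff hon.
exists iota', psi'; split=> //; last by case: hb => ->.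
have [_ _ Fs Fx Fp] := st; have [A0 N1 N2] := nA.
have sum1 B : B \in F -> exists2 C, C \in A :: F & (C :=: A + B)%MS.
  move=> BF; have [->|B0] := eqVneq B 0.
    by exists A; rewrite ?inE ?eqxx//; apply: eqmx_sym; exact: addsmx0.
  by have [C CF CE] := N2 B BF B0; exists C => //; rewrite inE CF orbT.
split=> //.
- by rewrite !inE F1 F0 !orbT.
- move=> B C; rewrite !inE => /orP[/eqP ->|BF] /orP[/eqP ->|CF].
  + by exists A; rewrite ?inE ?eqxx//; apply: eqmx_sym; exact: addsmx_idPl.
  + exact: sum1.
  + have [D DF DE] := sum1 B BF; exists D => //.
    by apply: (eqmx_trans DE); apply/eqmxP; rewrite addsmxC submx_refl.
  + by have [D DF DE] := Fs B C BF CF; exists D => //; rewrite inE DF orbT.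
- have [e' _ pi'] := pr'.
  move=> B; rewrite inE => /orP[/eqP -> |BF] r k.
    exists (psi' r 0 (lshift N k)).
    apply: (@xt_of_smooth R X' _ iota' r (fun r => psi' r 0 (lshift N k))); first exact: Sm_embed_coord e' I.
    by move=> v; rewrite pi' row_mxEl.
  by have [a ha] := Fx B BF (b r) k; exists a; exact: (xt_lift hb pr bi ha).
- move=> j; case: (split_ordP j) => k -> /=.
    by exists A, k; split=> [|v]; [rewrite inE eqxx|rewrite row_mxEl].
  by have [B [l [BF h]]] := Fp k; exists B, l; split=> [|v]; [rewrite inE BF orbT|rewrite row_mxEr h].
Qed.

(** The only new member of [A :: F] that the sum of [B] and [C] could be is [A]; then [C] would be a
    nonzero member of [F] inside [A]. *)
Lemma next_center_tail A B : next_center F A -> next_center (A :: F) B -> next_center F B.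
Proof.
move=> [_ A1 _] [B0 B1 B2]; split=> //.
  by move=> C CF CB; apply: B1 => //; rewrite inE CF orbT.
move=> C CF C0; have [||D DF DE] := B2 C; rewrite ?inE ?CF ?orbT//.
exists D => //; move: DF; rewrite inE => /orP[/eqP DA|//].
have /(A1 C CF) : (C <= A)%MS by rewrite -DA DE addsmxSr.
by move/eqP; rewrite (negbTE C0).
Qed.

Section Lift.
Variables (X' : germ_space R) (b : X' -> X) (A : 'M[R]_n) (iota' : 'rV[R]_n -> X').
Variables (N' : nat) (Psi' : 'rV[R]_n -> 'rV[R]_N') (psi' : X' -> 'rV[R]_N').
Hypothesis nA : next_center F A.
Hypothesis hb : is_blowup (face iota F A) b.
Hypothesis st' : is_stage iota' Psi' psi' (A :: F).
Hypothesis bi : forall v, b (iota' v) = iota v.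

Let aX' : ambient X'. Proof. by case: st' => /presents_ambient. Qed.
Let dX' := presents_dense (let: And5 h _ _ _ _ := st' in h).

Lemma xt_down r B C : C \in F -> (B <= C)%MS -> xt iota' r (q2 B C) 0 -> xt iota (b r) (q2 B C) 0.
Proof.
move=> CF BC h; have h1 := q2_xt st (b r) CF BC; have h2 := xt_lift hb pr bi h1.
by have h3 := xt_uniq aX' dX' h2 h; rewrite h3 in h1.
Qed.

Lemma face_down B r : face iota' (A :: F) B r -> face iota F B (b r).
Proof.
move=> fB C CF BC CB; apply: xt_down => //; apply: fB => //.
by rewrite inE CF orbT.
Qed.

(** Off the center some [NA A'] with [A'] in [F] has the same growth as [NA A], so being negligible
    against [A'] gives the one new condition, that against [A]. *)
Lemma face_up B r : ~~ (A <= B)%MS -> face iota F B (b r) -> ~ face iota F A (b r) ->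
  face iota' (A :: F) B r.
Proof.
move=> AB fB nfA C; rewrite inE => /orP[/eqP -> {C}|CF] BC CB; last exact: (xt_lift hb pr bi (fB C CF BC CB)).
have [A' [AF AA AA' nx]] : exists A', [/\ A' \in F, (A <= A')%MS, ~~ (A' <= A)%MS & ~ xt iota (b r) (q2 A A') 0].
  by apply: contrapT => h; apply: nfA => A' AF AA' A'A; apply: contrapT => nx; apply: h; exists A'.
have hq := q2_xt st (b r) AF AA; set a := (X in xt _ _ _ X) in hq.
have a0 : a != 0 by apply/eqP => a0; apply: nx; rewrite -a0.
have BA' : (B <= A')%MS := submx_trans BC AA.
have A'B : ~~ (A' <= B)%MS by apply: contra AA' => h; exact: submx_trans h BC.
have := xt_lift hb pr bi (xt_div aX a0 (fB A' AF BA' A'B) hq).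
rewrite mul0r; apply: xt_eq; apply: nearTW => v.
rewrite /q2 invf_div mulrA divfK// expf_neq0// NA_neq0//.
Qed.

(** [blowup_lift] treats a set contained in the center differently, and this excludes that case. At
    a common point, a coordinate that enters [A] but not [B] is moved: the point stays in the face
    of [B] and leaves that of [A]. *)
Lemma face_not_sub B p : next_center (A :: F) B -> face iota F B p -> ~ (face iota F B `<=` face iota F A).
Proof.
move=> nB fB sub; have fA := sub _ fB.
have nB' := next_center_tail nA nB.
have AB : ~~ (A <= B)%MS.
  apply/negP => h; case: nB => _ /(_ A); rewrite inE eqxx => /(_ isT h) A0 _.
  by case: nA; rewrite A0 eqxx.
have [m [Ac ch]] := chain_ex st p.
have [i [mi z Bi e0]] := face_chain st ch nB' fB.
have [i' [mi' _ Ai e1]] := face_chain st ch nA fA.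
have ii : i' = i by move: mi'; rewrite mi => -[].
subst i' m.
have gl := graded_last ch z Bi e0.
have nT : nbhs p [set: X] by exact: filterT.
have [K [lev [dm [g [U [kb [cg [gi gK gl' gd] kc UW hU]]]]]]] := chart_ex st ch gl nT.
have [f0 fS fE fN] := chain_flag st ch.
have [d dd dl] : exists2 c, c \in dm & lev c = i by case: cg => _; exact.
have gdm c : g c \notin dm by rewrite gd finset.inE.
have Kf : row_free K by have [cg1 _] := cg; apply: (graded_free fS cg1).
have levi j c : coef K A j c != 0 -> lev c = i.
  move=> c0; apply/eqP; rewrite eqn_leq; apply/andP; split; last first.
    rewrite leqNgt; apply/negP => lt; move: c0; by rewrite (coef_lev ch cg j Ai lt) eqxx.
  have [[h _ _ _ _] _] := cg; have [h1 h2] := h c.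
  rewrite leqNgt; apply/negP => lt.
  have le : lev c = i.+1 by apply/eqP; rewrite eqn_leq h1 lt.
  move: h2; rewrite le z submx0 => /eqP r0.
  have : delta_mx 0 c = 0 :> 'rV[R]_n by apply: (row_free_inj Kf); rewrite mul0mx -rowE.
  by move/rowP/(_ c); rewrite !mxE !eqxx => /eqP; rewrite oner_eq0.
(* Otherwise the rows of [A] are combinations of rows of [B] and of the marked row [d]; the limit
   functional kills [A] and [B] but not the row [d], which would give [A <= B]. *)
have [j [c1 [jc c1d c1g]]] : exists j c, [/\ coef K A j c != 0, c != d & forall a, c != g a].
  apply: contrapT => nex; case/negP: AB; apply/row_subP => j.
  have out c : c != d -> (forall a, c != g a) -> coef K A j c = 0.
    by move=> h1 h2; apply/eqP/negPn/negP => h3; apply: nex; exists j, c.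
  pose w : 'rV[R]_n := row j (coef K A).
  have wK : w *m K = row j A by rewrite -row_mul (coefK ch cg).
  have gB c a : c = g a -> (row c K <= B)%MS.
    by move=> ->; rewrite gK; apply: submx_trans (row_sub _ _) _; rewrite eq_row_base.
  have rj : row j A = w 0 d *: row d K + \sum_(c | c != d) w 0 c *: row c K.
    by rewrite -wK mulmx_sum_row (bigD1 d).
  have sB : ((\sum_(c | c != d) w 0 c *: row c K)%R <= B)%MS.
    apply: summx_sub => c cd; have [[a ca]|na] := pselect (exists a, c = g a).
      by apply: scalemx_sub; exact: gB ca.
    rewrite mxE out ?scale0r ?sub0mx// => a; apply/eqP => ca; apply: na; by exists a.
  have : (row j A *m ev iota p (Ac i)) 0 0 = 0 by rewrite -row_mul e1 row0 mxE.
  rewrite rj mulmxDl -scalemxAl [LHS]mxE [X in X + _]mxE.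
  have -> : (\sum_(c | c != d) w 0 c *: row c K) *m ev iota p (Ac i) = 0.
    by case/submxP: sB => D' ->; rewrite -mulmxA e0 mulmx0.
  have [_ _ /(_ d dd)[_ pd] _ _] := cg.1; rewrite dl in pd.
  rewrite [X in _ + X]mxE addr0 => /eqP; rewrite mulf_eq0 (gt_eqF pd) orbF => /eqP w0.
  by rewrite w0 scale0r add0r.
have [Up _ _ _] := kc.
have lc1 := levi _ _ jc.
have c1dm : c1 \notin dm.
  apply/negP => c1m; have [_ _ _ inj _] := cg.1.
  by move: c1d; rewrite (inj _ _ c1m dd) ?eqxx// lc1 dl.
have [t [s [t0 Us sE _]]] := kchart_perturb c1 kc Up nT.
have [A0 _ _] := nA; have [B0 N1 _] := nB'.
have AiF : Ac i \in F by case: ch => _ h _ _ _; apply: h; exact: leqW.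
have Ail : leveled iota p i.+1 Ac (Ac i) i by apply: (leveled_chain st ch); exact: ltnSn.
have nAi C : next_center F C -> (C <= Ac i)%MS -> ~~ (Ac i <= C)%MS.
  case=> C0 M1 _ Ci; apply/negP => /(M1 _ AiF) z'; move: C0; by move: Ci; rewrite z' submx0 => ->.
have val q C : U q -> (C <= Ac i)%MS -> xt iota q (q2 C (Ac i)) 0 -> cnum K lev dm C i (kb q) = 0.
  move=> Uq Ci; have := q2_chart st ch cg kc hU Uq Ci AiF Ail (leqnn i).
  rewrite qq_ge// mulr1 => h /(xt_uniq aX dX h)/eqP.
  have n0 : cnum K lev dm (Ac i) i (kb q) != 0 by case: (hU q Uq) => _; exact.
  by rewrite sqrf_eq0 mulf_eq0 invr_eq0 (gt_eqF (nrm_gt0 n0)) orbF => /eqP /nrm_eq0.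
have ev0 q C : U q -> next_center F C -> (C <= Ac i)%MS -> cnum K lev dm C i (kb q) = 0 -> face iota F C q.
  move=> Uq nC Ci n0 D' DF CD DC; have [j' Dj] := leveled_ex ch DF.
  have ji : (j' <= i)%N.
    have [jm Dl _] := Dj; rewrite leqNgt; apply/negP => ij.
    have jE : j' = i.+1 by apply/eqP; rewrite eqn_leq jm ij.
    move: Dl; rewrite jE z submx0 => /eqP D0; move: CD; rewrite D0 submx0.
    by case: nC => /negbTE ->.
  have := q2_chart st ch cg kc hU Uq Ci DF Dj ji.
  by rewrite n0 /nrm big1 ?sqrtr0 ?mul0r ?mul0r ?expr0n// => l _; rewrite mxE expr0n.
have cj (u : 'rV[R]_n) C l : cnum K lev dm C i u 0 (rshift 1 l) = \sum_c coef K C l c * (hat dm u c * qq lev dm i (lev c) u).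
  by rewrite row_mxEr mxE.
have coefB_out l c : (forall a, c != g a) -> coef K B l c = 0.
  move=> cg'; pose G : 'M[R]_(\rank B, n) := \matrix_(c, j) (j == g c)%:R.
  have GK : G *m K = row_base B.
    apply/row_matrixP => c'; rewrite row_mul -gK [in RHS]rowE; congr (_ *m _).
    by apply/rowP => j'; rewrite !mxE.
  have -> : coef K B = col_base B *m G.
    by apply: (row_free_inj Kf); rewrite (coefK ch cg) -mulmxA GK mulmx_base.
  by rewrite [LHS]mxE big1// => c' _; rewrite [X in _ * X]mxE (negbTE (cg' c')) mulr0.
have same c : c != c1 -> kb s 0 c = kb p 0 c.
  by move=> cc; rewrite sE !mxE eqxx (negbTE cc) mulr0 addr0.
have c1E : kb s 0 c1 = kb p 0 c1 + t by rewrite sE !mxE !eqxx mulr1.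
have qqE c : qq lev dm i (lev c) (kb s) = qq lev dm i (lev c) (kb p).
  by apply: eq_bigr => c' /andP[cd _]; apply: same; apply: contraNneq c1dm => <-.
have rrE : rr lev dm i (kb s) = rr lev dm i (kb p).
  by apply: eq_bigr => c' /andP[cd _]; apply: same; apply: contraNneq c1dm => <-.
have hatE c : c != c1 -> hat dm (kb s) c = hat dm (kb p) c.
  by move=> cc; rewrite /hat; case: (c \in dm) => //; exact: same.
have fBs : face iota F B s.
  apply: (ev0 s B Us nB' Bi); have <- := val p B Up Bi (fB _ AiF Bi (nAi _ nB' Bi)).
  apply/rowP => k; case: (split_ordP k) => l -> /=.
    by rewrite !row_mxEl !mxE rrE.
  rewrite !cj; apply: eq_bigr => c _; have [cc|cc] := eqVneq c c1; last by rewrite hatE// qqE.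
  by rewrite cc coefB_out ?mul0r.
have := val s A Us Ai (sub _ fBs _ AiF Ai (nAi _ nA Ai)).
move/rowP/(_ (rshift 1 j)); rewrite cj [RHS]mxE (bigD1 c1)//=.
have := val p A Up Ai (fA _ AiF Ai (nAi _ nA Ai)).
move/rowP/(_ (rshift 1 j)); rewrite cj [RHS]mxE (bigD1 c1)//=.
set S1 := \sum_(_ | _) _; set S2 := \sum_(_ | _) _.
have -> : S2 = S1 by apply: eq_bigr => c cc; rewrite hatE// qqE.
rewrite lc1 !(qq_ge lev dm _ (leqnn i)) /hat (negbTE c1dm) c1E !mulr1 mulrDr => h1.
rewrite -addrA [_ * t + _]addrC addrA h1 add0r => /eqP.
by rewrite mulf_eq0 (negbTE jc) (gt_eqF t0).
Qed.

(** Away from the center of [A] the old and the new face of [B] correspond. Over the center, [A] is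
    the member [Ac j.+1] of the chain and [B] lies further down; moving the boundary coordinate [d]
    of level [j] leaves the face of [A] without affecting the equations of [B], so the point is in
    the closure. *)
Theorem lift_face B : next_center (A :: F) B ->
  blowup_lift (face iota F A) b (face iota F B) = face iota' (A :: F) B.
Proof.
move=> nB.
have AB : ~~ (A <= B)%MS.
  apply/negP => h; case: nB => _ /(_ A); rewrite inE eqxx => /(_ isT h) A0 _.
  by case: nA; rewrite A0 eqxx.
have E : blowup_lift (face iota F A) b (face iota F B) = closure (b @^-1` (face iota F B `\` face iota F A)).
  apply/seteqP; split=> q; rewrite /blowup_lift /mkset; case: asboolP => // sub.
    by move=> fB; case: (face_not_sub nB fB sub).
  rewrite (_ : _ `\` _ = set0) ?preimage_set0 ?closure0//.
  by apply/seteqP; split=> // s [fB]; case; exact: sub.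
rewrite E; apply/seteqP; split.
  have cl : closed (face iota' (A :: F) B) by exact: face_closed st' B.
  apply: subset_trans cl; apply: closure_subset => r [fB nfA]; exact: face_up.
move=> r fB D nD.
have [fA|nfA] := pselect (face iota F A (b r)); last first.
  by exists r; split; [split=> //; exact: face_down|exact: nbhs_singleton].
have [m [Ac ch]] := chain_ex st' r.
have [i [mi z Bi e0]] := face_chain st' ch nB fB; subst m.
have fA' : face iota' (A :: F) A r.
  move=> C; rewrite inE => /orP[/eqP ->|CF] sAC sCA; first by rewrite submx_refl in sCA.
  exact: (xt_lift hb pr bi (fA C CF sAC sCA)).
have AF' : A \in A :: F by rewrite inE eqxx.
have [j [jm jA]] := face_in_chain st' ch AF' fA'.
have A0 : A != 0 by case: nA.
case: j jm jA => [|j] jm jA.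
  have c0 : Ac 0%N = 1%:M by case: ch.
  by have := next_not_full st nA; rewrite -jA c0 submx_refl.
have ji : (j < i)%N.
  rewrite ltn_neqAle -ltnS jm andbT; apply/eqP => ji; move: A0.
  by rewrite -submx0 -jA ji z submx_refl.
have gl := graded_last ch z Bi e0.
have [K [lev [dm [g [U [kb [cg [gi gK gl' gd] kc UD hU]]]]]]] := chart_ex st' ch gl nD.
have [f0 fS fE fN] := chain_flag st' ch.
have cS : complete_graded i.+1 Ac (fun i => ev iota' r (Ac i)) K lev dm := cg.
have [d dd dl] : exists2 c, c \in dm & lev c = j by case: cg => _; apply; exact: ltnW.
have [Ur _ _ _] := kc.
have [t [s [t0 Us sE _]]] := kchart_perturb d kc Ur nD.
have AjF : Ac j \in A :: F by case: ch => _ h _ _ _; apply: h; rewrite ltnW// ltnW.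
have jm' : (j < i.+1)%N by exact: ltnW.
have Ajl : leveled iota' r i.+1 Ac (Ac j) j by exact: (leveled_chain st' ch jm').
have AAj : (A <= Ac j)%MS by rewrite -jA.
have AjA : ~~ (Ac j <= A)%MS.
  apply/negP => h; have [f [fj fe]] := fN j jm'.
  have /submxP[D' fD] : (f <= Ac j.+1)%MS by rewrite jA; exact: submx_trans fj h.
  by move: fe; rewrite fD -mulmxA fE// mulmx0 mxE eqxx.
have AjF0 : Ac j \in F.
  by move: AjF; rewrite inE => /orP[/eqP h|//]; move: AjA; rewrite h submx_refl.
have lA : leveled iota' r i.+1 Ac A j.+1.
  have [l1 l2 l3] := leveled_chain st' ch (ji : (j.+1 < i.+1)%N).
  split=> //; first by rewrite jA.
  move=> _; apply: contra (l3 ji) => /eqP e1.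
  have /submxP[D' DE] : (Ac j.+1 <= A)%MS by rewrite jA.
  by rewrite {1}DE -mulmxA e1 mulmx0.
have [_ Aj1 _] := lA.
have nz : cnum K lev dm A j.+1 (kb s) != 0 by case: (hU s Us) => _; exact.
have nz' : cnum K lev dm (Ac j) j (kb s) != 0 by case: (hU s Us) => _; exact.
exists s; split; last exact: UD.
have same c : c != d -> kb s 0 c = kb r 0 c.
  by move=> cc; rewrite sE !mxE eqxx (negbTE cc) mulr0 addr0.
split.
  apply: face_down.
  have AiF : Ac i \in A :: F by case: ch => _ h _ _ _; apply: h; exact: leqW.
  have Ail : leveled iota' r i.+1 Ac (Ac i) i by apply: (leveled_chain st' ch); exact: ltnSn.
  have [B0 N1 _] := nB.
  have nAi : ~~ (Ac i <= B)%MS.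
    apply/negP => /(N1 _ AiF) z'; move: B0; by move: Bi; rewrite z' submx0 => ->.
  have := q2_chart st' ch cg kc hU Ur Bi AiF Ail (leqnn i).
  rewrite qq_ge// mulr1 => /(xt_uniq aX' dX' (fB _ AiF Bi nAi))/esym/eqP.
  have n0 : cnum K lev dm (Ac i) i (kb r) != 0 by case: (hU r Ur) => _; exact.
  rewrite sqrf_eq0 mulf_eq0 invr_eq0 (gt_eqF (nrm_gt0 n0)) orbF => /eqP /nrm_eq0 Br0.
  have dlt c : c \in dm -> (i <= lev c)%N -> c != d.
    by move=> _ ic; apply/eqP => cd; move: ic; rewrite cd dl leqNgt ji.
  have Bs0 : cnum K lev dm B i (kb s) = 0.
    rewrite -Br0; apply/rowP => k; case: (split_ordP k) => l -> /=.
      rewrite !row_mxEl !mxE; apply: eq_bigr => c /andP[cd ic]; exact/same/dlt.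
    rewrite !row_mxEr !mxE; apply: eq_bigr => c _.
    have [ci|ci] := ltnP (lev c) i; first by rewrite (coef_lev ch cg l Bi ci) !mul0r.
    have cd : c != d by apply/eqP => cd; move: ci; rewrite cd dl leqNgt ji.
    congr (_ * (_ * _)); first by rewrite /hat; case: (c \in dm) => //; exact: same.
    by apply: eq_bigr => c' /andP[c'm /andP[ic' _]]; exact/same/dlt.
  move=> C CF BC CB; have [j' Cj] := leveled_ex ch CF.
  have ji' : (j' <= i)%N.
    have [jm2 Cl _] := Cj; rewrite leqNgt; apply/negP => ij.
    have jE : j' = i.+1 by apply/eqP; rewrite eqn_leq jm2 ij.
    move: Cl; rewrite jE z submx0 => /eqP C0; move: BC; rewrite C0 submx0.
    by move: B0 => /negbTE ->.
  have := q2_chart st' ch cg kc hU Us Bi CF Cj ji'.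
  by rewrite Bs0 /nrm big1 ?sqrtr0 ?mul0r ?mul0r ?expr0n// => l _; rewrite mxE expr0n.
move=> /(_ _ AjF0 AAj AjA) /(xt_lift hb pr bi) h0.
have := q2_chart st' ch cg kc hU Us Aj1 AjF Ajl (leqnSn j).
move=> /(xt_uniq aX' dX' h0)/esym/eqP.
rewrite sqrf_eq0 !mulf_eq0 invr_eq0 (gt_eqF (nrm_gt0 nz)) (gt_eqF (nrm_gt0 nz')) /=.
rewrite (dm_at cg jm' dd dl) sE !mxE !eqxx mulr1.
have [_ _ _ /(_ d dd) ->] := kc.
by rewrite add0r (gt_eqF t0).
Qed.

End Lift.
End Step.
End StageStep.

(** * Iterated blow-ups and admissible orders *)

Section Iterate.
Context {R : realType} (n : nat).
Implicit Types (A B C : 'M[R]_n) (F l : seq 'M[R]_n).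

(** Being next is required of all remaining flats, not only of the first: [lift_face] needs it for
    every center that is lifted. *)
Fixpoint good_order F l : Prop := if l is A :: l' then
    (forall B, B \in A :: l' -> next_center F B) /\ good_order (A :: F) l' else True.

Lemma embeds_compact (X Y : germ_space R) (f : X -> Y) : embeds setT f -> compact (range f) ->
  compact [set: X].
Proof.
move=> e; rewrite !compact_ultra => cY F FU _.
have FfU : UltraFilter (f @ F) by exact: fmap_ultra.
have [|_ [[x _ <-] fx]] := cY (f @ F) FfU.
  by apply: (@filterS _ F _ setT); [move=> x _; exists x|exact: filterT].
exists x; split=> // A /(embeds_nbhsE e I)[B nB sB].
have h : F (f @^-1` B) := fx _ nB.
by apply: (@filterS _ F _ (f @^-1` B)) => // y By; exact: sB.
Qed.

(** An iterated blow-up without centers is an arbitrary diffeomorphism, so stages have to be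
    transported along these. *)
Lemma diffeo_stage (X X' : germ_space R) (b : X' -> X) (iota : 'rV[R]_n -> X) N (Psi : 'rV[R]_n -> 'rV[R]_N)
    psi F : diffeomorphism b -> is_stage iota Psi psi F -> compact [set: X] ->
  exists (iota' : 'rV[R]_n -> X') psi', [/\ is_stage iota' Psi psi' F, forall v, b (iota' v) = iota v &
    compact [set: X']].
Proof.
move=> [sd e r] [pr F1 Fs Fx Fp] cX.
have /choice[iota' bi] : forall v, exists x, b x = iota v.
  move=> v; have [x _ xv] : range b (iota v) by rewrite r.
  by exists x.
have aX := presents_ambient pr; have [ep er pi] := pr.
exists iota', (psi \o b); split=> //; last by apply: embeds_compact e _; rewrite r.
split=> //.
- split.
  + by have := embeds_comp e ep; rewrite setTI preimage_setT.
  + rewrite -er -r; apply/seteqP; split=> [_ [x _ <-]|_ [_ [x _ <-] <-]]; last by exists x.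
    by exists (b x) => //; exists x.
  + by move=> v; rewrite /= bi.
- move=> A AF p k; have [a [h [sh ha hF]]] := Fx A AF (b p) k.
  exists a, (h \o b); split=> //.
    by apply/(smooth_emb _ e I); exists h; split=> //; exact: near_all.
  have cb : {for p, continuous b} by move=> B nB; apply: embeds_nbhs e I nB.
  apply: filterS (near_cvg cb hF) => q h1 v vq; rewrite /= (h1 v)//.
  by rewrite -bi vq.
Qed.

(** The induction hypothesis speaks of another base space, so the statement is about arbitrary
    stages. The step replaces the lifted centers by faces of the next stage. *)
Theorem iterated_stage (X' X : germ_space R) (s : seq (set X)) (b : X' -> X) : iterated_blowup s b ->
  forall (iota : 'rV[R]_n -> X) N (Psi : 'rV[R]_n -> 'rV[R]_N) psi F l,
    is_stage iota Psi psi F -> sdim X = n -> compact [set: X] -> good_order F l ->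
    s = [seq face iota F A | A <- l] ->
  exists (iota' : 'rV[R]_n -> X') N' (Psi' : 'rV[R]_n -> 'rV[R]_N') psi',
    [/\ is_stage iota' Psi' psi' (catrev l F), forall v, b (iota' v) = iota v, compact [set: X'] &
      sdim X' = n].
Proof.
elim=> {X s b} [X b db|X Z s X1 b1 b2 hb _ IH] iota N Psi psi F [|A l] //= st sd cX.
  move=> _ _; have [iota' [psi' [h1 h2 h3]]] := diffeo_stage db st cX.
  by exists iota', N, Psi, psi'; split=> //; case: db => ->.
move=> [nc go] [ZE sE]; subst Z.
have nA : next_center F A by apply: nc; rewrite inE eqxx.
have [iota1 [psi1 [st1 bi1 cX1 sd1]]] := face_blowup_stage st sd cX nA hb.
have sE1 : [seq blowup_lift (face iota F A) b1 Z' | Z' <- s] = [seq face iota1 (A :: F) B | B <- l].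
  rewrite sE -map_comp; have : {subset l <= l} by [].
  have nc' C : C \in l -> next_center (A :: F) C.
    by case: (l) go => [//|B l'] /= [h _]; exact: h.
  move=> _; by apply/eq_in_map => C Cl /=; apply: (lift_face st nA hb st1 bi1); exact: nc'.
have [iota' [N' [Psi' [psi' [h1 h2 h3 h4]]]]] := IH _ _ _ _ _ _ st1 sd1 cX1 go sE1.
by exists iota', N', Psi', psi'; split=> // v; rewrite /= h2 bi1.
Qed.

Theorem iterated_ex l (X : germ_space R) (iota : 'rV[R]_n -> X) N (Psi : 'rV[R]_n -> 'rV[R]_N) psi F :
  is_stage iota Psi psi F -> sdim X = n -> compact [set: X] -> good_order F l ->
  exists (X' : germ_space R) (b : X' -> X), iterated_blowup [seq face iota F A | A <- l] b.
Proof.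
elim: l X iota N Psi psi F => [|A l IH] X iota N Psi psi F st sd cX /= go.
  exists X, id; apply: IteratedBlowup0; split=> //; last by apply/seteqP; split=> // x _; exists x.
  split=> //; first exact: openT.
  - move=> p _ B; split=> [nB|[C nC sC]]; first by exists B => // x [].
    by apply: filterS nC => x Cx; exact: sC.
  - move=> p _ f; have [pr _ _ _ _] := st; have aX := presents_ambient pr.
    split=> [sf|[h [sh fh]]]; first by exists f; split=> //; exact: near_all.
    by apply: (Sm_eq aX _ sh); apply: filterS fh => x ->.
have [nc go'] := go.
have nA : next_center F A by apply: nc; rewrite inE eqxx.
have [X1 [b1 hb]] := face_blowup_ex st sd nA.
have [iota1 [psi1 [st1 bi1 cX1 sd1]]] := face_blowup_stage st sd cX nA hb.
have [X' [b2 h]] := IH _ _ _ _ _ _ st1 sd1 cX1 go'.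
exists X', (b1 \o b2); apply: (IteratedBlowupS hb).
rewrite -map_comp; suff -> : [seq (blowup_lift (face iota F A) b1 \o face iota F) i | i <- l] = [seq face iota1 (A :: F) B | B <- l] by [].
have nc' C : C \in l -> next_center (A :: F) C.
  by case: (l) go' => [//|B l'] /= [h' _]; exact: h'.
by apply/eq_in_map => C Cl /=; apply: (lift_face st nA hb st1 bi1); exact: nc'.
Qed.

(** Large flats have small centers, so increasing dimension means decreasing rank. If the sum of a
    remaining [B] and a nonzero [C] in [F] were still to come, its rank would be at most that of
    [C], and it would equal [C]. *)
Lemma good_order_rank (P : 'M[R]_n -> Prop) F l : (forall A B, P A -> P B -> (A :=: B)%MS -> A = B) ->
  (forall A B, P A -> P B -> exists2 C, P C & (C :=: A + B)%MS) ->
  (forall A, P A <-> A \in F ++ l) -> uniq l -> (forall A, A \in l -> A \notin F) ->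
  (forall A, A \in l -> A != 0) ->
  (forall B C, B \in l -> C \in F -> C != 0 -> (\rank B <= \rank C)%N) ->
  sorted (fun A B => \rank B <= \rank A)%N l -> good_order F l.
Proof.
move=> cP sP; elim: l F => //= A l IH F PE /andP[Al ul] nF n0 rk so; split.
  move=> B Bl; split; first exact: n0.
    move=> C CF CB; apply/eqP; apply: contraT => C0.
    have r := rk B C Bl CF C0.
    have BC : (B <= C)%MS by rewrite -(geq_leqif (mxrank_leqif_sup CB)).
    have BCE : B = C.
      apply: cP; [by apply/PE; rewrite mem_cat Bl orbT|by apply/PE; rewrite mem_cat CF|].
      by apply/eqmxP; rewrite BC CB.
    by have := nF B Bl; rewrite BCE CF.
  move=> C CF C0; have [D PD DE] : exists2 C', P C' & (C' :=: B + C)%MS.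
    by apply: sP; apply/PE; rewrite mem_cat ?Bl ?CF ?orbT.
  have := PD => /PE; rewrite mem_cat => /orP[DF|Dl]; first by exists D.
  exists C => //; suff DC : D = C by rewrite -{1}DC.
  have CD : (C <= D)%MS by rewrite DE addsmxSr.
  apply: cP => //; first by apply/PE; rewrite mem_cat CF.
  by apply/eqmxP; rewrite CD andbT -(geq_leqif (mxrank_leqif_sup CD)) rk.
have tr : transitive (fun A B => \rank B <= \rank A)%N by move=> x y z h1 h2; exact: leq_trans h2 h1.
have al : all (fun B => \rank B <= \rank A)%N l by exact: order_path_min so.
apply: IH => //.
- move=> B; have -> : (B \in (A :: F) ++ l) = (B \in F ++ A :: l) by rewrite !(mem_cat, inE) orbCA orbA.
  exact: PE.
- move=> B Bl; rewrite inE negb_or nF ?inE ?Bl ?orbT// andbT.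
  by apply: contraNneq Al => <-.
- by move=> B Bl; apply: n0; rewrite inE Bl orbT.
- move=> B C Bl; rewrite inE => /orP[/eqP ->|CF] C0; first exact: (allP al).
  by apply: rk => //; rewrite inE Bl orbT.
- exact: path_sorted so.
Qed.

End Iterate.

(** * The radial compactification as the initial stage *)

Section Radial.
Context {R : realType} (W : vectType R).
Let n := dim W.

Definition radial_iota (v : 'rV[R]_(dim W)) : radial W := radial_incl (@r2v R W v).

Lemma radial_theta v : radial_row (r2v v : W) = theta 1%:M v.
Proof.
rewrite /radial_row /theta /hom_row r2vK trmx1 mulmx1; congr (_^-1 *: _).
apply: (pexpIrn (n := 2)) => //; rewrite ?nnegrE ?sqrtr_ge0 ?ltW ?NA_gt0//.
rewrite sqr_sqrtr; last by rewrite addr_ge0// sumr_ge0// => i _; exact: sqr_ge0.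
rewrite NA2; congr (_ + _); apply: eq_bigr => i _; congr (_ ^+ 2).
by rewrite -fe_row trmx1 mulmx1.
Qed.

(** A point of the half-sphere becomes the image of a vector after its first entry is raised by
    [s > 0] and the row is normalized; then [s] tends to 0. *)
Lemma radial_presents : presents radial_iota (theta 1%:M) (set_val : radial W -> 'rV[R]_(1 + n)).
Proof.
have pi v : (set_val (radial_iota v) : 'rV[R]_(1 + n)) = theta 1%:M v by rewrite -radial_theta.
split=> //; first exact: embeds_submanifold.
have -> : range (set_val : radial W -> 'rV[R]_(1 + n)) = @half_sphere R W.
  apply/seteqP; split=> [_ [x _ <-]|w hw]; first exact: set_valP.
  by exists (exist (fun w => w \in @half_sphere R W) w (mem_set hw)).
have aP := @ambient_euclidean R (1 + n).
apply/seteqP; split=> w.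
  move=> [w0 w1] B nB.
  pose u (s : R) : 'rV[R]_(1 + n) := w + s *: delta_mx 0 (lshift n 0).
  pose G (y : 'rV[R]_(1 + n)) : 'rV[R]_(1 + n) := \row_j ((nrm y)^-1 * y 0 j).
  have nw : nrm w = 1 by rewrite /nrm w1 sqrtr1.
  have Gw : G w = w by apply/rowP => j; rewrite mxE nw invr1 mul1r.
  have sG j : smooth_near_rV w (fun y => (nrm y)^-1 * y 0 j).
    apply: (SmM aP); last exact: sm_coord.
    apply: (SmV aP); last by rewrite nw oner_eq0.
    apply: (Sm_sqrt aP); last by rewrite w1 ltr01.
    by apply: (Sm_sum aP) => k _; apply: (SmX aP); exact: sm_coord.
  have cG : G y @[y --> w] --> G w := @Sm_row_cvg R (euclidean R (1 + n)) aP _ _ w sG.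
  have lim0 : u s @[s --> (0:R)^'+] --> w by apply: cvg_at_right_filter; exact: cvg_line.
  have nB' : \forall s \near (0:R)^'+, B (G (u s)).
    have nBG : \forall y \near w, B (G y) by apply: cG; rewrite Gw.
    exact: (near_cvg lim0 nBG).
  have [s [s0 Bs]] := filter_ex (rightI (nbhs_right_gt 0) nB').
  exists (G (u s)); split=> //.
  have u0 : 0 < u s 0 (lshift n 0).
    rewrite !mxE !eqxx mulr1; apply: ltr_wpDl => //.
    by move: w0; rewrite mxE.
  exists ((u s 0 (lshift n 0))^-1 *: rsubmx w) => //.
  have hE : hom_row 1%:M ((u s 0 (lshift n 0))^-1 *: rsubmx w) = (u s 0 (lshift n 0))^-1 *: u s.
    apply/rowP => j; case: (split_ordP j) => k -> /=.
      by rewrite row_mxEl [RHS]mxE [LHS]mxE (ord1 k) mulVf// gt_eqF.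
    rewrite row_mxEr trmx1 mulmx1 [LHS]mxE [RHS]mxE; congr (_ * _).
    by rewrite !mxE eq_rlshift !andbF ?mulr0 ?addr0.
  rewrite /theta /NA hE normalizeZ ?invr_gt0//.
  by apply/rowP => j; rewrite [LHS]mxE [RHS]mxE.
have clH : closed (@half_sphere R W).
  have cc i : continuous (fun w : 'rV[R]_(1 + n) => w 0 i) by exact: coord_continuous.
  have -> : @half_sphere R W = [set w : 'rV[R]_(1 + n) | 0 <= w 0 (lshift n 0)] `&` [set w : 'rV[R]_(1 + n) | \sum_i w 0 i ^+ 2 = 1].
    by apply/seteqP; split=> y [h1 h2]; split=> //; move: h1; rewrite mxE.
  apply: closedI.
    by apply: (closed_comp (f := fun w : 'rV[R]_(1 + n) => w 0 (lshift n 0))) (@closed_ge _ 0) => y _; exact: cc.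
  apply: (closed_comp (f := fun w : 'rV[R]_(1 + n) => \sum_i w 0 i ^+ 2)) (@closed_eq _ 1) => y _.
  apply: (Sm_cont aP).
  by apply: (Sm_sum aP) => k _; apply: (SmX aP); exact: sm_coord.
move=> h; apply: clH; apply: closure_subset h => _ [v _ <-].
by rewrite -radial_theta; apply: set_mem; exact: radial_row_in.
Qed.

Lemma radial_compact : compact [set: radial W].
Proof.
apply: (@embeds_compact R (radial W) (euclidean R (1 + n)) set_val); first exact: embeds_submanifold.
have [_ E _] := radial_presents.
have cl : closed (range (set_val : radial W -> 'rV[R]_(1 + n))) by rewrite E; exact: closed_closure.
apply: (subclosed_compact cl (B := [set w : 'rV[R]_(1 + n) | forall i, `[-1, 1]%classic (w 0 i)])).
  by have := @rV_compact R (1 + n) (fun=> `[-1, 1]%classic) (fun=> @segment_compact R (-1) 1).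
move=> _ [x _ <-] i; have [_ h] := set_valP x.
rewrite /= in_itv /= -ler_norml -(@expr_le1 _ 2)//.
rewrite -normrX ger0_norm ?sqr_ge0// -h (bigD1 i)//= lerDl sumr_ge0// => j _; exact: sqr_ge0.
Qed.

Lemma theta0 v : theta (0 : 'M[R]_n) v = row_mx (const_mx 1) 0.
Proof.
have N1 : NA (0 : 'M[R]_n) v = 1.
  apply: (pexpIrn (n := 2)) => //; rewrite ?nnegrE ?ler01 ?ltW ?NA_gt0//.
  by rewrite NA2 big1 ?addr0 ?expr1n// => j _; rewrite row0 fe0 expr0n.
by rewrite /theta N1 invr1 scale1r /hom_row trmx0 mulmx0.
Qed.

Lemma radial_stage : is_stage radial_iota (theta 1%:M) (set_val : radial W -> 'rV[R]_(1 + n)) [:: 1%:M; 0].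
Proof.
have pr := radial_presents; have [e _ pi] := pr.
split=> //; first by rewrite !inE !eqxx orbT.
- move=> A B; rewrite !inE => /orP[]/eqP -> /orP[]/eqP ->.
  + by exists 1%:M; rewrite ?inE ?eqxx//; apply: eqmx_sym; exact: addsmx_idPl.
  + by exists 1%:M; rewrite ?inE ?eqxx//; apply: eqmx_sym; exact: addsmx0.
  + by exists 1%:M; rewrite ?inE ?eqxx//; apply: eqmx_sym; exact: adds0mx.
  + by exists 0; rewrite ?inE ?eqxx ?orbT//; apply: eqmx_sym; exact: addsmx0.
- move=> A; rewrite !inE => /orP[]/eqP -> p k.
    exists (set_val p 0 k); apply: (@xt_of_smooth R (radial W) _ radial_iota p (fun p => (set_val p : 'rV[R]_(1 + n)) 0 k)).
      exact: Sm_embed_coord e I.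
    by move=> v; rewrite pi.
  exists ((row_mx (const_mx 1) 0 : 'rV[R]_(1 + n)) 0 k).
  have aX := presents_ambient pr.
  by apply: xt_eq (xt_cst aX _ p _); apply: nearTW => v; rewrite theta0.
- by move=> j; exists 1%:M, j; split; rewrite ?inE ?eqxx.
Qed.

Lemma radial_face A : ~~ (1%:M <= A)%MS ->
  face radial_iota [:: 1%:M; 0] A = at_infinity [set w : W | v2r w *m A^T = 0].
Proof.
move=> A1; have pr := radial_presents; have [e _ pi] := pr; have st := radial_stage.
have aX := presents_ambient pr; have dX := presents_dense pr.
have F1 : 1%:M \in [:: 1%:M; (0 : 'M[R]_n)] by rewrite inE eqxx.
have [_ _ _ Fx _] := st.
have thE p k : th radial_iota p 1%:M k = (set_val p : 'rV[R]_(1 + n)) 0 k.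
  apply: (xt_uniq aX dX (thP Fx p k F1)).
  apply: (@xt_of_smooth R (radial W) _ radial_iota p (fun p => (set_val p : 'rV[R]_(1 + n)) 0 k)).
    exact: Sm_embed_coord e I.
  by move=> v; rewrite pi.
have evE p (f : 'rV[R]_n) : (f *m ev radial_iota p 1%:M) 0 0 = (rsubmx (set_val p : 'rV[R]_(1 + n)) *m f^T) 0 0.
  rewrite /ev pinvmxE ?unitmx1// invmx1 mul1mx !mxE; apply: eq_bigr => j _; rewrite !mxE thE mulrC.
  by [].
apply/seteqP; split=> p.
  move=> fA; have [t0 e0] := q2_zero st F1 (submx1 A) (fA _ F1 (submx1 A) A1).
  split; first by rewrite mxE -thE.
  rewrite /mkset r2vK; apply/rowP => j; rewrite fe_row /fe -evE -row_mul e0 !mxE//.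
move=> [h1 h2] B; rewrite !inE => /orP[]/eqP ->; last first.
  by rewrite submx0 => /eqP ->; rewrite submx_refl.
move=> _ _; have := q2_xt st p F1 (submx1 A).
rewrite /tau thE; have -> : (set_val p : 'rV[R]_(1 + n)) 0 (lshift n 0) = 0 by move: h1; rewrite mxE.
rewrite expr0n /= add0r big1// => j _.
rewrite evE -/(fe (row j A) _) -fe_row; move: h2; rewrite /mkset r2vK => ->.
by rewrite mxE expr0n.
Qed.

End Radial.

(** * The diagonals at infinity *)

Section Dimension.
Context {R : realType}.

(** [size_order] allows any function [d] that gives dimensions, so dimension has to be well defined.
    By Hadamard's lemma each system of equations of [Z] is a combination of the other; the product
    of the two coefficient matrices is the identity at [p], which bounds the ranks. *)
Lemma codim_le (X : germ_space R) (Z : set X) (p : X) (c0 c : coords X) (A0 A : {set 'I_(sdim X)}) :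
  ambient X -> Z p -> p_submanifold_at Z p c0 A0 -> p_submanifold_at Z p c A -> (#|A0| <= #|A|)%N.
Proof.
move=> aX Zp [ac0 E0] [ac E].
have ch0 := adapted_chart ac0; have ch := adapted_chart ac.
have dp0 := adapted_dom ac0; have dp := adapted_dom ac.
have nd : \forall q \near p, dom c q /\ dom c0 q.
  by apply: nearI; apply: open_nbhs_nbhs; split=> //; [exact: embeds_open ch.1|exact: embeds_open ch0.1].
have quot (c1 c2 : coords X) A1 A2 : chart c1 -> chart c2 -> dom c1 p -> dom c2 p ->
    Z `&` dom c1 = vanishing c1 A1 `&` dom c1 -> Z `&` dom c2 = vanishing c2 A2 `&` dom c2 ->
    exists g : 'I_(sdim X) -> 'I_(sdim X) -> X -> R, forall k, k \in A1 -> (forall i, smooth_near p (g k i)) /\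
     \forall q \near p, crd c1 q 0 k = \sum_(i in A2) crd c2 q 0 i * g k i q.
  move=> ch1 ch2 dp1 dp2 E1 E2.
  have nd' : \forall q \near p, dom c1 q /\ dom c2 q.
    by apply: nearI; apply: open_nbhs_nbhs; split=> //; [exact: embeds_open ch1.1|exact: embeds_open ch2.1].
  have : forall k, exists g : 'I_(sdim X) -> X -> R, k \in A1 -> (forall i, smooth_near p (g i)) /\
     \forall q \near p, crd c1 q 0 k = \sum_(i in A2) crd c2 q 0 i * g i q.
    move=> k; have [kA|] := boolP (k \in A1); last by exists (fun _ _ => 0).
    have [||g gE] := @chart_hadamard R X p c2 A2 (fun q => crd c1 q 0 k) ch2 dp2 ((vanishing_eq E2 dp2).1 Zp).
    - exact: Sm_embed_coord ch1.1 dp1.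
    - by apply: filterS nd' => q [d1 d2] /(vanishing_eq E2 d2)/(vanishing_eq E1 d1); apply.
    - by exists g.
  by move=> /choice[g hg]; exists g.
have [g hg] := quot c0 c A0 A ch0 ch dp0 dp E0 E.
have [h hh] := quot c c0 A A0 ch ch0 dp dp0 E E0.
pose M k l q := \sum_(i in A) g k i q * h i l q.
have x0 i : i \in A0 -> crd c0 p 0 i = 0 by exact: (vanishing_eq E0 dp0).1.
have ME : forall k l, k \in A0 -> l \in A0 -> M k l p = (k == l)%:R.
  move=> k l kA lA; apply/eqP; rewrite -subr_eq0; apply/negPn/negP => ne.
  have sM : smooth_near p (fun q => M k l q - (k == l)%:R).
    apply: (SmB aX); last exact: (Sm_cst aX).
    apply: (Sm_sum aX) => i iA; apply: (SmM aX); [by case: (hg k kA)|by case: (hh i iA)].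
  have n1 : \forall q \near p, M k l q - (k == l)%:R != 0.
    exact: (cvgr_neq0 _ (Sm_cont aX sM) ne).
  have n2 : \forall q \near p, forall i, i \in A -> crd c q 0 i = \sum_(j in A0) crd c0 q 0 j * h i j q.
    apply: near_forall => i.
    have [iA|iA] := boolP (i \in A); last by apply: near_all.
    by have [_] := hh i iA; apply: filterS.
  have n3 := (hg k kA).2.
  have n4 := chart_near_pt ch0 dp0 (nearI n1 (nearI n2 n3)).
  have cp : corner (bnd c0) (crd c0 p) by exact: (chart_corner ch0 dp0).
  have d0 j : j \in bnd c0 -> crd c0 p 0 j = 0 -> 0 <= (delta_mx 0 l : 'rV[R]_(sdim X)) 0 j.
    by move=> _ _; rewrite mxE ler0n.
  have n5 := corner_near cp d0 n4.
  have [t [[hq hc] t0]] := filter_ex (rightI n5 (nbhs_right_gt 0)).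
  have [q [dq qE [m1 [m2 m3]]]] := hq hc.
  have xq j : j \in A0 -> crd c0 q 0 j = t * (j == l)%:R.
    by move=> jA; rewrite qE !mxE eqxx x0// add0r.
  have : crd c0 q 0 k = \sum_(j in A0) crd c0 q 0 j * M k j q.
    rewrite m3; under eq_bigr => i iA do rewrite m2// mulr_suml.
    rewrite exchange_big /=; apply: eq_bigr => j _; rewrite mulr_sumr.
    by apply: eq_bigr => i _; ring.
  rewrite (bigD1 l)//= big1 => [|j /andP[jA jl]]; last by rewrite xq// (negbTE jl) mulr0 mul0r.
  rewrite addr0 !xq// eqxx mulr1 => /(mulfI (lt0r_neq0 t0)) MkE.
  by move: m1; rewrite -MkE subrr eqxx.
pose Gm : 'M[R]_(#|A0|, #|A|) := \matrix_(a, b) g (enum_val a) (enum_val b) p.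
pose Hm : 'M[R]_(#|A|, #|A0|) := \matrix_(a, b) h (enum_val a) (enum_val b) p.
have GH : Gm *m Hm = 1%:M.
  apply/matrixP => a b; rewrite !mxE.
  have := ME _ _ (enum_valP a) (enum_valP b); rewrite (inj_eq enum_val_inj) => <-.
  rewrite /M [RHS]big_enum_val; apply: eq_bigr => i _; by rewrite !mxE.
rewrite -[X in (X <= _)%N](mxrank1 R) -GH; apply: leq_trans (mxrankM_maxl _ _) _.
exact: rank_leq_col.
Qed.

Lemma psub_dim_uniq (X : germ_space R) (Z : set X) d d' : ambient X -> Z !=set0 ->
  p_submanifold_dim Z d -> p_submanifold_dim Z d' -> d = d'.
Proof.
move=> aX [p Zp] [_ /(_ p Zp)[c [A [h e]]]] [_ /(_ p Zp)[c' [A' [h' e']]]].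
have := codim_le aX Zp h h'; have := codim_le aX Zp h' h => l1 l2.
have E : #|A| = #|A'| by apply/eqP; rewrite eqn_leq l1 l2.
by apply/eqP; rewrite -(eqn_add2l #|A|) e E e'.
Qed.

End Dimension.

Section RadialCollection.
Context {R : realType} (W : vectType R).
Let n := dim W.
Let F0 : seq 'M[R]_n := [:: 1%:M; 0].
Let st := radial_stage W.
Let aX : ambient (radial W) := presents_ambient (radial_presents W).

Lemma radial_center (A : 'M[R]_n) : A != 0 -> ~~ (1%:M <= A)%MS -> next_center F0 A.
Proof.
move=> A0 A1; split=> //.
  move=> B; rewrite !inE => /orP[]/eqP ->// h; by rewrite h in A1.
move=> B; rewrite !inE => /orP[]/eqP -> => [_|]; last by rewrite eqxx.
by exists 1%:M; rewrite ?inE ?eqxx//; apply: eqmx_sym; apply/addsmx_idPr; exact: submx1.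
Qed.

Lemma rank_not_full (A : 'M[R]_n) : ~~ (1%:M <= A)%MS -> (\rank A < n)%N.
Proof. by move=> A1; rewrite ltn_neqAle rank_leq_row andbT; move: A1; rewrite sub1mx. Qed.

Lemma face_dim (A : 'M[R]_n) : A != 0 -> ~~ (1%:M <= A)%MS ->
  p_submanifold_dim (face (radial_iota (W:=W)) F0 A) (n - (\rank A).+1)%N.
Proof.
move=> A0 A1; split; first by apply: (face_closed st).
move=> p fp; have [c [S [M1 [M2 [[h _ _] cS]]]]] := face_normal st erefl (radial_center A0 A1) fp.
by exists c, S; split=> //; rewrite cS subnKC// rank_not_full.
Qed.

(** In the initial stage the chain at a point at infinity is [1 > 0], and every flat whose face
    contains the point lies in the kernel of one limit functional. A basis adapted to this kernel
    gives coordinates in which all these faces are linear at once, with [1 / R_0] as boundary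
    coordinate. *)
Lemma face_clean (p : radial W) : tau (radial_iota (W:=W)) p 1%:M = 0 ->
  exists c : coords (radial W), adapted p c /\ forall A : 'M[R]_n, A != 0 -> ~~ (1%:M <= A)%MS ->
    face (radial_iota (W:=W)) F0 A p ->
    exists (S : {set 'I_(sdim (radial W))}) r (L : 'M[R]_(sdim (radial W), r)),
      [/\ S \subset bnd c, forall i j, i \in bnd c -> L i j = 0 &
        face (radial_iota (W:=W)) F0 A `&` dom c = vanishing c S `&` [set q | crd c q *m L = 0] `&` dom c].
Proof.
move=> t0; have [m [Ac ch]] := chain_ex st p.
have c0 : Ac 0%N = 1%:M by case: ch.
have m1 : (0 < m)%N.
  rewrite lt0n; apply/eqP => m0; case: ch => _ _ _ [_]; by rewrite m0 c0 t0 ltxx.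
have [f0 fS fE fN] := chain_flag st ch.
have z1 : Ac 1%N = 0.
  have : Ac 1%N \in F0 by case: ch => _ h _ _ _; exact: h.
  rewrite !inE => /orP[]/eqP // h.
  have := fE 0%N m1; rewrite h mul1mx => e0; have [f [_]] := fN 0%N m1.
  by rewrite e0 mulmx0 mxE eqxx.
have mE : m = 1%N.
  apply/eqP; rewrite eqn_leq m1 andbT leqNgt; apply/negP => lt.
  have : tau (radial_iota (W:=W)) p (Ac 1%N) = 0 by case: ch => _ _ _ [h _] _; exact: h.
  by rewrite z1 (tau0_gt0 st) => /eqP; rewrite oner_eq0.
subst m; pose Ke := kermx (ev (radial_iota (W:=W)) p (Ac 0%N)).
have gl := graded_last ch z1 (_ : Ke <= Ac 0%N)%MS (mulmx_ker _).
have {}gl := gl (ltac:(by rewrite c0 submx1)).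
have nT : nbhs p [set: radial W] by exact: filterT.
have [K [lev [dm [g [U [kb [cg [gi gK gl' gd] kc UW hU]]]]]]] := chart_ex st ch gl nT.
have [d dd dl] : exists2 c, c \in dm & lev c = 0%N by case: cg => _; exact.
have gdm c : g c \notin dm by rewrite gd finset.inE.
have Kf : row_free K by have [cg1 _] := cg; apply: (graded_free fS cg1).
have [Up e im zp] := kc.
exists (@Coords R (radial W) U kb dm); split; first by split.
move=> A A0 A1 fA; have nA := radial_center A0 A1.
have [i [mi _ Ai e0]] := face_chain st ch nA fA.
have i0 : i = 0%N by move: mi => -[].
subst i.
have coef_out j c : (forall a, c != g a) -> coef K A j c = 0.
  move=> cg'; pose G : 'M[R]_(\rank Ke, n) := \matrix_(c, j) (j == g c)%:R.
  have GK : G *m K = row_base Ke.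
    apply/row_matrixP => c'; rewrite row_mul -gK [in RHS]rowE; congr (_ *m _).
    by apply/rowP => j'; rewrite !mxE.
  have /submxP[D AD] : (A <= row_base Ke)%MS by rewrite eq_row_base; apply/sub_kermxP.
  have -> : coef K A = D *m G.
    by apply: (row_free_inj Kf); rewrite (coefK ch cg) -mulmxA GK -AD.
  by rewrite [LHS]mxE big1// => c' _; rewrite [X in _ * X]mxE (negbTE (cg' c')) mulr0.
have coef_dm j c : c \in dm -> coef K A j c = 0.
  move=> cd; apply: coef_out => a; apply/eqP => ca; move: (gdm a); by rewrite -ca cd.
have lev0 c : lev c = 0%N.
  have [[h _ _ _ _] _] := cg; have [h1 h2] := h c.
  apply/eqP; rewrite -leqn0 leqNgt; apply/negP => lt.
  have le : lev c = 1%N by apply/eqP; rewrite eqn_leq h1 lt.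
  move: h2; rewrite le z1 submx0 => /eqP r0.
  have : delta_mx 0 c = 0 :> 'rV[R]_n by apply: (row_free_inj Kf); rewrite mul0mx -rowE.
  by move/rowP/(_ c); rewrite !mxE !eqxx => /eqP; rewrite oner_eq0.
have numE u : cnum K lev dm A 0%N u = 0 <-> u 0 d = 0 /\ u *m (coef K A)^T = 0.
  have rd : rr lev dm 0%N u = u 0 d by have := rr_S cg u dd; rewrite dl (rr_ge cg _ (leqnn 1)) mulr1.
  have cE j : (u *m (coef K A)^T) 0 j = cnum K lev dm A 0%N u 0 (rshift 1 j).
    rewrite row_mxEr !mxE; apply: eq_bigr => c _; rewrite mxE mulrC.
    have [cd|cd] := boolP (c \in dm); first by rewrite coef_dm// !mul0r.
    by rewrite /hat (negbTE cd) lev0 qq_ge// mulr1.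
  split=> [h|[h1 h2]].
    split; first by have /rowP/(_ (lshift n 0)) := h; rewrite row_mxEl !mxE rd.
    by apply/rowP => j; rewrite cE h !mxE.
  apply/rowP => k; case: (split_ordP k) => j -> /=.
    by rewrite row_mxEl !mxE rd.
  by rewrite -cE h2 !mxE.
have F1 : 1%:M \in F0 by rewrite inE eqxx.
have A0l : leveled (radial_iota (W:=W)) p 1 Ac (Ac 0%N) 0%N by apply: (leveled_chain st ch).
have fE' q : U q -> face (radial_iota (W:=W)) F0 A q <-> cnum K lev dm A 0%N (kb q) = 0.
  move=> Uq; have A0F : Ac 0%N \in F0 by rewrite c0.
  have hq := q2_chart st ch cg kc hU Uq Ai A0F A0l (leqnn 0%N).
  rewrite qq_ge// mulr1 in hq.
  have dX := presents_dense (radial_presents W).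
  have n0 : cnum K lev dm (Ac 0%N) 0%N (kb q) != 0 by case: (hU q Uq) => _; exact.
  split=> [fq|n00].
    have An : ~~ (Ac 0%N <= A)%MS by rewrite c0.
    have /esym/eqP := xt_uniq aX dX (fq _ A0F Ai An) hq.
    by rewrite sqrf_eq0 mulf_eq0 invr_eq0 (gt_eqF (nrm_gt0 n0)) orbF => /eqP /nrm_eq0.
  move=> B; rewrite !inE => /orP[]/eqP -> => [_ _|]; last by rewrite submx0 (negbTE A0).
  move: hq; rewrite n00 c0 /nrm big1 ?sqrtr0 ?mul0r ?expr0n// => l _; by rewrite mxE expr0n.
exists [set d]%SET, n, (coef K A)^T; split.
- by rewrite finset.sub1set.
- by move=> i j ib; rewrite mxE coef_dm.
- apply/seteqP; split=> q.
    move=> [fq Uq]; have [h1 h2] := (numE _).1 ((fE' q Uq).1 fq).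
    by split=> //; split=> // i; rewrite finset.inE => /eqP ->.
  move=> [[h1 h2] Uq]; split=> //; apply/(fE' q Uq)/numE; split=> //.
  by apply: h1; rewrite finset.inE.
Qed.

End RadialCollection.

(** * Flats spanned by differences of two entries *)

Section Flats.
Context {R : realType}.

Lemma lin_matrix (V W : vectType R) (f : V -> W) : linear f ->
  exists M : 'M[R]_(dim V, dim W), forall v, v2r (f v) = v2r v *m M.
Proof.
move=> lf; have lg : linear (fun x : 'rV[R]_(dim V) => v2r (f (@r2v R V x))).
  by move=> a x y; rewrite linearP lf linearP.
pose g : {linear 'rV[R]_(dim V) -> 'rV[R]_(dim W)} :=
  HB.pack (fun x : 'rV[R]_(dim V) => v2r (f (@r2v R V x))) (GRing.isLinear.Build R _ _ _ _ lg).
exists (lin1_mx g) => v; rewrite mul_rV_lin1 /= v2rK //.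
Qed.

Lemma row_free_trE n (A : 'M[R]_n) : row_free A^T = row_full A.
Proof. by rewrite /row_free mxrank_tr. Qed.

(** For linear [f] the row space is spanned by the coordinate functionals of [f]; [genmx] turns the
    transpose of the matrix of [f], which has [dim W] rows, into a square matrix. *)
Definition ann_mx (V W : vectType R) (f : V -> W) : 'M[R]_(dim V) := match pselect (linear f) with
  | left h => <<(projT1 (cid (lin_matrix h)))^T>>%MS | right _ => 0 end.

Lemma mul_tr0 m n k (A : 'M[R]_(m, n)) (B : 'M[R]_(k, n)) (x : 'rV[R]_n) :
  (A :=: B)%MS -> x *m A^T = 0 -> x *m B^T = 0.
Proof.
move=> AB h; have : (A <= kermx x^T)%MS by apply/sub_kermxP; rewrite -[A]trmxK -trmx_mul h trmx0.
rewrite AB => /sub_kermxP h2; by rewrite -[x]trmxK -trmx_mul h2 trmx0.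
Qed.

Lemma ann_mxP (V W : vectType R) (f : V -> W) v : linear f -> (v2r v *m (ann_mx f)^T = 0) <-> f v = 0.
Proof.
move=> lf; rewrite /ann_mx; case: pselect => [h|//]; case: cid => M /= hM.
have E : v2r v *m M = 0 <-> f v = 0.
  rewrite -hM; split=> [h0|->]; last by rewrite linear0.
  by apply: (can_inj v2rK); rewrite h0 linear0.
rewrite -E -[in X in _ <-> X](trmxK M); split; apply: mul_tr0.
  exact: genmxE.
exact: (eqmx_sym (genmxE _)).
Qed.

Variable V : vectType R.

Lemma representativeE k (v : vpow V k) j : representative v (lift ord_max j) = v j.
Proof. by rewrite /representative liftK. Qed.

Lemma representative_max k (v : vpow V k) : representative v ord_max = 0.
Proof. by rewrite /representative unlift_none. Qed.

(** With the representative [(v_1, ..., v_k, 0)] both [D_j] and [D_jl] say that two entries are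
    equal, so pairs of indices describe all diagonals uniformly. *)
Definition pdiff k (ab : 'I_k.+1 * 'I_k.+1) (v : vpow V k) : V :=
  representative v ab.1 - representative v ab.2.

Lemma representative_linear k a : linear (fun v : vpow V k => representative v a).
Proof.
move=> x u v; rewrite /representative; case: (unlift ord_max a) => [j|]; first by rewrite !ffunE.
by rewrite scaler0 addr0.
Qed.

Lemma pdiff_linear k (ab : 'I_k.+1 * 'I_k.+1) : linear (pdiff ab).
Proof.
move=> x u v; rewrite /pdiff !(representative_linear, scalerBr) //.
by rewrite opprD addrACA.
Qed.

(** The outer [genmx] selects one matrix per row space, so that flats with the same span are equal
    as matrices and can be listed without repetition. *)
Definition flat_mx k (K : {set 'I_k.+1 * 'I_k.+1}) : 'M[R]_(dim (vpow V k)) :=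
  <<(\sum_(ab in K) ann_mx (pdiff ab))%MS>>%MS.

Lemma flat_mxP k (K : {set 'I_k.+1 * 'I_k.+1}) (v : vpow V k) :
  v2r v *m (flat_mx K)^T = 0 <-> forall ab, ab \in K -> representative v ab.1 = representative v ab.2.
Proof.
have sw m (A : 'M[R]_(m, _)) : v2r v *m A^T = 0 <-> (A <= kermx (v2r v)^T)%MS.
  split=> [h|/sub_kermxP h]; first by apply/sub_kermxP; rewrite -[A]trmxK -trmx_mul h trmx0.
  by rewrite -[v2r v]trmxK -trmx_mul h trmx0.
rewrite sw genmxE; split=> [/sumsmx_subP h ab abK|h].
  apply/eqP; rewrite -subr_eq0; apply/eqP/(ann_mxP _ (pdiff_linear ab)).
  by apply/sw; exact: h.
apply/sumsmx_subP => ab abK; apply/sw/(ann_mxP _ (pdiff_linear ab)).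
by rewrite /pdiff h// subrr.
Qed.

Lemma flat_mx_genmx k (K : {set 'I_k.+1 * 'I_k.+1}) : <<flat_mx K>>%MS = flat_mx K.
Proof. exact: genmx_id. Qed.

Lemma flat_mx_eq k (K K' : {set 'I_k.+1 * 'I_k.+1}) : (flat_mx K :=: flat_mx K')%MS -> flat_mx K = flat_mx K'.
Proof. by move=> h; rewrite -flat_mx_genmx -[RHS]flat_mx_genmx; apply/genmxP/eqmxP. Qed.

Lemma flat_mxU k (K K' : {set 'I_k.+1 * 'I_k.+1}) : (flat_mx (K :|: K') :=: flat_mx K + flat_mx K')%MS.
Proof.
apply/eqmxP/andP; split.
  rewrite genmxE; apply/sumsmx_subP => ab; rewrite finset.inE => /orP[abK|abK].
    apply: submx_trans (addsmxSl _ _); rewrite genmxE; exact: sumsmx_sup (submx_refl _).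
  apply: submx_trans (addsmxSr _ _); rewrite genmxE; exact: sumsmx_sup (submx_refl _).
rewrite addsmx_sub !genmxE; apply/andP; split; apply/sumsmx_subP => ab abK;
  apply: (sumsmx_sup ab) (submx_refl _); by rewrite finset.inE abK ?orbT.
Qed.

Lemma flat_mx0 k : flat_mx (finset.set0 : {set 'I_k.+1 * 'I_k.+1}) = 0.
Proof. by rewrite /flat_mx big_set0 genmx0. Qed.

Lemma flat_mxT k : flat_mx (finset.setT : {set 'I_k.+1 * 'I_k.+1}) = 1%:M.
Proof.
rewrite -flat_mx_genmx -genmx1; apply/genmxP; rewrite submx1 /= sub1mx -row_free_trE.
apply: inj_row_free => x xA.
have := (flat_mxP finset.setT (@r2v R (vpow V k) x)).1; rewrite r2vK => /(_ xA) h.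
suff x0 : @r2v R (vpow V k) x = 0 by rewrite -[x](@r2vK R (vpow V k)) x0 linear0.
apply/ffunP => j; rewrite -representativeE [RHS]ffunE.
by have := h (lift ord_max j, ord_max); rewrite finset.inE representative_max => ->.
Qed.

Definition is_flat k (A : 'M[R]_(dim (vpow V k))) := exists K, A = flat_mx K.
Definition kerset (W : vectType R) (A : 'M[R]_(dim W)) : set W := [set w : W | v2r w *m A^T = 0].

Lemma half_sphere0 (W : vectType R) (x : 'rV[R]_(dim W)) : x != 0 ->
  @half_sphere R W (row_mx 0 ((nrm x)^-1 *: x)).
Proof.
move=> x0; split; first by rewrite row_mxKl mxE.
rewrite big_split_ord /= big_ord1 row_mxEl mxE expr0n /= add0r.
by under eq_bigr do rewrite row_mxEr; rewrite -nrm2 nrm_normalize ?expr1n.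
Qed.

Lemma kerset_neq0 (W : vectType R) (A : 'M[R]_(dim W)) :
  at_infinity (kerset A) !=set0 <-> ~~ (1%:M <= A)%MS.
Proof.
split=> [[q [q0 hq]]|A1].
  apply/negP => A1; have [_ h] := set_valP q.
  have r0 : rsubmx (set_val q : 'rV[R]_(1 + dim W)) = 0.
    move: hq; rewrite /kerset /mkset r2vK => hq.
    have : row_free A^T by rewrite row_free_trE -sub1mx.
    by move=> /row_free_inj; apply; rewrite hq mul0mx.
  have := h; rewrite big_split_ord /= big_ord1; move: q0; rewrite mxE => ->.
  rewrite expr0n /= add0r big1 => [/esym/eqP|j _]; first by rewrite oner_eq0.
  by have /rowP/(_ j) := r0; rewrite !mxE => ->; rewrite expr0n.
have [x x0 xA] : exists2 x : 'rV[R]_(dim W), x != 0 & x *m A^T = 0.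
  apply: contrapT => h; case/negP: A1; rewrite sub1mx -row_free_trE.
  apply: inj_row_free => x xA; apply/eqP/negPn/negP => x0; by apply: h; exists x.
pose y : 'rV[R]_(1 + dim W) := row_mx 0 ((nrm x)^-1 *: x).
have yh : half_sphere y by exact: half_sphere0.
exists (exist (fun w => w \in @half_sphere R W) y (mem_set yh)); split=> /=.
  by rewrite row_mxKl mxE.
by rewrite row_mxKr /kerset /mkset r2vK -scalemxAl xA scaler0.
Qed.

Definition pair_set k (ab : 'I_k.+1 * 'I_k.+1) : set (vpow V k) :=
  [set v : vpow V k | representative v ab.1 = representative v ab.2].

Lemma diagonal_pair k (D : set (vpow V k)) : @diagonals R V k D <-> exists2 ab, ab.1 != ab.2 & D = pair_set ab.
Proof.
split.
  case=> [[j ->]|[j [l [jl ->]]]].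
    exists (lift ord_max j, ord_max) => /=; first by rewrite eq_sym neq_lift.
    by apply/seteqP; split=> v /=; rewrite /pair_set /= representativeE representative_max.
  exists (lift ord_max j, lift ord_max l) => /=.
    by rewrite (inj_eq lift_inj); apply/eqP => jl'; move: jl; rewrite jl' ltnn.
  by apply/seteqP; split=> v /=; rewrite /pair_set /= !representativeE.
move=> [[a b] /= ab ->]; rewrite /pair_set /=.
case: (unliftP ord_max a) => [j|] aE; case: (unliftP ord_max b) => [l|] bE; subst.
- right; have jl : j != l by apply: contraNneq ab => ->.
  have [lt|] := ltnP j l.
    by exists j, l; split=> //; apply/seteqP; split=> v /=; rewrite !representativeE.
  rewrite leq_eqVlt => /orP[/eqP h|lt]; first by move: jl; rewrite (val_inj h) eqxx.
  by exists l, j; split=> //; apply/seteqP; split=> v /=; rewrite !representativeE.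
- by left; exists j; apply/seteqP; split=> v /=; rewrite representativeE representative_max.
- by left; exists l; apply/seteqP; split=> v /=; rewrite representativeE representative_max.
- by rewrite eqxx in ab.
Qed.

(** A subcollection of diagonals corresponds to a set of pairs of indices. The full flat is excluded
    because it has no point at infinity, and the flat 0 because the whole sphere is an intersection
    of diagonals only for [V = 0], where the sphere is empty. *)
Lemma collectionE k (Z : set (radial (vpow V k))) : diagonals_at_infinity V k Z <->
  exists A, [/\ is_flat A, A != 0, ~~ (1%:M <= A)%MS & Z = at_infinity (kerset A)].
Proof.
split=> [[Z0 [K [K0 Kd ZE]]]|[A [[K ->] A0 A1 ->]]].
  pose K' : {set 'I_k.+1 * 'I_k.+1} := [set ab | (ab.1 != ab.2) && `[< K (pair_set ab) >]]%SET.
  have KE : \bigcap_(D in K) D = kerset (flat_mx K').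
    apply/seteqP; split=> v.
      move=> h; apply/flat_mxP => ab; rewrite finset.inE => /andP[_ /asboolP] /h.
      by [].
    move=> /flat_mxP h D KD; have [ab ab1 DE] := (diagonal_pair D).1 (Kd _ KD).
    rewrite DE; apply: h; rewrite finset.inE ab1; apply/asboolP; by rewrite -DE.
  have ZE' : Z = at_infinity (kerset (flat_mx K')) by rewrite ZE KE.
  have A1 : ~~ (1%:M <= flat_mx K')%MS by apply/kerset_neq0; rewrite -ZE'.
  exists (flat_mx K'); split=> //; first by exists K'.
  apply/eqP => A0.
  have all0 v ab : ab \in K' -> representative (v : vpow V k) ab.1 = representative v ab.2.
    by apply: (flat_mxP K' v).1; rewrite A0 trmx0 mulmx0.
  have [D KD] := K0; have [[a b] ab DE] := (diagonal_pair D).1 (Kd _ KD); rewrite /= in ab.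
  have abK : (a, b) \in K' by rewrite finset.inE /= ab; apply/asboolP; rewrite -DE.
  (* If the flat is 0, some diagonal [w_a = w_b] is the whole space; testing it on vectors with one
     nonzero entry gives [V = 0], and then the matrices 1 and 0 coincide. *)
  have V0 (u : V) : u = 0.
    case: (unliftP ord_max a) => [j|] aE.
      pose w : vpow V k := [ffun i => if i == j then u else 0].
      have := all0 w _ abK; rewrite /= aE representativeE ffunE eqxx => ->.
      case: (unliftP ord_max b) => [l|] bE; rewrite bE; last by rewrite representative_max.
      rewrite representativeE ffunE; case: eqP => // lj.
      by move: ab; rewrite aE bE lj eqxx.
    case: (unliftP ord_max b) => [l|] bE; last by move: ab; rewrite aE bE eqxx.
    pose w : vpow V k := [ffun i => if i == l then u else 0].
    by have := all0 w _ abK; rewrite /= aE bE representativeE representative_max ffunE eqxx => <-.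
  case/negP: A1; rewrite A0 submx0; apply/eqP/row_matrixP => i; rewrite row0.
  rewrite -[row i _](@r2vK R (vpow V k)).
  have -> : @r2v R (vpow V k) (row i 1%:M) = 0; last by rewrite linear0.
  by apply/ffunP => j; rewrite [RHS]ffunE; exact: V0.
split; first exact/kerset_neq0.
exists [set D | exists2 ab, ab \in K & ab.1 != ab.2 /\ D = pair_set ab]; split.
- have [[ab [abK ab1]]|h] := pselect (exists ab, ab \in K /\ ab.1 != ab.2).
    by exists (pair_set ab), ab.
  case/eqP: A0; rewrite -(flat_mx0 k); apply: flat_mx_eq; apply/eqmxP/andP; split; last by rewrite flat_mx0 sub0mx.
  rewrite genmxE; apply/sumsmx_subP => ab abK; rewrite flat_mx0 submx0.
  have abE : ab.1 = ab.2 by apply/eqP/negPn/negP => h1; apply: h; exists ab.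
  rewrite /ann_mx; case: pselect => // h2; case: cid => M /= hM.
  suff -> : M = 0 by rewrite trmx0 genmx0.
  apply/row_matrixP => i; rewrite row0 rowE -[delta_mx 0 i](@r2vK R (vpow V k)) -hM.
  by rewrite /pdiff abE subrr linear0.
- by move=> D [ab _ [ab1 ->]]; apply/diagonal_pair; exists ab.
- congr at_infinity; apply/seteqP; split=> v.
    by move=> /flat_mxP h D [ab abK [_ ->]]; exact: h.
  move=> h; apply/flat_mxP => ab abK; have [->//|ab1] := eqVneq ab.1 ab.2.
  by apply: (h (pair_set ab)); exists ab.
Qed.

End Flats.

Section Collection.
Context {R : realType}.

Lemma kermx_trP (W : vectType R) m (D : 'M[R]_(m, dim W)) (x : 'rV[R]_(dim W)) : x *m D^T = 0 <-> (D <= kermx x^T)%MS.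
Proof.
split=> [h|/sub_kermxP h]; first by apply/sub_kermxP; rewrite -[D]trmxK -trmx_mul h trmx0.
by rewrite -[x]trmxK -trmx_mul h trmx0.
Qed.

Lemma kersetD (W : vectType R) (A B C : 'M[R]_(dim W)) : (C :=: A + B)%MS ->
  at_infinity (kerset C) = at_infinity (kerset A) `&` at_infinity (kerset B).
Proof.
move=> CE; have kE w : kerset C w <-> kerset A w /\ kerset B w.
  rewrite /kerset /mkset !kermx_trP CE addsmx_sub; split; first by move/andP.
  by move=> ?; apply/andP.
apply/seteqP; split=> q; first by move=> [q0 /kE[]].
by move=> [[q0 h1] [_ h2]]; split=> //; apply/kE.
Qed.

(** The columns of [cokermx A] are solutions of the equations [A]; each nonzero one gives a point at
    infinity after normalization, where the equations [B] hold by hypothesis. *)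
Lemma kerset_sub (W : vectType R) (A B : 'M[R]_(dim W)) :
  at_infinity (kerset A) `<=` at_infinity (kerset B) -> (B <= A)%MS.
Proof.
move=> h; rewrite submxE; apply/eqP/matrixP => i j; rewrite [RHS]mxE.
pose x : 'rV[R]_(dim W) := (col j (cokermx A))^T.
have xA : x *m A^T = 0.
  apply/rowP => a; have := congr1 (fun M : 'M[R]_(dim W) => M a j) (mulmx_coker A).
  by rewrite /= [LHS]mxE [RHS]mxE => E0; rewrite [LHS]mxE [RHS]mxE; apply: etrans E0; apply: eq_bigr => c _; rewrite !mxE mulrC.
suff xB : x *m B^T = 0.
  have -> : (B *m cokermx A) i j = (x *m B^T) 0 i; last by rewrite xB mxE.
  by rewrite !mxE; apply: eq_bigr => c _; rewrite !mxE mulrC.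
have [->|x0] := eqVneq x 0; first by rewrite mul0mx.
pose y : 'rV[R]_(1 + dim W) := row_mx 0 ((nrm x)^-1 *: x).
have yh : half_sphere y by exact: half_sphere0.
have [|_] := h (exist (fun w => w \in @half_sphere R W) y (mem_set yh)).
  split; first by rewrite /= row_mxKl mxE.
  by rewrite /= row_mxKr /kerset /mkset r2vK -scalemxAl xA scaler0.
rewrite /= row_mxKr /kerset /mkset r2vK -scalemxAl => /eqP.
by rewrite scaler_eq0 invr_eq0 (gt_eqF (nrm_gt0 x0)) => /eqP.
Qed.

Variables (V : vectType R) (k : nat).
Local Notation W := (vpow V k : vectType R).
Local Notation n := (dim (vpow V k : vectType R)).
Let F0 : seq 'M[R]_n := [:: 1%:M; 0].
Let st := radial_stage W.
Let aX : ambient (radial W) := presents_ambient (radial_presents W).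

Definition proper_flat (A : 'M[R]_n) := [/\ is_flat (V := V) A, A != 0 & ~~ (1%:M <= A)%MS].

Lemma collection_face (A : 'M[R]_n) : ~~ (1%:M <= A)%MS ->
  at_infinity (kerset A) = face (radial_iota (W:=W)) F0 A.
Proof. by move=> A1; exact: (esym (radial_face A1)). Qed.

Lemma flat_inj (A B : 'M[R]_n) : is_flat (V := V) A -> is_flat (V := V) B -> (A :=: B)%MS -> A = B.
Proof. by move=> [K ->] [K' ->]; exact: flat_mx_eq. Qed.

Lemma flat_add (A B : 'M[R]_n) : is_flat (V := V) A -> is_flat (V := V) B ->
  exists2 C : 'M[R]_n, is_flat (V := V) C & (C :=: A + B)%MS.
Proof.
move=> [K ->] [K' ->]; exists (flat_mx V (K :|: K')%SET); last exact: flat_mxU.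
by exists (K :|: K')%SET.
Qed.

Lemma flat1 : is_flat (V := V) (1%:M : 'M[R]_n).
Proof. by exists finset.setT; rewrite flat_mxT. Qed.

Lemma flat0 : is_flat (V := V) (0 : 'M[R]_n).
Proof. by exists finset.set0; rewrite flat_mx0. Qed.

Lemma flat_full (A : 'M[R]_n) : is_flat (V := V) A -> (1%:M <= A)%MS -> A = 1%:M.
Proof. by move=> fA h; apply: flat_inj => //; [exact: flat1|apply/eqmxP; rewrite submx1 h]. Qed.

Lemma collection_inj (A B : 'M[R]_n) : is_flat (V := V) A -> is_flat (V := V) B ->
  at_infinity (kerset A) = at_infinity (kerset B) -> A = B.
Proof.
by move=> fA fB E; apply: flat_inj => //; apply/eqmxP/andP; split; apply: kerset_sub; rewrite E.
Qed.

Lemma proper_dim (A : 'M[R]_n) d : proper_flat A ->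
  p_submanifold_dim (at_infinity (kerset A)) d <-> d = (n - (\rank A).+1)%N.
Proof.
move=> [fA A0 A1]; have h := face_dim A0 A1; rewrite -collection_face// in h.
split=> [h'|->//]; apply: (psub_dim_uniq aX _ h' h).
exact/kerset_neq0.
Qed.

Lemma collection_proper (Z : set (radial W)) : diagonals_at_infinity V k Z <->
  exists2 A, proper_flat A & Z = at_infinity (kerset A).
Proof.
split=> [/collectionE[A [h1 h2 h3 h4]]|[A [h1 h2 h3] h4]]; first by exists A.
by apply/collectionE; exists A.
Qed.

Lemma collection_clean : p_clean (diagonals_at_infinity V k).
Proof.
split.
- apply: (sub_finite_set (B := (fun K => at_infinity (kerset (flat_mx V K))) @` [set: {set 'I_k.+1 * 'I_k.+1}])).
    by move=> Z /collection_proper[A [[K ->] _ _] ->]; exists K.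
  by apply: finite_image; exact: finite_finset.
- move=> Z /collection_proper[A pA ZE].
  have [c h] := (proper_dim _ pA).2 erefl; rewrite ZE; split=> // p Zp.
  by have [c0 [S [h1 _]]] := h p Zp; exists c0, S.
move=> p [Z /collection_proper[A [fA A0 A1] ZE] Zp].
have fp : face (radial_iota (W:=W)) F0 A p by rewrite -collection_face// -ZE.
have t0 : tau (radial_iota (W:=W)) p 1%:M = 0.
  have F1 : 1%:M \in F0 by rewrite inE eqxx.
  by have [] := q2_zero st F1 (submx1 A) (fp _ F1 (submx1 A) A1).
have [c [ac h]] := face_clean t0; exists c; split=> // Z' /collection_proper[B [fB B0 B1] ->].
rewrite collection_face// => fpB; exact: h.
Qed.

Lemma collection_inter : closed_under_intersection (diagonals_at_infinity V k).
Proof.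
move=> Z Z' /collection_proper[A [fA A0 A1] ->] /collection_proper[B [fB B0 B1] ->].
have [C fC CE] := flat_add fA fB; rewrite -(kersetD CE).
have [C1|C1] := boolP (1%:M <= C)%MS.
  left; apply/eqP/negPn/negP => /set0P h; have := (kerset_neq0 C).1 h; by rewrite C1.
right; apply/collection_proper; exists C => //; split=> //.
apply: contraNneq A0 => C0; rewrite -submx0 -C0 CE; exact: addsmxSl.
Qed.

Lemma collection_order (l : seq 'M[R]_n) : (forall A, A \in l <-> proper_flat A) -> uniq l ->
  sorted (fun A B : 'M[R]_n => \rank B <= \rank A)%N l -> good_order F0 l.
Proof.
move=> lP ul so; apply: (good_order_rank (P := fun A : 'M[R]_n => is_flat (V := V) A) _ _ _ ul _ _ _ so) => //.
- exact: flat_inj.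
- exact: flat_add.
- move=> A; split=> [fA|].
    rewrite mem_cat !inE; have [//|A1] := eqVneq A 1%:M; have [//|A0] := eqVneq A 0.
    by apply/lP; split=> //; apply: contra A1 => h; apply/eqP; exact: flat_full.
  rewrite mem_cat !inE => /orP[/orP[]/eqP ->|/lP[]//]; [exact: flat1|exact: flat0].
- move=> A /lP[_ A0 A1]; rewrite !inE negb_or A0 andbT; by apply: contraNneq A1 => ->.
- by move=> A /lP[].
- move=> B C _; rewrite !inE => /orP[]/eqP ->; last by rewrite eqxx.
  by rewrite mxrank1 rank_leq_row.
Qed.

Lemma rank_sub_leq (A B : 'M[R]_n) : proper_flat A -> proper_flat B ->
  (n - (\rank A).+1 <= n - (\rank B).+1)%N = (\rank B <= \rank A)%N.
Proof. by move=> [_ _ /rank_not_full h1] [_ _ /rank_not_full h2]; rewrite leq_sub2lE. Qed.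

Lemma collection_ex : exists (E : germ_space R) (b : E -> radial W),
  is_blowup_of_collection (diagonals_at_infinity V k) b.
Proof.
pose l0 : seq 'M[R]_n := undup [seq A <- [seq flat_mx V K | K <- enum [set: {set 'I_k.+1 * 'I_k.+1}]%SET] | (A != 0) && ~~ (1%:M <= A)%MS].
pose l := sort (fun A B : 'M[R]_n => \rank B <= \rank A)%N l0.
have lP A : A \in l <-> proper_flat A.
  rewrite mem_sort mem_undup mem_filter; split=> [/andP[/andP[A0 A1] /mapP[K _ AE]]|[[K ->] A0 A1]].
    by split=> //; exists K.
  rewrite A0 A1 /=; apply/mapP; exists K => //; by rewrite mem_enum finset.inE.
have ul : uniq l by rewrite sort_uniq undup_uniq.
have so : sorted (fun A B : 'M[R]_n => \rank B <= \rank A)%N l.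
  by apply: sort_sorted => A B; exact: leq_total.
have [E [b hb]] := iterated_ex st erefl (@radial_compact R W) (collection_order lP ul so).
exists E, b, [seq at_infinity (kerset A) | A <- l]; split; last first.
  have -> : [seq at_infinity (kerset A) | A <- l] = [seq face (radial_iota (W:=W)) F0 A | A <- l]; last exact: hb.
  by apply/eq_in_map => A /lP[_ _ A1]; exact: collection_face.
split.
- rewrite map_inj_in_uniq// => A B /lP[fA _ _] /lP[fB _ _]; exact: collection_inj.
- apply/seteqP; split=> Z /=.
    by move=> /mapP[A /lP pA ->]; apply/collection_proper; exists A.
  by move=> /collection_proper[A pA ->]; apply: map_f; apply/lP.
have : forall Z, exists d, diagonals_at_infinity V k Z -> p_submanifold_dim Z d.
  move=> Z; have [/collection_proper[A pA ->]|h] := pselect (diagonals_at_infinity V k Z); last by exists 0%N.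
  by exists (n - (\rank A).+1)%N => _; exact/(proper_dim _ pA).
move=> /choice[d hd]; exists d; split=> //.
have dE A : A \in l -> d (at_infinity (kerset A)) = (n - (\rank A).+1)%N.
  by move=> /lP pA; apply/(proper_dim _ pA)/hd/collection_proper; exists A.
rewrite sorted_map; have -> // := @eq_in_sorted _ (mem l) _ (fun A B : 'M[R]_n => \rank B <= \rank A)%N _ l (allss l).
by move=> A B Al Bl; rewrite /= !dE// rank_sub_leq//; apply/lP.
Qed.

(** An admissible order of the centers is translated into a list of flats. As dimensions are unique,
    weakly increasing dimension becomes weakly decreasing rank, and [iterated_stage] applies. In the
    end [F] consists of all flats, whatever the order. *)
Theorem collection_stage (E : germ_space R) (b : E -> radial W) :
  is_blowup_of_collection (diagonals_at_infinity V k) b ->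
  exists (iota : 'rV[R]_n -> E) N (Psi : 'rV[R]_n -> 'rV[R]_N) psi F,
    [/\ is_stage iota Psi psi F, forall A, A \in F <-> is_flat (V := V) A,
        forall v, b (iota v) = radial_iota v, compact [set: E] & sdim E = n].
Proof.
move=> [s [[us sC [d [hd so]]] ib]].
have : forall Z, exists A, diagonals_at_infinity V k Z -> proper_flat A /\ Z = at_infinity (kerset A).
  move=> Z; have [/collection_proper[A pA ->]|h] := pselect (diagonals_at_infinity V k Z); last by exists 0.
  by exists A.
move=> /choice[mat hm].
have sP Z : Z \in s <-> diagonals_at_infinity V k Z by rewrite -sC.
pose l : seq 'M[R]_n := [seq mat Z | Z <- s].
have lP A : A \in l <-> proper_flat A.
  split=> [/mapP[Z /sP/hm[pA _] ->]//|pA].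
  have ZC : diagonals_at_infinity V k (at_infinity (kerset A)) by apply/collection_proper; exists A.
  apply/mapP; exists (at_infinity (kerset A)); first exact/sP.
  have [[fB _ _] BE] := hm _ ZC; have [fA _ _] := pA.
  exact: collection_inj.
have sE : s = [seq at_infinity (kerset A) | A <- l].
  rewrite -map_comp -[LHS]map_id; apply/eq_in_map => Z /sP/hm[_ ZE]; exact: ZE.
have ul : uniq l by move: us; rewrite {1}sE; exact: map_uniq.
have dE A : A \in l -> d (at_infinity (kerset A)) = (n - (\rank A).+1)%N.
  by move=> /lP pA; apply/(proper_dim _ pA)/hd/collection_proper; exists A.
have sol : sorted (fun A B : 'M[R]_n => \rank B <= \rank A)%N l.
  move: so; rewrite sE sorted_map; have -> // := @eq_in_sorted _ (mem l) _ (fun A B : 'M[R]_n => \rank B <= \rank A)%N _ l (allss l).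
  by move=> A B Al Bl; rewrite /= !dE// rank_sub_leq//; apply/lP.
have sF : s = [seq face (radial_iota (W:=W)) F0 A | A <- l].
  by rewrite sE; apply/eq_in_map => A /lP[_ _ A1]; exact: collection_face.
have [iota' [N' [Psi' [psi' [h1 h2 h3 h4]]]]] := iterated_stage ib st erefl (@radial_compact R W) (collection_order lP ul sol) sF.
exists iota', N', Psi', psi', (catrev l F0); split=> // A.
rewrite catrevE mem_cat mem_rev !inE; split.
  move=> /orP[/lP[]//|/orP[]/eqP ->]; [exact: flat1|exact: flat0].
move=> fA; have [//|A1] := eqVneq A 1%:M; first by rewrite orbT.
have [//|A0] := eqVneq A 0; first by rewrite !orbT.
rewrite !orbF; apply/lP; split=> //; apply: contra A1 => h; apply/eqP; exact: flat_full.
Qed.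

End Collection.

(** * Boundary hypersurfaces *)

Section CoordinateChange.
Context {R : realType} (n : nat).

Definition box (p : 'rV[R]_n) (r : R) : set 'rV[R]_n := [set u | forall j, `|u 0 j - p 0 j| < r].

Lemma box_refl p r : 0 < r -> box p r p.
Proof. by move=> r0 j; rewrite subrr normr0. Qed.

Lemma box_nbhs p r : 0 < r -> nbhs p (box p r).
Proof.
move=> r0; apply: (@filter_forall _ _ (fun j (u : 'rV[R]_n) => `|u 0 j - p 0 j| < r) (nbhs p)) => j.
have := @sm_cont _ _ _ _ (sm_coord p j) => /cvgrPdist_lt/(_ r r0).
by apply: filterS => u; rewrite distrC.
Qed.

Lemma box_open p r : open (box p r).
Proof.
rewrite openE => u hu; rewrite /interior.
apply: (@filter_forall _ _ (fun j (u : 'rV[R]_n) => `|u 0 j - p 0 j| < r) (nbhs u)) => j.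
have c : {for u, continuous (fun u : 'rV[R]_n => `|u 0 j - p 0 j|)}.
  apply: cvg_norm; apply: cvgB; [exact: (sm_cont (sm_coord u j))|exact: cvg_cst].
exact: (near_cvg c (open_nbhs_nbhs (conj (@open_lt R r) (hu j)))).
Qed.

Lemma nbhs_box (p : 'rV[R]_n) W : nbhs p W -> exists2 r, 0 < r & box p r `<=` W.
Proof.
move=> /nbhs_ballP[e /= e0 h]; exists (e / 2); first exact: divr_gt0.
move=> u hu; apply: h; rewrite -ball_normE /ball_ /=.
apply: (@le_lt_trans _ _ (e / 2)); last by rewrite ltr_pdivrMr// ltr_pMr// ltr1n.
apply: rV_norm_le; first by rewrite ltW// divr_gt0.
by move=> j; rewrite !mxE distrC ltW.
Qed.

Lemma dn_cvg (f : R -> R) (l : R) : f t @[t --> (0:R)] --> l -> f t @[t --> (0:R)^'] --> l.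
Proof. by move=> c P nP; apply: nbhs_dnbhs; exact: c. Qed.

Variable d : 'I_n.

Definition setd (u : 'rV[R]_n) (a : R) : 'rV[R]_n := \row_j (if j == d then a else u 0 j).

Lemma setd_id u : setd u (u 0 d) = u.
Proof. by apply/rowP => j; rewrite mxE; case: eqP => // ->. Qed.

Lemma setd_setd u a b : setd (setd u a) b = setd u b.
Proof. by apply/rowP => j; rewrite !mxE; case: eqP. Qed.

Lemma setdd u a : setd u a 0 d = a.
Proof. by rewrite mxE eqxx. Qed.

Lemma setdE u a : setd u a = a *: delta_mx 0 d + setd u 0.
Proof. by apply/rowP => j; rewrite !mxE eqxx /=; case: eqP => _; rewrite ?mulr1 ?mulr0 ?addr0 ?add0r. Qed.

Variables (p : 'rV[R]_n) (r : R) (h : 'rV[R]_n -> R).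
Hypothesis hC : forall k, Ck_on k (box p r) h.
Hypothesis hD : forall u, box p r u -> 0 < 'D_(delta_mx 0 d) h u.

Let sh u : box p r u -> smooth_near_rV u h.
Proof. by move=> Bu; exists (box p r); split=> //; exact: box_open. Qed.

Lemma box_setd u a : box p r u -> `|a - p 0 d| < r -> box p r (setd u a).
Proof. by move=> Bu ha j; rewrite mxE; case: eqP => // ->. Qed.

Let der u t : box p r u -> `|t - p 0 d| < r ->
  is_derive t 1 (fun t => h (setd u t)) ('D_(delta_mx 0 d) h (setd u t)).
Proof.
move=> Bu ht; have := Ck_on_der d (hC 1) (box_setd Bu ht).
rewrite [X in is_derive X _ _ _]setdE => /is_derive_along.
by under [X in is_derive _ _ X _]eq_fun do rewrite -setdE.
Qed.

Let between a b t : `|a - p 0 d| < r -> `|b - p 0 d| < r -> a <= t <= b -> `|t - p 0 d| < r.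
Proof. by rewrite !ltr_norml => /andP[? ?] /andP[? ?] /andP[? ?]; apply/andP; split; lra. Qed.

Let line_cont u a b : box p r u -> `|a - p 0 d| < r -> `|b - p 0 d| < r ->
  {within `[a, b], continuous (fun t => h (setd u t))}.
Proof.
move=> Bu ha hb; apply: derivable_within_continuous => t; rewrite in_itv /= => ab.
by have [] := der Bu (between ha hb ab).
Qed.

Lemma coord_mono u a b : box p r u -> `|a - p 0 d| < r -> `|b - p 0 d| < r -> a < b ->
  h (setd u a) < h (setd u b).
Proof.
move=> Bu ha hb ab; rewrite -subr_gt0.
have Dg t : t \in `]a, b[%R -> is_derive t 1 (fun t => h (setd u t)) ('D_(delta_mx 0 d) h (setd u t)).
  rewrite in_itv /= => /andP[/ltW t1 /ltW t2]; apply: (der Bu).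
  by apply: (between ha hb); rewrite t1.
have [t tI ->] := MVT_segment (ltW ab) Dg (line_cont Bu ha hb).
rewrite mulr_gt0 ?subr_gt0//; apply: hD; apply: (box_setd Bu); apply: (between ha hb).
by move: tI; rewrite in_itv.
Qed.

(** The coordinate [d] is replaced by [h]. As the derivative of [h] along [d] is positive,
    bijectivity reduces to monotone functions of one variable on the segments of a box. *)
Definition phi (u : 'rV[R]_n) : 'rV[R]_n := setd u (h u).

Lemma phi_inj : {in box p r &, injective phi}.
Proof.
move=> u u' /set_mem Bu /set_mem Bu' E.
have uE : u' = setd u (u' 0 d).
  apply/rowP => j; rewrite mxE; case: eqP => [->//|/eqP jd].
  by have := congr1 (fun w : 'rV[R]_n => w 0 j) E; rewrite !mxE (negbTE jd).
have hE : h u = h u' by have := congr1 (fun w : 'rV[R]_n => w 0 d) E; rewrite !setdd.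
have [lt|lt|e] := ltgtP (u 0 d) (u' 0 d); last by rewrite uE -e setd_id.
- by have := coord_mono Bu (Bu d) (Bu' d) lt; rewrite -uE setd_id hE ltxx.
- by have := coord_mono Bu (Bu' d) (Bu d) lt; rewrite -uE setd_id hE ltxx.
Qed.

(** For [w] near [phi u], the value [w 0 d] lies between those of [h] at the two ends of a short
    segment in direction [d]; the intermediate value theorem gives the solution. *)
Lemma phi_solve u (P : set 'rV[R]_n) : box p r u -> nbhs u P ->
  \forall w \near phi u, exists u', [/\ box p r u', P u' & phi u' = w].
Proof.
move=> Bu nP; have nB : nbhs u (box p r) by apply: open_nbhs_nbhs; split=> //; exact: box_open.
have [e e0 eP] := nbhs_box (nearI nB nP).
pose e' := e / 2; have e'0 : 0 < e' by exact: divr_gt0.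
have e'e : e' < e by rewrite /e'; lra.
have near_e t : `|t - u 0 d| <= e' -> `|t - p 0 d| < r.
  move=> ht; have [] := eP (setd u t) _; last by move=> /(_ d); rewrite setdd.
  move=> j; rewrite mxE; case: eqP => [->|_]; first exact: le_lt_trans e'e.
  by rewrite subrr normr0.
have nm : `|(u 0 d - e') - u 0 d| <= e' by rewrite addrAC subrr sub0r normrN ger0_norm// ltW.
have np : `|(u 0 d + e') - u 0 d| <= e' by rewrite addrAC subrr add0r ger0_norm// ltW.
have cont t : `|t - u 0 d| <= e' -> h (setd w t) @[w --> phi u] --> h (setd u t).
  move=> ht; have -> : h (setd u t) = h (setd (phi u) t) by rewrite setd_setd.
  apply: (@sm_cont _ _ _ (fun w => h (setd w t))).
  apply: (@sm_comp _ _ _ _ (fun j w => if j == d then t else w 0 j)).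
    by move=> j; case: eqP => _; [exact: sm_cst|exact: sm_coord].
  apply: sh; have -> : \row_j (if j == d then t else phi u 0 j) = setd u t by rewrite -[RHS](setd_setd u (h u)).
  by apply: (box_setd Bu); exact: near_e.
have diff t (ht : `|t - u 0 d| <= e') : (h (setd w t) - w 0 d) @[w --> phi u] --> h (setd u t) - h u.
  by apply: cvgB (cont _ ht) _; have := sm_cont (sm_coord (phi u) d); rewrite /prop_for /continuous_at setdd.
have lo : \forall w \near phi u, h (setd w (u 0 d - e')) < (w : 'rV[R]_n) 0 d.
  have neg : h (setd u (u 0 d - e')) - h u < 0.
    rewrite subr_lt0 -[X in _ < h X]setd_id; apply: (coord_mono Bu (near_e _ nm) (Bu d)); by lra.
  by have := near_cvg (diff _ nm) (open_nbhs_nbhs (conj (@open_lt R 0) neg)); apply: filterS => w; rewrite /mkset subr_lt0.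
have hi : \forall w \near phi u, (w : 'rV[R]_n) 0 d < h (setd w (u 0 d + e')).
  have pos : 0 < h (setd u (u 0 d + e')) - h u.
    rewrite subr_gt0 -[X in h X < _]setd_id; apply: (coord_mono Bu (Bu d) (near_e _ np)); by lra.
  by have := near_cvg (diff _ np) (open_nbhs_nbhs (conj (@open_gt R 0) pos)); apply: filterS => w; rewrite /mkset subr_gt0.
have nb : \forall w \near phi u, forall j, j != d -> `|(w : 'rV[R]_n) 0 j - u 0 j| < e.
  have := box_nbhs (phi u) e0; apply: filterS => w hw j jd.
  by have := hw j; rewrite [phi u 0 j]mxE (negbTE jd).
apply: filterS (nearI nb (nearI lo hi)) => w [hw [l1 l2]].
have we t : `|t - u 0 d| <= e' -> box u e (setd w t).
  move=> ht j; rewrite mxE; case: eqP => [->|/eqP jd]; [exact: le_lt_trans e'e|exact: hw].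
have Bw : box p r (setd w (u 0 d)).
  by have [] := eP (setd w (u 0 d)) (we _ _); rewrite ?subrr ?normr0// ltW.
have wc : {within `[u 0 d - e', u 0 d + e'], continuous (fun t => h (setd w t))}.
  have := line_cont Bw (near_e _ nm) (near_e _ np).
  by under [X in {within _, continuous X}]eq_fun do rewrite setd_setd.
have [||t tI tE] := @IVT R (fun t => h (setd w t)) _ _ (w 0 d) _ wc; first by lra.
  by rewrite ge_min le_max (ltW l1) (ltW l2) orbT.
have te : `|t - u 0 d| <= e'.
  by move: tI; rewrite in_itv /= ler_norml => /andP[? ?]; apply/andP; split; lra.
exists (setd w t); have [B' P'] := eP _ (we _ te); split=> //.
by rewrite /phi tE setd_setd setd_id.
Qed.

Lemma phi_open (Q : set 'rV[R]_n) : open Q -> open (phi @` (Q `&` box p r)).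
Proof.
move=> oQ; rewrite openE => _ [u [Qu Bu] <-]; rewrite /interior.
have nQ : nbhs u Q by exact: open_nbhs_nbhs.
by apply: filterS (phi_solve Bu nQ) => w [u' [B' Q' <-]]; exists u'.
Qed.

Definition phi_inv (w : 'rV[R]_n) : 'rV[R]_n := match pselect (exists2 u, box p r u & phi u = w) with
  | left e => s2val (cid2 e) | right _ => 0 end.

Lemma phi_invK u : box p r u -> phi_inv (phi u) = u.
Proof.
move=> Bu; rewrite /phi_inv; case: pselect => [e|[]]; last by exists u.
by case: cid2 => u' /= B' E; apply: phi_inj => //; exact/mem_set.
Qed.

Let O := phi @` box p r.
Let oO : open O. Proof. by have := @phi_open setT openT; rewrite setTI. Qed.

Lemma phi_inv_cvg u : box p r u -> phi_inv w @[w --> phi u] --> u.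
Proof.
move=> Bu P nP; apply: filterS (phi_solve Bu nP) => w [u' [B' P' <-]].
by rewrite /preimage /= phi_invK.
Qed.

Let invd w := phi_inv w 0 d.
Let dinv (i : 'I_n) w := ((if i == d then 1 else - 'D_(delta_mx 0 i) h (phi_inv w))) /
   'D_(delta_mx 0 d) h (phi_inv w).

Let taylor_der u (G : 'I_n -> 'rV[R]_n -> R) i : box p r u -> smooth_near_rV u (G i) ->
  (\forall x \near u, h x = h u + \sum_k (x 0 k - u 0 k) * G k x) -> 'D_(delta_mx 0 i) h u = G i u.
Proof.
move=> Bu sG hE; apply: cvg_lim => //.
have c : G i (t *: delta_mx 0 i + u) @[t --> (0:R)] --> G i u.
  by apply: (cvg_comp _ _ (@cvg_lineC R n u (delta_mx 0 i))); exact: sm_cont.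
have nE := near_cvg (@cvg_lineC R n u (delta_mx 0 i)) hE.
apply: cvg_trans (dn_cvg c).
apply: near_eq_cvg; near=> t.
have t0 : t != 0 by near: t; exact: nbhs_dnbhs_neq.
change (G i (t *: delta_mx 0 i + u) = t^-1 *: (h (t *: delta_mx 0 i + u) - h u)).
have -> : h (t *: delta_mx 0 i + u) = h u + \sum_k ((t *: delta_mx 0 i + u) 0 k - u 0 k) * G k (t *: delta_mx 0 i + u).
  by near: t; apply: nbhs_dnbhs.
rewrite [_ + u]addrC taylor_line addrAC subrr add0r.
by rewrite /GRing.scale /= mulrA mulVf// mul1r.
Unshelve. all: by end_near. Qed.

(** With the smooth Taylor quotients [G] of [h] at [u], the relation between increments is linear in
    the increment of coordinate [d] and is solved for it before passing to the limit. *)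
Lemma is_derive_inv w i : O w -> is_derive w (delta_mx 0 i) (invd : 'rV[R]_n -> R^o) (dinv i w).
Proof.
move=> [u Bu <-]; have [G [sG hE]] := sm_taylor (sh Bu).
rewrite /dinv phi_invK//; have GE k := taylor_der Bu (sG k) hE; rewrite !GE.
set v := delta_mx 0 i : 'rV[R]_n.
have Gd : G d u != 0 by rewrite -GE gt_eqF// hD.
have cl : (t *: v + phi u) @[t --> (0:R)] --> phi u by exact: cvg_lineC.
have ci : phi_inv (t *: v + phi u) @[t --> (0:R)] --> u.
  by apply: (cvg_comp _ _ cl); exact: phi_inv_cvg.
have cG k : G k (phi_inv (t *: v + phi u)) @[t --> (0:R)] --> G k u.
  by apply: (cvg_comp _ _ ci); exact: sm_cont.
have n1 := near_cvg ci hE.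
have n2 := near_cvg cl (open_nbhs_nbhs (conj oO (ex_intro2 _ _ u Bu erefl : O (phi u)))).
have n3 := near_cvg (cG d) (open_nbhs_nbhs (conj (@open_neq R 0) Gd)).
have lim : (t^-1 *: (invd (t *: v + phi u) - invd (phi u))) @[t --> (0:R)^'] -->
    (if i == d then 1 else - G i u) / G d u.
  have c : ((if i == d then 1 else - G i (phi_inv (t *: v + phi u))) / G d (phi_inv (t *: v + phi u))) @[t --> (0:R)] -->
      (if i == d then 1 else - G i u) / G d u.
    apply: cvgM; last by apply: cvgV => //; exact: cG.
    by case: eqP => _; [exact: cvg_cst|apply: cvgN; exact: cG].
  apply: cvg_trans (dn_cvg c).
  apply: near_eq_cvg; near=> t.
  have t0 : t != 0 by near: t; exact: nbhs_dnbhs_neq.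
  have : G d (phi_inv (t *: v + phi u)) != 0 by near: t; apply: nbhs_dnbhs.
  have : O (t *: v + phi u) by near: t; apply: nbhs_dnbhs.
  have : h (phi_inv (t *: v + phi u)) = h u + \sum_k (phi_inv (t *: v + phi u) 0 k - u 0 k) * G k (phi_inv (t *: v + phi u)).
    by near: t; apply: nbhs_dnbhs.
  move=> + [x Bx xE]; rewrite -xE /invd !phi_invK// => hx gx.
  have xd : h x = t * (i == d)%:R + h u.
    by have := congr1 (fun w : 'rV[R]_n => w 0 d) xE; rewrite setdd !mxE !eqxx /= eq_sym.
  have xj k : k != d -> x 0 k - u 0 k = t * (k == i)%:R.
    by move=> kd; have := congr1 (fun w : 'rV[R]_n => w 0 k) xE; rewrite !mxE (negbTE kd) eqxx /= => ->; rewrite addrK.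
  have S : \sum_(k | k != d) (x 0 k - u 0 k) * G k x = t * (i != d)%:R * G i x.
    under eq_bigr => k kd do rewrite (xj k kd).
    have [->|id] := eqVneq i d.
      by rewrite big1 ?mulr0 ?mul0r// => k kd; rewrite (negbTE kd) mulr0 mul0r.
    rewrite (bigD1 i)//= eqxx mulr1 big1 ?addr0// => k /andP[_ ki].
    by rewrite (negbTE ki) mulr0 mul0r.
  move: hx; rewrite (bigD1 d)//= S xd => hx.
  have hx' : (x 0 d - u 0 d) * G d x = t * (i == d)%:R - t * (i != d)%:R * G i x by lra.
  have -> : x 0 d - u 0 d = (t * (i == d)%:R - t * (i != d)%:R * G i x) / G d x by rewrite -hx' mulfK.
  rewrite /GRing.scale /=; case: eqP => _ /=; by field; rewrite gx t0.
by apply: DeriveDef; [apply/cvg_ex; exists ((if i == d then 1 else - G i u) / G d u)|exact: cvg_lim lim].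
Unshelve. all: by end_near. Qed.

Lemma phi_invE w : O w -> phi_inv w = \row_j (if j == d then invd w else w 0 j).
Proof.
move=> [u Bu <-]; rewrite /invd phi_invK//; apply/rowP => j; rewrite !mxE; case: eqP => // ->//.
Qed.

(** Bootstrapping: the derivatives [dinv] of the inverse are smooth expressions in the inverse
    itself, so being C^k implies being C^(k+1). *)
Lemma Ck_on_inv k : Ck_on k O invd.
Proof.
elim: k => [|k IH].
  split=> // w [u Bu <-]; rewrite /prop_for /continuous_at /invd phi_invK//.
  by apply: (cvg_comp phi_inv (fun u : 'rV[R]_n => u 0 d) (phi_inv_cvg Bu)); exact: (sm_cont (sm_coord u d)).
apply: (Ck_onS (df := dinv)) => //.
- by move=> w Ow; exact: (Ck_on_cont IH Ow).
- by move=> w i Ow; exact: is_derive_inv.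
move=> i; have comp (g : 'rV[R]_n -> R) : (forall k, Ck_on k (box p r) g) -> Ck_on k O (fun w => g (phi_inv w)).
  move=> gC; apply: (@Ck_on_ext _ _ _ _ (fun w => g (\row_j (if j == d then invd w else w 0 j)))) => //.
    by move=> w Ow; rewrite -phi_invE.
  apply: (@Ck_on_comp _ _ _ _ _ (fun j w => if j == d then invd w else w 0 j) (box p r)) => //.
  - exact: box_open.
  - by move=> j; case: eqP => // _; exact: Ck_on_coord.
  by move=> w Ow; rewrite -phi_invE//; case: Ow => u Bu <-; rewrite phi_invK.
have cD j : Ck_on k O (fun w => 'D_(delta_mx 0 j) h (phi_inv w)).
  exact: (comp ('D_(delta_mx 0 j) h) (fun k' => Ck_on_D j (hC k'.+1))).
apply: Ck_onM => //.
  case: eqP => _; first exact: Ck_on_cst.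
  apply: (@Ck_on_ext _ _ _ _ (fun w => -1 * 'D_(delta_mx 0 i) h (phi_inv w))) => //.
    by move=> w _; rewrite mulN1r.
  by apply: Ck_onM => //; exact: Ck_on_cst.
apply: Ck_onV => // w [u Bu <-]; by rewrite phi_invK// gt_eqF// hD.
Qed.

Lemma phi_embeds : embeds (box p r : set (euclidean R n)) (phi : euclidean R n -> euclidean R n).
Proof.
apply: (@embeds_intro R (euclidean R n) (euclidean R n) (@ambient_euclidean R n) _ _ n id).
- exact: embeds_id.
- exact: box_open.
- move=> u Bu; apply: (@smooth_pull R (euclidean R n) (euclidean R n) (@ambient_euclidean R n) n id setT).
  + exact: embeds_id.
  + by [].
  + exact: near_all.
  move=> j; rewrite /=; apply: (@sm_eq _ _ _ (fun u => if j == d then h u else u 0 j)).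
    by apply: near_all => x; rewrite !mxE.
  by case: eqP => _; [exact: sh|exact: sm_coord].
move=> u Bu j; exists (fun w : 'rV[R]_n => if j == d then invd w else w 0 j).
  case: eqP => _; last exact: sm_coord.
  by exists O; split=> //; [exists u|exact: Ck_on_inv].
by apply: near_all => w q Bq <-; rewrite -[in LHS](phi_invK Bq) phi_invE ?mxE//; exists q.
Qed.

End CoordinateChange.

Section KChart.
Context {R : realType} (n : nat) (X : germ_space R).
Hypothesis aX : ambient X.
Implicit Types (p q : X) (U W : set X) (kb : X -> 'rV[R]_n) (D : {set 'I_n}).

Lemma kchart_corner p q U kb D c : kchart p U kb D -> U q -> c \in D -> 0 <= kb q 0 c.
Proof.
move=> [_ _ [Q _ im] _] Uq cD.
have [_ h] : (Q `&` corner D) (kb q) by rewrite -im; exists q.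
exact: h.
Qed.

Lemma kchart_open p U kb D q : kchart p U kb D -> U q -> nbhs q U.
Proof. by move=> [_ e _ _] Uq; exact: (embeds_dom e). Qed.

Lemma kchart_base p U kb D : kchart p U kb D -> U p.
Proof. by case. Qed.

Lemma kchart_Sm p U kb D q c : kchart p U kb D -> U q -> smooth_near q (fun q => kb q 0 c).
Proof. by move=> [_ e _ _] Uq; exact: Sm_embed_coord e Uq. Qed.

Lemma kchart_shrink p U kb D W : kchart p U kb D -> nbhs p W ->
  exists2 U', kchart p U' kb D & U' `<=` U `&` W.
Proof.
move=> kc nW; have [Up e [Q oQ im] z] := kc; have [B nB sB] := embeds_nbhsE e Up nW.
exists (U `&` kb @^-1` B°); last by move=> q [Uq Bq]; split=> //; apply: sB; split=> //; exact: interior_subset Bq.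
split=> //.
- apply: (embeds_sub _ _ e); first by move=> q [].
  by apply: (open_preimage e); exact: open_interior.
exists (Q `&` B°); first by apply: openI => //; exact: open_interior.
apply/seteqP; split=> u.
  move=> [q [Uq Bq] <-]; have [h1 h2] : (Q `&` corner D) (kb q) by rewrite -im; exists q.
  by split.
move=> [[Qu Bu] cu]; have [q Uq qu] : (kb @` U) u by rewrite im.
exists q; last exact: qu.
split; first exact: Uq.
by rewrite /preimage /mkset qu.
Qed.

(* The inverse function theorem in one variable lets the coordinate d absorb
   the positive factor S. *)
Lemma kchart_scale p U kb D d (S : X -> R) : kchart p U kb D -> d \in D -> smooth_near p S -> 0 < S p ->
  exists U' kb', [/\ kchart p U' kb' D, U' `<=` U & forall q, U' q -> kb' q 0 d = kb q 0 d * S q].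
Proof.
move=> kc dD sS Sp; have [Up e _ z] := kc.
have [s [[U0 [oU0 U0p sC]] SE]] := (smooth_emb S e Up).1 sS.
have [U1 kc1 U1s] := kchart_shrink kc SE.
have [U1p e1 [Q1 oQ1 im1] _] := kc1.
have s0 : 0 < s (kb p) by rewrite -(nbhs_singleton SE).
pose h (u : 'rV[R]_n) := u 0 d * s u.
have hC k : Ck_on k U0 h by apply: Ck_onM => //; exact: Ck_on_coord.
have Dp : 'D_(delta_mx 0 d) h (kb p) = s (kb p).
  have D1 := @is_derive_coord R n (kb p) (delta_mx 0 d) d.
  have D2 := Ck_on_der d (sC 1%N) U0p.
  have [_ ->] := is_deriveM D1 D2; rewrite z// scale0r add0r mxE !eqxx /= [_ *: _]mulr1 //.
have nD : \forall u \near kb p, 0 < 'D_(delta_mx 0 d) h u.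
  have c : ('D_(delta_mx 0 d) h u : R) @[u --> kb p] --> s (kb p).
    by rewrite -Dp; exact: (Ck_on_cont (Ck_on_D d (hC 1%N)) U0p).
  exact: (near_cvg c (open_nbhs_nbhs (conj (@open_gt R 0) s0))).
have ns : \forall u \near kb p, 0 < s u.
  exact: (near_cvg (Ck_on_cont (sC 0%N) U0p) (open_nbhs_nbhs (conj (@open_gt R 0) s0))).
have nU0 : nbhs (kb p) U0 by exact: open_nbhs_nbhs.
have [r r0 rP] := nbhs_box (nearI nU0 (nearI nD ns)).
have hCb k : Ck_on k (box (kb p) r) h by apply: Ck_on_sub (hC k) => u /rP[].
have hD u : box (kb p) r u -> 0 < 'D_(delta_mx 0 d) h u by move=> /rP[_ []].
have sb u : box (kb p) r u -> 0 < s u by move=> /rP[_ []].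
pose kb' q := phi d h (kb q).
have kbE q j : kb' q 0 j = if j == d then kb q 0 d * s (kb q) else kb q 0 j by rewrite /kb' mxE.
exists (U1 `&` kb @^-1` box (kb p) r), kb'; split.
- split.
  + by split=> //; exact: box_refl.
  + exact: (embeds_comp e1 (phi_embeds hCb hD)).
  + exists (phi d h @` (Q1 `&` box (kb p) r)); first exact: phi_open.
    have cor u : box (kb p) r u -> corner D (phi d h u) <-> corner D u.
      move=> Bu; split=> hu j jD; have := hu j jD; rewrite mxE; case: eqP => // ->.
        by rewrite pmulr_lge0// sb.
      by move=> h0; rewrite mulr_ge0// ltW// sb.
    apply/seteqP; split=> w.
      move=> [q [Uq Bq] <-]; have [h1 h2] : (Q1 `&` corner D) (kb q) by rewrite -im1; exists q.
      by split; [exists (kb q)|exact/cor].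
    move=> [[u [Qu Bu] <-] /(cor _ Bu) cu].
    have [q Uq qu] : (kb @` U1) u by rewrite im1.
    by exists q; [split=> //; rewrite /preimage /= qu|rewrite /kb' qu].
  by move=> c cD; rewrite kbE; case: eqP => _; rewrite z// mul0r.
- by move=> q [/U1s[]].
by move=> q [/U1s[_ E] _]; rewrite kbE eqxx E.
Qed.

(** A box intersected with a corner is convex, so the segment between the two coordinate rows lifts
    to a path in the chart. *)
Lemma kchart_path p q U kb D (Z : set X) r : kchart p U kb D -> U q ->
  (forall u, box (kb p) r u -> corner D u -> exists2 s, U s & kb s = u) ->
  box (kb p) r (kb q) -> 0 < r ->
  (forall s t, U s -> 0 <= t <= 1 -> kb s = kb p + t *: (kb q - kb p) -> Z s) ->
  connected_component Z p q.
Proof.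
move=> kc Uq ons Bq r0 hZ; have [Up e _ _] := kc.
have ln t : 0 <= t <= 1 -> exists2 s, U s & kb s = kb p + t *: (kb q - kb p).
  move=> /andP[t0 t1]; apply: ons => j.
    rewrite !mxE addrAC subrr add0r normrM ger0_norm//.
    apply: le_lt_trans (Bq j); rewrite -[X in _ <= X]mul1r; exact: ler_wpM2r.
  move=> jD; rewrite !mxE.
  have h1 := kchart_corner kc Up jD; have h2 := kchart_corner kc Uq jD.
  have -> : kb p 0 j + t * (kb q 0 j - kb p 0 j) = (1 - t) * kb p 0 j + t * kb q 0 j by ring.
  by rewrite addr_ge0// mulr_ge0// subr_ge0.
pose g t : X := if pselect (0 <= t <= 1) is left h then s2val (cid2 (ln t h)) else p.
have gE t : 0 <= t <= 1 -> U (g t) /\ kb (g t) = kb p + t *: (kb q - kb p).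
  by rewrite /g; case: pselect => // h _; case: cid2.
have I0 : is_true ((0 <= (0:R)) && ((0:R) <= 1)) by rewrite lexx ler01.
have I1 : is_true ((0 <= (1:R)) && ((1:R) <= 1)) by rewrite lexx ler01.
have g0 : g 0 = p.
  by have [h1 h2] := gE 0 I0; apply: (embeds_inj e) => //; rewrite h2 scale0r addr0.
have g1 : g 1 = q.
  by have [h1 h2] := gE 1 I1; apply: (embeds_inj e) => //; rewrite h2 scale1r addrC subrK.
have cg : {within [set t : R | 0 <= t <= 1], continuous g}.
  apply/subspace_continuousP => t tI A nA; have [Ut kt] := gE t tI.
  have [B nB sB] := embeds_nbhsE e Ut nA.
  have cl : (kb p + x *: (kb q - kb p)) @[x --> t] --> kb (g t).
    rewrite kt; apply: cvgD; first exact: cvg_cst.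
    by apply: cvgZr_tmp; exact: cvg_id.
  have nt : \forall x \near (t : R), B (kb p + x *: (kb q - kb p)) := cl _ nB.
  rewrite /within /=; apply: (@filterS _ (nbhs (t : R)) _ _ _ _ nt) => x Bx xI; have [Ux kx] := gE x xI.
  by apply: sB; split=> //; rewrite /preimage /= kx.
have ci : connected [set t : R | 0 <= t <= 1].
  have -> : [set t : R | 0 <= t <= 1] = [set` `[0:R, 1]] by apply/seteqP; split=> t; rewrite /= in_itv.
  exact/connected_intervalP/interval_is_interval.
have := connected_continuous_connected ci cg => cgi.
exists (g @` [set t : R | 0 <= t <= 1]); last by exists 1.
split=> //; first by exists 0.
by move=> _ [t tI <-]; have [h1 h2] := gE t tI; exact: hZ h1 tI h2.
Qed.

Lemma kchart_coord_cmp p q U kb D U' kb' D' c : sdim X = n -> kchart p U kb D -> kchart q U' kb' D' ->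
  U q -> c \in D -> kb q 0 c = 0 ->
  exists c' G, [/\ c' \in D', smooth_near q G, 0 < G q & \forall s \near q, kb s 0 c = kb' s 0 c' * G s].
Proof.
move=> dn kc kc' Uq cD kq0.
have [C [s [_ aC dC CE bC]]] := kchart_coords dn kc.
have [C' [s' [bij' aC' _ CE' bC']]] := kchart_coords dn kc'.
have [|C1 [aC1 _ c1 b1]] := @chart_at R X q C (adapted_chart aC); first by rewrite dC.
have [j [G [jb sG G0 GE]]] := @chart_face_cmp R X aX q C1 C' (s c) aC1 aC' (ltac:(by rewrite b1 finset.inE bC cD CE kq0 eqxx)).
have [i' i'K K'i] := bij'.
exists (i' j), G; split=> //; first by rewrite -bC' K'i.
by apply: filterS GE => x; rewrite c1 CE -[in X in X * _](K'i j) CE'.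
Qed.

Lemma kchart_coord_neq p q U kb D (W : set X) c c' : kchart p U kb D -> U q -> nbhs q W ->
  (forall s, W s -> kb s 0 c' = 0 -> kb s 0 c = 0) -> kb q 0 c' = 0 -> c = c'.
Proof.
move=> kc Uq nW h z; apply/eqP/negPn/negP => cc.
have [t [s [t0 Us sE Ws]]] := kchart_perturb c kc Uq nW.
have z' : kb s 0 c' = 0 by rewrite sE !mxE z (eq_sym c' c) (negbTE cc) andbF mulr0 addr0.
have zq : kb q 0 c = 0 by apply: h z; exact: nbhs_singleton nW.
by have := h _ Ws z'; rewrite sE !mxE zq !eqxx mulr1 add0r => /eqP; rewrite gt_eqF.
Qed.

Lemma kchart_generic p q U kb D (P : X -> Prop) (B : {set 'I_n}) : kchart p U kb D -> U q ->
  (\forall s \near q, P s) -> exists s, [/\ U s, P s, forall c, c \in D :\: B -> 0 < kb s 0 c &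
    forall c, c \notin D :\: B -> kb s 0 c = kb q 0 c].
Proof.
move=> kc Uq nP; have n1 := kchart_near kc Uq nP.
have cq : corner D (kb q) by move=> j jD; exact: kchart_corner kc Uq jD.
pose w : 'rV[R]_n := \row_j (if j \in D :\: B then 1 else 0).
have w0 j : j \in D -> kb q 0 j = 0 -> 0 <= w 0 j by move=> _ _; rewrite mxE; case: ifP.
have n2 := corner_near cq w0 n1.
have [t [[h hc] t0]] := filter_ex (rightI n2 (nbhs_right_gt 0)).
have [s [Us sE Ps]] := h hc; exists s; split=> // c cDB.
  by rewrite sE !mxE cDB mulr1 ltr_wpDl// (kchart_corner kc Uq)//; move: cDB; rewrite inE => /andP[].
by rewrite sE !mxE (negbTE cDB) mulr0 addr0.
Qed.

End KChart.

(** * Boundary defining functions and factorization of monomials *)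

Section Hypersurfaces.
Context {R : realType} (n : nat) (X : germ_space R).
Hypothesis dn : sdim X = n.
Hypothesis cX : compact [set: X].
Variables (N : nat) (psi : X -> 'rV[R]_N).
Hypothesis e : embeds setT (psi : X -> euclidean R N).
Variables (fs : set (set X)) (fl : seq (set X)).
Hypothesis fsl : forall Z, fs Z -> Z \in fl.
Hypothesis clZ : forall Z, fs Z -> closed Z.
Variables (T : Type) (iota : T -> X).
Hypothesis dX : forall (p : X) (A : set X), nbhs p A -> exists v, A (iota v).
Hypothesis iotaZ : forall Z v, fs Z -> ~ Z (iota v).

(** The labels tie the boundary coordinates of different charts together through the global family
    [fs]. *)
Definition hyp_chart p U kb (D : {set 'I_n}) (lab : 'I_n -> set X) :=
  [/\ kchart p U kb D, forall c, c \in D -> fs (lab c),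
      forall c q, c \in D -> U q -> (lab c q <-> kb q 0 c = 0) &
      forall Z q, fs Z -> U q -> Z q -> exists2 c, c \in D & lab c = Z].

Hypothesis hc : forall p W, nbhs p W -> exists U kb D lab, hyp_chart p U kb D lab /\ U `<=` W.

Let aX : ambient X := embeds_ambient e.

Lemma hyp_cmp p U kb D lab q U' kb' D' lab' c c' : hyp_chart p U kb D lab ->
  hyp_chart q U' kb' D' lab' -> U q -> c \in D -> c' \in D' -> lab c = lab' c' -> lab c q ->
  exists G, [/\ smooth_near q G, 0 < G q & \forall s \near q, kb s 0 c = kb' s 0 c' * G s].
Proof.
move=> [kc _ l1 _] [kc' _ l1' _] Uq cD cD' lE Zq.
have [c2 [G [c2D sG G0 GE]]] := kchart_coord_cmp aX dn kc kc' Uq cD ((l1 _ _ cD Uq).1 Zq).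
have Uq' := kchart_base kc'.
suff -> : c' = c2 by exists G.
have nW := nearI GE (nearI (kchart_open kc Uq) (kchart_open kc' Uq')).
apply: (kchart_coord_neq kc' Uq' nW); last by case: kc' => _ _ _; exact.
move=> s [sE [Us Us']] z; apply/(l1' _ _ cD' Us'); rewrite -lE; apply/(l1 _ _ cD Us).
by rewrite sE z mul0r.
Qed.

Definition dist2 (p q : X) : R := \sum_j (psi q 0 j - psi p 0 j) ^+ 2.

Let Sm_dist p q : smooth_near q (dist2 p).
Proof.
apply: (Sm_sum aX) => j _; apply: (SmX aX); apply: (SmB aX); last exact: (Sm_cst aX).
exact: Sm_embed_coord e _.
Qed.

Let dist_refl p : dist2 p p = 0.
Proof. by rewrite /dist2 big1// => j _; rewrite subrr expr0n. Qed.

Lemma dist_ball p W : nbhs p W -> exists2 r, 0 < r & forall q, dist2 p q <= r -> W q.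
Proof.
move=> nW; have [B nB sB] := embeds_nbhsE e (I : setT p) nW.
have [r r0 rB] := nbhs_box nB; exists ((r / 2) ^+ 2); first by rewrite exprn_gt0// divr_gt0.
move=> q h; apply: sB; split=> //; apply: rB => j.
have le : (psi q 0 j - psi p 0 j) ^+ 2 <= (r / 2) ^+ 2.
  by apply: le_trans h; rewrite /dist2 (bigD1 j)//= lerDl sumr_ge0// => i _; exact: sqr_ge0.
rewrite ltNge; apply/negP => rl; rewrite -real_normK ?num_real// in le; nra.
Qed.

(** The near-covering form of compactness is applied to the filter of finite lists ordered by
    inclusion. *)
Lemma finite_cover (P : X -> set X) : (forall p, open (P p)) -> (forall p, P p p) ->
  exists s : seq X, forall q, exists2 p, p \in s & P p q.
Proof.
move=> oP Pp; have /compact_near_coveringP nc := cX.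
pose F : set_system (seq X) := filter_from setT (fun s0 : seq X => [set s : seq X | {subset s0 <= s}]).
have FF : Filter F.
  apply: filter_from_filter; first by exists [::].
  move=> s s' _ _; exists (s ++ s') => // t h.
  by split=> x xs; apply: h; rewrite mem_cat xs ?orbT.
have [|s _ hs] := nc _ F (fun s q => exists2 p, p \in s & P p q) FF.
  move=> x _; exists (P x, [set s : seq X | x \in s]).
    split=> /=; first exact: (open_nbhs_nbhs (conj (oP x) (Pp x))).
    by exists [:: x] => // s h; apply: h; rewrite inE.
  by move=> [y s] /= [Pxy xs]; exists x.
by exists s => q; apply: (hs s).
Qed.

Let flat_gt0 (t : R) : 0 < t -> 0 < flat 0 t.
Proof. by move=> t0; rewrite /flat t0 mulr_gt0 ?expR_gt0// expr0 invr1 ltr01. Qed.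

Let flat_eq0 (t : R) : t <= 0 -> flat 0 t = 0.
Proof. by move=> t0; rewrite /flat ltNge t0. Qed.

Let flat_ge0 (t : R) : 0 <= flat 0 t.
Proof. by case: (ltP 0 t) => [/flat_gt0/ltW//|/flat_eq0->]. Qed.

Section Bump.
Variables (Z D : set X).
Hypothesis fZ : fs Z.
Hypothesis DZ : D `<=` Z.
Hypothesis cD : closed D.
Hypothesis cZD : closed (Z `\` D).

Definition defines_at q (f : X -> R) := forall U kb D1 lab c, hyp_chart q U kb D1 lab -> c \in D1 ->
  lab c = Z -> exists S, [/\ smooth_near q S, 0 < S q & \forall s \near q, f s = kb s 0 c * S s].

Lemma bump_local p : exists r (f : X -> R), 0 < r /\ forall q, dist2 p q <= r ->
  [/\ smooth_near q f, 0 <= f q, f q = 0 <-> D q & D q -> defines_at q f].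
Proof.
have [Dp|Dp] := pselect (D p); last first.
  have nW : nbhs p (~` D) by apply: open_nbhs_nbhs; split=> //; exact: closed_openC.
  have [r r0 rW] := dist_ball nW; exists r, (fun=> 1); split=> // q /rW nDq; split=> //.
  - exact: (Sm_cst aX).
  - by split=> // /eqP; rewrite oner_eq0.
have nW : nbhs p (~` (Z `\` D)).
  by apply: open_nbhs_nbhs; split; [exact: closed_openC|move=> -[_]; exact].
have [U [kb [D1 [lab [hp UW]]]]] := hc nW; have [kc fl1 l1 l2] := hp.
have Up := kchart_base kc; have [c cD1 lc] := l2 _ _ fZ Up (DZ Dp).
have [r r0 rU] := dist_ball (kchart_open kc Up); exists r, (fun q => kb q 0 c); split=> // q /rU Uq.
have ZE : kb q 0 c = 0 <-> D q.
  rewrite -(l1 c q cD1 Uq) lc; split=> [Zq|/DZ//].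
  by have [//|nD] := pselect (D q); case: (UW _ Uq).
split=> //.
- exact: kchart_Sm kc Uq.
- exact: kchart_corner kc Uq cD1.
move=> Dq U' kb' D' lab' c' hq cD' lc'; apply: (hyp_cmp hp hq Uq cD1 cD'); rewrite lc ?lc'//; exact: DZ.
Qed.

(** A sum of local defining functions weighted by bumps. All terms are non-negative and at every
    point some weight is positive, so the sum vanishes exactly on [D]; near a point of [D] each term
    is the boundary coordinate times a function that is non-negative at the point. *)
Lemma bump_sum : exists rho : X -> R,
  [/\ forall q, smooth_near q rho, forall q, 0 <= rho q, forall q, rho q = 0 <-> D q &
      forall q, D q -> defines_at q rho].
Proof.
have [r hr] := choice bump_local; have [f hf] := choice hr.
have opn p : open [set q | dist2 p q < r p].
  rewrite openE => q lt; rewrite /interior.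
  exact: (near_cvg (Sm_cont aX (Sm_dist p q)) (open_nbhs_nbhs (conj (@open_lt R (r p)) lt))).
have [|s hs] := finite_cover opn; first by move=> p; rewrite /mkset dist_refl; have [] := hf p.
pose b p q := flat 0 (r p - dist2 p q).
have Sb p q : smooth_near q (b p).
  by apply: (Sm_flat aX); apply: (SmB aX) => //; exact: (Sm_cst aX).
have b0 p q : 0 <= b p q by exact: flat_ge0.
have bfar p q : r p < dist2 p q -> \forall q' \near q, b p q' = 0.
  move=> lt; have n1 : \forall q' \near q, r p < dist2 p q'.
    exact: (near_cvg (Sm_cont aX (Sm_dist p q)) (open_nbhs_nbhs (conj (@open_gt R (r p)) lt))).
  by apply: filterS n1 => q' /ltW h; rewrite /b flat_eq0// subr_le0.
have bf0 p q : 0 <= b p q * f p q.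
  have [le|lt] := leP (dist2 p q) (r p); last by rewrite (nbhs_singleton (bfar _ _ lt)) mul0r.
  by have [_ /(_ q le)[_ h _ _]] := hf p; rewrite mulr_ge0.
have pos q : exists2 p, p \in s & 0 < b p q.
  by have [p ps lt] := hs q; exists p => //; rewrite /b flat_gt0// subr_gt0.
have bpos p q : 0 < b p q -> dist2 p q <= r p.
  by rewrite leNgt => b1; apply/negP => lt; move: b1; rewrite (nbhs_singleton (bfar _ _ lt)) ltxx.
exists (fun q => \sum_(p <- s) b p q * f p q); split.
- move=> q; apply: (Sm_sum aX) => p _.
  have [le|lt] := leP (dist2 p q) (r p); first by have [_ /(_ q le)[h _ _ _]] := hf p; exact: (SmM aX).
  apply: (Sm_eq aX _ (Sm_cst aX q 0)); apply: filterS (bfar _ _ lt) => q' ->; by rewrite mul0r.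
- by move=> q; rewrite sumr_ge0.
- move=> q; split=> [/eqP|Dq].
    rewrite psumr_eq0// => /allP h; have [p ps b1] := pos q.
    have := h p ps; rewrite /= mulf_eq0 (gt_eqF b1) => /eqP.
    by have [_ /(_ q (bpos _ _ b1))[_ _ -> _]] := hf p.
  rewrite big1// => p _; have [le|lt] := leP (dist2 p q) (r p); last first.
    by rewrite (nbhs_singleton (bfar _ _ lt)) mul0r.
  by have [_ /(_ q le)[_ _ h _]] := hf p; rewrite h.2// mulr0.
move=> q Dq U kb D1 lab c hq cD1 lc.
have : forall p, exists S, [/\ smooth_near q S, 0 <= S q, 0 < b p q -> 0 < S q &
    \forall s \near q, b p s * f p s = kb s 0 c * (b p s * S s)].
  move=> p; have [le|lt] := leP (dist2 p q) (r p).
    have [_ /(_ q le)[_ _ _ /(_ Dq)/(_ _ _ _ _ _ hq cD1 lc)[S [sS S0 SE]]]] := hf p.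
    by exists S; split=> //; [exact: ltW|apply: filterS SE => s' ->; rewrite mulrCA].
  exists (fun=> 0); split=> //; first exact: (Sm_cst aX).
    by rewrite (nbhs_singleton (bfar _ _ lt)) ltxx.
  by apply: filterS (bfar _ _ lt) => s' ->; rewrite !mul0r mulr0.
move=> /choice[S hS]; exists (fun x => \sum_(p <- s) b p x * S p x); split.
- by apply: (Sm_sum aX) => p _; apply: (SmM aX) => //; have [] := hS p.
- have ge p : 0 <= b p q * S p q by have [_ h _ _] := hS p; rewrite mulr_ge0.
  have [p ps b1] := pos q; rewrite lt_neqAle sumr_ge0// andbT eq_sym psumr_eq0//.
  apply/negP => /allP/(_ p ps); rewrite /= mulf_eq0 !gt_eqF//.
  by have [_ _ -> //] := hS p.
have : \forall x \near q, forall p, p \in s -> b p x * f p x = kb x 0 c * (b p x * S p x).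
  elim: (s) => [|p s' IH]; first by apply: near_all => x p; rewrite in_nil.
  have [_ _ _ h] := hS p; apply: filterS (nearI h IH) => x [h1 h2] p'.
  by rewrite inE => /orP[/eqP ->|/h2].
by apply: filterS => x hx; rewrite mulr_sumr; apply: eq_big_seq => p /hx.
Qed.

End Bump.

(** The segment in a chart from [p] to a nearby point of [Z] stays in [Z]. So components are open in
    [Z], and by compactness finitely many suffice for the whole family. *)
Lemma comp_near p : \forall q \near p, forall Z, fs Z -> Z q -> Z p /\ connected_component Z p q.
Proof.
have [U [kb [D [lab [[kc f1 l1 l2] _]]]]] := hc (filterT : nbhs p setT).
have Up := kchart_base kc; have [_ _ _ z] := kc.
have := kchart_near kc Up (kchart_open kc Up) => /nbhs_box[r r0 rP].
have nb : \forall q \near p, box (kb p) r (kb q).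
  have [_ e' _ _] := kc; exact: (embeds_nbhs e' Up (box_nbhs _ r0)).
apply: filterS (nearI nb (kchart_open kc Up)) => q [Bq Uq] Z fZ Zq.
have [c cD lc] := l2 _ _ fZ Uq Zq; have zq : kb q 0 c = 0 by apply/(l1 _ _ cD Uq); rewrite lc.
split; first by rewrite -lc; apply/(l1 _ _ cD Up); exact: z.
apply: (kchart_path kc Uq _ Bq r0); first by move=> u /rP h /h[s [Us su _]]; exists s.
move=> s t Us _ sE; rewrite -lc; apply/(l1 _ _ cD Us).
by rewrite sE !mxE zq z// subrr mulr0 addr0.
Qed.

Lemma comp_compl_closed Z p : fs Z -> closed (Z `\` connected_component Z p).
Proof.
move=> fZ; rewrite -[X in closed X]setCK; apply: open_closedC; rewrite openE => q.
move=> nq; rewrite /interior; have [Zq|Zq] := pselect (Z q); last first.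
  have nZ : nbhs q (~` Z) by apply: open_nbhs_nbhs; split=> //; apply: closed_openC; exact: clZ.
  by apply: filterS nZ => x nZx [].
have cq : connected_component Z p q by apply: contrapT => h; apply: nq.
apply: filterS (comp_near q) => x hx [Zx]; apply; have [_ h] := hx Z fZ Zx.
exact: connected_component_trans cq h.
Qed.

(** A member of [fs] is not known to be connected, whereas the zero set of a boundary defining
    function is; hence there is one function per component. *)
Lemma hyper_bdf Z p : fs Z -> Z p -> exists rho : X -> R,
  [/\ boundary_defining rho, forall q, rho q = 0 <-> connected_component Z p q &
      forall q, connected_component Z p q -> defines_at Z q rho].
Proof.
move=> fZ Zp; pose D := connected_component Z p.
have DZ : D `<=` Z by exact: connected_component_sub.
have cD : closed D by apply: component_closed; exact: clZ.
have [rho [h1 h2 h3 h4]] := bump_sum fZ DZ cD (comp_compl_closed fZ).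
exists rho; split=> //; split=> //.
- by exists p; apply/h3; exact: connected_component_refl.
- have -> : [set q | rho q = 0] = D by apply/seteqP; split=> q /h3.
  exact: component_connected.
move=> q /h3 Dq; have [U [kb [D1 [lab [hq _]]]]] := hc (filterT : nbhs q setT).
have [kc f1 l1 l2] := hq; have [c cD1 lc] := l2 _ _ fZ (kchart_base kc) (DZ _ Dq).
have [S [sS S0 SE]] := h4 _ Dq _ _ _ _ _ hq cD1 lc.
(* [rho] is the coordinate [c] times a positive [S]; absorbing [S] makes [rho] itself a coordinate,
   as [boundary_defining] requires. *)
have [U' [kb' [kc' _ kE]]] := kchart_scale kc cD1 sS S0.
have [C [s [_ aC dC CE bC]]] := kchart_coords dn kc'.
exists C, (s c); split=> //; first by rewrite bC.
apply: filterS (nearI SE (kchart_open kc' (kchart_base kc'))) => x [xE Ux].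
by rewrite CE kE.
Qed.

(** For each [k] finitely many boxes of radius [1 / (k + 1)] cover the space; together they form a
    countable base, since two points of one box differ by less than twice the radius. *)
Lemma compact_embedded_countable : @second_countable X.
Proof.
pose P k p := [set q | box (psi p) (k.+1%:R^-1) (psi q)].
have k0 k : 0 < k.+1%:R^-1 :> R by rewrite invr_gt0 ltr0n.
have oP k p : open (P k p).
  rewrite -[P k p]setTI; exact: (open_preimage e (@box_open R N (psi p) _)).
have [s hs] : exists s : nat -> seq X, forall k q, exists2 p, p \in s k & P k p q.
  have h k := finite_cover (oP k) (fun p => box_refl (psi p) (k0 k)).
  by have [s hs] := choice h; exists s.
exists (\bigcup_k (P k @` [set` s k])).
  apply: bigcup_countable => // k _; apply: finite_set_countable; apply: finite_image.
  exact: finite_seq.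
split; first by move=> _ [k _ [p _ <-]].
move=> x W nW; have [B nB sB] := embeds_nbhsE e (I : setT x) nW.
have [r r0 rB] := nbhs_box nB.
have [k kr] : exists k, 2 * k.+1%:R^-1 < r.
  have [k] := ltr_add_invr (y := 0) (x := r / 2) (ltac:(by rewrite divr_gt0)).
  by rewrite add0r => h; exists k; set a := _^-1 in h *; lra.
have [p ps Px] := hs k x; exists (P k p).
  by split=> //; exists k => //; exists p.
move=> q Pq; apply: sB; split=> //; apply: rB => j.
have -> : psi q 0 j - psi x 0 j = (psi q 0 j - psi p 0 j) - (psi x 0 j - psi p 0 j) by ring.
apply: le_lt_trans (ler_normB _ _) _.
move: (Px j : `|_| < k.+1%:R^-1) (Pq j : `|_| < k.+1%:R^-1) kr; set a := _^-1; lra.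
Qed.

Lemma embedded_hausdorff : hausdorff_space X.
Proof.
move=> p q pq; apply: (embeds_inj e) => //; apply: (@norm_hausdorff R 'rV[R]_N).
move=> A B nA nB; have [x [Ax Bx]] := pq _ _ (embeds_nbhs e I nA) (embeds_nbhs e I nB).
by exists (psi x).
Qed.

Theorem hyper_manifold : manifold_with_corners X.
Proof.
split.
- exact: embedded_hausdorff.
- exact: compact_embedded_countable.
- move=> p; have [U [kb [D [lab [[kc _ _ _] _]]]]] := hc (filterT : nbhs p setT).
  by have [C [s [_ aC _ _ _]]] := kchart_coords dn kc; exists C.
move=> p c i ac ib; have [U [kb [D [lab [hp _]]]]] := hc (filterT : nbhs p setT).
have [kc f1 l1 l2] := hp; have Up := kchart_base kc.
have [C [s [bij aC _ CE bC]]] := kchart_coords dn kc; have [s' s'K K's] := bij.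
have [j [G [jb sG G0 GE]]] := chart_face_cmp aX ac aC ib.
have aD : s' j \in D by rewrite -bC K's.
have Zp : lab (s' j) p by apply/(l1 _ _ aD Up); have [_ _ _ z] := kc; exact: z.
have [rho [h1 h2 _]] := hyper_bdf (f1 _ aD) Zp; exists rho => //.
have nG : \forall q \near p, 0 < G q.
  exact: (near_cvg (Sm_cont aX sG) (open_nbhs_nbhs (conj (@open_gt R 0) G0))).
apply: filterS (nearI (nearI GE nG) (nearI (kchart_open kc Up) (comp_near p))) => q [[qE Gq] [Uq hq]].
rewrite h2 qE -[X in crd C q 0 X](K's j) CE; split.
  by move=> /connected_component_sub /(l1 _ _ aD Uq) ->; rewrite mul0r.
move=> /eqP; rewrite mulf_eq0 (gt_eqF Gq) orbF => /eqP/(l1 _ _ aD Uq) Zq.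
by have [_] := hq _ (f1 _ aD) Zq.
Qed.

(** The pull-backs to be factored have exponents 0 or 1 in the boundary coordinates, so a set [J] of
    coordinates takes the place of exponents. *)
Definition monomial_data (g : X -> R) p U kb D lab (J : {set 'I_n}) (u : X -> R) :=
  [/\ hyp_chart p U kb D lab, J \subset D, smooth_near p u, 0 < u p &
    \forall q \near p, g q = u q * \prod_(c in J) kb q 0 c].

Definition locally_monomial (g : X -> R) := (forall p, smooth_near p g) /\
  forall p, exists U kb D lab J u, monomial_data g p U kb D lab J u.

Definition vanishes (g : X -> R) (Z : set X) (p : X) := \forall q \near p, Z q -> g q = 0.

Lemma monomial_vanish g p U kb D lab J u c : monomial_data g p U kb D lab J u -> c \in J ->
  vanishes g (lab c) p.
Proof.
move=> [[kc _ l1 _] JD _ _ gE] cJ; have cD := fintype.subsetP JD _ cJ.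
apply: filterS (nearI gE (kchart_open kc (kchart_base kc))) => q [-> Uq] /(l1 _ _ cD Uq) z.
by rewrite (bigD1 c)//= z mul0r mulr0.
Qed.

Lemma monomial_not_vanish g p U kb D lab J u c : monomial_data g p U kb D lab J u -> c \in D -> c \notin J ->
  \forall q \near p, lab c q -> ~ vanishes g (lab c) q.
Proof.
move=> [[kc _ l1 _] JD su u0 gE] cD cJ.
have nu : \forall q \near p, 0 < u q.
  exact: (near_cvg (Sm_cont aX su) (open_nbhs_nbhs (conj (@open_gt R 0) u0))).
have := nearI (nearI gE nu) (kchart_open kc (kchart_base kc)).
move=> /nbhs_interior; apply: filterS => q nq Zq vq.
have [[_ _] Uq] := nbhs_singleton nq.
have [s [Us [[[sE us] _] vs] sp sc]] := kchart_generic [set c]%SET kc Uq (nearI nq vq).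
have zs : kb s 0 c = 0 by rewrite sc ?inE ?eqxx//; apply/(l1 _ _ cD Uq).
have : g s = 0 by apply: vs; apply/(l1 _ _ cD Us).
apply/eqP; rewrite gt_eqF// sE mulr_gt0// prodr_gt0// => c' c'J.
by apply: sp; rewrite !finset.inE (fintype.subsetP JD _ c'J) andbT; apply: contraNneq cJ => <-.
Qed.

Lemma vanish_at g p U kb D lab J u c : monomial_data g p U kb D lab J u -> c \in D ->
  vanishes g (lab c) p -> c \in J.
Proof.
move=> md cD v; apply/negPn/negP => cJ.
have := nbhs_singleton (monomial_not_vanish md cD cJ); apply=> //.
by have [[kc _ l1 _] _ _ _ _] := md; apply/(l1 _ _ cD (kchart_base kc)); case: kc => _ _ _; exact.
Qed.

(** Vanishing along [Z] near a point is an open condition, and by the monomial form its failure is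
    open in [Z] as well; a component is connected. *)
Lemma vanish_comp g Z p q : locally_monomial g -> fs Z -> connected_component Z p q ->
  vanishes g Z p -> vanishes g Z q.
Proof.
move=> [_ lm] fZ cq vp; pose H := connected_component Z p.
have HZ : H `<=` Z by exact: connected_component_sub.
have Zp : Z p by case: cq => B [Bp BZ _] _; exact: BZ.
have Hp : H p by exact: connected_component_refl.
have cH : connected H := @component_connected X Z p.
suff : H `&` [set x | vanishes g Z x] = H.
  by move=> hE; have : H q by []; rewrite -hE => -[].
apply: cH.
- by exists p.
- exists [set x | vanishes g Z x] => //; rewrite openE => x vx.
  exact: (nbhs_interior vx).
exists (~` [set x | \forall y \near x, Z y -> ~ vanishes g Z y]).
  by apply: open_closedC; rewrite openE => x vx; exact: (nbhs_interior vx).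
apply/seteqP; split=> x [Hx vx]; split=> //.
  by move=> nx; have := nbhs_singleton nx (HZ _ Hx).
have [U [kb [D [lab [J [u md]]]]]] := lm x; have [[kc f1 l1 l2] _ _ _ _] := md.
have [c cD lc] := l2 _ _ fZ (kchart_base kc) (HZ _ Hx).
have [cJ|cJ] := boolP (c \in J); first by rewrite /mkset -lc; exact: monomial_vanish md cJ.
by case: vx; rewrite /mkset -lc; exact: monomial_not_vanish md cD cJ.
Qed.

(** The quotient of [g] by [rho] is formed on the dense interior. It extends across a point of the
    component because the monomial contains the coordinate of [Z], which cancels against that of
    [rho], and across any other point because [rho] is positive there. *)
Lemma strip_hypersurface g Z p : locally_monomial g -> fs Z -> Z p -> vanishes g Z p ->
  exists rho g1, [/\ boundary_defining rho, locally_monomial g1, forall q, g q = g1 q * rho q &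
    forall q, connected_component Z p q -> ~ vanishes g1 Z q].
Proof.
move=> lm fZ Zp vp; have [sg lg] := lm; have [rho [rb r0 rd]] := hyper_bdf fZ Zp.
have srho q : smooth_near q rho by case: rb.
have ri v : rho (iota v) != 0.
  by apply/eqP => /r0 /connected_component_sub; exact: iotaZ.
pose F v := g (iota v) / rho (iota v).
have off q : ~ connected_component Z p q -> exists U kb D lab J u, monomial_data g q U kb D lab J u /\
    smooth_near q (fun x => u x / rho x) /\ 0 < u q / rho q /\
    \forall x \near q, forall v, iota v = x -> u x / rho x * \prod_(c in J) kb x 0 c = F v.
  move=> nq; have [U [kb [D [lab [J [u md]]]]]] := lg q; have [_ _ su u0 gE] := md.
  have rq : 0 < rho q.
    have [_ ge _ _ _] := rb; rewrite lt_neqAle ge andbT eq_sym; by apply/eqP => /r0.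
  exists U, kb, D, lab, J, u; split=> //; split; first by apply: (Sm_div aX) => //; rewrite gt_eqF.
  split; first exact: divr_gt0.
  by apply: filterS gE => x gx v vx; rewrite /F vx gx mulrAC.
have on q : connected_component Z p q -> exists U kb D lab J u c S, [/\ monomial_data g q U kb D lab J u,
    c \in J, lab c = Z & [/\ smooth_near q (fun x => u x / S x), 0 < u q / S q &
    \forall x \near q, forall v, iota v = x -> u x / S x * \prod_(c' in J :\ c) kb x 0 c' = F v]].
  move=> cq; have [U [kb [D [lab [J [u md]]]]]] := lg q; have [hq JD su u0 gE] := md.
  have [kc f1 l1 l2] := hq.
  have [c cD lc] := l2 _ _ fZ (kchart_base kc) (connected_component_sub cq).
  have vq := vanish_comp lm fZ cq vp.
  have cJ : c \in J by apply: (vanish_at md cD); rewrite lc.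
  have [S [sS S0 SE]] := rd _ cq _ _ _ _ _ hq cD lc.
  exists U, kb, D, lab, J, u, c, S; split=> //; split.
  - by apply: (Sm_div aX) => //; rewrite gt_eqF.
  - exact: divr_gt0.
  have nS : \forall q \near q, 0 < S q.
    exact: (near_cvg (Sm_cont aX sS) (open_nbhs_nbhs (conj (@open_gt R 0) S0))).
  apply: filterS (nearI (nearI gE SE) (nearI nS (kchart_open kc (kchart_base kc)))) => x [[gx rx] [Sx Ux]] v vx.
  have kx : kb x 0 c != 0.
    by apply/eqP => /(l1 _ _ cD Ux); rewrite -vx; apply: iotaZ; exact: f1.
  have EJ : \prod_(c' in J) kb x 0 c' = kb x 0 c * \prod_(c' in J :\ c) kb x 0 c' by rewrite (big_setD1 c).
  rewrite /F vx gx rx EJ; move: (\prod_(c' in J :\ c) kb x 0 c') => Q.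
  by field; rewrite kx gt_eqF.
have Sprod (q : X) (U : set X) (kb : X -> 'rV[R]_n) (D J : {set 'I_n}) : kchart q U kb D -> smooth_near q (fun x => \prod_(c in J) kb x 0 c).
  by move=> kc; apply: (Sm_prod aX) => c _; exact: kchart_Sm kc (kchart_base kc).
have [|g1 [sg1 g1E _]] := xt_extend aX dX (F := F).
  move=> q; have [/on|/off] := pselect (connected_component Z p q).
    move=> [U [kb [D [lab [J [u [c [S [[[kc _ _ _] _ _ _ _] _ _ [s1 _ s3]]]]]]]]]].
    by eexists; eexists; split; [apply: (SmM aX s1 (Sprod _ _ _ _ (J :\ c)%SET kc))|reflexivity|].
  move=> [U [kb [D [lab [J [u [[[kc _ _ _] _ _ _ _] [s1 [_ s3]]]]]]]]].
  by eexists; eexists; split; [apply: (SmM aX s1 (Sprod _ _ _ _ J kc))|reflexivity|].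
have g1near q h : smooth_near q h -> (\forall x \near q, forall v, iota v = x -> h x = F v) ->
    \forall x \near q, g1 x = h x.
  move=> sh hh; apply: (Sm_eq_dense aX dX (sg1 q) sh).
  by apply: filterS hh => x hx v vx; rewrite (hx v vx) -vx g1E.
have offm q : ~ connected_component Z p q -> exists U kb D lab J u, monomial_data g1 q U kb D lab J u.
  move=> /off[U [kb [D [lab [J [u [md [s1 [s2 s3]]]]]]]]]; have [hq JD _ _ _] := md; have [kc _ _ _] := hq.
  exists U, kb, D, lab, J, (fun x => u x / rho x); split=> //.
  by apply: g1near s3; apply: (SmM aX) => //; exact: Sprod kc.
have onm q : connected_component Z p q -> exists U kb D lab J u c, [/\ monomial_data g1 q U kb D lab J u, c \in D, c \notin J & lab c = Z].
  move=> /on[U [kb [D [lab [J [u [c [S [md cJ lc [s1 s2 s3]]]]]]]]]]; have [hq JD _ _ _] := md; have [kc _ _ _] := hq.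
  exists U, kb, D, lab, (J :\ c)%SET, (fun x => u x / S x), c; split=> //.
  - split=> //; first exact: fintype.subset_trans (finset.subsetDl _ _) JD.
    by apply: g1near s3; apply: (SmM aX) => //; exact: Sprod kc.
  - exact: (fintype.subsetP JD).
  by rewrite !inE eqxx.
exists rho, g1; split=> //.
- split=> // q; have [/onm|/offm//] := pselect (connected_component Z p q).
  by move=> [U [kb [D [lab [J [u [c [md _ _ _]]]]]]]]; exists U, kb, D, lab, J, u.
- move=> q; have h : \forall x \near q, g x = g1 x * rho x; last exact: nbhs_singleton h.
  apply: (Sm_eq_dense aX dX (sg q) (SmM aX (sg1 q) (srho q))).
  by apply: near_all => x v <-; rewrite g1E /F divfK.
move=> q /onm[U [kb [D [lab [J [u [c [md cD cJ lc]]]]]]]] v.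
by move: cJ; rewrite (vanish_at md cD)// lc.
Qed.

(** Induction on a finite list of components that contains all those along which [g] vanishes; each
    step divides by one defining function. For the empty list all local monomials are empty, so [g]
    is smooth and positive. *)
Lemma locally_monomial_factor g : locally_monomial g -> boundary_monomial g.
Proof.
have [s hs] := finite_cover (fun p => @open_interior X [set q | forall Z, fs Z -> Z q -> Z p /\ connected_component Z p q])
  (fun p => comp_near p).
pose Hs := [seq (Z, p) | Z <- fl, p <- s].
have cov Z q : fs Z -> Z q -> exists2 H, H \in Hs & H.1 = Z /\ connected_component Z H.2 q.
  move=> fZ Zq; have [p ps /interior_subset /(_ _ fZ Zq)[_ h]] := hs q.
  by exists (Z, p) => //; apply/allpairsP; exists (Z, p); split=> //; exact: fsl.
have {cov}: forall Z q, fs Z -> Z q -> vanishes g Z q -> exists2 H, H \in Hs & H.1 = Z /\ connected_component Z H.2 q.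
  by move=> Z q fZ Zq _; exact: cov.
elim: Hs g => [|[Z p] Hs IH] g cov lm.
  exists g, [::]; have [sg lg] := lm; split=> // p; last by rewrite big_nil mulr1.
  have [U [kb [D [lab [J [u md]]]]]] := lg p; have [hp JD su u0 gE] := md.
  rewrite (nbhs_singleton gE) big_pred0 ?mulr1// => c; apply/negbTE/negP => cJ.
  have [kc f1 l1 l2] := hp; have cD := fintype.subsetP JD _ cJ.
  have [|H] := cov (lab c) p (f1 _ cD) _ (monomial_vanish md cJ); last by rewrite in_nil.
  by apply/(l1 _ _ cD (kchart_base kc)); case: kc => _ _ _; exact.
have [[fZ [Zp vp]]|h] := pselect (fs Z /\ Z p /\ vanishes g Z p); last first.
  apply: IH => // Z' q fZ' Zq' vq; have [H] := cov _ _ fZ' Zq' vq.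
  rewrite inE => /orP[/eqP ->|Hin [h1 h2]]; last by exists H.
  move=> /= [ZZ' cq]; subst Z'; case: h; split=> //.
  have cs := connected_component_sym cq; split; first exact: connected_component_sub cs.
  exact: vanish_comp cs vq.
have [rho [g1 [rb lm1 gE nv]]] := strip_hypersurface lm fZ Zp vp.
have [|alpha [s' [h1 h2 h3 h4]]] := IH g1 _ lm1.
  move=> Z' q fZ' Zq' vq; have vg : vanishes g Z' q.
    by apply: filterS vq => x hx /hx; rewrite gE => ->; rewrite mul0r.
  have [H] := cov _ _ fZ' Zq' vg; rewrite inE => /orP[/eqP ->|Hin [k1 k2]]; last by exists H.
  by move=> /= [ZZ' cq]; subst Z'; case: (nv _ cq).
exists alpha, ((rho, 1%N) :: s'); split=> //.
  by move=> e'; rewrite inE => /orP[/eqP ->|/h3].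
by move=> q; rewrite gE h4 big_cons /= expr1 -mulrA [X in alpha q * X]mulrC.
Qed.

End Hypersurfaces.

(** * A stage is a manifold with corners *)

Section StageManifold.
Context {R : realType} (n : nat) (X : germ_space R) (iota : 'rV[R]_n -> X).
Variables (N : nat) (Psi : 'rV[R]_n -> 'rV[R]_N) (psi : X -> 'rV[R]_N) (F : seq 'M[R]_n).
Hypothesis st : is_stage iota Psi psi F.
Hypothesis cX : compact [set: X].
Hypothesis dn : sdim X = n.
Implicit Types (A B : 'M[R]_n) (U : set X).

Let pr : presents iota Psi psi. Proof. by case: st. Qed.
Let F1 : 1%:M \in F. Proof. by case: st => _ []. Qed.
Let F0 : 0 \in F. Proof. by case: st => _ []. Qed.
Let Fxt A : A \in F -> forall p k, exists a, xt iota p (fun v => theta A v 0 k) a.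
Proof. by case: st => _ _ _ h _; exact: h. Qed.
Let aX : ambient X := presents_ambient pr.
Let dX := presents_dense pr.
Let e : embeds setT (psi : X -> euclidean R N). Proof. by case: pr. Qed.

Definition stage_at p m Ac K lev (dm : {set 'I_n}) U kb :=
  [/\ is_chain iota F p m Ac 1%:M, complete_graded m Ac (fun i => ev iota p (Ac i)) K lev dm,
      kchart p U kb dm &
      forall q, U q -> (forall v, iota v = q -> (forall i, 0 < Rf m K lev dm i v) /\ kb q = kapv m K lev dm v) /\
        forall A i, A \in F -> leveled iota p m Ac A i -> cnum K lev dm A i (kb q) != 0].

Lemma stage_at_ex p W : nbhs p W -> exists m Ac K lev dm U kb, stage_at p m Ac K lev dm U kb /\ U `<=` W.
Proof.
move=> nW; have [m [Ac ch]] := chain_ex st p.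
have g : graded m Ac (fun i => ev iota p (Ac i)) (0 : 'M[R]_(0, n)) (fun=> 0%N) finset.set0.
  split.
  - by case.
  - by move=> i a _ _; rewrite thinmx0.
  - by case.
  - by case.
  - by case.
have [K [lev [dm [g' [U [kb [cg _ kc UW hU]]]]]]] := chart_ex st ch g nW.
by exists m, Ac, K, lev, dm, U, kb; split; first split.
Qed.

Section AtPoint.
Variables (p : X) (m : nat) (Ac : nat -> 'M[R]_n) (K : 'M[R]_n) (lev : 'I_n -> nat).
Variables (dm : {set 'I_n}) (U : set X) (kb : X -> 'rV[R]_n).
Hypothesis sa : stage_at p m Ac K lev dm U kb.

Let ch : is_chain iota F p m Ac 1%:M. Proof. by case: sa. Qed.
Let cg : complete_graded m Ac (fun i => ev iota p (Ac i)) K lev dm. Proof. by case: sa. Qed.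
Let kc : kchart p U kb dm. Proof. by case: sa. Qed.
Let c0 : Ac 0%N = 1%:M. Proof. by case: ch. Qed.
Let cF i : (i <= m)%N -> Ac i \in F. Proof. by case: ch => _ h _ _ _; exact: h. Qed.
Let cS i : (Ac i.+1 <= Ac i)%MS. Proof. by have [_ h _ _] := chain_flag st ch. Qed.

Lemma chain_mono i j : (i <= j)%N -> (Ac j <= Ac i)%MS.
Proof. exact: (flag_mono cS). Qed.

Lemma lev_lt c : c \in dm -> (lev c < m)%N.
Proof. by case: cg => -[_ _ h _ _] _ cd; have [] := h c cd. Qed.

Lemma leveled_at j : (j <= m)%N -> leveled iota p m Ac (Ac j) j.
Proof.
rewrite leq_eqVlt => /orP[/eqP ->|jm]; last exact: (leveled_chain st ch).
by split=> //; rewrite ltnn.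
Qed.

Let hq2 q A i B j : U q -> (A <= Ac i)%MS -> B \in F -> leveled iota p m Ac B j -> (j <= i)%N ->
  xt iota q (q2 A B) ((nrm (cnum K lev dm A i (kb q)) / nrm (cnum K lev dm B j (kb q)) * qq lev dm j i (kb q)) ^+ 2).
Proof. by case: sa => h1 h2 h3 h4; apply: (q2_chart st h1 h2 h3 h4). Qed.

Let cnum_gt0 q A i : U q -> A \in F -> leveled iota p m Ac A i -> 0 < nrm (cnum K lev dm A i (kb q)).
Proof. by case: sa => _ _ _ h Uq AF Al; apply: nrm_gt0; have [_ k] := h q Uq; exact: k. Qed.

(** The ratio [qq] from level [lev c] to the next one is the coordinate [c] itself, and it is a
    factor of the ratio to every flat [B] strictly above [Ac (lev c).+1]. *)
Lemma face_coord c q : c \in dm -> U q -> face iota F (Ac (lev c).+1) q <-> kb q 0 c = 0.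
Proof.
move=> cd Uq; have lt := lev_lt cd; have le := ltnW lt; split=> [fq|kq0].
  have nn : ~~ (Ac (lev c) <= Ac (lev c).+1)%MS.
    have [_ _ fE fN] := chain_flag st ch; have [f [fA]] := fN _ lt; apply: contraNN => h.
    have /submxP[D ->] := submx_trans fA h; by rewrite -mulmxA fE// mulmx0 mxE.
  have := xt_uniq aX dX (hq2 Uq (submx_refl _) (cF le) (leveled_at le) (leqnSn _)) (fq _ (cF le) (cS _) nn).
  move=> /eqP; rewrite (dm_at cg lt cd)// sqrf_eq0 !mulf_eq0 invr_eq0.
  have n1 := cnum_gt0 Uq (cF lt) (leveled_at lt); have n2 := cnum_gt0 Uq (cF le) (leveled_at le).
  by rewrite (gt_eqF n1) (gt_eqF n2) => /eqP.
move=> B BF AB BA; have [j Bj] := leveled_ex ch BF; have [jm BAj _] := Bj.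
have jl : (j <= lev c)%N.
  by rewrite leqNgt; apply: contra BA => lj; apply: submx_trans BAj (chain_mono lj).
have := hq2 Uq (submx_refl (Ac (lev c).+1)) BF Bj (leqW jl).
suff -> : qq lev dm j (lev c).+1 (kb q) = 0 by rewrite mulr0 expr0n.
by rewrite /qq (bigD1 c) ?cd ?jl ?ltnSn//= kq0 mul0r.
Qed.

(** Up to a positive factor, [1 / NA 1] is the product of all boundary coordinates. *)
Lemma kchart_interior q : U q -> (forall c, c \in dm -> 0 < kb q 0 c) -> 0 < tau iota q 1%:M.
Proof.
move=> Uq kp; rewrite lt_neqAle (tau_ge0 pr Fxt q F1) andbT eq_sym -sqrf_eq0.
have l1 : leveled iota p m Ac 1%:M 0 by rewrite -c0; exact: leveled_at.
have l0 : leveled iota p m Ac 0 m by split; rewrite ?sub0mx ?ltnn.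
have h := hq2 Uq (sub0mx _ (Ac m)) F1 l1 (leq0n m).
have t := tau_xt Fxt q F1.
have E : xt iota q (q2 0 1%:M) (tau iota q 1%:M ^+ 2).
  rewrite expr2; apply: xt_eq (xtM aX t t); apply: nearTW => v; rewrite /q2 NA2.
  by rewrite big1 ?addr0 => [|j _]; rewrite ?div1r -?expr2 ?exprVn// row0 fe0 expr0n.
rewrite (xt_uniq aX dX E h) gt_eqF// exprn_gt0// mulr_gt0//.
  by rewrite divr_gt0// cnum_gt0.
by rewrite prodr_gt0// => c /andP[cd _]; exact: kp.
Qed.

End AtPoint.

Hypothesis Feq : forall A B, A \in F -> B \in F -> (A :=: B)%MS -> A = B.

Definition boundary_faces : set (set X) :=
  [set Z | exists A, [/\ A \in F, ~~ (1%:M <= A)%MS & Z = face iota F A]].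

Lemma boundary_face_list Z : boundary_faces Z -> Z \in [seq face iota F A | A <- F].
Proof. by move=> [A [AF _ ->]]; exact: map_f. Qed.

Lemma boundary_face_closed Z : boundary_faces Z -> closed Z.
Proof. by move=> [A [_ _ ->]]; apply: (face_closed st). Qed.

Lemma boundary_face_iota Z v : boundary_faces Z -> ~ Z (iota v).
Proof. by move=> [A [_ A1 ->]]; exact: (face_iota st). Qed.

Lemma near_faces p : \forall q \near p, forall A, A \in F -> face iota F A q -> face iota F A p.
Proof.
suff h (s : seq 'M[R]_n) : \forall q \near p, forall A, A \in s -> face iota F A q -> face iota F A p by exact: h.
elim: s => [|B s IH]; first by apply: near_all => q A; rewrite in_nil.
have h : \forall q \near p, face iota F B q -> face iota F B p.
  have [fp|fp] := pselect (face iota F B p); first by apply: near_all.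
  have : nbhs p (~` face iota F B) by apply: open_nbhs_nbhs; split=> //; apply: closed_openC; apply: (face_closed st).
  by apply: filterS => q.
by apply: filterS (nearI h IH) => q [h1 h2] A; rewrite inE => /orP[/eqP ->|/h2].
Qed.

Lemma stage_hyper p W : nbhs p W -> exists m Ac K lev dm U kb,
  [/\ stage_at p m Ac K lev dm U kb, U `<=` W &
      hyp_chart boundary_faces p U kb dm (fun c => face iota F (Ac (lev c).+1))].
Proof.
move=> nW; have [m [Ac [K [lev [dm [U [kb [sa UW]]]]]]]] := stage_at_ex (nearI nW (near_faces p)).
exists m, Ac, K, lev, dm, U, kb; have [ch cg kc _] := sa.
have [c0 cF _ _ _] := ch; have [f0 fS fE fN] := chain_flag st ch.
split=> //; first by move=> q /UW[].
split=> //.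
- move=> c cd; have lt := lev_lt sa cd; exists (Ac (lev c).+1); split=> //; first exact: cF.
  apply/negP => h; have [f [_]] := fN _ lt.
  have /submxP[D ->] := submx_trans (submx1 f) h.
  by rewrite -mulmxA fE// mulmx0 mxE eqxx.
- by move=> c q cd Uq; exact: (face_coord sa).
move=> Z q [A [AF A1 ->]] Uq Zq; have [_ fp] := UW q Uq.
have [j [jm E]] := face_in_chain st ch AF (fp _ AF Zq).
have EA := Feq (cF _ jm) AF E; case: j => [|j] in jm E EA *.
  by move: A1; rewrite -EA c0 submx_refl.
have [_ /(_ j jm)[c cd cj]] := cg; by exists c => //; rewrite cj EA.
Qed.

Let hc p W : nbhs p W -> exists U (kb : X -> 'rV[R]_n) D lab, hyp_chart boundary_faces p U kb D lab /\ U `<=` W.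
Proof.
move=> nW; have [m [Ac [K [lev [dm [U [kb [_ UW hp]]]]]]]] := stage_hyper nW.
by exists U, kb, dm, (fun c => face iota F (Ac (lev c).+1)).
Qed.

Lemma stage_manifold : manifold_with_corners X.
Proof. exact: (hyper_manifold dn cX e boundary_face_closed hc). Qed.

Lemma stage_factor g : locally_monomial n boundary_faces g -> boundary_monomial g.
Proof.
exact: (locally_monomial_factor dn cX e boundary_face_list boundary_face_closed dX boundary_face_iota hc).
Qed.

Lemma Sm_fe (f v : 'rV[R]_n) : smooth_near_rV v (fe f).
Proof.
have aP := @ambient_euclidean R n.
apply: (@sm_eq _ _ _ (fun v => \sum_j v 0 j * f 0 j)); first by apply: near_all => w; rewrite feE.
apply: (Sm_sum aP) => j _; apply: smM; [exact: sm_coord|exact: sm_cst].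
Qed.

Lemma Sm_theta A (v : 'rV[R]_n) k : smooth_near_rV v (fun v => theta A v 0 k).
Proof.
have aP := @ambient_euclidean R n.
have sN : smooth_near_rV v (fun v => (NA A v)^-1).
  apply: smV; last exact: NA_neq0.
  apply: (@sm_eq _ _ _ (fun v => Num.sqrt (1 + \sum_j fe (row j A) v ^+ 2))).
    by apply: near_all => w; rewrite -NA2 sqrtr_sqr gtr0_norm// NA_gt0.
  apply: sm_sqrt; last by rewrite -NA2 exprn_gt0// NA_gt0.
  apply: smD; first exact: sm_cst.
  apply: (Sm_sum aP) => j _; apply: (SmX aP); exact: Sm_fe.
case: (split_ordP k) => j ->.
  by apply: (sm_eq _ sN); apply: near_all => w; rewrite (ord1 j) thetal.
apply: (@sm_eq _ _ _ (fun w => fe (row j A) w * (NA A w)^-1)); last exact: smM (Sm_fe _ _) sN.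
by apply: near_all => w; rewrite thetar.
Qed.

Lemma iota_smooth v : {for v, continuous (iota : euclidean R n -> X)} /\
  forall f, smooth_near (iota v) f -> smooth_near_rV v (f \o iota).
Proof.
have [_ _ _ _ hPsi] := st; have [_ _ pi] := pr.
apply: (@smooth_pull R (euclidean R n) X (@ambient_euclidean R n) N psi setT) => //; first exact: near_all.
move=> j; have [A [k [AF PsiE]]] := hPsi j.
by apply: (sm_eq _ (Sm_theta A v k)); apply: near_all => w; rewrite -PsiE -pi.
Qed.

Lemma stage_connected : connected [set: X].
Proof.
have -> : [set: X] = closure (range iota).
  by apply/seteqP; split=> // p _ A /dX[v Av]; exists (iota v); split=> //; exists v.
apply: connected_closure; apply: connected_continuous_connected.
  have -> : [set: 'rV[R]_n] = \bigcup_v ((fun t : R => t *: v) @` setT).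
    by apply/seteqP; split=> // v _; exists v => //; exists 1; rewrite ?scale1r.
  apply: bigcup_connected; first by exists 0 => v _; exists 0; rewrite ?scale0r.
  move=> v _; apply: connected_continuous_connected; first exact/connected_intervalP.
  by apply: continuous_subspaceT => t; apply: cvgZr_tmp; exact: cvg_id.
by apply: continuous_subspaceT => v; have [] := iota_smooth v.
Qed.

Lemma coord_xt q : 0 < tau iota q 1%:M ->
  exists w : 'rV[R]_n, forall j, xt iota q (fun v => v 0 j) (w 0 j).
Proof.
move=> t0; have t := tau_xt Fxt q F1; have tn : tau iota q 1%:M != 0 by rewrite gt_eqF.
exists (\row_j ((row j 1%:M *m ev iota q 1%:M) 0 0 / tau iota q 1%:M)) => j.
have h := xt_div aX tn (ev_xt pr Fxt q F1 (submx1 (row j 1%:M))) t.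
rewrite [X in xt _ _ _ X]mxE; apply: (xt_eq _ h); apply: nearTW => v; rewrite invrK divfK ?NA_neq0//.
by rewrite -(fe_row 1%:M) trmx1 mulmx1.
Qed.

(** Where [1 / NA 1] has a positive limit, the entries of [v] themselves have limits, and these form
    the vector sought. *)
Lemma tau_interior q : 0 < tau iota q 1%:M -> exists v, iota v = q.
Proof.
move=> t0; have [w cx] := coord_xt t0; have [_ _ _ _ hPsi] := st; have [_ _ pi] := pr.
exists w; apply: (embeds_inj e) => //; rewrite pi; apply/rowP => j.
have [A [k [AF PsiE]]] := hPsi j; rewrite PsiE.
have h1 := xt_comp aX (h := fun v => theta A v 0 k) cx (Sm_theta A w k).
have h2 : xt iota q (fun v => theta A (\row_j v 0 j) 0 k) (psi q 0 j).
  exists (fun q => psi q 0 j); split=> //; first exact: Sm_embed_coord e I.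
  by apply: near_all => x v <-; rewrite rV_row pi PsiE.
exact: (xt_uniq aX dX h1 h2).
Qed.

Lemma tau_iota v : 0 < tau iota (iota v) 1%:M.
Proof. by rewrite (xt_iota (tau_xt Fxt (iota v) F1)) invr_gt0 NA_gt0. Qed.

Lemma iota_inj : injective iota.
Proof.
move=> v w E; have [x xE] := coord_xt (tau_iota v); apply/rowP => j.
have h1 := xE j; have h2 := xE j; rewrite E in h2.
by rewrite -(xt_iota h1) -(xt_iota h2).
Qed.

Lemma stage_embeds : embeds setT (iota : euclidean R n -> X).
Proof.
apply: (@embeds_intro R (euclidean R n) X aX setT iota n id); [exact: embeds_id|exact: openT|by move=> v _; exact: iota_smooth|].
move=> v _ j; have [x xE] := coord_xt (tau_iota v); have [h [sh _ hE]] := xE j; exists h => //.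
by apply: filterS hE => y hy w _ wy; rewrite (hy w wy).
Qed.

Lemma interior_chart v m Ac K lev dm U kb : stage_at (iota v) m Ac K lev dm U kb -> dm = finset.set0.
Proof.
move=> sa; have [ch _ _ _] := sa; have [c0 _ _ [ct _] _] := ch.
apply/setP => c; rewrite finset.inE; apply/negbTE/negP => /(lev_lt sa) lt.
have := ct 0%N (leq_ltn_trans (leq0n _) lt); have := tau_iota v; rewrite c0 => /gt_eqF h.
by move=> /eqP; rewrite h.
Qed.

(** [tau] is positive at an interior point, so the chain there has length 0 and the chart of the
    stage no boundary coordinate; by [chart_face_cmp] no other chart has one. *)
Lemma iota_no_boundary v (c : coords X) i : adapted (iota v) c -> i \notin bnd c.
Proof.
move=> ac; apply/negP => ib; have [m [Ac [K [lev [dm [U [kb [sa _]]]]]]]] := stage_at_ex (filterT : nbhs (iota v) setT).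
have [_ _ kc _] := sa; have [C [s [bij aC _ _ bC]]] := kchart_coords dn kc.
have [j [_ [jb _ _ _]]] := chart_face_cmp aX ac aC ib.
have [s' s'K K's] := bij; by move: jb; rewrite -(K's j) bC (interior_chart sa) finset.inE.
Qed.

Lemma stage_interior : range iota = @interior_points R X.
Proof.
apply/seteqP; split=> p.
  move=> [v _ <-]; have [m [Ac [K [lev [dm [U [kb [sa _]]]]]]]] := stage_at_ex (filterT : nbhs (iota v) setT).
  have [_ _ kc _] := sa; have [C [s [bij aC _ _ bC]]] := kchart_coords dn kc.
  exists C; split=> //; apply/setP => i; rewrite finset.inE; apply/negbTE; exact: iota_no_boundary aC.
move=> [c [ac b0]]; have [m [Ac [K [lev [dm [U [kb [sa _]]]]]]]] := stage_at_ex (filterT : nbhs p setT).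
have [_ _ kc _] := sa; have [C [s [bij aC _ CE bC]]] := kchart_coords dn kc.
have [|v vp] := tau_interior (q := p); last by exists v.
apply: (kchart_interior sa (kchart_base kc)) => d dd.
have [j [_ [jb _ _ _]]] := chart_face_cmp aX aC ac (ltac:(by rewrite bC) : s d \in bnd C).
by move: jb; rewrite b0 finset.inE.
Qed.

Lemma bdf_iota rho v : boundary_defining rho -> rho (iota v) != 0.
Proof.
by move=> [_ _ _ _ h]; apply/eqP => /h[c [i [ac ib _]]]; move: (iota_no_boundary i ac); rewrite ib.
Qed.

End StageManifold.

(** * Maps induced by linear maps *)

Section FibrationCharts.
Context {R : realType} (n n' : nat) (X X' : germ_space R) (S : X -> X').

Definition fibration_charts p U (kb : X -> 'rV[R]_n) (D : {set 'I_n}) U' (kb' : X' -> 'rV[R]_n') (D' : {set 'I_n'})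
    (g : 'I_n' -> 'I_n) (J : 'I_n' -> {set 'I_n}) :=
  [/\ kchart p U kb D, kchart (S p) U' kb' D', injective g,
    forall c, c \notin D' -> g c \notin D /\ \forall q \near p, kb' (S q) 0 c = kb q 0 (g c) &
    (forall c d, c \in D' -> d \in D' -> c != d -> (J c :&: J d = finset.set0)%SET) /\
    forall c, c \in D' -> J c \subset D /\ \forall q \near p, kb' (S q) 0 c = \prod_(i in J c) kb q 0 i].

End FibrationCharts.

Lemma b_fibration_intro (R : realType) n n' (X X' : germ_space R) (S : X -> X') : sdim X = n -> sdim X' = n' -> b_map S -> range S = setT ->
  (forall p, exists U (kb : X -> 'rV[R]_n) D U' (kb' : X' -> 'rV[R]_n') D' g J,
    fibration_charts S p U kb D U' kb' D' g J) -> b_fibration S.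
Proof.
move=> dn dn' bS rS h; subst n n'; split=> // p.
have [U [kb [D [U' [kb' [D' [g [J [kc kc' gi gn [Jd Jn]]]]]]]]]] := h p.
exists (@Coords R X U kb D), (@Coords R X' U' kb' D'); split; first exact: kc.
- exact: kc'.
- by exists g; split=> // a b _ _; exact: gi.
by exists J.
Qed.

Section StageMaps.
Context {R : realType} (n n' : nat) (X X' : germ_space R).
Variables (iota : 'rV[R]_n -> X) (N : nat) (Psi : 'rV[R]_n -> 'rV[R]_N) (psi : X -> 'rV[R]_N).
Variables (iota' : 'rV[R]_n' -> X') (N' : nat) (Psi' : 'rV[R]_n' -> 'rV[R]_N') (psi' : X' -> 'rV[R]_N').
Variables (F : seq 'M[R]_n) (F' : seq 'M[R]_n').
Hypothesis st : is_stage iota Psi psi F.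
Hypothesis st' : is_stage iota' Psi' psi' F'.
Hypothesis cX : compact [set: X].
Hypothesis cX' : compact [set: X'].
Hypothesis dn : sdim X = n.
Hypothesis dn' : sdim X' = n'.
Hypothesis Feq : forall A B, A \in F -> B \in F -> (A :=: B)%MS -> A = B.
Variable T : 'M[R]_(n, n').
Hypothesis TF : forall A, A \in F' -> exists2 C, C \in F & (A *m T^T :=: C)%MS.
Let pr : presents iota Psi psi. Proof. by case: st. Qed.
Let pr' : presents iota' Psi' psi'. Proof. by case: st'. Qed.
Let Fxt A : A \in F -> forall p k, exists a, xt iota p (fun v => theta A v 0 k) a.
Proof. by case: st => _ _ _ h _; exact: h. Qed.
Let Fxt' A : A \in F' -> forall p k, exists a, xt iota' p (fun v => theta A v 0 k) a.
Proof. by case: st' => _ _ _ h _; exact: h. Qed.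
Let aX : ambient X := presents_ambient pr.
Let dX := presents_dense pr.
Let aX' : ambient X' := presents_ambient pr'.
Let e : embeds setT (psi : X -> euclidean R N). Proof. by case: pr. Qed.
Let e' : embeds setT (psi' : X' -> euclidean R N'). Proof. by case: pr'. Qed.

Lemma fe_pull (f : 'rV[R]_n') v : fe f (v *m T) = fe (f *m T^T) v.
Proof. by rewrite /fe trmx_mul trmxK mulmxA. Qed.

Section Chain.
Variables (p : X) (m : nat) (Ac : nat -> 'M[R]_n).
Hypothesis ch : is_chain iota F p m Ac 1%:M.
Let E i : 'cV[R]_n := ev iota p (Ac i).
Let cF i : (i <= m)%N -> Ac i \in F. Proof. by case: ch => _ h _ _ _; exact: h. Qed.
Let cS i : (Ac i.+1 <= Ac i)%MS. Proof. by have [_ h _ _] := chain_flag st ch. Qed.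
Let mono i j : (i <= j)%N -> (Ac j <= Ac i)%MS. Proof. exact: (flag_mono cS). Qed.
Let cE i : (i < m)%N -> Ac i.+1 *m E i = 0. Proof. by have [_ _ h _] := chain_flag st ch; exact: h. Qed.

Definition pull_level (A : 'M[R]_n') i :=
  [/\ (i <= m)%N, (A *m T^T <= Ac i)%MS & (i < m)%N -> A *m T^T *m E i != 0].

Lemma pull_level_ex A : A \in F' -> exists i, pull_level A i.
Proof.
move=> AF; have [C CF CE] := TF AF; have [i [im Ci Cn]] := leveled_ex ch CF.
exists i; split=> //; first by rewrite CE.
move=> /Cn; apply: contraNN => /eqP/sub_kermxP; rewrite CE => /sub_kermxP h; exact/eqP.
Qed.

Lemma pull_level_gt A j i : pull_level A i -> (j <= m)%N -> (A *m T^T <= Ac j)%MS -> (j <= i)%N.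
Proof.
move=> [im Ai An] jm Aj; rewrite leqNgt; apply/negP => ij.
have im' := leq_trans ij jm; have := An im'; apply/negP; rewrite negbK; apply/eqP/sub_kermxP.
by apply: submx_trans (submx_trans Aj (mono ij)) _; apply/sub_kermxP; exact: cE.
Qed.

(** The squared ratio tends to the sum of the squares of [tau] and of the limits of the pulled-back
    functionals relative to [Ac i]; by the choice of [i] these do not all vanish. *)
Lemma pull_ratio A i : pull_level A i ->
  exists2 b : R, 0 < b & xt iota p (fun v => NA A (v *m T) / NA (Ac i) v) b.
Proof.
move=> [im Ai An]; pose a j := (row j (A *m T^T) *m E i) 0 0.
have h0 := tau_xt Fxt p (cF im).
have h j := ev_xt pr Fxt p (cF im) (submx_trans (row_sub j _) Ai).
have b0 : 0 < tau iota p (Ac i) * tau iota p (Ac i) + \sum_j a j * a j.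
  have [im'|im'] := eqVneq i m.
    have t0 : 0 < tau iota p (Ac i) by rewrite im'; case: ch => _ _ _ [].
    by rewrite ltr_wpDr ?mulr_gt0// sumr_ge0// => j _; rewrite -expr2 sqr_ge0.
  have lt : (i < m)%N by rewrite ltn_neqAle im'.
  rewrite ltr_wpDl//; first by rewrite -expr2 sqr_ge0.
  rewrite lt_neqAle sumr_ge0 ?andbT => [|j _]; last by rewrite -expr2 sqr_ge0.
  apply/eqP => /esym/eqP; rewrite psumr_eq0 => [/allP hz|j _]; last by rewrite -expr2 sqr_ge0.
  move: (An lt) => /eqP; apply; apply/row_matrixP => j; rewrite row_mul row0.
  apply/matrixP => x y; rewrite !ord1 [RHS]mxE; apply/eqP; have := hz j; rewrite mem_index_enum -expr2 sqrf_eq0.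
  exact.
exists (Num.sqrt (tau iota p (Ac i) * tau iota p (Ac i) + \sum_j a j * a j)); first by rewrite sqrtr_gt0.
have h2 : xt iota p (fun v => (NA (Ac i) v)^-1 * (NA (Ac i) v)^-1 + \sum_j (fe (row j (A *m T^T)) v / NA (Ac i) v) * (fe (row j (A *m T^T)) v / NA (Ac i) v))
    (tau iota p (Ac i) * tau iota p (Ac i) + \sum_j a j * a j).
  by apply: (xtD aX (xtM aX h0 h0)); apply: (xt_sum aX) => j _; exact: (xtM aX (h j) (h j)).
apply: (xt_eq _ (xt_sqrt aX b0 h2)).
apply: nearTW => v; rewrite -[RHS]gtr0_norm; last by rewrite divr_gt0// NA_gt0.
rewrite -sqrtr_sqr; congr (Num.sqrt _); rewrite expr_div_n NA2 mulrDl mul1r -expr2 exprVn; congr (_ + _).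
by rewrite mulr_suml; apply: eq_bigr => j _; rewrite -expr2 expr_div_n fe_pull row_mul.
Qed.

End Chain.

Lemma pull_theta A p k : A \in F' -> exists a, xt iota p (fun v => theta A (v *m T) 0 k) a.
Proof.
move=> AF; have [m [Ac ch]] := chain_ex st p; have [i Ai] := pull_level_ex ch AF.
have [b b0 hb] := pull_ratio ch Ai; have bn : b != 0 by rewrite gt_eqF.
have [im AAi _] := Ai; have cF : Ac i \in F by case: ch => _ h _ _ _; exact: h.
have nz v : NA A (v *m T) / NA (Ac i) v != 0 by rewrite mulf_neq0 ?invr_neq0 ?NA_neq0.
case: (split_ordP k) => j ->; eexists.
  apply: xt_eq (xt_div aX bn (tau_xt Fxt p cF) hb); apply: nearTW => v.
  by rewrite (ord1 j) thetal; field; rewrite !NA_neq0.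
apply: xt_eq (xt_div aX bn (ev_xt pr Fxt p cF (submx_trans (row_sub j _) AAi)) hb); apply: nearTW => v.
by rewrite thetar fe_pull row_mul; field; rewrite !NA_neq0.
Qed.

Lemma stage_map_ex : exists S : X -> X', smooth_map S /\ forall v, S (iota v) = iota' (v *m T).
Proof.
have [_ _ _ _ hPsi] := st'; have [_ rpsi pi'] := pr'.
have : forall j, exists Fb : X -> R, (forall p, smooth_near p Fb) /\ forall v, Fb (iota v) = Psi' (v *m T) 0 j.
  move=> j; have [A [k [AF PE]]] := hPsi j.
  have [|Fb [h1 h2 _]] := xt_extend aX dX (F := fun v => theta A (v *m T) 0 k).
    by move=> p; exact: pull_theta.
  by exists Fb; split=> // v; rewrite h2 PE.
move=> /choice[Fb hF]; pose G p : 'rV[R]_N' := \row_j Fb j p.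
have Gi v : G (iota v) = Psi' (v *m T) by apply/rowP => j; rewrite mxE; case: (hF j).
have : forall p, exists q, psi' q = G p.
  move=> p; suff : (range psi') (G p) by move=> [q _ qE]; exists q.
  rewrite rpsi => A nA; have [|v Av] := dX (Sm_row_cvg aX (g := Fb) (p := p) _ nA); first by move=> j; case: (hF j).
  by exists (Psi' (v *m T)); split; [exists (v *m T)|rewrite -Gi].
move=> /choice[S SE]; exists S; split; last first.
  by move=> v; apply: (embeds_inj e') => //; rewrite SE Gi pi'.
have h p : {for p, continuous S} /\ forall f, smooth_near (S p) f -> smooth_near p (f \o S).
  apply: (smooth_pull aX e') => //; first exact: near_all.
  by move=> j; have [sF _] := hF j; apply: (Sm_eq aX _ (sF p)); apply: near_all => q; rewrite SE mxE.
by split=> [p|p f]; [case: (h p)|case: (h p) => _; exact].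
Qed.

Variable S : X -> X'.
Hypothesis sS : smooth_map S.
Hypothesis Si : forall v, S (iota v) = iota' (v *m T).

Lemma near_S p (P : X' -> Prop) : (\forall q \near S p, P q) -> \forall q \near p, P (S q).
Proof. by move=> nP; have [cS _] := sS; exact: cS. Qed.

Lemma xt_pull p G a : xt iota' (S p) G a -> xt iota p (fun v => G (v *m T)) a.
Proof.
move=> [h [sh h0 hE]]; have [cS pS] := sS; exists (h \o S); split=> //; first exact: pS.
by apply: filterS (near_S hE) => q hq v vq; apply: (hq (v *m T)); rewrite -vq Si.
Qed.

Section TwoCharts.
Variables (p : X) (m : nat) (Ac : nat -> 'M[R]_n) (K : 'M[R]_n) (lev : 'I_n -> nat).
Variables (dm : {set 'I_n}) (U : set X) (kb : X -> 'rV[R]_n).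
Hypothesis sa : stage_at iota F p m Ac K lev dm U kb.
Variables (m' : nat) (Ac' : nat -> 'M[R]_n') (K' : 'M[R]_n') (lev' : 'I_n' -> nat).
Variables (dm' : {set 'I_n'}) (U' : set X') (kb' : X' -> 'rV[R]_n').
Hypothesis sa' : stage_at iota' F' (S p) m' Ac' K' lev' dm' U' kb'.

Let ch : is_chain iota F p m Ac 1%:M. Proof. by case: sa. Qed.
Let ch' : is_chain iota' F' (S p) m' Ac' 1%:M. Proof. by case: sa'. Qed.
Let cg : complete_graded m Ac (fun i => ev iota p (Ac i)) K lev dm. Proof. by case: sa. Qed.
Let cg' : complete_graded m' Ac' (fun i => ev iota' (S p) (Ac' i)) K' lev' dm'. Proof. by case: sa'. Qed.
Let kc : kchart p U kb dm. Proof. by case: sa. Qed.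
Let kc' : kchart (S p) U' kb' dm'. Proof. by case: sa'. Qed.

Lemma R_pull l i : (l <= m')%N -> pull_level p m Ac (Ac' l) i ->
  exists2 a : R, 0 < a & xt iota p (fun v => Rf m' K' lev' dm' l (v *m T) / Rf m K lev dm i v) a.
Proof.
move=> lm Ai; have [a a0 ha] := RN_xt pr' Fxt' ch' cg' lm; have [b b0 hb] := pull_ratio ch Ai.
have [im _ _] := Ai; have [c c0 hc] := RN_xt pr Fxt ch cg im; have cn : c != 0 by rewrite gt_eqF.
exists (a * b / c); first by rewrite divr_gt0// mulr_gt0.
have := xt_div aX cn (xtM aX (xt_pull ha) hb) hc; apply: xt_eq.
have := R_pos pr Fxt ch cg; apply: nearTS => v /(_ i)/gt_eqF ri.
by field; rewrite !NA_neq0 ri.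
Qed.

(** The pull-back of [R'_(l+1) / R'_l] is a positive smooth function times [R_j / R_i], where [i]
    and [j] are the levels of the two pulled-back flats; that ratio is the product of the boundary
    coordinates of levels from [i] up to, but excluding, [j]. *)
Lemma dm_pull d : d \in dm' -> exists (J : {set 'I_n}) u, [/\ J \subset dm, smooth_near p u, 0 < u p &
  \forall q \near p, kb' (S q) 0 d = u q * \prod_(c in J) kb q 0 c].
Proof.
move=> dd; set l := lev' d; have lt : (l < m')%N := lev_lt sa' dd.
have [_ cF' _ _ cch] := ch'.
have [i Ai] := pull_level_ex ch (cF' _ (ltnW lt)); have [j Aj] := pull_level_ex ch (cF' _ lt).
have ij : (i <= j)%N.
  have [im Ai' _] := Ai; apply: (pull_level_gt ch Aj im); apply: submx_trans Ai'; apply: submxMr.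
  by have [] := cch _ lt.
have [a a0 [h [sh hp hE]]] := R_pull (ltnW lt) Ai; have [b b0 [g [sg gp gE]]] := R_pull lt Aj.
have hn : h p != 0 by rewrite hp gt_eqF.
exists [set c in dm | (i <= lev c < j)%N]%SET, (fun q => g q / h q); split.
- by apply/fintype.subsetP => c; rewrite finset.inE => /andP[].
- exact: (Sm_div aX).
- by rewrite gp hp divr_gt0.
have [cS pS] := sS; have nU := kchart_open kc (kchart_base kc).
have nU' : \forall q \near p, U' (S q) := near_S (kchart_open kc' (kchart_base kc')).
apply: (Sm_eq_dense aX dX).
- exact: (pS p _ (kchart_Sm d kc' (kchart_base kc'))).
- apply: (SmM aX (Sm_div aX sg sh hn)); apply: (Sm_prod aX) => c _; exact: kchart_Sm kc (kchart_base kc).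
apply: filterS (nearI (nearI hE gE) (nearI nU nU')) => q [[hq gq] [Uq Uq']] v vq.
have [_ _ _ /(_ q Uq)[/(_ v vq)[Rp kE] _]] := sa.
have Sv : iota' (v *m T) = S q by rewrite -vq Si.
have [_ _ _ /(_ _ Uq')[/(_ _ Sv)[Rp' kE'] _]] := sa'.
rewrite (hq v vq) (gq v vq) kE' mxE /kap dd; have := qq_kap cg ij Rp; rewrite -kE /qq => E.
under eq_bigl => c do rewrite finset.inE.
rewrite E -/l; field; by rewrite !gt_eqF.
Qed.

End TwoCharts.

(** If [rho] vanishes at [S p], it is proportional to a boundary coordinate of the chart of the
    stage, to which [dm_pull] applies; otherwise it is positive and the monomial is empty. *)
Lemma bdf_pull rho : boundary_defining rho -> locally_monomial n (boundary_faces iota F) (rho \o S).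
Proof.
move=> rb; have [sr r0 _ _ rl] := rb; have [cS pS] := sS; split=> [p|p]; first exact: pS.
have [m [Ac [K [lev [dm [U [kb [sa _ hp]]]]]]]] := stage_hyper st Feq (filterT : nbhs p setT).
exists U, kb, dm, (fun c => face iota F (Ac (lev c).+1)).
have [z|nz] := eqVneq (rho (S p)) 0; last first.
  exists finset.set0, (rho \o S); split=> //; first exact: finset.sub0set.
  - exact: pS.
  - by rewrite lt_neqAle eq_sym nz r0.
  by apply: near_all => q; rewrite finset.big_set0 mulr1.
have [c [i [ac ib rE]]] := rl _ z.
have [m' [Ac' [K' [lev' [dm' [U' [kb' [sa' _]]]]]]]] := stage_at_ex st' (filterT : nbhs (S p) setT).
have [_ _ kc' _] := sa'; have [C [s [[s' s'K K's] aC _ CE bC]]] := kchart_coords dn' kc'.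
have [j [G [jb sG G0 GE]]] := chart_face_cmp aX' ac aC ib.
have jd : s' j \in dm' by rewrite -bC K's.
have [J [u [JD su u0 uE]]] := dm_pull sa sa' jd.
exists J, (fun q => u q * G (S q)); split=> //.
- apply: (SmM aX su); exact: (pS p _ sG).
- by rewrite mulr_gt0.
apply: filterS (nearI uE (near_S (nearI rE GE))) => q [uq [rq Gq]].
by rewrite /= rq Gq -[X in crd C (S q) 0 X](K's j) CE uq mulrAC.
Qed.

Theorem stage_map_interior : interior_b_map S.
Proof.
split; last by move=> rho rb /(_ (iota 0)); rewrite Si; apply/eqP; exact: (bdf_iota st' dn').
by split=> // rho rb; right; exact: (stage_factor st cX dn Feq (bdf_pull rb)).
Qed.

Lemma stage_map_closed : closed (range S).
Proof.
apply: compact_closed; first exact: embedded_hausdorff e'.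
apply: continuous_compact => //; apply: continuous_subspaceT; by case: sS.
Qed.

Section Submersion.
Hypothesis Tsurj : forall v, exists w : 'rV[R]_n, w *m T = v.
Hypothesis Tflat : forall A, A \in F ->
  exists2 P, P \in F' & forall f : 'rV[R]_n', (f <= P)%MS = (f *m T^T <= A)%MS.

Lemma stage_map_onto : range S = setT.
Proof.
apply/seteqP; split=> // q _; apply: stage_map_closed => A nA.
have [v Av] := presents_dense pr' nA; have [w wT] := Tsurj v.
by exists (iota' v); split=> //; exists (iota w) => //; rewrite Si wT.
Qed.

Section PulledSystem.
Variables (p : X) (m : nat) (Ac : nat -> 'M[R]_n).
Hypothesis ch : is_chain iota F p m Ac 1%:M.
Variables (m' : nat) (Ac' : nat -> 'M[R]_n') (K' : 'M[R]_n') (lev' : 'I_n' -> nat).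
Variables (dm' : {set 'I_n'}) (U' : set X') (kb' : X' -> 'rV[R]_n').
Hypothesis sa' : stage_at iota' F' (S p) m' Ac' K' lev' dm' U' kb'.
Let ch' : is_chain iota' F' (S p) m' Ac' 1%:M. Proof. by case: sa'. Qed.
Let cg' : complete_graded m' Ac' (fun i => ev iota' (S p) (Ac' i)) K' lev' dm'. Proof. by case: sa'. Qed.
Let E i : 'cV[R]_n := ev iota p (Ac i).
Let E' i : 'cV[R]_n' := ev iota' (S p) (Ac' i).
Let cF i : (i <= m)%N -> Ac i \in F. Proof. by case: ch => _ h _ _ _; exact: h. Qed.
Let cF' i : (i <= m')%N -> Ac' i \in F'. Proof. by case: ch' => _ h _ _ _; exact: h. Qed.
Let cS i : (Ac i.+1 <= Ac i)%MS. Proof. by have [_ h _ _] := chain_flag st ch. Qed.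
Let cE i : (i < m)%N -> Ac i.+1 *m E i = 0. Proof. by have [_ _ h _] := chain_flag st ch; exact: h. Qed.
Let sub0E i (f : 'rV[R]_n) : (i < m)%N -> (f <= Ac i.+1)%MS -> (f *m E i) 0 0 = 0.
Proof. by move=> im /submxP[D ->]; rewrite -mulmxA cE// mulmx0 mxE. Qed.

(** Evaluating at [S p] and pulling back is evaluating at [p], up to the ratio [b] of the two
    normalizations. *)
Lemma ev_pull l i : (l <= m')%N -> pull_level p m Ac (Ac' l) i -> exists2 b : R, 0 < b &
  tau iota p (Ac i) = tau iota' (S p) (Ac' l) * b /\
  forall f : 'rV[R]_n', (f <= Ac' l)%MS -> (f *m T^T *m E i) 0 0 = (f *m E' l) 0 0 * b.
Proof.
move=> lm Ai; have [b b0 hb] := pull_ratio ch Ai; exists b => //; have [im AAi _] := Ai; split.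
  apply: (xt_uniq aX dX (tau_xt Fxt p (cF im))); apply: xt_eq (xtM aX (xt_pull (tau_xt Fxt' (S p) (cF' lm))) hb).
  by apply: nearTW => v; field; rewrite !NA_neq0.
move=> f fA; have fAi := submx_trans (submxMr T^T fA) AAi.
apply: (xt_uniq aX dX (ev_xt pr Fxt p (cF im) fAi)).
apply: xt_eq (xtM aX (xt_pull (ev_xt pr' Fxt' (S p) (cF' lm) fA)) hb).
by apply: nearTW => v; rewrite fe_pull; field; rewrite !NA_neq0.
Qed.

(** The largest flat [P] of the target that pulls back into [Ac (iL l).+1] consists of functionals
    negligible against [Ac' l], so it is contained in [Ac' l.+1]. Thus the chain of the target is
    induced by that of the source, and the levels increase strictly. *)
Lemma level_flag : exists iL : nat -> nat, forall l, (l <= m')%N ->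
  [/\ pull_level p m Ac (Ac' l) (iL l), (l < m')%N -> [/\ (iL l < iL l.+1)%N, (iL l < m)%N &
         forall f : 'rV[R]_n', (f *m T^T <= Ac (iL l).+1)%MS -> (f <= Ac' l.+1)%MS] &
     l = m' -> iL l = m].
Proof.
have : forall l, exists i, (l <= m')%N -> pull_level p m Ac (Ac' l) i.
  move=> l; have [lm|lm] := leqP l m'; last by exists 0%N.
  by have [i Ai] := pull_level_ex ch (cF' lm); exists i.
move=> /choice[iL hL]; exists iL.
have [c0' _ _ [ct' ctm'] cch'] := ch'; have [_ _ _ [ct ctm] cch] := ch.
have step l : (l < m')%N -> (forall f : 'rV[R]_n', (f *m T^T <= Ac (iL l))%MS -> (f <= Ac' l)%MS) ->
    [/\ (iL l < iL l.+1)%N, (iL l < m)%N &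
         forall f : 'rV[R]_n', (f *m T^T <= Ac (iL l).+1)%MS -> (f <= Ac' l.+1)%MS].
  move=> lm IH; have Ai := hL l (ltnW lm); have [im AAi An] := Ai.
  have [b b0 [tE fE]] := ev_pull (ltnW lm) Ai.
  have im' : (iL l < m)%N.
    rewrite ltn_neqAle im andbT; apply/eqP => iE.
    by move: ctm; rewrite -iE tE ct'// mul0r ltxx.
  have [A'l A'0 A'max] := cch' _ lm; have [_ _ Amax] := cch _ im'.
  have [P PF PE] := Tflat (cF im').
  have PA : (P <= Ac' l)%MS.
    by apply/row_subP => j; apply: IH; apply: submx_trans (cS _); rewrite -PE row_sub.
  have PA' : (P <= Ac' l.+1)%MS.
    apply: A'max => //; apply/row_matrixP => j; rewrite row_mul row0.
    apply/rowP => x; rewrite (ord1 x) [RHS]mxE.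
    have := fE (row j P) (submx_trans (row_sub _ _) PA).
    rewrite (sub0E im') -?PE ?row_sub// => /esym/eqP; rewrite mulf_eq0 (gt_eqF b0) orbF => /eqP.
    exact.
  have sub : (Ac' l.+1 *m T^T <= Ac (iL l).+1)%MS.
    have [C CF CE] := TF (cF' lm); suff : (C <= Ac (iL l).+1)%MS by rewrite CE.
    apply: Amax => //.
      by rewrite -CE; exact: submx_trans (submxMr _ A'l) AAi.
    apply/sub_kermxP; rewrite -CE; apply/sub_kermxP; apply/row_matrixP => j; rewrite !row_mul row0.
    apply/rowP => x; rewrite (ord1 x) [RHS]mxE fE; last exact: submx_trans (row_sub _ _) A'l.
    have -> : row j (Ac' l.+1) *m E' l = 0 by rewrite -row_mul A'0 row0.
    by rewrite mxE mul0r.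
  split=> //; last by move=> f; rewrite -PE => h; exact: submx_trans h PA'.
  exact: (pull_level_gt ch (hL _ lm) im' sub).
have claim l : (l <= m')%N -> forall f : 'rV[R]_n', (f *m T^T <= Ac (iL l))%MS -> (f <= Ac' l)%MS.
  elim: l => [|l IH] lm f; first by rewrite c0' submx1.
  have [lt _ h] := step l lm (IH (ltnW lm)); move=> hf; apply: h; apply: submx_trans hf _.
  exact: (flag_mono cS).
move=> l lm; split; first exact: hL.
  by move=> lt; apply: step => //; exact: claim.
move=> lE; have Ai := hL l lm; have [im _ _] := Ai; have [b b0 [tE _]] := ev_pull lm Ai.
apply/eqP; rewrite eqn_leq im leqNgt; apply/negP => lt.
by move: b0; rewrite -(pmulr_rgt0 _ ctm') -lE -tE ct// ltxx.
Qed.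

Variable iL : nat -> nat.
Hypothesis hL : forall l, (l <= m')%N -> [/\ pull_level p m Ac (Ac' l) (iL l),
     (l < m')%N -> [/\ (iL l < iL l.+1)%N, (iL l < m)%N &
         forall f : 'rV[R]_n', (f *m T^T <= Ac (iL l).+1)%MS -> (f <= Ac' l.+1)%MS] &
     l = m' -> iL l = m].

Lemma iL_mono l k : (l < k)%N -> (k <= m')%N -> (iL l < iL k)%N.
Proof.
elim: k => // k IH; rewrite ltnS leq_eqVlt => /orP[/eqP ->|lk] km.
  by have [_ /(_ km)[]] := hL (ltnW km).
have [_ /(_ km)[h _ _]] := hL (ltnW km); move=> _; exact: ltn_trans (IH lk (ltnW km)) h.
Qed.

Lemma iL_inj l k : (l <= m')%N -> (k <= m')%N -> iL l = iL k -> l = k.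
Proof.
move=> lm km E0; have [lt|lt|//] := ltngtP l k.
  by have := iL_mono lt km; rewrite E0 ltnn.
by have := iL_mono lt lm; rewrite E0 ltnn.
Qed.
Let lev_le' c : (lev' c <= m')%N. Proof. by case: cg' => -[h _ _ _ _ _]; case: (h c). Qed.

(** Independence at level [iL l] holds since only functionals in [Ac' l.+1] pull back into
    [Ac (iL l).+1]; at the last level it is the injectivity of the pull-back, as [T] is onto. *)
Lemma pull_graded : graded m Ac E (K' *m T^T) (iL \o lev') dm'.
Proof.
have [[g1 g2 g3 g4 g5] g6] := cg'.
split=> /=.
- move=> c; have [[im Ai _] _ _] := hL (lev_le' c); split=> //; rewrite row_mul.
  by apply: submx_trans Ai; apply: submxMr; case: (g1 c).
- move=> i a aS; rewrite mulmxA => hA; apply/eqP/negPn/negP => a0.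
  have [c0 ac0] : exists c, a 0 c != 0.
    apply: contrapT => h; case/negP: a0; apply/eqP/rowP => c; rewrite mxE; apply/eqP/negPn/negP => ac.
    by apply: h; exists c.
  have iE : iL (lev' c0) = i by apply/eqP/negPn/negP => /aS z; rewrite z eqxx in ac0.
  case/eqP: a0; apply: (g2 (lev' c0)).
    move=> c cc; apply: aS; rewrite -iE; apply: contraNneq cc => h.
    by apply/eqP; apply: iL_inj h; exact: lev_le'.
  have [_ h1 h2] := hL (lev_le' c0); have := lev_le' c0; rewrite leq_eqVlt => /orP[/eqP lE|lt].
    move: hA; rewrite -iE h2//; case: ch => _ _ cz _ _; rewrite cz// submx0 => /eqP fT0.
    suff -> : a *m K' = 0 by rewrite sub0mx.
    apply/trmx_inj/row_matrixP => j; have [w wT] := Tsurj (delta_mx 0 j).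
    rewrite rowE -wT -mulmxA -[T *m _]trmxK trmx_mul trmxK fT0 trmx0 mulmx0.
    by rewrite trmx0 row0.
  by have [_ _ h3] := h1 lt; apply: h3; rewrite iE.
- move=> c cd; have [lt pos] := g3 c cd; have [Ai h1 _] := hL (lev_le' c); have [_ h2 _] := h1 lt; split=> //.
  have [b b0 [_ fE]] := ev_pull (lev_le' c) Ai; rewrite row_mul fE ?mulr_gt0//.
  by case: (g1 c).
- by move=> c d cd dd /= /iL_inj h; apply: g4 => //; apply: h; exact: lev_le'.
move=> c lt _; have lt' : (lev' c < m')%N.
  by rewrite ltn_neqAle lev_le' andbT; apply: contraTneq lt => lE; have [_ _ /(_ lE) ->] := hL (lev_le' c); rewrite ltnn.
by have [d dd dE] := g6 _ lt'; exists d => //=; rewrite dE.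
Qed.

End PulledSystem.

Lemma fibration_charts_ex p : exists U (kb : X -> 'rV[R]_n) D U' (kb' : X' -> 'rV[R]_n') D' g J, [/\ fibration_charts S p U kb D U' kb' D' g J,
  forall q, U q -> (forall c, c \in D -> 0 < kb q 0 c) -> 0 < tau iota q 1%:M &
  forall v c, U' (iota' v) -> c \in D' -> 0 < kb' (iota' v) 0 c].
Proof.
have [m' [Ac' [K' [lev' [dm' [U' [kb' [sa' _]]]]]]]] := stage_at_ex st' (filterT : nbhs (S p) setT).
have [m [Ac ch]] := chain_ex st p; have [iL hL] := level_flag ch sa'.
have [K [lev [dm [g [U [kb [cg [gi gK gl gd] kc _ hU]]]]]]] := chart_ex st ch (pull_graded ch sa' hL) (filterT : nbhs p setT).
have sa : stage_at iota F p m Ac K lev dm U kb by [].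
have [ch' cg' kc' hU'] := sa'; have lev_le' c : (lev' c <= m')%N by case: cg' => -[h _ _ _ _ _]; case: (h c).
(* The marked rows of the target are among those of the source, so the pull-back of [R'_l] is
   exactly [R_(iL l)], and the ratio of two of them is the product of the boundary coordinates of
   the levels in between. *)
pose J c := [set i in dm | (iL (lev' c) <= lev i < iL (lev' c).+1)%N]%SET.
have fE c v : f_ K (g c) v = f_ K' c (v *m T) by rewrite /f_ gK row_mul -fe_pull.
have RE l v : (l <= m')%N -> Rf m K lev dm (iL l) v = Rf m' K' lev' dm' l (v *m T).
  rewrite leq_eqVlt => /orP[/eqP ->|lt].
    by have [_ _ /(_ erefl) ->] := hL m' (leqnn _); rewrite !Rf_ge.
  have [d dd dE] := cg'.2 l lt; rewrite -dE (Rf_dm cg' _ dd) -fE -(Rf_dm cg) ?gd//.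
  by rewrite gl.
have nUU := nearI (kchart_open kc (kchart_base kc)) (near_S (kchart_open kc' (kchart_base kc'))).
have [cS pS] := sS.
exists U, kb, dm, U', kb', dm', g, J; split; first split=> //.
- move=> c cd; split; first by rewrite gd.
  apply: (Sm_eq_dense aX dX).
  + exact: (pS p _ (kchart_Sm c kc' (kchart_base kc'))).
  + exact: (kchart_Sm (g c) kc (kchart_base kc)).
  apply: filterS nUU => q [Uq Uq'] v vq; have Sv : iota' (v *m T) = S q by rewrite -vq Si.
  have [/(_ v vq)[_ ->] _] := hU q Uq; have [/(_ _ Sv)[_ ->] _] := hU' _ Uq'.
  by rewrite !mxE /kap gd (negbTE cd) fE gl /= RE.
- split.
    move=> c d cd dd; apply: contraNeq => /set0Pn[i]; rewrite !finset.inE.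
    move=> /andP[/andP[_ /andP[h1 h2]] /andP[_ /andP[h3 h4]]].
    have [[_ _ _ inj _] _] := cg'; apply/eqP; apply: inj => //.
    have lc := lev_lt sa' cd; have ld := lev_lt sa' dd.
    have [lt|lt|//] := ltngtP (lev' c) (lev' d).
      have : (iL (lev' c).+1 <= iL (lev' d))%N.
        by move: lt; rewrite leq_eqVlt => /orP[/eqP ->//|lt]; apply: ltnW; exact: (iL_mono hL lt (ltnW ld)).
      by move=> h; have := leq_trans h2 (leq_trans h h3); rewrite ltnn.
    have : (iL (lev' d).+1 <= iL (lev' c))%N.
      by move: lt; rewrite leq_eqVlt => /orP[/eqP ->//|lt]; apply: ltnW; exact: (iL_mono hL lt (ltnW lc)).
    by move=> h; have := leq_trans h4 (leq_trans h h1); rewrite ltnn.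
  move=> c cd; split; first by apply/fintype.subsetP => i; rewrite finset.inE => /andP[].
  apply: (Sm_eq_dense aX dX).
  + exact: (pS p _ (kchart_Sm c kc' (kchart_base kc'))).
  + apply: (Sm_prod aX) => i _; exact: (kchart_Sm i kc (kchart_base kc)).
  apply: filterS nUU => q [Uq Uq'] v vq; have Sv : iota' (v *m T) = S q by rewrite -vq Si.
  have [/(_ v vq)[Rp kE] _] := hU q Uq; have [/(_ _ Sv)[_ ->] _] := hU' _ Uq'.
  have lc := lev_lt sa' cd; have [_ /(_ lc)[il _ _] _] := hL _ (ltnW lc).
  rewrite mxE /kap cd; have := qq_kap cg (ltnW il) Rp; rewrite -kE !RE ?(ltnW lc)// => <-.
  by rewrite /qq; apply: eq_bigl => i; rewrite finset.inE.
- by move=> q Uq; exact: (kchart_interior st sa).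
move=> v c Uv cd; have [/(_ v erefl)[Rp ->] _] := hU' _ Uv.
by rewrite mxE /kap cd divr_gt0.
Qed.

(** In the normal form of a fibration the equations for a lift have solutions with small positive
    boundary coordinates: all factors in [J c] are given the root of order [#|J c|] of [kb' y 0 c],
    which is small for [y] near [S p]. *)
Lemma fibre_lift p W : nbhs p W -> \forall y \near S p, forall v, iota' v = y ->
  exists2 w, W (iota w) & w *m T = v.
Proof.
move=> nW; have [U [kb [D [U' [kb' [D' [g [J [[kc kc' gi gn [Jd Jn]] hU hU']]]]]]]]] := fibration_charts_ex p.
have Up := kchart_base kc; have Up' := kchart_base kc'; have [_ _ _ z] := kc; have [_ _ _ z'] := kc'.
have rel : \forall q \near p, forall c, (c \notin D' -> kb' (S q) 0 c = kb q 0 (g c)) /\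
    (c \in D' -> kb' (S q) 0 c = \prod_(i in J c) kb q 0 i).
  apply: (@filter_forall _ _ (fun c q => (c \notin D' -> kb' (S q) 0 c = kb q 0 (g c)) /\
    (c \in D' -> kb' (S q) 0 c = \prod_(i in J c) kb q 0 i)) (nbhs p)) => c.
  have [cD|cD] := boolP (c \in D').
    by have [_] := Jn c cD; apply: filterS => q h; split.
  by have [_] := gn c cD; apply: filterS => q h; split.
have nUU := near_S (kchart_open kc' Up').
have [r r0 rP] := nbhs_box (kchart_near kc Up (nearI (nearI nW nUU) rel)).
have nJ c : c \in D' -> (0 < #|J c|)%N.
  move=> cD; rewrite lt0n cards_eq0; apply/eqP => J0; have [_ /nbhs_singleton] := Jn c cD.
  by rewrite J0 finset.big_set0 z'// => /eqP; rewrite eq_sym oner_eq0.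
have near_y : \forall y \near S p, forall c, (c \notin D' -> `|kb' y 0 c - kb' (S p) 0 c| < r) /\
    (c \in D' -> kb' y 0 c < (r / 2) ^+ #|J c|).
  apply: (@filter_forall _ _ (fun c y => (c \notin D' -> `|kb' y 0 c - kb' (S p) 0 c| < r) /\
    (c \in D' -> kb' y 0 c < (r / 2) ^+ #|J c|)) (nbhs (S p))) => c.
  have cc := Sm_cont aX' (kchart_Sm c kc' Up').
  have n1 : \forall y \near S p, `|kb' y 0 c - kb' (S p) 0 c| < r.
    by move: cc => /cvgrPdist_lt/(_ r r0); apply: filterS => y; rewrite distrC.
  have [cD|cD] := boolP (c \in D'); last by apply: filterS n1 => y h; split.
  have pos : kb' (S p) 0 c < (r / 2) ^+ #|J c| by rewrite z'// exprn_gt0// divr_gt0.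
  by have := near_cvg cc (open_nbhs_nbhs (conj (@open_lt R _) pos)); apply: filterS => y h; split.
apply: filterS (nearI near_y (kchart_open kc' Up')) => y [ny Uy] v vy.
have yp c : c \in D' -> 0 < kb' y 0 c by rewrite -vy => cD; apply: hU' => //; rewrite vy.
have : forall c, exists t : R, c \in D' -> [/\ 0 < t, t < r & t ^+ #|J c| = kb' y 0 c].
  move=> c; have [cD|cD] := boolP (c \in D'); last by exists 0.
  exists (kb' y 0 c `^ (#|J c|%:R^-1)) => _.
  have tE : (kb' y 0 c `^ (#|J c|%:R^-1)) ^+ #|J c| = kb' y 0 c.
    rewrite -powR_mulrn ?powR_ge0// -powRrM mulVf ?pnatr_eq0 -?lt0n ?nJ// powRr1// ltW// yp//.
  split=> //; first by rewrite powR_gt0// yp.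
  apply: (@lt_trans _ _ (r / 2)); last by rewrite ltr_pdivrMr// ltr_pMr// ltr1n.
  rewrite ltNge; apply/negP => h; have := (ny c).2 cD; rewrite -tE ltNge => /negP; apply.
  by rewrite lerXn2r// nnegrE ?powR_ge0// ltW// divr_gt0.
move=> /choice[t ht].
(* Boundary coordinates outside all the [J c] are set to [r / 2], so that the lifted point is
   interior; free interior coordinates keep their values at [p]. *)
pose u : 'rV[R]_n := \row_i (if i \in D then (if [pick c in D' | i \in J c] is Some c then t c else r / 2)
   else (if [pick c | (c \notin D') && (g c == i)] is Some c then kb' y 0 c else kb p 0 i)).
have r2 : 0 < r / 2 < r by apply/andP; split; [exact: divr_gt0|rewrite ltr_pdivrMr// ltr_pMr// ltr1n].
have uD i : i \in D -> 0 < u 0 i < r.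
  move=> iD; rewrite mxE iD; case: pickP => [c /andP[/ht[h1 h2 _] _]|_]; last exact: r2.
  by rewrite h1.
have rp := nbhs_singleton rel.
have ub : box (kb p) r u.
  move=> i; have [iD|iD] := boolP (i \in D).
    by rewrite z// subr0 gtr0_norm; have /andP[] := uD i iD.
  rewrite mxE (negbTE iD); case: pickP => [c /andP[cD /eqP <-]|_]; last by rewrite subrr normr0.
  by rewrite -(rp c).1//; exact: (ny c).1.
have [|s [Us su [[Ws Us'] rs]]] := rP u ub; first by move=> i /uD/andP[/ltW].
have [w ws] := tau_interior st (hU s Us (fun c cD => (ltac:(by rewrite su; case/andP: (uD c cD)) : 0 < kb s 0 c))).
exists w; first by rewrite ws.
apply: (iota_inj st'); rewrite -Si ws vy; have [_ ek _ _] := kc'; apply: (embeds_inj ek) => //; apply/rowP => c.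
have [cD|cD] := boolP (c \in D').
  rewrite (rs c).2//; have [JD _] := Jn c cD; have [_ _ <-] := ht c cD; rewrite -prodr_const.
  apply: eq_bigr => i iJ; rewrite su mxE (fintype.subsetP JD _ iJ).
  case: pickP => [d /andP[dD iJd]|/(_ c)]; last by rewrite cD iJ.
  have [->//|cd] := eqVneq c d; have := Jd c d cD dD cd => /setP/(_ i).
  by rewrite !finset.inE iJ iJd.
rewrite (rs c).1// su mxE; have [/negbTE -> _] := gn c cD.
case: pickP => [d /andP[_ /eqP/gi ->]//|/(_ c)]; by rewrite cD eqxx.
Qed.

Theorem stage_fibration : b_fibration S.
Proof.
apply: (b_fibration_intro dn dn'); first by case: stage_map_interior.
  exact: stage_map_onto.
move=> p; have [U [kb [D [U' [kb' [D' [g [J [h _ _]]]]]]]]] := fibration_charts_ex p.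
by exists U, kb, D, U', kb', D', g, J.
Qed.

(* The fibres over interior points are connected and, by fibre_lift, no part of
   a fibre is isolated from them. *)
Theorem stage_fibre_connected q : connected (S @^-1` [set q]).
Proof.
have [cS _] := sS; have hX' := embedded_hausdorff e'; have hX := embedded_hausdorff e.
have clf : closed (S @^-1` [set q]).
  by apply: preimage_closed => //; exact: accessible_closed_set1 (hausdorff_accessible hX') q.
apply: contrapT => /connectedPn[E [E0 fE [s1 s2]]].
have cE0 : closed (E false).
  move=> x xE; have : (S @^-1` [set q]) x by apply: clf; apply: closureS xE; rewrite fE; exact: subsetUl.
  rewrite fE => -[//|xE1]; suff : (closure (E false) `&` E true) x by rewrite s1.
  by [].
have cE1 : closed (E true).
  move=> x xE; have : (S @^-1` [set q]) x by apply: clf; apply: closureS xE; rewrite fE; exact: subsetUr.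
  rewrite fE => -[xE1|//]; suff : (E false `&` closure (E true)) x by rewrite s2.
  by [].
(* The two closed parts of a disconnected fibre get disjoint open neighbourhoods. By compactness
   these cover all nearby fibres, and over a nearby interior point a segment between two interior
   points of the fibre would join them. *)
have /(_ (~` E true))[|B nB cB] := compact_normal hX cX cE0.
  move=> x xE; apply: open_nbhs_nbhs; split; first exact: closed_openC.
  by move=> xE1; have : (closure (E false) `&` E true) x; [split=> //; exact: subset_closure|rewrite s1].
pose O0 := B°; pose O1 := ~` closure B.
have o0 : open O0 by exact: open_interior.
have o1 : open O1 by apply: closed_openC; exact: closed_closure.
have dis x : O0 x -> O1 x -> False by move=> /interior_subset/subset_closure h; exact.
have h0 x : E false x -> O0 x by move=> xE; exact: nB xE.
have h1 x : E true x -> O1 x by move=> xE /cB.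
have nq : \forall y \near q, forall x, S x = y -> O0 x \/ O1 x.
  have clC : closed (S @` ~` (O0 `|` O1)).
    apply: compact_closed => //; apply: continuous_compact; first exact: continuous_subspaceT.
    apply: (subclosed_compact _ cX) => //; apply: open_closedC; exact: openU.
  have : nbhs q (~` (S @` ~` (O0 `|` O1))).
    apply: open_nbhs_nbhs; split; first exact: closed_openC.
    move=> [x nx xq]; apply: nx; have : (S @^-1` [set q]) x by [].
    by rewrite fE => -[/h0|/h1]; [left|right].
  by apply: filterS => y ny x xy; apply: contrapT => h; apply: ny; exists x.
have [x0 x0E] := E0 false; have [x1 x1E] := E0 true.
have Sx0 : S x0 = q by have : (S @^-1` [set q]) x0 by rewrite fE; left.
have Sx1 : S x1 = q by have : (S @^-1` [set q]) x1 by rewrite fE; right.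
have l0 := fibre_lift (open_nbhs_nbhs (conj o0 (h0 _ x0E))); rewrite Sx0 in l0.
have l1 := fibre_lift (open_nbhs_nbhs (conj o1 (h1 _ x1E))); rewrite Sx1 in l1.
have [v [hv [/(_ v erefl)[w0 W0 w0T] /(_ v erefl)[w1 W1 w1T]]]] := presents_dense pr' (nearI nq (nearI l0 l1)).
pose gam t := iota (w0 + t *: (w1 - w0)).
have cgam : connected (gam @` [set: R]).
  apply: connected_continuous_connected; first exact/connected_intervalP.
  apply: continuous_subspaceT => t; apply: (cvg_comp (fun t => w0 + t *: (w1 - w0)) iota); last exact: (proj1 (iota_smooth st (w0 + t *: (w1 - w0)))).
  by apply: cvgD; [exact: cvg_cst|apply: cvgZr_tmp; exact: cvg_id].
have [||/(_ (gam 1))|/(_ (gam 0))] := @connected_subset X O0 O1 (gam @` [set: R]) _ _ cgam.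
- split; apply/seteqP; split=> // x [].
    by move=> c0; apply; apply: closureS c0; exact: interior_subset.
  by move=> a0 /(_ O0 (open_nbhs_nbhs (conj o0 a0)))[y [/[swap]/dis]].
- move=> _ [t _ <-]; apply: hv; rewrite Si mulmxDl -scalemxAl mulmxBl w0T w1T subrr scaler0 addr0 //.
- by move=> h; apply: (dis (gam 1)); [apply: h; exists 1|rewrite /gam scale1r addrC subrK].
by move=> h; apply: (dis (gam 0)); [rewrite /gam scale0r addr0|apply: h; exists 0].
Qed.

End Submersion.

Section Immersion.
Variable S2 : X' -> X.
Hypothesis sS2 : smooth_map S2.
Hypothesis S2K : cancel S S2.
Hypothesis Tker : exists2 Kf, Kf \in F' & (Kf :=: kermx T^T)%MS.
Hypothesis Trank : \rank T = n.

Let sub_range (M : 'M[R]_n') (v : 'rV[R]_n') : (M :=: kermx T^T)%MS -> v *m (row_base M)^T = 0 ->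
  exists w, w *m T = v.
Proof.
move=> ME v0; have /submxP[w ->] : (v <= T)%MS; last by exists w.
have /submxP[D DE] : ((cokermx T)^T <= row_base M)%MS.
  by rewrite eq_row_base ME; apply/sub_kermxP; rewrite -trmx_mul mulmx_coker trmx0.
by rewrite submxE -[cokermx T]trmxK DE trmx_mul mulmxA v0 mul0mx.
Qed.

(** The smooth left inverse [S2] makes [S] an embedding. The functionals in [Kf] vanish along the
    image, so they are negligible at every step of the chain at [S p] and lie in its last flat,
    where [R_m = 1]; a basis of [Kf] therefore serves as interior coordinates, and the image is
    their zero set. *)
Theorem stage_map_embedding : p_embedding S.
Proof.
have [cS pS] := sS; have [_ pS2] := sS2; split.
  apply: (embeds_intro aX' e openT) => [p _|p _ j]; first by split; [exact: cS|move=> f; exact: pS].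
  exists (fun y => psi (S2 y) 0 j); last by apply: near_all => y q _ <-; rewrite S2K.
  by apply: (pS2 (S p) (fun q => psi q 0 j)); rewrite S2K; exact: Sm_embed_coord e I.
split; first exact: stage_map_closed.
move=> _ [p _ <-]; have [Kf KF KE] := Tker; have [m [Ac ch]] := chain_ex st' (S p).
have [c0 cF cz _ cch] := ch.
have KT (f : 'rV[R]_n') : (f <= Kf)%MS -> f *m T^T = 0 by rewrite KE => /sub_kermxP.
have KA i : (i <= m)%N -> (Kf <= Ac i)%MS.
  elim: i => [|i IH] im; first by rewrite c0 submx1.
  have [_ _ mx] := cch i im; apply: mx (IH (ltnW im)) _ => //; apply/row_matrixP => j; rewrite row_mul row0.
  apply/rowP => x; rewrite (ord1 x) [RHS]mxE.
  have fA := submx_trans (row_sub j Kf) (IH (ltnW im)).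
  apply: (xt_uniq aX dX (xt_pull (ev_xt pr' Fxt' (S p) (cF _ (ltnW im)) fA))).
  apply: xt_eq (xt_cst aX iota p 0); apply: nearTW => v.
  by rewrite fe_pull KT ?row_sub// fe0 mul0r.
have gr : graded m Ac (fun i => ev iota' (S p) (Ac i)) (row_base Kf) (fun=> m) finset.set0.
  split=> [c|i a aS|c|c d|c]; rewrite ?finset.inE ?ltnn//.
    by split=> //; apply: submx_trans (row_sub _ _) _; rewrite eq_row_base; exact: KA.
  have [->|im] := eqVneq i m; last by move=> _; apply/rowP => c; rewrite aS ?mxE// eq_sym.
  by rewrite cz// submx0 => /eqP h; apply: (row_free_inj (row_base_free Kf)); rewrite h mul0mx.
have [K [lev [dm [g [U [kb [cg [gi gK gl gd] kc _ hU]]]]]]] := chart_ex st' ch gr (filterT : nbhs (S p) setT).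
have sa : stage_at iota' F' (S p) m Ac K lev dm U kb by [].
have gdm c : g c \notin dm by rewrite gd finset.inE.
have kE c v : kapv m K lev dm v 0 (g c) = fe (row c (row_base Kf)) v.
  by rewrite mxE /kap (negbTE (gdm c)) /f_ gK gl Rf_ge// divr1.
have [C [s [[s' s'K K's] aC dC CE bC]]] := kchart_coords dn' kc.
exists C, [set s (g c) | c in 'I_(\rank Kf)]%SET; split; last first.
  rewrite card_imset ?card_ord; last by apply: inj_comp gi; exact: can_inj s'K.
  rewrite KE mxrank_ker mxrank_tr Trank dn dn' subnK//.
  by rewrite -Trank rank_leq_col.
split=> //; rewrite dC; apply/seteqP; split=> x [hx Ux]; split=> //.
  move: hx => [q _ qx] i /imsetP[c _ ->]; rewrite CE -qx.
  have Uq : U (S q) by rewrite qx.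
  have h : \forall y \near q, kb (S y) 0 (g c) = 0; last exact: nbhs_singleton h.
  apply: (Sm_eq_dense aX dX (pS q _ (kchart_Sm (g c) kc Uq)) (Sm_cst aX q 0)).
  apply: filterS (near_S (kchart_open kc Uq)) => y Uy v vy.
  have Sv : iota' (v *m T) = S y by rewrite -vy Si.
  have [/(_ _ Sv)[_ kSy] _] := hU _ Uy; rewrite /= kSy kE fe_pull KT ?fe0//.
  by rewrite -(eq_row_base Kf) row_sub.
(* Conversely, a point where these coordinates vanish is a limit of interior points with the same
   property; there the functionals in [Kf] vanish, so the vector is in the range of [T]. *)
apply: stage_map_closed => A nA.
have [y [Uy Ay yp yz]] := kchart_generic finset.set0 kc Ux nA.
have [v vy] : exists v, iota' v = y.
  by apply: (tau_interior st'); apply: (kchart_interior st' sa Uy) => c cd; apply: yp; rewrite finset.setD0.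
have [|w wT] := @sub_range Kf v KE.
  apply/rowP => c; rewrite fe_row [RHS]mxE -kE; have [/(_ _ vy)[_ <-] _] := hU _ Uy.
  rewrite yz ?finset.setD0//; rewrite -CE; apply: hx; exact: imset_f.
by exists y; split=> //; exists (iota w) => //; rewrite Si wT.
Qed.

End Immersion.

End StageMaps.

(** * Translation maps *)

Section Translations.
Context {R : realType} (V : vectType R).

Lemma ker_submx n a b (A : 'M[R]_(a, n)) (B : 'M[R]_(b, n)) :
  (forall x : 'rV[R]_n, x *m A^T = 0 -> x *m B^T = 0) -> (B <= A)%MS.
Proof.
move=> h; rewrite submxE; apply/eqP/trmx_inj/row_matrixP => j; rewrite trmx_mul trmx0 row0 row_mul.
by apply: h; rewrite -row_mul -trmx_mul mulmx_coker trmx0 row0.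
Qed.

Definition translation n m (I : 'I_n.+1 -> 'I_m.+1) (v : vpow V m) : vpow V n :=
  quotient_map (representative v \o I).

Lemma rep_translation n m (I : 'I_n.+1 -> 'I_m.+1) v a :
  representative (translation I v) a = representative v (I a) - representative v (I ord_max).
Proof.
case: (unliftP ord_max a) => [j|] ->; first by rewrite representativeE ffunE.
by rewrite representative_max subrr.
Qed.

Lemma translation_linear n m (I : 'I_n.+1 -> 'I_m.+1) : linear (translation I).
Proof.
move=> a u v; apply/ffunP => j; rewrite !ffunE /= !representative_linear scalerBr opprD addrACA.
by [].
Qed.

Lemma translation_id n v : translation (n := n) id v = v.
Proof. by apply/ffunP => j; rewrite ffunE /= representativeE representative_max subr0. Qed.

Lemma translation_comp n m r (I : 'I_n.+1 -> 'I_m.+1) (I' : 'I_m.+1 -> 'I_r.+1) v :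
  translation (I' \o I) v = translation I (translation I' v).
Proof.
by apply/ffunP => j; rewrite !ffunE /= !rep_translation opprB addrA subrK.
Qed.

Definition translation_mx n m (I : 'I_n.+1 -> 'I_m.+1) : 'M[R]_(dim (vpow V m), dim (vpow V n)) :=
  projT1 (cid (lin_matrix (translation_linear I))).

Lemma translation_mxE n m (I : 'I_n.+1 -> 'I_m.+1) v : v2r (translation I v) = v2r v *m translation_mx I.
Proof. by rewrite /translation_mx; case: cid. Qed.

(** The values of [v'] are prescribed on the classes of [E] that meet the image of [I], and 0 is
    taken on the other classes; [quotient_map] then normalizes the last entry to 0. *)
Lemma rep_lift n m (I : 'I_n.+1 -> 'I_m.+1) (E : rel 'I_m.+1) (v' : vpow V n) :
  equivalence_rel E -> (forall a b, E (I a) (I b) -> representative v' a = representative v' b) ->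
  exists2 v, translation I v = v' & forall x y, E x y -> representative v x = representative v y.
Proof.
move=> eE h; have Er x : E x x by have [] := eE x x x.
have Et x y z : E x y -> E x z = E y z by have [_] := eE x y z.
have Es x y : E x y = E y x by apply/idP/idP => hx; rewrite -(Et _ _ _ hx) Er.
pose w x := if [pick a | E (I a) x] is Some a then representative v' a else 0.
have wE x y : E x y -> w x = w y.
  move=> xy; rewrite /w; case: pickP => [a ax|na]; case: pickP => [b by'|nb] //.
  - by apply: h; rewrite (Et _ _ _ ax) (Et _ _ _ xy) Es.
  - by have := nb a; rewrite (Et _ _ _ ax) xy.
  by have := na b; rewrite (Et _ _ _ by') Es xy.
have wI a : w (I a) = representative v' a.
  by rewrite /w; case: pickP => [b /h//|/(_ a)]; rewrite Er.
pose v : vpow V m := quotient_map w.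
have vE x : representative v x = w x - w ord_max.
  by case: (unliftP ord_max x) => [j|] ->; [rewrite representativeE ffunE|rewrite representative_max subrr].
exists v => [|x y /wE]; last by rewrite !vE => ->.
apply/ffunP => j; rewrite ffunE /= !vE opprB addrA subrK !wI representativeE.
by rewrite representative_max subr0.
Qed.

Section OneMap.
Variables (n m : nat) (I : 'I_n.+1 -> 'I_m.+1).
Let T := translation_mx I.

Lemma flat_pull A : is_flat (V := V) (k := n) A -> exists2 C, is_flat (V := V) (k := m) C & (A *m T^T :=: C)%MS.
Proof.
move=> [K ->]; pose K' : {set 'I_m.+1 * 'I_m.+1} := [set (I ab.1, I ab.2) | ab in K]%SET.
exists (flat_mx V K'); first by exists K'.
have kE (x : 'rV[R]_(dim (vpow V m))) : x *m (flat_mx V K *m T^T)^T = 0 <-> x *m (flat_mx V K')^T = 0.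
  rewrite trmx_mul trmxK mulmxA -[x](@r2vK R (vpow V m)) -translation_mxE !flat_mxP; split=> h.
    by move=> _ /imsetP[ab abK ->] /=; have := h ab abK; rewrite !rep_translation => /addIr.
  by move=> ab abK; rewrite !rep_translation; have := h _ (imset_f _ abK) => /= ->.
by apply/eqmxP/andP; split; apply: ker_submx => x /kE.
Qed.

(** [E] relates the indices at which all solutions of [flat_mx V K] agree, and [K'] is its preimage
    under [I]. If [f *m T^T] vanishes on these solutions, then [f] vanishes on those of [K'],
    because each of them lifts by [rep_lift]. *)
Lemma flat_preimage A : is_flat (V := V) (k := m) A -> exists2 P, is_flat (V := V) (k := n) P &
  forall f : 'rV[R]_(dim (vpow V n)), (f <= P)%MS = (f *m T^T <= A)%MS.
Proof.
move=> [K ->].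
pose E x y := `[< forall v : vpow V m, v2r v *m (flat_mx V K)^T = 0 -> representative v x = representative v y >].
pose K' : {set 'I_n.+1 * 'I_n.+1} := [set ab | E (I ab.1) (I ab.2)]%SET.
exists (flat_mx V K'); first by exists K'.
move=> f; apply/idP/idP => h; last first.
  apply: ker_submx => x; rewrite -[x](@r2vK R (vpow V n)); set v' := r2v x => /flat_mxP hx.
  have [||v vE vK] := @rep_lift n m I E v'.
  - move=> x1 x2 x3; split; first exact/asboolP.
    move=> /asboolP h12; apply/asboolP/asboolP => h13 v hv; [rewrite -h12//|rewrite h12//]; exact: h13.
  - by move=> a b ab; apply: (hx (a, b)); rewrite finset.inE.
  have fT : v2r v *m T *m f^T = v2r v *m (f *m T^T)^T by rewrite trmx_mul trmxK mulmxA.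
  rewrite -vE translation_mxE -/T fT.
  have /submxP[D ->] := h; rewrite trmx_mul mulmxA.
  suff -> : v2r v *m (flat_mx V K)^T = 0 by rewrite mul0mx.
  by apply/flat_mxP => ab abK; apply: vK; apply/asboolP => u /flat_mxP; exact.
have /submxP[D ->] := h; rewrite -mulmxA; apply: submx_trans (submxMl _ _) _.
apply: ker_submx => x; rewrite -[x](@r2vK R (vpow V m)) => hx; rewrite trmx_mul trmxK mulmxA -translation_mxE.
by apply/flat_mxP => ab; rewrite finset.inE => /asboolP hab; rewrite !rep_translation hab.
Qed.

Lemma translation_onto : injective I -> forall v, exists w : 'rV[R]_(dim (vpow V m)), w *m T = v.
Proof.
move=> Ii v; have [||w wE _] := @rep_lift n m I (fun x y => x == y) (r2v v).
- by move=> x y z; split=> // /eqP ->.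
- by move=> a b /eqP/Ii ->.
by exists (v2r w); rewrite -translation_mxE wE r2vK.
Qed.

Lemma flat_kernel : exists2 P, is_flat (V := V) (k := n) P & (P :=: kermx T^T)%MS.
Proof.
have [P fP PE] := flat_preimage (flat0 V m); exists P => //; apply/eqmxP/andP; split; apply/row_subP => j.
  by apply/sub_kermxP; apply/eqP; rewrite -submx0 -PE row_sub.
by rewrite PE submx0; apply/eqP/sub_kermxP; exact: row_sub.
Qed.

End OneMap.

Lemma translation_rank n m (I : 'I_n.+1 -> 'I_m.+1) (J : 'I_m.+1 -> 'I_n.+1) : cancel J I ->
  \rank (translation_mx I) = dim (vpow V m).
Proof.
move=> JK; apply/eqP; rewrite eqn_leq rank_leq_row /=.
suff TT : translation_mx I *m translation_mx J = 1%:M by rewrite -[X in (X <= _)%N](mxrank1 R) -TT mxrankM_maxl.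
apply/row_matrixP => j; rewrite !rowE mulmx1 mulmxA -[delta_mx 0 j](@r2vK R (vpow V m)).
rewrite -!translation_mxE -translation_comp; congr v2r.
have -> : I \o J = id by apply/funext => x; exact: JK.
exact: translation_id.
Qed.

End Translations.

Lemma v2r_embeds (R : realType) (W : vectType R) :
  embeds setT ((fun w => v2r (w : W)) : vector_space W -> euclidean R (dim W)).
Proof.
have nE (p : vector_space W) A : nbhs p A <-> exists2 B, nbhs (v2r (p : W)) B & setT `&` (fun w : W => v2r w) @^-1` B `<=` A.
  split.
    move=> [_ [[B oB <-] Bp] BA]; exists B; first exact: open_nbhs_nbhs.
    by move=> x [_ Bx]; exact: BA.
  move=> [B nB BA]; have h : nbhs p ((fun w : W => v2r w) @^-1` B).
    exact: (@initial_continuous _ _ (v2r : W -> 'rV[R]_(dim W)) p _ nB).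
  by apply: filterS h => x Bx; apply: BA.
split.
- exact: openT.
- by move=> p q _ _ /(can_inj v2rK).
- by move=> p _ A; exact: nE.
move=> p _ f; split=> [sf|[h [sh fh]]].
  by exists (f \o r2v); split=> //; apply: near_all => q /=; rewrite v2rK.
have [B nB sB] := (nE _ _).1 fh; apply: (sm_eq _ sh); apply: filterS nB => x Bx.
by rewrite /= sB ?r2vK//; split=> //; rewrite /preimage /= r2vK.
Qed.

(** * Assembling the compactification *)

Theorem proposition11 (R : realType) (V : vectType R) :
  (forall k : nat,
     p_clean (diagonals_at_infinity V k) /\
     closed_under_intersection (diagonals_at_infinity V k)) /\
  (forall k : nat, exists (E : germ_space R) (b : E -> radial (vpow V k)),
     is_blowup_of_collection (diagonals_at_infinity V k) b) /\
  (forall (E : nat -> germ_space R) (b : forall k, E k -> radial (vpow V k)),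
     (forall k, is_blowup_of_collection (diagonals_at_infinity V k) (b k)) ->
     exists (S : simplicial_maps E)
            (iota : forall k, translation_group V k -> E k),
       (forall k (v : vpow V k), b k (iota k v) = radial_incl v) /\
       simplicial_compactification (translation_maps V) S iota).
Proof.
split; first by move=> k; split; [exact: collection_clean|exact: collection_inter].
split; first by move=> k; exact: collection_ex.
move=> E b hb.
pose D k (i : 'rV[R]_(dim (vpow V k)) -> E k) := exists N (Psi : _ -> 'rV[R]_N) psi F,
    [/\ is_stage i Psi psi F, forall A, A \in F <-> is_flat (V := V) A,
        forall v, b k (i v) = radial_iota v, compact [set: E k] & sdim (E k) = dim (vpow V k)].
have hD k : exists i, D k i.
  by have [i [N [Psi [psi [F h]]]]] := collection_stage (hb k); exists i, N, Psi, psi, F.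
pose i k := projT1 (cid (hD k)); have iD k : D k (i k) by rewrite /i; case: cid.
have hS n m (I : 'I_n.+1 -> 'I_m.+1) : exists S : E m -> E n, smooth_map S /\
    forall v, S (i m v) = i n (v *m translation_mx V I).
  have [N [Psi [psi [F [st FE _ _ _]]]]] := iD m; have [N' [Psi' [psi' [F' [st' FE' _ _ _]]]]] := iD n.
  apply: (stage_map_ex st st') => A /FE' /(flat_pull I)[C /FE CF CE]; by exists C.
pose S n m I := projT1 (cid (hS n m I)).
have SP n m I : smooth_map (S n m I) /\ forall v, S n m I (i m v) = i n (v *m translation_mx V I).
  by rewrite /S; case: cid.
(* The identities of a functor hold on the dense vector spaces, where the maps are linear, and
   extend by continuity. *)
have eqD r n (f g : E r -> E n) : continuous f -> continuous g -> (forall v, f (i r v) = g (i r v)) -> f =1 g.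
  move=> cf cg fg p; have [N [Psi [psi [F [[pr _ _ _ _] _ _ _ _]]]]] := iD r.
  have [N' [Psi' [psi' [F' [[[e' _ _] _ _ _ _] _ _ _ _]]]]] := iD n.
  apply: (embedded_hausdorff e') => A B nA nB.
  by have [v [Av Bv]] := presents_dense pr (nearI (cf p _ nA) (cg p _ nB)); exists (f (i r v)); split=> //; rewrite fg.
have cS n m I : continuous (S n m I) by case: (SP n m I) => -[].
have mxE k n (I : 'I_n.+1 -> 'I_k.+1) v : v *m translation_mx V I = v2r (translation I (@r2v R (vpow V k) v)).
  by rewrite translation_mxE r2vK.
have Sid n : S n n id =1 id.
  apply: eqD => [|x A|v] //; have [_ ->] := SP n n id; by rewrite mxE translation_id r2vK.
have Scomp n m r (I : 'I_n.+1 -> 'I_m.+1) (I' : 'I_m.+1 -> 'I_r.+1) :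
    S n r (I' \o I) =1 S n m I \o S m r I'.
  apply: eqD => [//|x|v]; first by apply: continuous_comp; exact: cS.
  have [_ h1] := SP n r (I' \o I); have [_ h2] := SP m r I'; have [_ h3] := SP n m I.
  by rewrite h1 /= h2 h3 !mxE translation_comp v2rK.
have main n m (I : 'I_n.+1 -> 'I_m.+1) : [/\ interior_b_map (S n m I),
    injective I -> b_fibration (S n m I) /\ forall q, connected (S n m I @^-1` [set q]) &
    (forall x, exists y, I y = x) -> p_embedding (S n m I)].
  have [N [Psi [psi [F [st FE _ cX dn]]]]] := iD m; have [N' [Psi' [psi' [F' [st' FE' _ cX' dn']]]]] := iD n.
  have Feq A B : A \in F -> B \in F -> (A :=: B)%MS -> A = B by move=> /FE fA /FE; exact: flat_inj.
  have TF A : A \in F' -> exists2 C, C \in F & (A *m (translation_mx V I)^T :=: C)%MS.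
    by move=> /FE' /(flat_pull I)[C /FE CF CE]; exists C.
  have [sS Si] := SP n m I; split; first exact: (stage_map_interior st st' cX dn dn' Feq TF sS Si).
    move=> /(translation_onto (V := V)) To; have Tf A : A \in F -> exists2 P, P \in F' &
        forall f : 'rV[R]_(dim (vpow V n)), (f <= P)%MS = (f *m (translation_mx V I)^T <= A)%MS.
      by move=> /FE /(flat_preimage I)[P /FE' PF PE]; exists P.
    by split; [exact: (stage_fibration st st' cX dn dn' Feq TF sS Si To Tf)|exact: (stage_fibre_connected st st' cX TF sS Si To Tf)].
  (* A section [J] of the surjective [I] induces a left inverse of [S n m I], by functoriality. *)
  move=> /choice[J JK]; have [sS2 _] := SP m n J.
  apply: (stage_map_embedding st st' cX dn dn' sS Si sS2 _ _ (translation_rank V JK)).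
    move=> x; apply: etrans (esym (Scomp m n m J I x)) _; rewrite -[RHS]Sid; congr (S m m _ x).
    by apply/funext => a; exact: JK.
  by have [P /FE' PF PE] := flat_kernel V I; exists P.
exists S, (fun k v => i k (v2r (v : vpow V k))); split.
  by move=> k v; have [N [Psi [psi [F [_ _ h _ _]]]]] := iD k; rewrite h /radial_iota v2rK.
split; last 1 first.
- split=> [k|n m I v].
    have [N [Psi [psi [F [st _ _ _ dn]]]]] := iD k; split=> //.
      have := embeds_comp (v2r_embeds (vpow V k)) (stage_embeds st).
      by rewrite setTI preimage_setT.
    rewrite -(stage_interior st dn); apply/seteqP; split=> x [v _ <-]; first by exists (v2r (v : vpow V k)).
    by exists (@r2v R (vpow V k) v) => //; rewrite r2vK.
  by have [_ ->] := SP n m I; rewrite mxE v2rK.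
- split=> //; last 3 first.
  + by move=> n m I; case: (main n m I).
  + by move=> n m I; case: (main n m I).
  + by move=> n m I; case: (main n m I).
  split=> [k|].
    have [N [Psi [psi [F [st FE _ cX dn]]]]] := iD k; split; last exact: stage_connected st.
    by apply: (stage_manifold st cX dn) => A B /FE fA /FE; exact: flat_inj.
  (* With shifted indices [E k] compactifies the sum of [k] copies of [V], so its dimension is [k]
     times that of [V], and [mu], the dimension of the point [E 0], is 0. *)
  exists 0, (dim V)%:Z => k; have [N [Psi [psi [F [_ _ _ _ ->]]]]] := iD k.
  rewrite add0r -PoszM; congr Posz; transitivity (#|'I_k| * dim V)%N; last by rewrite card_ord.
  by [].
by move=> k; have [N [Psi [psi [F [_ _ _ h _]]]]] := iD k.
Qed.
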